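(* There does not exist an algorithm that, given as input a sentence $\varphi$ of the first order language of graphs which is guaranteed to satisfy $\lim_{n\to\infty}\Pr[P_n\models\varphi]\in\{0,1\}$ (the limit existing), decides whether this limit equals $1$. Here $P_n$ is a graph chosen uniformly at random from all labelled perfect graphs on the vertex set $\{1,\dots,n\}$.
   Context: A graph is perfect if, for every induced subgraph, the chromatic number equals the clique number. The first order language of graphs consists of formulas built from variables ranging over vertices, the quantifiers $\forall,\exists$, the logical connectives, parentheses, and the binary relations $=$ and $\sim$ (adjacency). A sentence is a formula with no free variables; $G\models\varphi$ means the graph $G$ satisfies $\varphi$. *)

(* Defs.v *)
From HB Require Import structures.
From mathcomp Require Import all_boot all_order all_algebra.
From mathcomp Require Import all_classical all_reals all_analysis.

Set Implicit Arguments.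
Unset Strict Implicit.
Unset Printing Implicit Defensive.

Import Order.TTheory GRing.Theory Num.Theory.
Import numFieldNormedType.Exports.

Section Graphs.
Variable T : finType.

Definition simple_adj (a : {ffun T * T -> bool}) : bool :=
  [forall x, ~~ a (x, x)] && [forall x, forall y, a (x, y) == a (y, x)].

Record sgraph := SGraph { adj_ffun : {ffun T * T -> bool};
                          _ : simple_adj adj_ffun }.

HB.instance Definition _ := [isSub for adj_ffun].
HB.instance Definition _ := [Finite of sgraph by <:].

Definition adj (G : sgraph) : rel T := fun x y => adj_ffun G (x, y).

Lemma adj_irrefl (G : sgraph) : irreflexive (adj G).
Proof.
case: G => a a_simple x; case/andP: (a_simple) => /forallP/(_ x)/negbTE.
by rewrite /adj.
Qed.

Lemma adj_sym (G : sgraph) : symmetric (adj G).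
Proof.
case: G => a a_simple x y; case/andP: (a_simple) => _.
by move=> /forallP/(_ x)/forallP/(_ y)/eqP.
Qed.

Definition clique (G : sgraph) (K : {set T}) : bool :=
  [forall x in K, forall y in K, (x != y) ==> adj G x y].

Definition clique_number (G : sgraph) : nat :=
  \max_(K : {set T} | clique G K) #|K|.

Definition colorable (G : sgraph) (k : nat) : bool :=
  [exists c : {ffun T -> 'I_k}, forall x, forall y, adj G x y ==> (c x != c y)].

Lemma colorable_card (G : sgraph) : colorable G #|T|.
Proof.
apply/existsP; exists [ffun x => enum_rank x].
apply/forallP => x; apply/forallP => y; apply/implyP; rewrite !ffunE.
by apply: contraTneq => /enum_rank_inj ->; rewrite adj_irrefl.
Qed.

Lemma colorable_ex (G : sgraph) : exists k, colorable G k.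
Proof. by exists #|T|; apply: colorable_card. Qed.

Definition chromatic_number (G : sgraph) : nat := ex_minn (colorable_ex G).

End Graphs.

Section Perfect.
Variable T : finType.

Definition induced_adj (G : sgraph T) (S : {set T}) :
    {ffun {x : T | x \in S} * {x : T | x \in S} -> bool} :=
  [ffun p => adj G (val p.1) (val p.2)].

Lemma induced_simple (G : sgraph T) (S : {set T}) :
  simple_adj (induced_adj G S).
Proof.
apply/andP; split; first by apply/forallP => x; rewrite ffunE adj_irrefl.
by apply/forallP => x; apply/forallP => y; rewrite !ffunE adj_sym.
Qed.

Definition induced (G : sgraph T) (S : {set T}) : sgraph {x : T | x \in S} :=
  SGraph (induced_simple G S).

Definition perfect (G : sgraph T) : bool :=
  [forall S : {set T},
    chromatic_number (induced G S) == clique_number (induced G S)].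

End Perfect.

Inductive graph_formula : Type :=
  | FEq of nat & nat
  | FAdj of nat & nat
  | FNot of graph_formula
  | FAnd of graph_formula & graph_formula
  | FOr of graph_formula & graph_formula
  | FImp of graph_formula & graph_formula
  | FIff of graph_formula & graph_formula
  | FAll of nat & graph_formula
  | FEx of nat & graph_formula.

Fixpoint free_vars (p : graph_formula) : seq nat :=
  match p with
  | FEq i j | FAdj i j => [:: i; j]
  | FNot q => free_vars q
  | FAnd q r | FOr q r | FImp q r | FIff q r => free_vars q ++ free_vars r
  | FAll i q | FEx i q => [seq j <- free_vars q | j != i]
  end.

Definition sentence (p : graph_formula) : bool := free_vars p == [::].

Definition update (V : Type) (e : nat -> V) (i : nat) (x : V) : nat -> V :=
  fun j => if j == i then x else e j.

Fixpoint sat (T : finType) (G : sgraph T) (e : nat -> T) (p : graph_formula) : Prop :=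
  match p with
  | FEq i j => e i = e j
  | FAdj i j => adj G (e i) (e j)
  | FNot q => ~ sat G e q
  | FAnd q r => sat G e q /\ sat G e r
  | FOr q r => sat G e q \/ sat G e r
  | FImp q r => sat G e q -> sat G e r
  | FIff q r => sat G e q <-> sat G e r
  | FAll i q => forall x : T, sat G (update e i x) q
  | FEx i q => exists x : T, sat G (update e i x) q
  end.

(* For a sentence on a nonempty graph the choice of assignment is immaterial;
   on the empty graph (which no limit sees) this is vacuously true. *)
Definition models (T : finType) (G : sgraph T) (p : graph_formula) : Prop :=
  forall e : nat -> T, sat G e p.

Definition prob_perfect (R : realType) (p : graph_formula) (n : nat) : R :=
  (#|[set G : sgraph 'I_n | perfect G & `[< models G p >]]|%:R /
   #|[set G : sgraph 'I_n | perfect G]|%:R)%R.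

Definition limit_prob (R : realType) (p : graph_formula) (l : R) : Prop :=
  (prob_perfect R p n @[n --> \oo] --> l)%classic.

(* [CodeSeq.code] is the bijection code [::] = 0,
   code (n :: s) = 2 ^ n * (2 * code s + 1), so [godel] and its partial inverse
   are computable in the intuitive sense. *)
Fixpoint godel (p : graph_formula) : nat :=
  match p with
  | FEq i j => CodeSeq.code [:: 0; i; j]
  | FAdj i j => CodeSeq.code [:: 1; i; j]
  | FNot q => CodeSeq.code [:: 2; godel q]
  | FAnd q r => CodeSeq.code [:: 3; godel q; godel r]
  | FOr q r => CodeSeq.code [:: 4; godel q; godel r]
  | FImp q r => CodeSeq.code [:: 5; godel q; godel r]
  | FIff q r => CodeSeq.code [:: 6; godel q; godel r]
  | FAll i q => CodeSeq.code [:: 7; i; godel q]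
  | FEx i q => CodeSeq.code [:: 8; i; godel q]
  end.

Lemma godel_inj : injective godel.
Proof.
have ci := can_inj CodeSeq.codeK.
elim=> [i j|i j|q IHq|q IHq r IHr|q IHq r IHr|q IHq r IHr|q IHq r IHr
       |i q IHq|i q IHq] [i' j'|i' j'|q'|q' r'|q' r'|q' r'|q' r'|i' q'|i' q']
  /ci // [];
  by [move=> -> -> | move=> /IHq -> | move=> /IHq -> /IHr -> | move=> -> /IHq ->].
Qed.

(* Algorithms are partial recursive functions.  Codes are untyped: the arguments
   come as a list, and a code that needs a missing argument has no value. *)
Inductive recf : Type :=
  | Zero
  | Succ
  | Proj of nat
  | Comp of recf & seq recf
  | Prec of recf & recf
  | Mu of recf.

(* [computes f v y]: on arguments v, f halts with output y. *)
Fixpoint computes (f : recf) (v : seq nat) (y : nat) {struct f} : Prop :=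
  match f with
  | Zero => y = 0
  | Succ => if v is x :: _ then y = x.+1 else False
  | Proj i => i < size v /\ y = nth 0 v i
  | Comp g hs =>
      exists2 ws : seq nat,
        (fix computes_all (hs : seq recf) (ws : seq nat) {struct hs} : Prop :=
           match hs, ws with
           | [::], [::] => True
           | h :: hs', w :: ws' => computes h v w /\ computes_all hs' ws'
           | _, _ => False
           end) hs ws
        & computes g ws y
  | Prec g h =>
      if v is n :: v' then
        (fix iterate (n : nat) (z : nat) {struct n} : Prop :=
           if n is m.+1 then
             exists2 r : nat, iterate m r & computes h [:: m, r & v'] z
           else computes g v' z) n y
      else False
  | Mu g =>
      computes g (y :: v) 0 /\
      (forall m, m < y -> exists k, computes g (m :: v) k.+1)
  end.

(* Main.v *)
(* Almost every perfect graph, or its complement, is unipolar up to boundedly many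
   vertices: a clique Y together with a disjoint union X of cliques ("blocks"), with
   almost arbitrary edges between X and Y.  Indeed, with g = n / log n, the unipolar
   graphs number g^(n/2) 2^(n^2/4) up to a factor 2^O(n), and the other C5-free graphs in
   which every vertex set S contains a homogeneous set of size sqrt |S| (both properties
   hold for perfect graphs) are fewer by an arbitrary exponential factor: deviations from
   the structure force obstructions that reduce the number of ways to choose the edges
   between the two sides.

   In a typical unipolar graph the blocks have size of order log n, the vertices of Y cut
   out every subset of a part of a block, and there are definable sets S in Y of any
   prescribed finite size on which one block realises all traces.  So a fixed formula with
   parameters interprets arbitrarily long initial segments of arithmetic together with all
   binary relations on them.  For a supposed decision procedure f let p be a sentence which
   says that in such a segment f is computed to output 0 on the code of p.  If f does
   output 0 on p, then p has limit 1; otherwise p holds in no graph at all and has limit 0.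
   Either way f is wrong on p. *)
Require Import Defs.
From mathcomp Require Import all_boot all_order all_algebra.
From mathcomp Require Import all_classical all_reals all_analysis.
From mathcomp Require Import all_boot all_order all_algebra zify.

Set Implicit Arguments.
Unset Strict Implicit.
Unset Printing Implicit Defensive.

(** * Traces *)

(** The upper and lower bounds must agree up to [2 ^ O(n)], while a mere choice of blocks already
    costs [2 ^ O(n log n)]. Therefore the structure is refined in stages: deviations that lose a
    constant fraction of [n ^ 2] bits are removed by crude counting; then every exceptional vertex
    is shown to lose linearly many bits more than its description costs, so that boundedly many
    survive; only then are block sizes and crossing edges analysed within [O(n)] bits. Rich pairs
    are designed so that a vertex cutting both of their sides closes an induced C5. The numbers [J],
    [t], [r] that shape the formula are fixed before the length [sg] of the arithmetic segment,
    because the length needed depends on the sentence. Truth of the sentence in a single graph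
    already certifies the computation; only the converse needs a long segment, and there a halting
    computation uses finitely many numbers. A binary relation on the segment serves as the course of
    values of a primitive recursion and replaces the coding of sequences. *)

Section Traces.
Variable T : finType.
Implicit Types (G : sgraph T) (D : {set T * T}) (GG HH : {set sgraph T}).

(* All counting goes through [nt D GG], the number of restrictions to the set of
   pairs [D] of adjacency relations of graphs in [GG]. *)
Definition tr D G : {set T * T} := [set p in D | adj G p.1 p.2].

Definition nt D GG : nat := #|tr D @: GG|.

Lemma in_tr D G x y : ((x, y) \in tr D G) = ((x, y) \in D) && adj G x y.
Proof. by rewrite inE. Qed.

Lemma tr_sub D G : tr D G \subset D.
Proof. by apply/subsetP => p; rewrite inE => /andP []. Qed.

Lemma trP D G G' :
  reflect (forall x y, (x, y) \in D -> adj G x y = adj G' x y) (tr D G == tr D G').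
Proof.
apply: (iffP eqP) => [e x y xyD|e].
  by have := congr1 (fun S : {set _} => (x, y) \in S) e; rewrite !in_tr xyD.
by apply/setP => -[x y]; rewrite !in_tr; case: (boolP (_ \in D)) => //= /e.
Qed.

Lemma tr_mono D D' G G' :
  (forall x y, (x, y) \in D -> [|| x == y, (x, y) \in D' | (y, x) \in D']) ->
  tr D' G = tr D' G' -> tr D G = tr D G'.
Proof.
move=> sDD' /eqP /trP e; apply/eqP/trP => x y /sDD' /or3P [/eqP ->|/e //|/e].
- by rewrite !adj_irrefl.
- by rewrite adj_sym => ->; rewrite adj_sym.
Qed.

Lemma adj_inj G G' : (forall x y, adj G x y = adj G' x y) -> G = G'.
Proof. by move=> e; apply/val_inj/ffunP => -[x y]; apply: e. Qed.

(** The way in which encodings enter: [h] may carry more information than the trace, as long as it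
    determines the trace on the graphs of [GG]. *)
Lemma nt_le_im (rT : finType) (h : sgraph T -> rT) D GG :
  (forall G G', G \in GG -> G' \in GG -> h G = h G' -> tr D G = tr D G') ->
  nt D GG <= #|h @: GG|.
Proof.
move=> hh.
pose k (y : rT) := if [pick G in GG | h G == y] is Some G then tr D G else set0.
have sub : tr D @: GG \subset k @: (h @: GG).
  apply/subsetP => _ /imsetP [G GGG ->]; apply/imsetP; exists (h G).
    by apply: imset_f.
  rewrite /k; case: pickP => [G' /andP [G'GG /eqP e]|/(_ G)].
    by apply: hh.
  by rewrite GGG eqxx.
by apply: leq_trans (subset_leq_card sub) (leq_imset_card _ _).
Qed.

(** Adjacency is irreflexive and symmetric, so that covering [D] up to the diagonal and up to
    transposition is enough. *)
Lemma nt_mono D D' GG :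
  (forall x y, (x, y) \in D -> [|| x == y, (x, y) \in D' | (y, x) \in D']) ->
  nt D GG <= nt D' GG.
Proof. by move=> sDD'; apply: nt_le_im => G G' _ _; apply: tr_mono. Qed.

Lemma nt_sub D D' GG : D \subset D' -> nt D GG <= nt D' GG.
Proof. by move=> /subsetP sDD'; apply: nt_mono => x y /sDD' ->; rewrite orbT. Qed.

Lemma nt_subset D GG HH : GG \subset HH -> nt D GG <= nt D HH.
Proof. by move=> s; apply/subset_leq_card/imsetS. Qed.

Lemma nt_setT GG : nt setT GG = #|GG|.
Proof.
rewrite /nt card_imset // => G G' /eqP /trP e.
by apply: adj_inj => x y; apply: e; rewrite inE.
Qed.

(** Subadditivity of entropy in counting form: a trace on the union is determined by its traces on
    the pieces. *)
Lemma nt_bigU (K : finType) (P : pred K) (D : K -> {set T * T}) GG :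
  nt (\bigcup_(k | P k) D k) GG <= \prod_(k | P k) nt (D k) GG.
Proof.
pose F k : {set {set T * T}} := if P k then tr (D k) @: GG else [set set0].
pose h G : {ffun K -> {set T * T}} := [ffun k => if P k then tr (D k) G else set0].
have le1 : nt (\bigcup_(k | P k) D k) GG <= #|h @: GG|.
  apply: nt_le_im => G G' _ _ /ffunP e; apply/eqP/trP => x y /bigcupP [k Pk xyD].
  by have := e k; rewrite !ffunE Pk => /eqP /trP; apply.
apply: leq_trans le1 _.
have sub : h @: GG \subset family F.
  apply/subsetP => _ /imsetP [G GGG ->]; apply/familyP => k; rewrite ffunE /F.
  by case: ifP => _; [apply: imset_f | rewrite inE].
apply: leq_trans (subset_leq_card sub) _; rewrite card_family foldrE big_map big_enum /=.
rewrite [X in _ <= X]big_mkcond; apply: leq_prod => k _; rewrite /F.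
by case: ifP => // _; rewrite cards1.
Qed.

Lemma nt_U D D' GG : nt (D :|: D') GG <= nt D GG * nt D' GG.
Proof.
have := @nt_bigU bool xpredT (fun b => if b then D else D') GG.
by rewrite !big_bool /=.
Qed.

Lemma nt_family D GG (F : {set {set T * T}}) :
  (forall G, G \in GG -> tr D G \in F) -> nt D GG <= #|F|.
Proof.
by move=> s; apply/subset_leq_card/subsetP => _ /imsetP [G /s ? ->].
Qed.

Lemma nt_exp D GG : nt D GG <= 2 ^ #|D|.
Proof.
rewrite -card_powerset; apply: nt_family => G _; rewrite powersetE; exact: tr_sub.
Qed.

Lemma nt_avoid D GG (p : {set T * T}) : p \subset D ->
  (forall G, G \in GG -> tr D G != p) -> nt D GG <= (2 ^ #|D|).-1.
Proof.
move=> pD av; apply: leq_trans (_ : #|powerset D :\ p| <= _).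
  by apply: nt_family => G GGG; rewrite !inE av // tr_sub.
by rewrite -card_powerset (cardsD1 p (powerset D)) powersetE pD.
Qed.

Definition nb G (v : T) : {set T} := [set x | adj G v x].

Lemma nt_row v (S : {set T}) GG (F : {set {set T}}) :
  (forall G, G \in GG -> nb G v :&: S \in F) -> nt (setX [set v] S) GG <= #|F|.
Proof.
move=> s; apply: leq_trans (_ : #|(fun G => nb G v :&: S) @: GG| <= _).
  apply: nt_le_im => G G' _ _ e; apply/eqP/trP => x y.
  rewrite !inE /= => /andP [/eqP -> yS].
  by have := congr1 (fun S : {set _} => y \in S) e; rewrite !inE yS !andbT.
by apply/subset_leq_card/subsetP => _ /imsetP [G /s ? ->].
Qed.

Lemma setX_bigl (A B : {set T}) : setX A B = \bigcup_(v in A) setX [set v] B.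
Proof.
apply/setP => -[x y]; rewrite inE /=; apply/andP/bigcupP => [[xA yB]|[v vA]].
  by exists x => //; rewrite !inE eqxx.
by rewrite !inE /= => /andP [/eqP -> ->].
Qed.

Lemma nt_rows (A S : {set T}) GG b :
  (forall v, v \in A -> nt (setX [set v] S) GG <= b) -> nt (setX A S) GG <= b ^ #|A|.
Proof.
move=> h; rewrite setX_bigl; apply: leq_trans (nt_bigU _ _ _) _.
by rewrite -prod_nat_const; apply: leq_prod.
Qed.

(** Union bound over labels. A graph may admit several labels, and [P] keeps those whose class has
    to be estimated. *)
Lemma nt_union (L : finType) (P : pred L) (CC : L -> {set sgraph T}) D GG b :
  (forall G, G \in GG -> exists2 l, P l & G \in CC l) ->
  (forall l, P l -> nt D (CC l) <= b) -> nt D GG <= #|P| * b.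
Proof.
move=> cov le_b; have sub : tr D @: GG \subset \bigcup_(l | P l) tr D @: CC l.
  apply/subsetP => _ /imsetP [G /cov [l Pl Gl] ->]; apply/bigcupP; exists l => //.
  exact: imset_f.
apply: leq_trans (subset_leq_card sub) _.
apply: leq_trans (_ : \sum_(l | P l) #|tr D @: CC l| <= _); last first.
  by rewrite -sum_nat_const; apply: leq_sum => l; apply: le_b.
elim/big_ind2: _ => [|A a B b' ha hb|//]; first by rewrite cards0.
by apply: leq_trans (leq_card_setU _ _) _; apply: leq_add.
Qed.

(** Conditioning on the trace on [D']. Within a fibre all graphs agree there, so a configuration
    found in one of them is present in all of them; this is how packings of obstructions become
    common to a whole class. *)
Lemma nt_fiber D D' GG b :
  (forall t, nt D [set G in GG | tr D' G == t] <= b) -> nt D GG <= nt D' GG * b.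
Proof.
move=> le_b.
apply: (@nt_union _ [in tr D' @: GG] (fun t => [set G in GG | tr D' G == t])) => [G GGG|t _].
  by exists (tr D' G); [apply: imset_f | rewrite inE GGG eqxx].
exact: le_b.
Qed.

Lemma nt1 D GG t : (forall G, G \in GG -> tr D G = t) -> nt D GG <= 1.
Proof.
move=> h; rewrite -(cards1 t); apply: nt_family => G /h ->; exact: set11.
Qed.

(** Take a packing with the largest number of members. Excluding the empty set makes a further
    disjoint member a new one. *)
Lemma maximal_packing (c : {set T} -> bool) (X : {set T}) : ~~ c set0 ->
  exists P : {set {set T}},
    [/\ trivIset P, forall S : {set T}, S \in P -> c S && (S \subset X) &
        forall S : {set T}, S \subset X :\: cover P -> ~~ c S].
Proof.
move=> c0; pose ok (P : {set {set T}}) :=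
  trivIset P && [forall S in P, c S && (S \subset X)].
have ok0 : ok set0.
  rewrite /ok; apply/andP; split; last by apply/forallP => S; rewrite inE.
  by apply/trivIsetP => A B; rewrite inE.
case: (@arg_maxnP _ set0 ok (fun P => #|P|) ok0) => P /andP [tP /forallP aP] mx.
exists P; split => // [S SP|S sS]; first by have := aP S; rewrite SP.
apply/negP => cS.
have S0 : S != set0 by apply: contraTneq cS => ->.
have SnP : S \notin P.
  apply/negP => SP; have /set0Pn [x xS] := S0.
  move/subsetP: sS => /(_ x xS); rewrite inE => /andP [/negP []].
  by apply/bigcupP; exists S.
have okS : ok (S |: P).
  apply/andP; split; last first.
    apply/forallP => A; rewrite !inE; apply/implyP => /orP [/eqP ->|AP].
      by rewrite cS (subset_trans sS) // subsetDl.
    by have := aP A; rewrite AP.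
  have dis A : A \in P -> [disjoint S & A].
    move=> AP; apply/pred0P => x /=; apply/negP => /andP [xS xA].
    move/subsetP: sS => /(_ x xS); rewrite inE => /andP [/negP []].
    by apply/bigcupP; exists A.
  apply/trivIsetP => A B; rewrite !inE => /orP [/eqP ->|AP] /orP [/eqP ->|BP].
  - by rewrite eqxx.
  - by move=> _; apply: dis.
  - by move=> _; rewrite disjoint_sym; apply: dis.
  - by move/trivIsetP: tP; apply.
by have := mx _ okS; rewrite cardsU1 SnP add1n; rewrite /= ltnn.
Qed.

End Traces.

(** * Shattered sets *)

Lemma subset_of_card (I : finType) (A : {set I}) d : d <= #|A| ->
  exists2 A' : {set I}, A' \subset A & #|A'| = d.
Proof.
move=> led; exists [set x in take d (enum A)].
  by apply/subsetP => x; rewrite inE => /mem_take; rewrite mem_enum.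
by rewrite cardsE (card_uniqP _) ?take_uniq ?enum_uniq // size_takel // -cardE.
Qed.

Section Shattering.
Variable I : finType.
Implicit Types (F : {set {set I}}) (S A : {set I}).

Definition shattered F S : bool :=
  [forall A in powerset S, exists B in F, B :&: S == A].

Lemma shatteredP F S :
  reflect (forall A, A \subset S -> exists2 B, B \in F & B :&: S = A) (shattered F S).
Proof.
apply: (iffP forall_inP) => h A.
  move=> AS; have := h A; rewrite powersetE AS => /(_ isT) /exists_inP [B BF /eqP e].
  by exists B.
rewrite powersetE => /h [B BF e]; apply/exists_inP; exists B => //; exact/eqP.
Qed.

(* Pajor's form of the Sauer-Shelah lemma. *)
Lemma pajor F : #|F| <= #|[set S | shattered F S]|.
Proof.
have [m] := ubnP #|F|; elim: m F => // m IHm F leFm.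
have [->|/set0Pn [A0 A0F]] := eqVneq F set0; first by rewrite cards0.
have [/forall_inP all_eq|/forall_inPn [A1 A1F neA]] := boolP [forall A in F, A == A0].
  have -> : F = [set A0].
    apply/setP => A; rewrite inE; apply/idP/eqP => [/all_eq /eqP //|->//].
  rewrite cards1 card_gt0; apply/set0Pn; exists set0; rewrite inE.
  apply/shatteredP => A; rewrite subset0 => /eqP ->; exists A0; rewrite ?set11 //.
  by rewrite setI0.
have [x xA] : exists x, (x \in A0) != (x \in A1).
  apply/existsP; rewrite -negb_forall; apply: contra neA => /forallP e.
  by apply/eqP/setP => x; have /eqP := e x.
pose F1 := [set A in F | x \in A]; pose F0 := [set A in F | x \notin A].
have cF : #|F| = #|F1| + #|F0|.
  rewrite -(cardsID [set A : {set I} | x \in A] F); congr (_ + _); apply: eq_card => A.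
    by rewrite !inE.
  by rewrite !inE andbC.
have F1p : 0 < #|F1|.
  apply/card_gt0P; case: (boolP (x \in A0)) xA => h h'.
    by exists A0; rewrite inE A0F h.
  by exists A1; rewrite inE A1F; case: (x \in A1) h'.
have F0p : 0 < #|F0|.
  apply/card_gt0P; case: (boolP (x \in A0)) xA => h h'.
    by exists A1; rewrite inE A1F; case: (x \in A1) h'.
  by exists A0; rewrite inE A0F h.
have le1 : #|F1| <= #|[set S | shattered F1 S]| by apply: IHm; lia.
have le0 : #|F0| <= #|[set S | shattered F0 S]| by apply: IHm; lia.
set X1 := [set S | _] in le1; set X0 := [set S | _] in le0.
have nx1 S : S \in X1 -> x \notin S.
  rewrite inE => /shatteredP h; apply/negP => xS.
  have [B] := h _ (sub0set S); rewrite inE => /andP [_ xB] e.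
  by have := in_set0 x; rewrite -e inE xB xS.
have nx0 S : S \in X0 -> x \notin S.
  rewrite inE => /shatteredP h; apply/negP => xS.
  have [B] := h _ (subxx S); rewrite inE => /andP [_ xB] e.
  by move: xS; rewrite -e inE (negbTE xB).
(* A set shattered by both halves is counted once for each of them; adding [x] to it gives the
   second shattered set. *)
pose Y := (fun S => x |: S) @: (X1 :&: X0).
have injY : {in X1 :&: X0 &, injective (fun S => x |: S)}.
  move=> S S' /setIP [s1 _] /setIP [s1' _] e.
  have h S2 : x \notin S2 -> (x |: S2) :\ x = S2 by move=> h; rewrite setU1K.
  by rewrite -(h S (nx1 _ s1)) e h //; apply: nx1.
have cY : #|Y| = #|X1 :&: X0| by rewrite card_in_imset.
have dY : [disjoint X1 :|: X0 & Y].
  apply/pred0P => S /=; apply/negP => /andP [+ /imsetP [S' _ eS]].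
  by rewrite inE => /orP [/nx1|/nx0]; rewrite eS !inE eqxx.
have sub : (X1 :|: X0) :|: Y \subset [set S | shattered F S].
  apply/subsetP => S /setUP [|/imsetP [S' + ->]].
    move=> /setUP SX; rewrite inE; apply/shatteredP => A sA.
    by case: SX => /[!inE] /shatteredP /(_ A sA) [B] /[!inE] /andP [BF _] e; exists B.
  move=> /setIP [s1 s0]; rewrite inE; apply/shatteredP => A sA.
  move: (s1) (s0); rewrite !inE => /shatteredP h1 /shatteredP h0.
  have sA' : A :\ x \subset S' by rewrite subDset.
  case: (boolP (x \in A)) => xA'.
    have [B] := h1 _ sA'; rewrite inE => /andP [BF xB] e; exists B => //.
    by rewrite setIUr e (setIidPr _) ?sub1set // setD1K.
  have [B] := h0 _ sA'; rewrite inE => /andP [BF xB] e; exists B => //.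
  rewrite setIUr e; have -> : B :&: [set x] = set0.
    by apply/setP => y; rewrite !inE; case: eqP => [->|]; rewrite ?(negbTE xB) ?andbF.
  rewrite set0U; apply/setP => y; rewrite !inE; case: eqP => [->|//].
  by rewrite (negbTE xA').
rewrite cF; apply: leq_trans (subset_leq_card sub).
have := cardsUI (X1 :|: X0) Y; rewrite (disjoint_setI0 dY) cards0 cY.
by have := cardsUI X1 X0; lia.
Qed.

Lemma card_small_subsets S d :
  #|[set A : {set I} | (A \subset S) && (#|A| <= d)]| <= #|S|.+1 ^ d.
Proof.
(* [None] fills up the sequences of sets with fewer than [d] elements. *)
pose R : {set option I} := None |: (Some @: S).
have cR : #|R| = #|S|.+1.
  rewrite cardsU1 card_imset; last by move=> a b [].
  by case: imsetP => [[] //|_].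
rewrite -cR -[d in X in _ <= X]card_ord -card_ffun_on.
pose h (f : {ffun 'I_d -> option I}) := [set x | Some x \in codom f].
apply: leq_trans (_ : #|h @: ffun_on R| <= _); last exact: leq_imset_card.
apply/subset_leq_card/subsetP => A; rewrite inE => /andP [AS leAd].
apply/imsetP; exists [ffun i : 'I_d => onth (enum A) i].
  apply/ffun_onP => i; rewrite ffunE; case e: (onth _ _) => [x|]; last by rewrite !inE.
  rewrite !inE /=; apply/imsetP; exists x => //.
  have : x \in enum A by apply/onthP; exists i.
  by rewrite mem_enum; apply/subsetP.
apply/setP => x; rewrite inE; apply/idP/codomP => [xA|[i]].
  have xE : x \in enum A by rewrite mem_enum.
  have ltd : index x (enum A) < d.
    by apply: leq_trans leAd; rewrite cardE index_mem.
  by exists (Ordinal ltd); rewrite ffunE /= onthE (nth_map x) ?index_mem // nth_index.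
rewrite ffunE => /esym e; rewrite -mem_enum; apply/onthP; by exists i.
Qed.

(** The Sauer-Shelah lemma, with a crude bound for the number of subsets of size at most [d] in
    place of the binomial sum. *)
Lemma small_of_unshattered F S d : (forall A, A \in F -> A \subset S) ->
  (forall A, A \subset S -> #|A| = d.+1 -> ~~ shattered F A) -> #|F| <= #|S|.+1 ^ d.
Proof.
move=> FS unsh; apply: (leq_trans (pajor F)).
apply: (leq_trans _ (card_small_subsets S d)).
apply/subset_leq_card/subsetP => A; rewrite !inE => shA.
have AS : A \subset S.
  have [B BF e] := shatteredP _ _ shA A (subxx _).
  by rewrite -e; apply: subset_trans (subsetIl _ _) (FS _ BF).
rewrite AS /= leqNgt; apply/negP => ltd.
have [A' sA' cA'] := subset_of_card ltd.
have /negP [] := unsh _ (subset_trans sA' AS) cA'.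
apply/shatteredP => B sB; have [C CF e] := shatteredP _ _ shA B (subset_trans sB sA').
exists C => //; rewrite -(setIidPr sA') setIA e; exact/setIidPl.
Qed.

End Shattering.

(** * Rich matrices *)

Lemma card_cover_bound (I K : finType) (P : pred K) (D : K -> {set I}) (MM : {set {set I}}) :
  \bigcup_(k | P k) D k = setT ->
  #|MM| <= \prod_(k | P k) #|(fun M => M :&: D k) @: MM|.
Proof.
move=> cov; pose F k : {set {set I}} :=
  if P k then (fun M => M :&: D k) @: MM else [set set0].
pose h (M : {set I}) : {ffun K -> {set I}} := [ffun k => if P k then M :&: D k else set0].
have inj : injective h.
  move=> M M' /ffunP e; apply/setP => x.
  have /bigcupP [k Pk xD] : x \in \bigcup_(k | P k) D k by rewrite cov inE.
  have := e k; rewrite !ffunE Pk => /setP /(_ x); by rewrite !inE xD !andbT.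
rewrite -(card_imset _ inj).
have sub : h @: MM \subset family F.
  apply/subsetP => _ /imsetP [M MMM ->]; apply/familyP => k; rewrite ffunE /F.
  by case: ifP => _; [apply/imsetP; exists M | rewrite inE].
apply: leq_trans (subset_leq_card sub) _; rewrite card_family foldrE big_map big_enum /=.
rewrite [X in _ <= X]big_mkcond; apply: leq_prod => k _; rewrite /F.
by case: ifP => // _; rewrite cards1.
Qed.

Lemma enum_fun (T : finType) (A : {set T}) a : #|A| = a ->
  exists2 f : 'I_a -> T, injective f & f @: setT = A.
Proof.
move=> e; subst a; exists enum_val; first exact: enum_val_inj.
apply/setP => x; apply/imsetP/idP => [[i _ ->]|xA]; first exact: enum_valP.
by exists (enum_rank_in xA x); rewrite ?enum_rankK_in.
Qed.

Lemma bij_sets (T : finType) (A B : {set T}) k :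
  #|A| = k -> #|B| = k -> exists f, f @: A = B.
Proof.
move=> eA eB; have [f fi fA] := enum_fun eA; have [g gi gB] := enum_fun eB.
exists (fun x => if [pick i | f i == x] is Some i then g i else x).
have h i : (if [pick j | f j == f i] is Some j then g j else f i) = g i.
  by case: pickP => [j /eqP /fi ->|/(_ i)] //; rewrite eqxx.
by rewrite -gB -fA -imset_comp; apply: eq_imset => i /=; rewrite h.
Qed.

Lemma leq_expW m n e : m <= n -> m ^ e <= n ^ e.
Proof. by case: e => // e le_mn; rewrite leq_exp2r. Qed.

(** It rests on [2 * 15 ^ 11 <= 16 ^ 11]; hence the constant 11 wherever one of 16 patterns is
    excluded. *)
Lemma exp15 m : 2 ^ m * 15 ^ (11 * m) <= 16 ^ (11 * m).
Proof.
rewrite !expnM -expnMn; apply: leq_expW; lia.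
Qed.

Section RichMatrix.
Variables a k : nat.

(** A finite substitute for a random matrix. All sixteen patterns are demanded since the one that
    closes an induced C5 depends on whether the two sides are cliques or independent sets. *)
Definition richM (M : {set 'I_a * 'I_a}) : Prop :=
  forall A1 A2 B1 B2 : {set 'I_a},
    #|A1| = k -> #|A2| = k -> #|B1| = k -> #|B2| = k ->
    [disjoint A1 & A2] -> [disjoint B1 & B2] -> forall p1 p2 p3 p4 : bool,
  exists a1 a2 b1 b2, [/\ a1 \in A1, a2 \in A2, b1 \in B1 & b2 \in B2] /\
    [/\ ((a1, b1) \in M) = p1, ((a1, b2) \in M) = p2,
        ((a2, b1) \in M) = p3 & ((a2, b2) \in M) = p4].

(** Bijections of [A1] with [A2] and of [B1] with [B2] split the rectangle into [k * k] disjoint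
    boxes of size two by two, and a matrix that fails misses one of the 16 patterns in each box. *)
Lemma rich_fail_count (A1 A2 B1 B2 : {set 'I_a}) (p1 p2 p3 p4 : bool) (MM : {set {set 'I_a * 'I_a}}) :
  #|A1| = k -> #|A2| = k -> #|B1| = k -> #|B2| = k ->
  [disjoint A1 & A2] -> [disjoint B1 & B2] ->
  (forall M a1 a2 b1 b2, M \in MM -> a1 \in A1 -> a2 \in A2 -> b1 \in B1 -> b2 \in B2 ->
     ~ [/\ ((a1, b1) \in M) = p1, ((a1, b2) \in M) = p2,
        ((a2, b1) \in M) = p3 & ((a2, b2) \in M) = p4]) ->
  #|MM| * 16 ^ (k * k) <= 15 ^ (k * k) * 2 ^ (a * a).
Proof.
move=> c1 c2 d1 d2 dA dB fail.
have [al alA] : exists f, f @: A1 = A2 by apply: bij_sets c1 c2.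
have [be beB] : exists f, f @: B1 = B2 by apply: bij_sets d1 d2.
pose full := setX (A1 :|: A2) (B1 :|: B2).
pose box x y := setX [set x; al x] [set y; be y].
pose D (o : option ('I_a * 'I_a)) := if o is Some xy then box xy.1 xy.2 else ~: full.
pose P (o : option ('I_a * 'I_a)) := if o is Some xy then xy \in setX A1 B1 else true.
have cov : \bigcup_(o | P o) D o = setT.
  apply/setP => -[x y]; rewrite inE; apply/bigcupP.
  have [xyf|xyn] := boolP ((x, y) \in full); last by exists None; rewrite ?inE //=; rewrite !inE in xyn *.
  have {xyf} [/setUP hx /setUP hy] := setXP xyf.
  have [x' x'A xx'] : exists2 x', x' \in A1 & x \in [set x'; al x'].
    case: hx => [xA|]; first by exists x; rewrite // !inE eqxx.
    by rewrite -alA => /imsetP [x' x'A ->]; exists x'; rewrite // !inE eqxx orbT.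
  have [y' y'B yy'] : exists2 y', y' \in B1 & y \in [set y'; be y'].
    case: hy => [yB|]; first by exists y; rewrite // !inE eqxx.
    by rewrite -beB => /imsetP [y' y'B ->]; exists y'; rewrite // !inE eqxx orbT.
  by exists (Some (x', y')); rewrite /= ?inE /= ?x'A ?y'B //; rewrite !inE /= in xx' yy' *; rewrite xx' yy'.
have := card_cover_bound MM cov; rewrite (bigD1 None) //= => le1.
have cfull : #|full| = 4 * (k * k).
  rewrite cardsX !cardsU c1 c2 d1 d2 (disjoint_setI0 dA) (disjoint_setI0 dB) !cards0; lia.
have ctot : #|[set: 'I_a * 'I_a]| = a * a by rewrite cardsT card_prod !card_ord.
have le4 : 4 * (k * k) <= a * a by rewrite -cfull -ctot; apply: subset_leq_card; apply: subsetT.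
have leN : #|(fun M => M :&: ~: full) @: MM| <= 2 ^ (a * a - 4 * (k * k)).
  have <- : #|~: full| = a * a - 4 * (k * k).
    by have := cardsC full; rewrite cfull -cardsT ctot; lia.
  rewrite -card_powerset; apply/subset_leq_card/subsetP => _ /imsetP [M _ ->].
  by rewrite powersetE subsetIr.
have leS : \prod_(o | P o && (o != None)) #|(fun M => M :&: D o) @: MM| <= 15 ^ (k * k).
  apply: leq_trans (_ : \prod_(o | P o && (o != None)) 15 <= _).
    apply: leq_prod => -[[x y]|] //=; rewrite andbT => /setXP [xA yB].
    have axA : al x \in A2 by rewrite -alA; apply: imset_f.
    have byB : be y \in B2 by rewrite -beB; apply: imset_f.
    have nx : al x != x by apply: contraTneq axA => ->; rewrite (disjointFr dA).
    have ny : be y != y by apply: contraTneq byB => ->; rewrite (disjointFr dB).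
    pose q : {set 'I_a * 'I_a} := [set z in box x y |
      if z.1 == x then (if z.2 == y then p1 else p2) else (if z.2 == y then p3 else p4)].
    have cb : #|box x y| = 4.
      by rewrite cardsX !cards2 eq_sym nx eq_sym ny.
    apply: leq_trans (_ : #|powerset (box x y) :\ q| <= _); last first.
      rewrite -ltnS -[X in _ <= X]/(2 ^ 4) -cb -card_powerset (cardsD1 q (powerset _)) powersetE.
      have -> // : q \subset box x y.
      by apply/subsetP => z; rewrite inE => /andP [].
    apply/subset_leq_card/subsetP => _ /imsetP [M MMM ->]; rewrite !inE subsetIr andbT.
    apply/negP => /eqP /setP e; apply: (fail M x (al x) y (be y) MMM xA axA yB byB).
    by split; [have := e (x, y)|have := e (x, be y)|have := e (al x, y)|have := e (al x, be y)];
      rewrite !inE /= ?eqxx ?(negbTE nx) ?(negbTE ny) ?orbT /= ?andbT.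
  rewrite prod_nat_const leq_exp2l //.
  apply: leq_trans (_ : #|setX A1 B1| <= _); last by rewrite cardsX c1 d1.
  have <- : #|[set Some z | z in setX A1 B1]| = #|setX A1 B1|.
    by rewrite card_imset // => u v [].
  apply: subset_leq_card; apply/subsetP => -[[x y]|]; rewrite unfold_in //= ?andbF // andbT => h.
  exact: imset_f.
have : #|MM| <= 2 ^ (a * a - 4 * (k * k)) * 15 ^ (k * k).
  by apply: leq_trans le1 _; apply: leq_mul.
move=> le2; rewrite -[X in 2 ^ X](subnK le4) expnD (expnM 2 4).
rewrite -[16]/(2 ^ 4); move: le2; move: (2 ^ (_ - _)) (15 ^ _) ((2 ^ 4) ^ _) => x y z le2.
by have := leq_mul le2 (leqnn z); rewrite -mulnA mulnCA.
Qed.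

(** Counting: a failure is described by four sets and a pattern, [2 ^ (4 * a + 4)] choices, and by
    [exp15] each occurs in a fraction of at most [2 ^ -(4 * a + 5)] of all matrices. *)
Lemma richM_exists : 11 * (4 * a + 5) <= k * k -> exists M, richM M.
Proof.
move=> le_k; apply: contrapT => none.
pose L := ({set 'I_a} * {set 'I_a} * {set 'I_a} * {set 'I_a} * (bool * bool * bool * bool))%type.
pose MM (l : L) : {set {set 'I_a * 'I_a}} := let: (A1, A2, B1, B2, (p1, p2, p3, p4)) := l in
  [set M : {set 'I_a * 'I_a} | [&& #|A1| == k, #|A2| == k, #|B1| == k, #|B2| == k,
     [disjoint A1 & A2], [disjoint B1 & B2] &
     [forall a1 in A1, forall a2 in A2, forall b1 in B1, forall b2 in B2,
      ~~ [&& ((a1, b1) \in M) == p1, ((a1, b2) \in M) == p2,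
        ((a2, b1) \in M) == p3 & ((a2, b2) \in M) == p4]]]].
have cov : [set: {set 'I_a * 'I_a}] \subset \bigcup_(l : L) MM l.
  apply/subsetP => M _; apply: contrapT => Mn; apply: none; exists M.
  move=> A1 A2 B1 B2 c1 c2 d1 d2 dA dB p1 p2 p3 p4; apply: contrapT => h; apply: Mn.
  apply/bigcupP; exists (A1, A2, B1, B2, (p1, p2, p3, p4)) => //=.
  rewrite inE c1 c2 d1 d2 dA dB !eqxx /=.
  apply/forall_inP => a1 a1A; apply/forall_inP => a2 a2A.
  apply/forall_inP => b1 b1B; apply/forall_inP => b2 b2B; apply/negP => /and4P [/eqP e1 /eqP e2 /eqP e3 /eqP e4].
  by apply: h; exists a1, a2, b1, b2.
have leM (l : L) : #|MM l| * 16 ^ (k * k) <= 15 ^ (k * k) * 2 ^ (a * a).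
  case: l => [[[[A1 A2] B1] B2] [[[p1 p2] p3] p4]] /=; set MMl := [set M | _].
  have [->|/set0Pn [M0]] := eqVneq MMl set0; first by rewrite cards0.
  rewrite inE => /and4P [/eqP c1 /eqP c2 /eqP d1 /and4P [/eqP d2 dA dB _]].
  apply: (rich_fail_count (p1 := p1) (p2 := p2) (p3 := p3) (p4 := p4) c1 c2 d1 d2 dA dB).
  move=> M a1 a2 b1 b2; rewrite inE => /and4P [_ _ _ /and4P [_ _ _ /forall_inP h]] a1A a2A b1B b2B.
  move: h => /(_ _ a1A) /forall_inP /(_ _ a2A) /forall_inP /(_ _ b1B) /forall_inP /(_ _ b2B) /negP h.
  by move=> [e1 e2 e3 e4]; apply: h; rewrite e1 e2 e3 e4 !eqxx.
have : 2 ^ (a * a) <= \sum_(l : L) #|MM l|.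
  have -> : 2 ^ (a * a) = #|[set: {set 'I_a * 'I_a}]|.
    by rewrite -powersetT card_powerset cardsT card_prod !card_ord.
  apply: leq_trans (subset_leq_card cov) _.
  elim/big_ind2: _ => [|A x B y hx hy|//]; first by rewrite cards0.
  by apply: leq_trans (leq_card_setU _ _) _; apply: leq_add.
have cL : #|{: L}| = 2 ^ (4 * a + 4).
  rewrite !card_prod !card_bool.
  have -> : #|{set 'I_a}| = 2 ^ a by rewrite -cardsT -powersetT card_powerset cardsT card_ord.
  by rewrite (_ : 4 * a + 4 = a + a + a + a + 4) ?expnD //; lia.
move=> le_sum.
have : 2 ^ (a * a) * 16 ^ (k * k) <= 2 ^ (4 * a + 4) * (15 ^ (k * k) * 2 ^ (a * a)).
  apply: leq_trans (_ : (\sum_(l : L) #|MM l|) * 16 ^ (k * k) <= _).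
    by rewrite leq_mul2r le_sum orbT.
  by rewrite big_distrl /= -cL -sum_nat_const; apply: leq_sum => l _.
have [d ->] : exists d, k * k = 11 * (4 * a + 5) + d by exists (k * k - 11 * (4 * a + 5)); lia.
rewrite !(expnD _ (11 * _)); have := exp15 (4 * a + 5); move: (11 * _) => m.
rewrite (_ : 4 * a + 5 = (4 * a + 4).+1); last by lia.
rewrite expnS; move: (2 ^ (4 * a + 4)) => w h1 h2.
have p0 : 0 < 2 ^ (a * a) * (16 ^ m * 16 ^ d) by rewrite !muln_gt0 !expn_gt0.
have h3 : 15 ^ d <= 16 ^ d by apply: leq_expW.
have := leq_mul h1 h3; move: p0 h2; rewrite -!mulnA; move: (2 ^ (a * a)) (15 ^ m) (15 ^ d) (16 ^ m * 16 ^ d) => x y z u.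
by nia.
Qed.

End RichMatrix.

(** * Rich pairs in graphs *)

Lemma linear_le_exp A : exists m0, forall m, m0 <= m -> A * m.+1 <= 2 ^ m.
Proof.
exists (4 * A) => m le_m; pose h := m %/ 2.
have -> : 2 ^ m = 2 ^ h * 2 ^ (m - h) by rewrite -expnD; congr (2 ^ _); rewrite /h; lia.
have h1 : h.+1 <= 2 ^ h by apply: ltn_expl.
have h2 : (m - h).+1 <= 2 ^ (m - h) by apply: ltn_expl.
apply: leq_trans (leq_mul h1 h2); rewrite /h; nia.
Qed.

Lemma succ_le_exp_div c : 0 < c -> exists n0, forall n, n0 <= n -> n.+1 <= 2 ^ (n %/ c).
Proof.
move=> c0; have [m0 hm] := linear_le_exp c; exists (c * m0) => n le_n.
apply: leq_trans (hm _ _); last by rewrite leq_divRL // mulnC.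
by rewrite mulnC; apply: ltn_ceil.
Qed.

Section Graphs.
Variable T : finType.
Implicit Types (G : sgraph T) (GG : {set sgraph T}) (A B S U X : {set T}).

Definition indep G A : bool := [forall x in A, forall y in A, ~~ adj G x y].
Definition homog G A : bool := clique G A || indep G A.

Lemma cliqueP G A :
  reflect (forall x y, x \in A -> y \in A -> x != y -> adj G x y) (clique G A).
Proof.
apply: (iffP forall_inP) => h x.
  by move=> y /h /forall_inP hx /hx /implyP.
by move=> xA; apply/forall_inP => y yA; apply/implyP; apply: h.
Qed.

Lemma indepP G A :
  reflect (forall x y, x \in A -> y \in A -> ~~ adj G x y) (indep G A).
Proof.
apply: (iffP forall_inP) => h x; first by move=> y /h /forall_inP hx /hx.
by move=> xA; apply/forall_inP => y yA; apply: h.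
Qed.

Lemma homog_sub G A B : A \subset B -> homog G B -> homog G A.
Proof.
move=> /subsetP s /orP [/cliqueP h|/indepP h]; apply/orP; [left|right].
  by apply/cliqueP => x y /s xB /s yB; apply: h.
by apply/indepP => x y /s xB /s yB; apply: h.
Qed.

(** The Erdos-Hajnal property with exponent 1/2, required of all induced subgraphs at once. *)
Definition EH G : Prop := forall S, exists2 A : {set T}, A \subset S & homog G A && (#|S| <= #|A| * #|A|).

(** The ten conditions already force the five vertices to be distinct. *)
Definition C5free G : Prop := forall v0 v1 v2 v3 v4,
  adj G v0 v1 -> adj G v1 v2 -> adj G v2 v3 -> adj G v3 v4 -> adj G v4 v0 ->
  ~~ adj G v0 v2 -> ~~ adj G v0 v3 -> ~~ adj G v1 v3 -> ~~ adj G v1 v4 -> ~~ adj G v2 v4 -> False.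

(** The family of rows on [B] is chosen first; by [small_of_unshattered] it has at most
    [#|B|.+1 ^ d] members. Each vertex of [Q] then selects one of them. *)
Lemma nt_unshattered (Q B : {set T}) d GG :
  (forall G A, G \in GG -> A \subset B -> #|A| = d.+1 ->
     ~~ shattered [set nb G v :&: B | v in Q] A) ->
  nt (setX Q B) GG <= (2 ^ #|B|).+1 ^ (#|B|.+1 ^ d) * (#|B|.+1 ^ d) ^ #|Q|.
Proof.
move=> unsh; set Phi := #|B|.+1 ^ d.
pose P (F : {set {set T}}) := (F \subset powerset B) && (#|F| <= Phi).
pose CC (F : {set {set T}}) := [set G in GG | [forall v in Q, nb G v :&: B \in F]].
apply: leq_trans (_ : #|P| * Phi ^ #|Q| <= _); last first.
  rewrite leq_mul2r; apply/orP; right; rewrite -card_powerset.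
  have := card_small_subsets (powerset B) Phi; rewrite cardsE; apply: leq_trans.
  by apply: subset_leq_card; apply/subsetP => F.
apply: (nt_union (CC := CC)) => [G GGG|F /andP [_ cF]].
  exists [set nb G v :&: B | v in Q].
    apply/andP; split.
      by apply/subsetP => _ /imsetP [v _ ->]; rewrite powersetE subsetIr.
    apply: small_of_unshattered => [A /imsetP [v _ ->]|A sA cA]; first exact: subsetIr.
    exact: unsh.
  by rewrite inE GGG; apply/forall_inP => v vQ; apply: imset_f.
apply: nt_rows => v vQ; apply: leq_trans cF; apply: nt_row => G.
by rewrite inE => /andP [_ /forall_inP]; apply.
Qed.

(** A partial partition is stored as a function, with [None] for the vertices left over, so that at
    most [#|T|.+1 ^ #|T|] of them have to be considered. *)
Definition blk (f : {ffun T -> option T}) (y : T) : {set T} := [set x | f x == Some y].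

(** A maximal packing of homogeneous sets of size [t] leaves at most [t * t] vertices, since more of
    them would contain another such set by [EH]. *)
Lemma EH_partition G U t : EH G -> 0 < t -> exists f : {ffun T -> option T},
  (forall y, blk f y != set0 -> [&& homog G (blk f y), #|blk f y| == t & blk f y \subset U]) /\
  #|U :\: \bigcup_y blk f y| <= t * t.
Proof.
move=> eh t0; pose c S := homog G S && (#|S| == t).
have c0 : ~~ c set0 by rewrite /c cards0 eq_sym (gtn_eqF t0) andbF.
have [P [tP cP mP]] := maximal_packing U c0.
pose f := [ffun x => if x \in cover P then [pick y in pblock P x] else None].
have fS S x : S \in P -> x \in S -> f x = [pick y in S].
  by move=> SP xS; rewrite ffunE (def_pblock tP SP xS); have -> : x \in cover P by apply/bigcupP; exists S.
have bS y : blk f y != set0 -> exists2 S, S \in P & blk f y = S.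
  case/set0Pn => x; rewrite inE => /eqP fx; exists (pblock P x).
    by apply: pblock_mem; move: fx; rewrite ffunE; case: ifP.
  have xc : x \in cover P by move: fx; rewrite ffunE; case: ifP.
  have xp : x \in pblock P x by rewrite mem_pblock.
  have pP := pblock_mem xc.
  apply/setP => z; rewrite inE; apply/eqP/idP => [fz|zp].
    have zc : z \in cover P by move: fz; rewrite ffunE; case: ifP.
    have zp : z \in pblock P z by rewrite mem_pblock.
    move: fx fz; rewrite (fS _ _ pP xp) (fS _ _ (pblock_mem zc) zp).
    case: pickP => // u ux [<-]; case: pickP => // w wz [ewu]; move: wz; rewrite ewu => uz.
    by rewrite -(def_pblock tP pP ux) (def_pblock tP (pblock_mem zc) uz).
  by rewrite (fS _ _ pP zp) -(fS _ _ pP xp).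
exists f; split.
  by move=> y /bS [S /cP /andP [/andP [h1 h2] h3] ->]; rewrite h1 h2 h3.
have -> : \bigcup_y blk f y = cover P.
  apply/setP => x; apply/bigcupP/idP => [[y _]|/bigcupP [S SP xS]].
    by rewrite inE ffunE; case: ifP.
  case e: (f x) => [y|]; first by exists y; rewrite ?inE ?e.
  by move: e; rewrite (fS _ _ SP xS); case: pickP => // /(_ x); rewrite xS.
have [A sA /andP [hA leA]] := eh (U :\: cover P).
rewrite leqNgt; apply/negP => lt.
have tA : t <= #|A| by nia.
have [A' sA' cA'] := subset_of_card tA.
have /negP [] := mP A' (subset_trans sA' sA).
by rewrite /c (homog_sub sA' hA) cA' eqxx.
Qed.

Definition rich a k G A B : Prop :=
  [/\ #|A| = a, #|B| = a, [disjoint A & B], homog G A & homog G B] /\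
  forall A1 A2 B1 B2, A1 \subset A -> A2 \subset A -> B1 \subset B -> B2 \subset B ->
    #|A1| = k -> #|A2| = k -> #|B1| = k -> #|B2| = k ->
    [disjoint A1 & A2] -> [disjoint B1 & B2] -> forall p1 p2 p3 p4 : bool,
  exists a1 a2 b1 b2, [/\ a1 \in A1, a2 \in A2, b1 \in B1 & b2 \in B2] /\
    [/\ adj G a1 b1 = p1, adj G a1 b2 = p2, adj G a2 b1 = p3 & adj G a2 b2 = p4].

(* The second half of the shattered set serves to make the chosen rows distinct. *)
Lemma shattered_rich a k (M : {set 'I_a * 'I_a}) G Q B A : richM k M -> homog G Q -> homog G B ->
  [disjoint Q & B] -> A \subset B -> #|A| = a + a ->
  shattered [set nb G v :&: B | v in Q] A ->
  exists A' B', [/\ A' \subset B, B' \subset Q & rich a k G A' B'].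
Proof.
move=> rM hQ hB dQB AB cA /shatteredP sh.
have [A0 sA0 cA0] : exists2 A0 : {set T}, A0 \subset A & #|A0| = a.
  by apply: subset_of_card; lia.
have cE : #|A :\: A0| = a by have := cardsID A0 A; rewrite (setIidPr sA0); lia.
have [f fi fA] := enum_fun cA0; have [g gi gE] := enum_fun cE.
have fA0 i : f i \in A0 by rewrite -fA imset_f.
have gE0 i : g i \in A :\: A0 by rewrite -gE imset_f.
pose S j := [set f i | i in [set i | (i, j) \in M]] :|: [set g j].
have [v vQ vS] : exists2 v : 'I_a -> T, forall j, v j \in Q & forall j, nb G (v j) :&: A = S j.
  have h j : exists2 w, w \in Q & nb G w :&: A = S j.
    have [|_ /imsetP [w wQ ->] e] := sh (S j); last by exists w; rewrite // -e -setIA (setIidPr AB).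
    rewrite subUset sub1set; have /setDP [-> _] := gE0 j; rewrite andbT.
    by apply/subsetP => _ /imsetP [i _ ->]; apply: (subsetP sA0).
  by have [v h1 h2] := fin_all_exists2 h; exists v.
have vf i j : adj G (v j) (f i) = ((i, j) \in M).
  have := vS j => /setP /(_ (f i)); rewrite !inE (subsetP sA0 _ (fA0 i)) andbT => ->.
  have -> : (f i == g j) = false.
    by apply: contraTF (fA0 i) => /eqP ->; have /setDP [_] := gE0 j.
  rewrite orbF; apply/imsetP/idP => [[i' + /fi ->]|iM]; first by rewrite inE.
  by exists i; rewrite ?inE.
have vi : injective v.
  move=> j j' e; have := vS j; rewrite e vS => /setP /(_ (g j)); rewrite !inE eqxx orbT.
  have nf j2 : (g j \in [set f i | i in [set i | (i, j2) \in M]]) = false.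
    apply/imsetP => -[i _ e']; have /setDP [_] := gE0 j; by rewrite e' fA0.
  by rewrite nf /= => /eqP /gi.
exists A0, (v @: setT); split.
- exact: subset_trans AB.
- by apply/subsetP => _ /imsetP [j _ ->].
have sv : v @: setT \subset Q by apply/subsetP => _ /imsetP [j _ ->].
split.
  split=> //; first by rewrite card_imset // cardsT card_ord.
  - rewrite disjoint_sym; apply: disjointWl sv _; apply: disjointWr _ dQB.
    exact: subset_trans AB.
  - by apply: homog_sub hB; apply: subset_trans AB.
  - exact: homog_sub hQ.
have pre (h : 'I_a -> T) (C : {set T}) D : injective h -> h @: setT = D -> C \subset D ->
    #|h @^-1: C| = #|C|.
  move=> hi hD sC; have {2}-> : C = h @: (h @^-1: C).
    apply/setP => x; apply/idP/imsetP => [xC|[i + ->]]; last by rewrite inE.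
    have : x \in D by apply: (subsetP sC).
    by rewrite -hD => /imsetP [i _ e]; exists i; rewrite // inE -e.
  by rewrite card_imset.
move=> A1 A2 B1 B2 s1 s2 t1 t2 c1 c2 d1 d2 dA dB p1 p2 p3 p4.
have [||||||i1 [i2 [j1 [j2 [[h1 h2 h3 h4] [e1 e2 e3 e4]]]]]] :=
  rM (f @^-1: A1) (f @^-1: A2) (v @^-1: B1) (v @^-1: B2) _ _ _ _ _ _ p1 p2 p3 p4.
- by rewrite (pre _ _ _ fi fA).
- by rewrite (pre _ _ _ fi fA).
- by rewrite (pre _ _ _ vi (erefl _)).
- by rewrite (pre _ _ _ vi (erefl _)).
- apply/pred0P => i /=; rewrite !inE; apply/negP => /andP [h h'].
  by have := disjointFr dA h; rewrite h'.
- apply/pred0P => i /=; rewrite !inE; apply/negP => /andP [h h'].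
  by have := disjointFr dB h; rewrite h'.
exists (f i1), (f i2), (v j1), (v j2); rewrite !inE in h1 h2 h3 h4; split=> //.
by split; rewrite adj_sym vf.
Qed.

Definition nearhom m G v A : bool := (#|nb G v :&: A| < m) || (#|A :\: nb G v| < m).

Lemma split_card A m : m + m <= #|A| -> exists A1 A2,
  [/\ A1 \subset A, A2 \subset A, #|A1| = m, #|A2| = m & [disjoint A1 & A2]].
Proof.
move=> le_m; have [A1 s1 c1] : exists2 A1 : {set T}, A1 \subset A & #|A1| = m.
  by apply: subset_of_card; lia.
have [A2 s2 c2] : exists2 A2 : {set T}, A2 \subset A :\: A1 & #|A2| = m.
  by apply: subset_of_card; have := cardsID A1 A; rewrite (setIidPr s1); lia.
exists A1, A2; split=> //; first exact: (subset_trans s2 (subsetDl _ _)).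
apply/pred0P => x /=; apply/negP => /andP [x1 /(subsetP s2)].
by rewrite inE x1.
Qed.

(** If [v] has at least [k + k] neighbours and non-neighbours in both [A] and [B], two vertices of
    each side can be chosen in parts prescribed by [v] and with a prescribed pattern between them.
    In each of the four cases for the types of [A] and [B] a suitable choice closes an induced C5
    through [v]. The threshold is [k + k] because some cases take both vertices of one side from the
    same part. *)
Lemma rich_nearhom a k G A B v : C5free G -> rich a k G A B -> v \notin A :|: B ->
  nearhom (k + k) G v A || nearhom (k + k) G v B.
Proof.
move=> c5 [[_ _ dAB hA hB] rAB]; rewrite inE negb_or => /andP [vA vB].
apply/negPn/negP; rewrite !negb_or -!leqNgt => /andP [/andP [a1 a2] /andP [b1 b2]].
have [A1 [A1' [s1 s1' c1 c1' d1]]] := split_card a1.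
have [A2 [A2' [s2 s2' c2 c2' d2]]] := split_card a2.
have [B1 [B1' [t1 t1' e1 e1' f1]]] := split_card b1.
have [B2 [B2' [t2 t2' e2 e2' f2]]] := split_card b2.
have sI (C D : {set T}) : C \subset nb G v :&: D -> (C \subset D) /\ (forall x, x \in C -> adj G v x).
  rewrite subsetI => /andP [/subsetP h ->]; split=> // x /h; by rewrite inE.
have sD (C D : {set T}) : C \subset D :\: nb G v -> (C \subset D) /\ (forall x, x \in C -> ~~ adj G v x).
  move=> /subsetP h; split=> [|x /h]; last by rewrite !inE => /andP [].
  by apply/subsetP => x /h; rewrite inE => /andP [].
have [s1A n1] := sI _ _ s1; have [s1A' n1'] := sI _ _ s1'.
have [s2A n2] := sD _ _ s2; have [s2A' n2'] := sD _ _ s2'.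
have [t1B m1] := sI _ _ t1; have [t1B' m1'] := sI _ _ t1'.
have [t2B m2] := sD _ _ t2; have [t2B' m2'] := sD _ _ t2'.
have dis (C D : {set T}) : (forall x, x \in C -> adj G v x) -> (forall x, x \in D -> ~~ adj G v x) -> [disjoint C & D].
  by move=> h h'; apply/pred0P => x /=; apply/negP => /andP [/h + /h' /negP].
have ne (C D : {set T}) x y : [disjoint C & D] -> x \in C -> y \in D -> x != y.
  by move=> dd xC yD; apply: contraTneq yD => <-; rewrite (disjointFr dd xC).
case/orP: hA => [/cliqueP|/indepP] hA; case/orP: hB => [/cliqueP|/indepP] hB.
- have [x1 [x2 [y1 [y2 [[xA1 xA2 yB1 yB2] [p1 p2 p3 p4]]]]]] :=
    rAB A1 A2 B1 B2 s1A s2A t1B t2B c1 c2 e1 e2 (dis _ _ n1 n2) (dis _ _ m1 m2) false false false true.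
  apply: (c5 v x1 x2 y2 y1); rewrite ?p1 ?p2 ?p3 ?p4 ?(n1 _ xA1) ?(n2 _ xA2) ?(m2 _ yB2) //.
  + by apply: hA; [exact: (subsetP s1A)|exact: (subsetP s2A)|exact: ne (dis _ _ n1 n2) _ _].
  + by apply: hB; [exact: (subsetP t2B)|exact: (subsetP t1B)|rewrite eq_sym; apply: ne (dis _ _ m1 m2) _ _].
  + by rewrite adj_sym (m1 _ yB1).
- have [x1 [x2 [y1 [y2 [[xA1 xA2 yB1 yB2] [p1 p2 p3 p4]]]]]] :=
    rAB A2 A2' B1 B1' s2A s2A' t1B t1B' c2 c2' e1 e1' d2 f1 true false false true.
  apply: (c5 v y1 x1 x2 y2); rewrite ?p2 ?p4 ?(m1 _ yB1) ?(n2 _ xA1) ?(n2' _ xA2) //.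
  + by rewrite adj_sym p1.
  + by apply: hA; [exact: (subsetP s2A)|exact: (subsetP s2A')|exact: ne d2 _ _].
  + by rewrite adj_sym (m1' _ yB2).
  + by rewrite adj_sym p3.
  + by apply: hB; [exact: (subsetP t1B) | exact: (subsetP t1B')].
- have [x1 [x2 [y1 [y2 [[xA1 xA2 yB1 yB2] [p1 p2 p3 p4]]]]]] :=
    rAB A1 A1' B2 B2' s1A s1A' t2B t2B' c1 c1' e2 e2' d1 f2 true false false true.
  apply: (c5 v x1 y1 y2 x2); rewrite ?p1 ?p2 ?(n1 _ xA1) ?(m2 _ yB1) ?(m2' _ yB2) //.
  + by apply: hB; [exact: (subsetP t2B)|exact: (subsetP t2B')|exact: ne f2 _ _].
  + by rewrite adj_sym p4.
  + by rewrite adj_sym (n1' _ xA2).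
  + by apply: hA; [exact: (subsetP s1A) | exact: (subsetP s1A')].
  + by rewrite adj_sym p3.
- have [x1 [x2 [y1 [y2 [[xA1 xA2 yB1 yB2] [p1 p2 p3 p4]]]]]] :=
    rAB A1 A2 B1 B2 s1A s2A t1B t2B c1 c2 e1 e2 (dis _ _ n1 n2) (dis _ _ m1 m2) false true true true.
  apply: (c5 v x1 y2 x2 y1); rewrite ?p1 ?p2 ?p3 ?(n1 _ xA1) ?(n2 _ xA2) ?(m2 _ yB2) //.
  + by rewrite adj_sym p4.
  + by rewrite adj_sym (m1 _ yB1).
  + by apply: hA; [exact: (subsetP s1A) | exact: (subsetP s2A)].
  + by apply: hB; [exact: (subsetP t2B) | exact: (subsetP t1B)].
Qed.

End Graphs.

(** * Graphs without rich pairs *)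

Section LowClass.
Variables (T : finType) (a k d t q : nat) (M : {set 'I_a * 'I_a}).
Hypotheses (rM : richM k M) (dE : d.+1 = a + a).
Implicit Types (G : sgraph T) (GG : {set sgraph T}) (A B S U X : {set T}).
Let n := #|T|.
Let Phi := t.+1 ^ d.
Let beta := (2 ^ t).+1 ^ Phi * Phi ^ q.

Lemma nt_homog S GG : (forall G, G \in GG -> homog G S) -> nt (setX S S) GG <= 2.
Proof.
move=> h; pose F := [set [set p in setX S S | p.1 != p.2]; set0].
apply: leq_trans (_ : #|F| <= _); last by rewrite cards2; case: eqP.
apply: nt_family => G /h /orP [/cliqueP c|/indepP c]; rewrite !inE; apply/orP.
  left; apply/eqP/setP => -[x y]; rewrite !inE /=; case: (boolP (x \in S)) => //= xS.
  case: (boolP (y \in S)) => //= yS; case: eqVneq => [->|ne]; first by rewrite adj_irrefl.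
  by rewrite c.
right; apply/eqP/setP => -[x y]; rewrite !inE /=; case: (boolP (x \in S)) => //= xS.
by case: (boolP (y \in S)) => //= yS; apply/negbTE/c.
Qed.

Definition norich G U : Prop :=
  forall A B, A \subset U -> B \subset U -> ~ rich a k G A B.

Definition parted (s : nat) (f : {ffun T -> option T}) U : Prop :=
  (forall y, blk f y != set0 -> #|blk f y| = s /\ blk f y \subset U) /\
  #|U :\: \bigcup_y blk f y| <= s * s.

Definition homparts G (f : {ffun T -> option T}) : Prop :=
  forall y, blk f y != set0 -> homog G (blk f y).

Lemma parted_count s f U : parted s f U -> s * #|[set y | blk f y != set0]| <= n.
Proof.
move=> [h _]; set N := [set y | _].
have <- : \sum_(y in N) #|blk f y| = s * #|N|.
  rewrite (eq_bigr (fun=> s)) ?sum_nat_const 1?mulnC // => y; rewrite inE => /h [] //.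
have -> : \sum_(y in N) #|blk f y| = \sum_(y in N) \sum_(x | f x == Some y) 1.
  by apply: eq_bigr => y _; rewrite sum1_card; apply: eq_card => x; rewrite inE.
have -> : n = \sum_(x : T) 1 by rewrite sum1_card.
rewrite (exchange_big_dep predT) //=; apply: leq_sum => x _.
rewrite sum1_card; apply: leq_trans (_ : #|[pred y | f x == Some y]| <= _).
  by apply: subset_leq_card; apply/subsetP => y; rewrite !inE => /andP [].
case: (f x) => [z|]; last by rewrite eq_card0.
by rewrite (@eq_card1 _ z) // => y; rewrite !inE eq_sym; apply/eqP/eqP => [[]|->].
Qed.

(** Left-over vertices pay for all their pairs, and each part of size [t] pays one bit for being a
    clique or independent. Between a part of size [t] and one of size [q] the rows cannot shatter a
    set of size [a + a], as this would produce a rich pair, so they cost at most a factor [beta]. *)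
Lemma low_class U (f1 f2 : {ffun T -> option T}) GG :
  parted t f1 U -> parted q f2 U ->
  (forall G, G \in GG -> [/\ homparts G f1, homparts G f2 & norich G U]) ->
  nt (setX U U) GG <= 2 ^ ((t * t + q * q) * n) * (2 ^ n *
    beta ^ (#|[set y | blk f1 y != set0]| * #|[set y | blk f2 y != set0]|)).
Proof.
move=> [p1 l1] [p2 l2] hG.
pose L1 := U :\: \bigcup_y blk f1 y; pose L2 := U :\: \bigcup_y blk f2 y.
pose D0 := setX (L1 :|: L2) [set: T].
pose D1 y := setX (blk f1 y) (blk f1 y).
pose D2 (yz : T * T) := setX (blk f2 yz.2 :\: blk f1 yz.1) (blk f1 yz.1).
apply: leq_trans (_ : nt (D0 :|: (\bigcup_y D1 y :|: \bigcup_yz D2 yz)) GG <= _).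
  apply: nt_mono => x y; rewrite !inE /= => /andP [xU yU]; apply/orP; right.
  case: (boolP (x \in L1 :|: L2)) => [|xL]; first by rewrite !inE => ->.
  case: (boolP (y \in L1 :|: L2)) => [|yL]; first by rewrite !inE => ->; rewrite !orbT.
  move: xL yL; rewrite !inE !negb_or !negb_and !negbK xU yU !orbF => /andP [/bigcupP [x1 _ hx1] /bigcupP [x2 _ hx2]].
  move=> /andP [/bigcupP [y1 _ hy1] _]; apply/orP; left; apply/orP; right.
  case: (boolP (x \in blk f1 y1)) => hx.
    by apply/orP; left; apply/bigcupP; exists y1; rewrite // inE /= hx hy1.
  by apply/orP; right; apply/bigcupP; exists (y1, x2) => //; apply/setXP; split=> //=; apply/setDP; split.
apply: leq_trans (nt_U _ _ _) _; apply: leq_mul.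
  apply: leq_trans (nt_exp _ _) _; rewrite leq_exp2l // cardsX cardsT leq_mul2r.
  apply/orP; right; apply: leq_trans (leq_card_setU _ _) _; exact: leq_add.
apply: leq_trans (nt_U _ _ _) _; apply: leq_mul.
  apply: leq_trans (nt_bigU _ _ _) _; rewrite -[n]/#|T| -prod_nat_const; apply: leq_prod => y _.
  have [e|ne] := eqVneq (blk f1 y) set0.
    apply: leq_trans (nt_exp _ _) _; by rewrite /D1 e cardsX cards0.
  by apply: nt_homog => G /hG [h _ _]; apply: h.
apply: leq_trans (nt_bigU _ _ _) _.
set N1 := [set y | _]; set N2 := [set y | _].
rewrite -cardsX -prod_nat_const [X in _ <= X]big_mkcond; apply: leq_prod => -[y z] _.
case: ifP => [|ne]; last first.
  apply: leq_trans (nt_exp _ _) _; rewrite -[1]/(2 ^ 0) leq_exp2l // leqn0 cardsX muln_eq0 !cards_eq0 /=.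
  have [->|n1] := eqVneq (blk f1 y) set0; first by rewrite orbT.
  have [->|n2] := eqVneq (blk f2 z) set0; first by rewrite set0D eqxx.
  by move: ne; rewrite !inE /= n1 n2.
rewrite !inE /= => /andP [n1 n2]; have [c1 s1] := p1 _ n1; have [c2 s2] := p2 _ n2.
apply: leq_trans (@nt_unshattered _ _ _ d _ _) _.
  move=> G A GGG AB cA; apply/negP => sh; have [h1 h2 nr] := hG _ GGG.
  have dj : [disjoint blk f2 z :\: blk f1 y & blk f1 y].
    by rewrite -setI_eq0 setIDAC setDIl setDv setI0.
  have [A' [B' [sA' sB' r]]] := shattered_rich rM (homog_sub (subsetDl _ _) (h2 _ n2)) (h1 _ n1)
    dj AB (etrans cA dE) sh.
  apply: (nr A' B') r; first exact: subset_trans s1.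
  exact: (subset_trans sB' (subset_trans (subsetDl _ _) s2)).
rewrite c1 leq_mul2l; apply/orP; right; rewrite leq_pexp2l ?expn_gt0 //.
by rewrite -c2 subset_leq_card // subsetDl.
Qed.

Lemma low_union U GG : 0 < t -> 0 < q ->
  (forall G, G \in GG -> EH G /\ norich G U) -> exists N1 N2, [/\ t * N1 <= n, q * N2 <= n &
  nt (setX U U) GG <= (n.+1 ^ n * n.+1 ^ n) * (2 ^ ((t * t + q * q) * n) * (2 ^ n * beta ^ (N1 * N2)))].
Proof.
move=> t0 q0 hG; pose L := ({ffun T -> option T} * {ffun T -> option T})%type.
pose P (l : L) := `[< parted t l.1 U /\ parted q l.2 U >].
pose CC (l : L) := [set G in GG | `[< homparts G l.1 /\ homparts G l.2 >]].
exists (n %/ t), (n %/ q); split; [by rewrite mulnC leq_trunc_div| by rewrite mulnC leq_trunc_div|].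
apply: leq_trans (_ : #|P| * (2 ^ ((t * t + q * q) * n) * (2 ^ n * beta ^ (n %/ t * (n %/ q)))) <= _).
  apply: (nt_union (CC := CC)) => [G GGG|l /asboolP [p1 p2]].
    have [eh nr] := hG _ GGG.
    have [f1 [h1 l1]] := EH_partition U eh t0; have [f2 [h2 l2]] := EH_partition U eh q0.
    exists (f1, f2); first apply/asboolP.
      by split; split=> //= y ne; [have /and3P [_ /eqP] := h1 _ ne|have /and3P [_ /eqP] := h2 _ ne].
    by rewrite inE GGG; apply/asboolP; split=> y /=; [move=> /h1 /and3P []|move=> /h2 /and3P []].
  apply: leq_trans (low_class p1 p2 _) _.
    move=> G; rewrite inE => /andP [/hG [_ nr] /asboolP [h1 h2]]; by split.
  apply: leq_mul => //; rewrite leq_mul2l; apply/orP; right.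
  rewrite leq_pexp2l //; first by rewrite muln_gt0 !expn_gt0.
  by apply: leq_mul; rewrite leq_divRL // mulnC; apply: parted_count; [exact: p1|exact: p2].
apply: leq_mul => //; apply: leq_trans (max_card _) _.
by rewrite card_prod !card_ffun card_option.
Qed.

End LowClass.

(** Two scales are needed. The logarithm of [beta] is at most [t.+1 * Phi + s * d * q] with
    [Phi = t.+1 ^ d]: the second summand is small against [t * q] once [t] dominates [s * d], the
    first one once [q] dominates [Phi]. Both are kept below [t * q / (8 * Th)]. *)
Lemma low_params Th d : 0 < Th -> exists s t q,
  [/\ t.+1 = 2 ^ s, 0 < t, 0 < q, 8 * Th * (s * d) <= t & q = 16 * Th * t.+1 ^ d].
Proof.
move=> Th0; have [s hs] := linear_le_exp (8 * Th * d.+1).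
have {hs} hs := hs _ (leqnn _); exists s, (2 ^ s).-1.
have tE : (2 ^ s).-1.+1 = 2 ^ s by rewrite prednK // expn_gt0.
move: tE; move: (2 ^ s).-1 => t tE; exists (16 * Th * t.+1 ^ d).
rewrite -tE in hs; split=> //.
- have : 0 < Th * d.+1 * s.+1 by rewrite !muln_gt0 Th0.
  move: hs; rewrite -!mulnA; move: (Th * _) => x; lia.
- by rewrite !muln_gt0 Th0 expn_gt0.
- have : 0 < 8 * Th by rewrite muln_gt0.
  by move: hs; move: (8 * Th) => x; nia.
Qed.

Lemma low_count a k (M : {set 'I_a * 'I_a}) Th : 0 < a -> richM k M -> 0 < Th ->
  exists n0, forall (T : finType), n0 <= #|T| -> forall (U : {set T}) (GG : {set sgraph T}),
    (forall G, G \in GG -> EH G /\ norich a k G U) ->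
    nt (setX U U) GG <= 2 ^ (#|T| * #|T| %/ Th).
Proof.
move=> a0 rM Th0; have [d dE] : exists d, d.+1 = a + a by exists (a + a).-1; lia.
have [s [t [q [tE t0 q0 le_t qE]]]] := low_params d Th0.
have Th16 : 0 < 16 * Th by rewrite muln_gt0.
have [n1 hn1] := succ_le_exp_div Th16.
exists (n1 + 4 * Th * (t * t + q * q + 2)) => T le_n U GG hG.
have [N1 [N2 [hN1 hN2 le1]]] := low_union rM dE t0 q0 hG.
apply: leq_trans le1 _; move: #|T| le_n hN1 hN2 => n le_n hN1 hN2.
have [Phi PhiE] : exists Phi, Phi = t.+1 ^ d by exists (t.+1 ^ d).
rewrite -PhiE; rewrite -PhiE in qE.
have hb : (2 ^ t).+1 ^ Phi * Phi ^ q <= 2 ^ (t.+1 * Phi + s * d * q).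
  rewrite expnD; apply: leq_mul.
    rewrite expnM; apply: leq_expW; rewrite expnS; have := expn_gt0 2 t; lia.
  by rewrite PhiE tE -!expnM mulnA.
apply: leq_trans (_ : (2 ^ (n * (n %/ (16 * Th))) * 2 ^ (n * (n %/ (16 * Th)))) *
   (2 ^ ((t * t + q * q) * n) * (2 ^ n * 2 ^ ((t.+1 * Phi + s * d * q) * (N1 * N2)))) <= _).
  have h1 : n.+1 ^ n <= 2 ^ (n * (n %/ (16 * Th))).
    by rewrite [n * _]mulnC expnM; apply: leq_expW; apply: hn1; lia.
  apply: leq_mul; first exact: leq_mul.
  rewrite !leq_mul2l; apply/orP; right; apply/orP; right.
  by rewrite (expnM 2 _ (N1 * N2)); apply: leq_expW.
rewrite -!expnD leq_exp2l // leq_divRL //.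
have h2 : 4 * Th * ((t.+1 * Phi + s * d * q) * (N1 * N2)) <= n * n.
  apply: leq_trans (_ : t * q * (N1 * N2) <= _); last first.
    by rewrite mulnACA; apply: leq_mul.
  rewrite mulnA leq_mul2r; apply/orP; right.
  have e1 : t.+1 * Phi <= 2 * t * Phi by rewrite leq_mul2r; apply/orP; right; lia.
  have e2 : 8 * Th * (s * d) * q <= t * q by rewrite leq_mul2r le_t orbT.
  have f1 : 2 * (4 * Th * (t.+1 * Phi)) <= t * q.
    have := leq_mul (leqnn (8 * Th)) e1; rewrite qE; lia.
  by move: f1 e2; rewrite mulnDr; move: (t * q) (t.+1 * Phi) => x1 x2; lia.
have h3 : 16 * Th * (n %/ (16 * Th)) <= n by rewrite mulnC leq_trunc_div.
have h4 : 4 * Th * (t * t + q * q + 2) * n <= n * n by rewrite leq_mul2r; apply/orP; right; lia.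
have h5 : 16 * Th * (n %/ (16 * Th)) * n <= n * n by rewrite leq_mul2r h3 orbT.
move: h2 h4 h5; move: ((t.+1 * Phi + _) * _) (n %/ _) (t * t + q * q) => z x y; lia.
Qed.

(** * Decomposition along rich pairs *)

Lemma card_setTE (T : finType) : #|{set T}| = 2 ^ #|T|.
Proof. by have := card_powerset [set: T]; rewrite powersetT !cardsT. Qed.

Section Coarse.
Variables (T : finType) (a k : nat).
Implicit Types (G : sgraph T) (GG : {set sgraph T}) (A B S U V W X VA : {set T}).
Let n := #|T|.
Let m := k + k.
Let nu := 2 * a.+1 ^ m.

Lemma nt_split D GG (P : pred (sgraph T)) :
  nt D GG <= nt D [set G in GG | P G] + nt D [set G in GG | ~~ P G].
Proof.
rewrite /nt; apply: leq_trans (leq_card_setU _ _).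
apply/subset_leq_card/subsetP => _ /imsetP [G GGG ->]; rewrite inE.
by case: (boolP (P G)) => PG; apply/orP; [left|right]; apply: imset_f; rewrite inE GGG.
Qed.

Lemma card_nearhom A : #|A| = a ->
  #|[set S : {set T} | (S \subset A) && ((#|S| < m) || (#|A :\: S| < m))]| <= nu.
Proof.
move=> cA; pose F := [set S : {set T} | (S \subset A) && (#|S| <= m)].
have cF : #|F| <= a.+1 ^ m by rewrite -cA; apply: card_small_subsets.
apply: leq_trans (_ : #|F :|: [set A :\: S | S in F]| <= _).
  apply/subset_leq_card/subsetP => S; rewrite !inE => /andP [sS /orP [h|h]]; apply/orP.
    by left; rewrite sS ltnW.
  right; apply/imsetP; exists (A :\: S); first by rewrite inE subsetDl ltnW.
  by rewrite setDDr setDv set0U (setIidPr sS).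
apply: leq_trans (leq_card_setU _ _) _; rewrite /nu mul2n -addnn; apply: leq_add => //.
exact: leq_trans (leq_imset_card _ _) cF.
Qed.

Lemma nt_nearhom v A GG : #|A| = a -> (forall G, G \in GG -> nearhom m G v A) ->
  nt (setX [set v] A) GG <= nu.
Proof.
move=> cA h; apply: leq_trans (card_nearhom cA); apply: nt_row => G /h.
rewrite inE subsetIr /= /nearhom; have -> // : A :\: nb G v :&: A = A :\: nb G v.
by rewrite setDIr setDv setU0.
Qed.

Lemma nt_rowexp v A GG : #|A| = a -> nt (setX [set v] A) GG <= 2 ^ a.
Proof. by move=> cA; apply: leq_trans (nt_exp _ _) _; rewrite cardsX cards1 mul1n cA. Qed.

(** The factor 2 records which side is nearly homogeneous to [v]; the other one stays free. A vertex
    thus spends about [a] instead of [a + a] bits on a rich pair, which is where [n ^ 2 / 4] comes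
    from. *)
Lemma nt_rich_row A B v GG : (forall G, G \in GG -> C5free G /\ rich a k G A B) ->
  v \notin A :|: B -> nt (setX [set v] (A :|: B)) GG <= 2 * (nu * 2 ^ a).
Proof.
move=> h vAB; have [->|/set0Pn [G0 G0G]] := eqVneq GG set0.
  by rewrite /nt imset0 cards0.
have [_ [[cA cB _ _ _] _]] := h _ G0G.
have -> : setX [set v] (A :|: B) = setX [set v] A :|: setX [set v] B.
  by apply/setP => -[x y]; rewrite !inE /= andb_orr.
apply: leq_trans (nt_split _ _ (fun G => nearhom m G v A)) _.
rewrite mul2n -addnn; apply: leq_add; apply: leq_trans (nt_U _ _ _) _.
  apply: leq_mul; last exact: nt_rowexp.
  by apply: nt_nearhom => // G; rewrite inE => /andP [].
rewrite mulnC; apply: leq_mul; last exact: nt_rowexp.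
apply: nt_nearhom => // G; rewrite inE => /andP [/h [c5 r] /negbTE na].
by have := rich_nearhom c5 r vAB; rewrite na.
Qed.

Lemma rich_sym G A B : rich a k G A B -> rich a k G B A.
Proof.
move=> [[cA cB d hA hB] r]; split; first by split=> //; rewrite disjoint_sym.
move=> B1 B2 A1 A2 t1 t2 s1 s2 d1 d2 c1 c2 dB dA p1 p2 p3 p4.
have [x1 [x2 [y1 [y2 [[h1 h2 h3 h4] [e1 e2 e3 e4]]]]]] :=
  r A1 A2 B1 B2 s1 s2 t1 t2 c1 c2 d1 d2 dA dB p1 p3 p2 p4.
by exists y1, y2, x1, x2; split=> //; split; rewrite adj_sym.
Qed.

Lemma homog_tr G G' S V : S \subset V -> tr (setX V V) G = tr (setX V V) G' ->
  homog G S -> homog G' S.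
Proof.
move=> /subsetP s /eqP /trP e /orP [/cliqueP h|/indepP h]; apply/orP; [left|right].
  by apply/cliqueP => x y xS yS ne; rewrite -e ?h // inE /= !s.
by apply/indepP => x y xS yS; rewrite -e ?h // inE /= !s.
Qed.

Lemma rich_tr G G' A B V : A \subset V -> B \subset V ->
  tr (setX V V) G = tr (setX V V) G' -> rich a k G A B -> rich a k G' A B.
Proof.
move=> sA sB e [[cA cB d hA hB] r]; split.
  by split=> //; [apply: homog_tr e hA|apply: homog_tr e hB].
move=> A1 A2 B1 B2 s1 s2 t1 t2 c1 c2 d1 d2 dA dB p1 p2 p3 p4.
have [x1 [x2 [y1 [y2 [[h1 h2 h3 h4] [e1 e2 e3 e4]]]]]] :=
  r A1 A2 B1 B2 s1 s2 t1 t2 c1 c2 d1 d2 dA dB p1 p2 p3 p4.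
move/eqP/trP: e => e; exists x1, x2, y1, y2; split=> //.
have iA x : x \in A1 \/ x \in A2 -> x \in V.
  by case=> h; apply: (subsetP sA); [apply: (subsetP s1)|apply: (subsetP s2)].
have iB x : x \in B1 \/ x \in B2 -> x \in V.
  by case=> h; apply: (subsetP sB); [apply: (subsetP t1)|apply: (subsetP t2)].
by split; rewrite -e //; apply/setXP; (split; [apply: iA|apply: iB]); tauto.
Qed.

Definition low b G X : Prop :=
  exists X0 : {set T}, [/\ X0 \subset X, #|X :\: X0| <= b & norich a k G X0].

Definition bad b G U : Prop :=
  ~ exists X : {set T}, [/\ X \subset U, low b G X & low b G (U :\: X)].

Lemma low_add b c G X W : low b G X -> #|W| <= c -> low (b + c) G (X :|: W).
Proof.
move=> [X0 [s l nr]] cW; exists X0; split=> //; first exact: subset_trans s (subsetUl _ _).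
apply: leq_trans (_ : #|(X :\: X0) :|: W| <= _).
  by rewrite setDUl; apply/subset_leq_card/setUS/subsetDl.
by apply: leq_trans (leq_card_setU _ _) _; apply: leq_add.
Qed.

Lemma low_mono b c G X : b <= c -> low b G X -> low c G X.
Proof. by move=> le [X0 [s l nr]]; exists X0; split=> //; apply: leq_trans l le. Qed.

Lemma bad_sub b c G U W : bad (b + c) G U -> W \subset U -> #|W| <= c -> bad b G (U :\: W).
Proof.
move=> bd sW cW [X [sX l1 l2]]; apply: bd; exists (X :|: W); split.
- by rewrite subUset sW (subset_trans sX) // subsetDl.
- exact: low_add.
- apply: (low_mono (leq_addr c b)); have -> // : U :\: (X :|: W) = U :\: W :\: X.
  by rewrite setUC -setDDl.
Qed.

Lemma bad_rich b G U : bad b G U ->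
  exists A B, [/\ A \subset U, B \subset U & rich a k G A B].
Proof.
move=> bd; apply: contrapT => no; apply: bd; exists U; rewrite subxx setDv; split=> //.
  exists U; rewrite subxx setDv cards0; split=> // A B sA sB r; apply: no.
  by exists A, B.
exists set0; rewrite sub0set setDv cards0; split=> // A B sA sB r; apply: no.
by exists A, B; split=> //; apply: subset_trans (sub0set U).
Qed.

(** A maximal packing of rich pairs inside [X] must cover more than [b] vertices, since deleting the
    covered vertices destroys all rich pairs. *)
Lemma notlow_packing b G X : 0 < a -> ~ low b G X -> exists P : {set {set T}},
  [/\ trivIset P, b < (a + a) * #|P|,
      forall S, S \in P -> S \subset X /\ #|S| = a + a &
      forall S, S \in P -> exists A B, S = A :|: B /\ rich a k G A B].
Proof.
move=> a0 nl; pose c S := `[< exists A B, S = A :|: B /\ rich a k G A B >].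
have c0 : ~~ c set0.
  apply/asboolP => -[A [B [e [[cA _ _ _ _] _]]]].
  have : A \subset set0 by rewrite e subsetUl.
  by rewrite subset0 => /eqP eA; move: cA a0; rewrite eA cards0 => <-.
have [P [tP cP mP]] := maximal_packing X c0; exists P.
have cS S : S \in P -> S \subset X /\ #|S| = a + a.
  move=> /cP /andP [/asboolP [A [B [-> [[cA cB d _ _] _]]]] ->]; split=> //.
  by rewrite cardsU (disjoint_setI0 d) cards0 cA cB subn0.
split=> //; last by move=> S /cP /andP [/asboolP].
rewrite ltnNge; apply/negP => le; apply: nl; exists (X :\: cover P); split.
- exact: subsetDl.
- rewrite setDDr setDv set0U; apply: leq_trans (subset_leq_card (subsetIr _ _)) _.
  move/eqP: tP => <-; rewrite (eq_bigr (fun=> a + a)) => [|S /cS []//].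
  by rewrite sum_nat_const mulnC.
- move=> A B sA sB r; have := mP (A :|: B); rewrite subUset sA sB => /(_ isT) /negP; apply.
  by apply/asboolP; exists A, B.
Qed.

(* Attaching a rich pair [(A, B)]: a further rich pair [S] inside the side that
   is nearly homogeneous to [A] halves the freedom between [S] and [(A, B)]. *)
Lemma attach_saving A B V VA GG (P : {set {set T}}) (fA fB : {set T} -> {set T}) e1 :
  2 * nu <= 2 ^ e1 -> #|A| = a -> #|B| = a -> [disjoint V & A :|: B] -> VA \subset V ->
  (forall G, G \in GG -> C5free G /\ rich a k G A B) ->
  (forall G v, G \in GG -> v \in VA -> nearhom m G v A) ->
  trivIset P -> (forall S, S \in P -> S \subset VA /\ #|S| = a + a) ->
  (forall G S, G \in GG -> S \in P -> S = fA S :|: fB S /\ rich a k G (fA S) (fB S)) ->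
  nt (setX V (A :|: B)) GG * 2 ^ (#|P| * (a * a)) <=
  2 ^ ((a + e1) * #|V| + #|P| * (a * e1)).
Proof.
move=> hnu cA cB dV sVA hG nhA tP cP rP.
have nVA v : v \in V -> v \notin A :|: B by move=> vV; rewrite (disjointFr dV).
have scP : cover P \subset V.
  apply/subsetP => x /bigcupP [S SP xS]; have [s _] := cP _ SP.
  exact: (subsetP (subset_trans s sVA)).
have ccP : #|cover P| = #|P| * (a + a).
  by move/eqP: tP => <-; rewrite (eq_bigr (fun=> a + a)) ?sum_nat_const // => S /cP [].
have row : 2 * (nu * 2 ^ a) <= 2 ^ (a + e1).
  by rewrite mulnA mulnC expnD leq_mul2l hnu orbT.
have hnu1 : nu <= 2 ^ e1 by apply: leq_trans hnu; rewrite leq_pmull.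
(* A vertex of [S] pays at most [e1] bits towards [A]; a vertex of [B] is nearly homogeneous to one
   half of [S] and pays [a + e1] bits. Together this is [a * (a + e1) + (a + a) * e1] instead of
   [(a + a) * (a + e1)]. *)
have inS S : S \in P -> nt (setX S (A :|: B)) GG <= 2 ^ (a * (a + e1) + (a + a) * e1).
  move=> SP; have [sS cS] := cP _ SP.
  have -> : setX S (A :|: B) = setX S A :|: setX S B.
    by apply/setP => -[x y]; rewrite !inE /= andb_orr.
  apply: leq_trans (nt_U _ _ _) _; rewrite expnD mulnC; apply: leq_mul.
    apply: leq_trans (_ : nt (setX B S) GG <= _).
      by apply: nt_mono => x y; rewrite !inE /= => /andP [-> ->]; rewrite !orbT.
    rewrite mulnC expnM -{2}cB; apply: nt_rows => v vB; apply: leq_trans row.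
    have vS : v \notin S.
      apply/negP => vS; have /negP [] := nVA v (subsetP (subset_trans sS sVA) _ vS).
      by rewrite inE vB orbT.
    have [->|/set0Pn [G0 G0G]] := eqVneq GG set0; first by rewrite /nt imset0 cards0.
    have [eS _] := rP _ _ G0G SP; rewrite eS; apply: nt_rich_row; last by rewrite -eS.
    by move=> G GGG; have [c5 _] := hG _ GGG; have [_ r] := rP _ _ GGG SP.
  rewrite mulnC expnM -cS; apply: nt_rows => v vS.
  apply: leq_trans hnu1; apply: nt_nearhom => // G GGG; apply: nhA => //.
  exact: (subsetP sS).
have cov : setX V (A :|: B) = setX (V :\: cover P) (A :|: B) :|: \bigcup_(S in P) setX S (A :|: B).
  apply/setP => -[x y]; rewrite in_setU !in_setX in_setD.
  apply/andP/orP => [[xV yW]|].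
    case: (boolP (x \in cover P)) => [/bigcupP [S SP xS]|xc]; last by left; rewrite xV.
    by right; apply/bigcupP; exists S; rewrite // in_setX xS.
  case=> [/andP [/andP [_ ->] ->] //|/bigcupP [S SP]]; rewrite in_setX => /andP [xS ->]; split=> //.
  by apply: (subsetP scP); apply/bigcupP; exists S.
have le1 : nt (setX V (A :|: B)) GG <=
    2 ^ ((a + e1) * (#|V| - #|P| * (a + a))) * 2 ^ (#|P| * (a * (a + e1) + (a + a) * e1)).
  rewrite cov; apply: leq_trans (nt_U _ _ _) _; apply: leq_mul.
    rewrite -ccP -[in X in _ <= X](setIidPr scP) -cardsD expnM; apply: nt_rows => v.
    by rewrite inE => /andP [_ vV]; apply: leq_trans row; apply: nt_rich_row; [exact: hG|exact: nVA].
  apply: leq_trans (nt_bigU _ _ _) _; rewrite [#|P| * _]mulnC expnM -prod_nat_const.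
  by apply: leq_prod => S; apply: inS.
have leV : #|P| * (a + a) <= #|V| by rewrite -ccP; apply: subset_leq_card.
apply: leq_trans (leq_mul le1 (leqnn _)) _; rewrite -!expnD leq_exp2l //.
move: leV; move: #|V| #|P| => v p leV.
rewrite mulnBr; have : (a + e1) * (p * (a + a)) <= (a + e1) * v by rewrite leq_mul2l leV orbT.
by move: ((a + e1) * v) => w; lia.
Qed.

Lemma attach_plain A B V GG e1 :
  2 * nu <= 2 ^ e1 -> [disjoint V & A :|: B] ->
  (forall G, G \in GG -> C5free G /\ rich a k G A B) ->
  nt (setX V (A :|: B)) GG <= 2 ^ ((a + e1) * #|V|).
Proof.
move=> hnu dV hG; rewrite expnM; apply: nt_rows => v vV.
have row : 2 * (nu * 2 ^ a) <= 2 ^ (a + e1).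
  by rewrite mulnA mulnC expnD leq_mul2l hnu orbT.
by apply: leq_trans row; apply: nt_rich_row; rewrite // (disjointFr dV).
Qed.

Lemma setX_split U W : W \subset U ->
  forall x y, (x, y) \in setX U U -> [|| x == y, (x, y) \in setX W W :|: (setX (U :\: W) W :|: setX (U :\: W) (U :\: W)) |
    (y, x) \in setX W W :|: (setX (U :\: W) W :|: setX (U :\: W) (U :\: W))].
Proof.
move=> sW x y; rewrite !inE /= => /andP [-> ->]; rewrite !andbT.
by case: (x \in W); case: (y \in W); rewrite ?orbT.
Qed.

(** The floors do no harm because the squares of [u] and [u - (a + a)] differ by [4 * a * (u - a)],
    a multiple of 4. *)
Lemma square_step u : a + a <= u -> u * u %/ 4 = (u - (a + a)) * (u - (a + a)) %/ 4 + a * (u - a).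
Proof.
move=> le; have [w ->] : exists w, u = w + (a + a) by exists (u - (a + a)); lia.
rewrite addnK; have -> : (w + (a + a)) * (w + (a + a)) = w * w + (a * (w + a)) * 4 by lia.
rewrite divnMDl_r || rewrite addnC divnMDl // addnC; congr (_ + a * _); lia.
Qed.

Section Steps.
Variables (e1 e2 L : nat).
Hypotheses (a0 : 0 < a) (hnu : 2 * nu <= 2 ^ e1)
  (le1a : e1 <= a) (he2 : 3 * n + 1 + 4 * (a * a) + e1 * n <= (a + a) * e2)
  (hL : forall U GG, (forall G, G \in GG -> EH G /\ norich a k G U) -> nt (setX U U) GG <= 2 ^ L).

(** One removal of a rich pair. The allowance [e2] for each of the [a + a] removed vertices covers
    the choice of up to three sets, the pairs inside the rich pair and the surplus [e1] of every
    remaining vertex. *)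
Lemma attach_arith u : a + a <= u -> u <= n ->
  3 * n + 1 + 4 * (a * a) + (a + e1) * (u - (a + a)) +
    ((u - (a + a)) * (u - (a + a)) %/ 4 + e2 * (u - (a + a))) <= u * u %/ 4 + e2 * u.
Proof.
move=> le leN; rewrite (square_step le); have [w eu] : exists w, u = w + (a + a) by exists (u - (a + a)); lia.
have h1 : e1 * w <= e1 * n by rewrite leq_mul2l; apply/orP; right; lia.
rewrite eu addnK; have -> : w + (a + a) - a = w + a by lia.
move: (w * w %/ 4) he2 => z; lia.
Qed.

(** Rich pairs are removed until none is left; the factor [#|U|.+1] sums over the moment of
    stopping. *)
Lemma count_all U GG : (forall G, G \in GG -> C5free G /\ EH G) ->
  nt (setX U U) GG <= #|U|.+1 * 2 ^ (L + (#|U| * #|U| %/ 4 + e2 * #|U|)).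
Proof.
have [w] := ubnP #|U|; elim: w U GG => // w IHw U GG leU hG.
pose NR G := `[< norich a k G U >].
apply: leq_trans (nt_split _ _ NR) _; rewrite mulSn; apply: leq_add.
  apply: leq_trans (_ : 2 ^ L <= _); last by rewrite leq_exp2l // leq_addr.
  by apply: hL => G; rewrite inE => /andP [/hG [_ eh] /asboolP].
pose P (l : {set T} * {set T}) := (l.1 :|: l.2 \subset U) && (#|l.1 :|: l.2| == a + a).
pose CC (l : {set T} * {set T}) := [set G in GG | `[< rich a k G l.1 l.2 >]].
apply: leq_trans (@nt_union _ _ P CC _ _ (#|U| * 2 ^ (4 * (a * a) + (a + e1) * (#|U| - (a + a)) +
   (L + ((#|U| - (a + a)) * (#|U| - (a + a)) %/ 4 + e2 * (#|U| - (a + a)))))) _ _) _.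
- move=> G; rewrite inE => /andP [GGG /asboolP nr].
  have [A [B [sA sB r]]] : exists A B, [/\ A \subset U, B \subset U & rich a k G A B].
    by apply: contrapT => no; apply: nr => A B sA sB r; apply: no; exists A, B.
  exists (A, B); last by rewrite inE GGG; apply/asboolP.
  have [[cA cB d _ _] _] := r.
  by rewrite /P /= subUset sA sB cardsU (disjoint_setI0 d) cards0 cA cB subn0 eqxx.
- move=> [A B] /andP [/= sW /eqP cW]; set W := A :|: B in sW cW *.
  have hC G : G \in CC (A, B) -> (C5free G /\ EH G) /\ rich a k G A B.
    by rewrite inE => /andP [/hG h /asboolP].
  apply: leq_trans (nt_mono (CC (A, B)) (setX_split sW)) _.
  apply: leq_trans (nt_U _ _ _) _; rewrite -addnA expnD mulnCA; apply: leq_mul.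
    by apply: leq_trans (nt_exp _ _) _; rewrite leq_exp2l // cardsX cW; lia.
  have cUW : #|U :\: W| = #|U| - (a + a) by rewrite cardsD (setIidPr sW) cW.
  have leW : a + a <= #|U| by rewrite -cW; apply: subset_leq_card.
  apply: leq_trans (nt_U _ _ _) _; rewrite [X in X <= _]mulnC expnD [2 ^ _ * _]mulnC mulnA; apply: leq_mul; last first.
    rewrite -cUW; apply: attach_plain => //; last by move=> G /hC [[]].
    by rewrite -setI_eq0 setIDAC setDIl setDv setI0.
  apply: leq_trans (IHw _ _ _ (fun G h => (hC G h).1)) _; first by rewrite cUW; lia.
  by rewrite cUW leq_mul2r; apply/orP; right; lia.
have [leW|gtW] := leqP (a + a) #|U|; last first.
  suff -> : #|P| = 0 by [].
  apply: eq_card0 => -[A B]; rewrite unfold_in /=; apply/negP => /andP [sW /eqP cW].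
  by have := subset_leq_card sW; rewrite cW leqNgt gtW.
apply: leq_trans (_ : 2 ^ (3 * n + 1) * (#|U| * 2 ^ (4 * (a * a) + (a + e1) * (#|U| - (a + a)) +
   (L + ((#|U| - (a + a)) * (#|U| - (a + a)) %/ 4 + e2 * (#|U| - (a + a)))))) <= _).
  rewrite leq_mul2r; apply/orP; right; apply: leq_trans (max_card _) _.
  by rewrite card_prod !card_setTE -expnD leq_exp2l // /n; lia.
rewrite mulnCA -expnD leq_mul2l; apply/orP; right; rewrite leq_exp2l //.
have := attach_arith leW (max_card _); lia.
Qed.

Variable s : nat.

(** Each of [j] rounds removes a rich pair, which lowers the badness by [a + a]. As long as the
    graph is bad, one of the two sides attached to the pair is not low and contains more than
    [b / (a + a)] disjoint rich pairs; by [attach_saving] these are worth [s] bits. *)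
Lemma count_bad j U GG b :
  s * (a + a) + e1 * a * b <= a * a * b -> 
  (forall G, G \in GG -> C5free G /\ EH G) ->
  (forall G, G \in GG -> bad (b + j * (a + a)) G U) ->
  nt (setX U U) GG * 2 ^ (j * s) <= n.+1 * 2 ^ (L + (#|U| * #|U| %/ 4 + e2 * #|U|)).
Proof.
move=> hs; elim: j U GG => [|j IHj] U GG hG hb.
  rewrite muln1; apply: leq_trans (count_all U hG) _.
  by rewrite leq_mul2r ltnS max_card orbT.
pose Lb := ({set T} * {set T} * {set T})%type.
pose P (l : Lb) := [&& l.1.1 :|: l.1.2 \subset U, #|l.1.1| == a, #|l.1.2| == a & #|l.1.1 :|: l.1.2| == a + a].
pose CC (l : Lb) := let: (A, B, VA) := l in [set G in GG | `[< [/\ rich a k G A B,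
   VA \subset U :\: (A :|: B), (forall v, v \in VA -> nearhom m G v A) &
   ~ low (b + j * (a + a)) G VA] >]].
pose E := 4 * (a * a) + (a + e1) * (#|U| - (a + a)) +
   (L + ((#|U| - (a + a)) * (#|U| - (a + a)) %/ 4 + e2 * (#|U| - (a + a)))).
have key l : P l -> nt (setX U U) (CC l) * 2 ^ (j.+1 * s) <= n.+1 * 2 ^ E.
  case: l => [[A B] VA] /and4P [/= sW /eqP cA /eqP cB /eqP cW]; set W := A :|: B in sW cW *.
  pose V := U :\: W; have cUW : #|V| = #|U| - (a + a) by rewrite cardsD (setIidPr sW) cW.
  have dV : [disjoint V & W] by rewrite -setI_eq0 setIDAC setDIl setDv setI0.
  pose Y := (a + e1) * #|V|.
  (* The packing is found in one graph [G0] of the fibre; richness of its members depends on the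
     trace on [V] only, hence they are rich in all graphs of the fibre. *)
  have fib t : nt (setX U U) [set G in CC (A, B, VA) | tr (setX V V) G == t] <=
      2 ^ (4 * (a * a)) * (2 ^ Y %/ 2 ^ s).
    set FF := [set G in _ | _].
    have [->|/set0Pn [G0 G0F]] := eqVneq FF set0; first by rewrite /nt imset0 cards0.
    have hF G : G \in FF -> [/\ C5free G /\ rich a k G A B, VA \subset V,
        (forall v, v \in VA -> nearhom m G v A), ~ low (b + j * (a + a)) G VA & tr (setX V V) G = t].
      by rewrite inE => /andP [/[!inE] /andP [/hG [c5 _] /asboolP [r sV nh nl]] /eqP e].
    apply: leq_trans (nt_mono FF (setX_split sW)) _.
    apply: leq_trans (nt_U _ _ _) _; apply: leq_mul.
      by apply: leq_trans (nt_exp _ _) _; rewrite leq_exp2l // cardsX cW; lia.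
    apply: leq_trans (nt_U _ _ _) _.
    have n1 : nt (setX (U :\: W) (U :\: W)) FF <= 1 by apply: (nt1 (t := t)) => G /hF [].
    apply: leq_trans (leq_mul (leqnn _) n1) _; rewrite muln1 leq_divRL ?expn_gt0 //.
    have [[_ r0] sV _ nl e0] := hF _ G0F.
    have [Q [tQ cQ sQ rQ]] := notlow_packing a0 nl.
    have [f hf] : exists f : {set T} -> {set T} * {set T}, forall S, S \in Q ->
        S = (f S).1 :|: (f S).2 /\ rich a k G0 (f S).1 (f S).2.
      have h S : exists AB : {set T} * {set T}, S \in Q -> S = AB.1 :|: AB.2 /\ rich a k G0 AB.1 AB.2.
        case: (boolP (S \in Q)) => [/rQ [A' [B' h]]|]; [by exists (A', B')|by exists (set0, set0)].
      exact: fin_all_exists h.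
    have main : nt (setX V (A :|: B)) FF * 2 ^ (#|Q| * (a * a)) <=
        2 ^ ((a + e1) * #|V| + #|Q| * (a * e1)).
      apply: (attach_saving (VA := VA) (fA := fun S => (f S).1) (fB := fun S => (f S).2)) => //.
      - by move=> G /hF [].
      - by move=> G v /hF [_ _ h _ _]; apply: h.
      - move=> G S GF SQ; have [eS rS] := hf _ SQ; split=> //; have [_ _ _ _ e] := hF _ GF.
        have sSV : S \subset V by have [h _] := sQ _ SQ; apply: subset_trans sV.
        have s1 := subsetUl (f S).1 (f S).2; have s2 := subsetUr (f S).1 (f S).2.
        rewrite -eS in s1 s2.
        by apply: (rich_tr _ _ (etrans e0 (esym e)) rS); apply: subset_trans sSV.
    have hp : s + #|Q| * (a * e1) <= #|Q| * (a * a).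
      have bQ : b <= (a + a) * #|Q| by lia.
      have [c ac] : exists c, a = e1 + c by exists (a - e1); lia.
      have h1 : s * (a + a) <= a * c * b by move: hs; rewrite {3}ac; nia.
      have h2 : a * c * b <= a * c * ((a + a) * #|Q|) by rewrite leq_mul2l bQ orbT.
      have h3 : s <= a * c * #|Q| by move: (leq_trans h1 h2); rewrite mulnCA [s * _]mulnC leq_pmul2l //; lia.
      by move: h3; rewrite {4}ac; nia.
    have [r er] : exists r, #|Q| * (a * a) = r + (s + #|Q| * (a * e1)) by exists (#|Q| * (a * a) - (s + #|Q| * (a * e1))); lia.
    move: main; rewrite er !expnD -/Y => main.
    rewrite -(leq_pmul2r (expn_gt0 2 (#|Q| * (a * e1)))); apply: leq_trans main.
    by rewrite -!mulnA leq_mul2l; apply/orP; right; rewrite leq_pmull // expn_gt0.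
  have ih : nt (setX V V) (CC (A, B, VA)) * 2 ^ (j * s) <=
      n.+1 * 2 ^ (L + (#|V| * #|V| %/ 4 + e2 * #|V|)).
    apply: IHj => G; rewrite inE => /andP [GGG _]; first exact: hG.
    have := hb _ GGG; rewrite mulSn [a + a + _]addnC addnA => bd.
    by apply: (bad_sub bd sW); rewrite cW.
  apply: leq_trans (leq_mul (nt_fiber fib) (leqnn _)) _.
  have -> : 2 ^ (j.+1 * s) = 2 ^ (j * s) * 2 ^ s by rewrite -expnD; congr (2 ^ _); lia.
  set N := nt _ _ in ih *; set Z := 2 ^ Y %/ 2 ^ s.
  have hZ : Z * 2 ^ s <= 2 ^ Y by apply: leq_trunc_div.
  apply: leq_trans (_ : (N * 2 ^ (j * s)) * (2 ^ (4 * (a * a)) * (Z * 2 ^ s)) <= _).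
    apply: eq_leq; move: (2 ^ (4 * (a * a))) (2 ^ (j * s)) (2 ^ s) Z N {ih hZ} => x y z u v; lia.
  apply: leq_trans (leq_mul ih (leq_mul (leqnn _) hZ)) _.
  rewrite -mulnA leq_mul2l; apply/orP; right; rewrite -!expnD leq_exp2l // /E /Y -cUW; lia.
have [leW|gtW] := leqP (a + a) #|U|; last first.
  have [->|/set0Pn [G GGG]] := eqVneq GG set0; first by rewrite /nt imset0 cards0.
  have [A [B [sA sB [[cA cB d _ _] _]]]] := bad_rich (hb _ GGG).
  have : #|A :|: B| <= #|U| by apply: subset_leq_card; rewrite subUset sA.
  by rewrite cardsU (disjoint_setI0 d) cards0 cA cB subn0 leqNgt gtW.
have le1 : nt (setX U U) GG <= #|P| * (n.+1 * 2 ^ E %/ 2 ^ (j.+1 * s)).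
  apply: (nt_union (CC := CC)) => [G GGG|l Pl]; last by rewrite leq_divRL ?expn_gt0 // key.
  have bd := hb _ GGG; have [c5 eh] := hG _ GGG.
  have [A [B [sA sB r]]] := bad_rich bd; have [[cA cB d _ _] _] := r.
  have cW : #|A :|: B| = a + a by rewrite cardsU (disjoint_setI0 d) cards0 cA cB subn0.
  have sW : A :|: B \subset U by rewrite subUset sA.
  have {bd} bd : bad (b + j * (a + a)) G (U :\: (A :|: B)).
    move: bd; rewrite mulSn [a + a + _]addnC addnA => bd.
    by apply: (bad_sub bd sW); rewrite cW.
  pose VA := [set v in U :\: (A :|: B) | nearhom m G v A].
  have sVA : VA \subset U :\: (A :|: B) by apply/subsetP => v; rewrite inE => /andP [].
  have [l1|nl1] := pselect (low (b + j * (a + a)) G VA).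
    have nl2 : ~ low (b + j * (a + a)) G (U :\: (A :|: B) :\: VA).
      by move=> l2; apply: bd; exists VA.
    (* If the side nearly homogeneous to [A] is low, the other one is not, and it is nearly
       homogeneous to [B]: the pair is used in the opposite order. *)
    exists (B, A, U :\: (A :|: B) :\: VA).
      by rewrite /P /= setUC sW cA cB cW !eqxx.
    rewrite /CC inE GGG; apply/asboolP; split=> //; first exact: rich_sym.
      by rewrite setUC subsetDl.
    move=> v; rewrite !inE => /andP [nv /andP [vW vU]].
    have := rich_nearhom c5 r (v := v); rewrite inE => /(_ vW) /orP [h|//].
    by move: nv; rewrite vW vU h.
  exists (A, B, VA); first by rewrite /P /= sW cA cB cW !eqxx.
  rewrite /CC inE GGG; apply/asboolP; split=> //.
  by move=> v; rewrite inE => /andP [].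
apply: leq_trans (leq_mul le1 (leqnn _)) _; rewrite -mulnA.
apply: leq_trans (leq_mul (leqnn _) (leq_trunc_div _ _)) _.
rewrite mulnCA leq_mul2l; apply/orP; right.
apply: leq_trans (_ : 2 ^ (3 * n) * 2 ^ E <= _).
  rewrite leq_mul2r; apply/orP; right; apply: leq_trans (max_card _) _.
  by rewrite !card_prod !card_setTE -!expnD leq_exp2l // /n; lia.
rewrite -expnD leq_exp2l // /E; have := attach_arith leW (max_card _); lia.
Qed.

End Steps.
End Coarse.

(** * Complements and obstructions *)

(** With [a = h * h] and [k = 8 * h] the condition of [richM_exists] reads roughly
    [44 * h * h <= 64 * h * h], while the entropy [e1] of a nearly homogeneous trace is of order
    [h * log h] and thus negligible against [a]. *)
Lemma coarse_params K : 0 < K -> exists a k e1 (M : {set 'I_a * 'I_a}),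
  [/\ 0 < a, richM k M, 2 * (2 * a.+1 ^ (k + k)) <= 2 ^ e1 & K * (e1 + 4) <= a].
Proof.
move=> K0; have [p0 hp] := linear_le_exp (38 * K).
have {hp} := hp p0.+1 (leqnSn _); move: p0.+1 (ltn0Sn p0) => p pp hp.
have [h hE] : exists h, h = 2 ^ p by exists (2 ^ p).
have h2 : 2 <= h by rewrite hE -[2 in X in X <= _]/(2 ^ 1) leq_exp2l.
pose e1 := 16 * h * (p + p + 1) + 2.
have [M rM] := @richM_exists (h * h) (8 * h) (ltac:(lia)).
exists (h * h), (8 * h), e1, M; split => //; first by lia.
- have le1 : (h * h).+1 <= 2 ^ (p + p + 1).
    have h0 : 0 < h * h by rewrite muln_gt0 (ltnW h2).
    rewrite !expnD -hE expn1; lia.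
  have -> : e1 = 2 + (p + p + 1) * (8 * h + 8 * h) by rewrite /e1; lia.
  rewrite (expnD 2 2); apply: leq_trans (_ : 2 * (2 * 2 ^ ((p + p + 1) * (8 * h + 8 * h))) <= _).
    by rewrite !leq_pmul2l // [X in _ <= X]expnM; apply: leq_expW.
  by move: (2 ^ (_ * _)) => y; lia.
- rewrite -hE in hp; have : K * (e1 + 4) <= h * (38 * K * p.+1).
    rewrite /e1; have : 6 * K <= 3 * h * K by rewrite leq_mul2r; apply/orP; right; lia.
    lia.
  by move=> /leq_trans; apply; rewrite leq_mul2l hp orbT.
Qed.

Lemma coarse De : 0 < De -> exists a k n0 De', 0 < De' /\ forall T : finType, n0 <= #|T| ->
  (forall GG : {set sgraph T}, (forall G, G \in GG -> [/\ C5free G, EH G & bad a k (#|T| %/ De) G setT]) ->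
     #|GG| * 2 ^ (#|T| * #|T| %/ De') <= 2 ^ (#|T| * #|T| %/ 4)) /\
  (forall (X : {set T}) (GG : {set sgraph T}), (forall G, G \in GG -> EH G /\ low a k (#|T| %/ De) G X) ->
     nt (setX X X) GG <= 2 ^ (3 * (#|T| * #|T| %/ De))).
Proof.
move=> De0; have [K KE] : exists K, K = 40 * (50 * (De * De)) by exists (40 * (50 * (De * De))).
have D0 : 0 < De * De by rewrite muln_gt0 De0.
have K0 : 0 < K by rewrite KE !muln_gt0 De0.
have K2 : 2 <= K by rewrite KE; lia.
have DeK : De <= K by rewrite KE; have := leq_pmulr De De0; lia.
have [a [k [e1 [M [a0 rM hnu he1]]]]] := coarse_params K0.
have [n1 hn1] := low_count a0 rM K0.
have [n2 hn2] := succ_le_exp_div K0.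
exists a, k, (n1 + n2 + De + 40 * (De * a) + K * (2 * a + 1) + 100 * De + 1), (4 * (50 * (De * De))); split.
  by rewrite !muln_gt0 De0.
move=> T; set n := #|T| => le_n; split=> [GG hG|X GG hG]; last first.
  pose CC (X0 : {set T}) := [set G in GG | `[< norich a k G X0 >]].
  pose P (X0 : {set T}) := (X0 \subset X) && (#|X :\: X0| <= n %/ De).
  apply: leq_trans (_ : #|P| * (2 ^ (n %/ De * n) * 2 ^ (n * n %/ K)) <= _).
    apply: (nt_union (CC := CC)) => [G GGG|X0 /andP [sX cX]].
      have [_ [X0 [sX cX nr]]] := hG _ GGG; exists X0; first by rewrite /P sX.
      by rewrite inE GGG; apply/asboolP.
    apply: leq_trans (_ : nt (setX (X :\: X0) setT :|: setX X0 X0) (CC X0) <= _).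
      apply: nt_mono => x y; rewrite !inE /= => /andP [-> ->]; rewrite !andbT.
      by case: (x \in X0); case: (y \in X0); rewrite ?orbT.
    apply: leq_trans (nt_U _ _ _) _; apply: leq_mul.
      apply: leq_trans (nt_exp _ _) _; rewrite leq_exp2l // cardsX cardsT leq_mul2r.
      by rewrite cX orbT.
    apply: hn1; first by rewrite -/n; clear - le_n; lia.
    by move=> G; rewrite inE => /andP [/hG [eh _] /asboolP].
  apply: leq_trans (_ : 2 ^ n * (2 ^ (n %/ De * n) * 2 ^ (n * n %/ K)) <= _).
    rewrite leq_mul2r; apply/orP; right; apply: leq_trans (max_card _) _.
    by rewrite card_setTE.
  rewrite -!expnD leq_exp2l //.
  have h1 : n %/ De * n <= n * n %/ De by rewrite leq_divRL // mulnAC leq_mul2r leq_trunc_div orbT.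
  have h2 : n * n %/ K <= n * n %/ De by apply: leq_div2l.
  have h3 : n <= n * n %/ De by rewrite leq_divRL // leq_mul2l; apply/orP; right; clear - le_n; lia.
  clear - h1 h2 h3; lia.
(* Half of the admissible badness [n / De] is kept as [b], the other half is used up by [j] rounds.
   Each round gains about [a * b / 4] bits, in total about [n ^ 2 / (32 * De ^ 2)]. *)
pose b := n %/ (2 * De); pose j := n %/ (4 * De * a); pose s := a * b %/ 4.
pose e2 := n * (e1 + 4) %/ (2 * a) + 2 * a + 1.
have le1a : 2 * e1 <= a.
  have := leq_mul K2 (leqnn (e1 + 4)) => h; clear - h he1; lia.
have he2 : 3 * n + 1 + 4 * (a * a) + e1 * n <= (a + a) * e2.
  have a20 : 0 < 2 * a by clear - a0; lia.
  have h : n * (e1 + 4) < (n * (e1 + 4) %/ (2 * a)).+1 * (2 * a) by apply: ltn_ceil.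
  have n0 : 0 < n by clear - le_n; lia.
  rewrite /e2; move: (n * (e1 + 4) %/ (2 * a)) h => z h; clear - h n0; lia.
have hs : s * (a + a) + e1 * a * b <= a * a * b.
  have h : s * 4 <= a * b by apply: leq_trunc_div.
  have h1 : s * 4 * a <= a * b * a by rewrite leq_mul2r h orbT.
  have h2 : 2 * e1 * (a * b) <= a * (a * b) by rewrite leq_mul2r le1a orbT.
  clearbody s b; clear - h1 h2; lia.
have hL (U : {set T}) (GG0 : {set sgraph T}) : (forall G, G \in GG0 -> EH G /\ norich a k G U) ->
    nt (setX U U) GG0 <= 2 ^ (n * n %/ K) by apply: hn1; rewrite -/n; clear - le_n; lia.
have hbj : b + j * (a + a) <= n %/ De.
  rewrite leq_divRL //.
  have h1 : b * (2 * De) <= n by apply: leq_trunc_div.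
  have h2 : j * (4 * De * a) <= n by apply: leq_trunc_div.
  clearbody b j; clear - h1 h2; lia.
have main : nt (setX setT setT) GG * 2 ^ (j * s) <=
    n.+1 * 2 ^ (n * n %/ K + (#|[set: T]| * #|[set: T]| %/ 4 + e2 * #|[set: T]|)).
  apply: (count_bad a0 hnu _ he2 hL hs) => [|G /hG [] //|G /hG [_ _ bd]]; first by clear - le1a; lia.
  move=> [X [sX l1 l2]]; apply: bd; exists X.
  by split=> //; [apply: low_mono l1|apply: low_mono l2].
have eX : setX [set: T] [set: T] = setT by apply/setP => -[x y]; rewrite !inE.
rewrite eX nt_setT cardsT -/n in main.
have hn1' : n.+1 <= 2 ^ (n * n %/ K).
  apply: leq_trans (hn2 n _) _; first by clear - le_n; lia.
  by rewrite leq_exp2l // leq_div2r // leq_pmull //; clear - le_n; lia.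
suff hj : n * n %/ (4 * (50 * (De * De))) + (n * n %/ K + (n * n %/ K + e2 * n)) <= j * s.
  rewrite -(leq_pmul2r (expn_gt0 2 (n * n %/ K + (n * n %/ K + e2 * n)))) -mulnA -expnD.
  apply: leq_trans (_ : #|GG| * 2 ^ (j * s) <= _); first by rewrite leq_mul2l leq_exp2l // hj orbT.
  apply: leq_trans main _; apply: leq_trans (leq_mul hn1' (leqnn _)) _.
  rewrite -!expnD leq_exp2l //; clear; lia.
have hb9 : 9 * n <= 20 * (b * De).
  have h : n < b.+1 * (2 * De) by apply: ltn_ceil; clear - De0; lia.
  clearbody b; clear - h le_n; lia.
have hj9 : 9 * n <= 40 * (j * (De * a)).
  have h : n < j.+1 * (4 * De * a) by apply: ltn_ceil; rewrite !muln_gt0 De0.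
  clearbody j; clear - h le_n; lia.
have b30 : 30 <= b by rewrite leq_divRL; clear - le_n De0; lia.
have hs9 : 9 * (a * b) <= 40 * s.
  have h1 : a * b < s.+1 * 4 by apply: ltn_ceil.
  have h2 : b <= a * b by rewrite leq_pmull.
  clearbody s b; clear - h1 h2 b30; lia.
have low1 : n * n <= j * s * (44 * (De * De)).
  have h1 : 9 * n * (9 * n) <= 40 * (j * (De * a)) * (20 * (b * De)) by apply: leq_mul.
  have h2 : j * (De * De) * (9 * (a * b)) <= j * (De * De) * (40 * s) by rewrite leq_mul2l hs9 orbT.
  move: h1 h2; clearbody j s b; move: j s b {hb9 hj9 b30 hs9 main hs hbj} => x y z; clear.
  have -> : 40 * (x * (De * a)) * (20 * (z * De)) = 40 * (20 * (x * (De * De) * (a * z))) by lia.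
  have -> : x * (De * De) * (9 * (a * z)) = 9 * (x * (De * De) * (a * z)) by lia.
  have -> : x * (De * De) * (40 * y) = 40 * (x * y * (De * De)) by lia.
  have -> : x * y * (44 * (De * De)) = 44 * (x * y * (De * De)) by lia.
  by move: (x * (De * De) * (a * z)) (x * y * (De * De)) => u v; lia.
have hz : e2 * n * (2 * K) <= n * n + (2 * a + 1) * n * (2 * K).
  rewrite /e2; have hz : n * (e1 + 4) %/ (2 * a) * (2 * a) <= n * (e1 + 4) by apply: leq_trunc_div.
  suff : n * (e1 + 4) %/ (2 * a) * (2 * K) <= n.
    by move: (n * (e1 + 4) %/ (2 * a)) => z h; have := leq_mul h (leqnn n); clear; lia.
  rewrite -(leq_pmul2r a0); move: hz he1; move: (n * (e1 + 4) %/ _) => z hz hK.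
  have := leq_mul (leqnn K) hz; have := leq_mul (leqnn n) hK; clear; lia.
have h2a : K * (2 * a + 1) * n <= n * n by rewrite leq_mul2r; apply/orP; right; clear - le_n; lia.
have q1 : n * n %/ K * K <= n * n by apply: leq_trunc_div.
have q2 : n * n %/ (4 * (50 * (De * De))) * (4 * (50 * (De * De))) <= n * n by apply: leq_trunc_div.
rewrite -(leq_pmul2r K0); move: low1 hz h2a q1 q2.
move: (n * n %/ K) (n * n %/ (4 * (50 * (De * De)))) (j * s) (e2 * n) (n * n) => x y z u q.
rewrite KE; move: (De * De) => D; clear.
have -> : z * (44 * D) = 44 * (z * D) by lia.
have -> : z * (40 * (50 * D)) = 40 * (50 * (z * D)) by lia.
have -> : u * (2 * (40 * (50 * D))) = 2 * (40 * (50 * (u * D))) by lia.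
have -> : (2 * a + 1) * n * (2 * (40 * (50 * D))) = 2 * (40 * (50 * D) * (2 * a + 1) * n) by lia.
move: (40 * (50 * D) * (2 * a + 1) * n) => w; lia.
Qed.

(** * Complements, induced paths on three vertices, and the cost of boxes *)

Section Complement.
Variable T : finType.
Implicit Types (G : sgraph T) (GG : {set sgraph T}) (A B S U V W X Y : {set T}).

Definition cg_adj G : {ffun T * T -> bool} := [ffun p => (p.1 != p.2) && ~~ adj G p.1 p.2].

Lemma cg_simple G : simple_adj (cg_adj G).
Proof.
apply/andP; split; first by apply/forallP => x; rewrite ffunE eqxx.
by apply/forallP => x; apply/forallP => y; apply/eqP; rewrite !ffunE /= adj_sym [x == y]eq_sym.
Qed.

Definition cg G : sgraph T := SGraph (cg_simple G).

Lemma cgE G x y : adj (cg G) x y = (x != y) && ~~ adj G x y.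
Proof. by rewrite /adj ffunE. Qed.

Lemma cgK : involutive cg.
Proof.
move=> G; apply: adj_inj => x y; rewrite !cgE negb_and !negbK.
by case: eqVneq => [->|//]; rewrite adj_irrefl.
Qed.

Lemma cg_clique G A : clique (cg G) A = indep G A.
Proof.
apply/cliqueP/indepP => h x y xA yA.
  by case: (eqVneq x y) => [->|ne]; [rewrite adj_irrefl|have := h _ _ xA yA ne; rewrite cgE ne].
by move=> ne; rewrite cgE ne h.
Qed.

Lemma cg_indep G A : indep (cg G) A = clique G A.
Proof. by rewrite -[G in RHS]cgK cg_clique. Qed.

(** The complement of an induced C5 is the cycle [v0 v2 v4 v1 v3]. Most of the work is distinctness,
    since non-adjacency in the complement also allows equality. *)
Lemma C5free_cg G : C5free G -> C5free (cg G).
Proof.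
move=> c5 v0 v1 v2 v3 v4; rewrite !cgE !negb_and !negbK.
move=> /andP [n01 a01] /andP [n12 a12] /andP [n23 a23] /andP [n34 a34] /andP [n40 a40].
have d02 : v0 != v2 -> (v0 == v2) || adj G v0 v2 -> adj G v0 v2 by move=> /negbTE ->.
move=> h02 h03 h13 h14 h24.
have n02 : v0 != v2.
  apply: contraTneq h03 => ->; by rewrite negb_or n23 a23.
have n03 : v0 != v3.
  apply: contraTneq h02 => ->; by rewrite negb_or eq_sym n23 adj_sym a23.
have n13 : v1 != v3.
  apply: contraTneq h14 => ->; by rewrite negb_or n34 a34.
have n14 : v1 != v4.
  apply: contraTneq h13 => ->; by rewrite negb_or eq_sym n34 adj_sym a34.
have n24 : v2 != v4.
  apply: contraTneq h02 => ->; by rewrite negb_or eq_sym n40 adj_sym a40.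
move: h02 h03 h13 h14 h24; rewrite (negbTE n02) (negbTE n03) (negbTE n13) (negbTE n14) (negbTE n24) /=.
move=> h02 h03 h13 h14 h24.
apply: (c5 v0 v2 v4 v1 v3) => //; rewrite 1?adj_sym //.
Qed.

Lemma nt_cg D GG : nt D [set cg G | G in GG] = nt D GG.
Proof.
have le (HH : {set sgraph T}) : nt D [set cg G | G in HH] <= nt D HH.
  pose f (t : {set T * T}) := [set p in D | (p.1 != p.2) && (p \notin t)].
  have -> : nt D [set cg G | G in HH] = #|f @: (tr D @: HH)|.
    rewrite /nt -!imset_comp; congr #|pred_of_set _|; apply: eq_imset => G /=.
    by apply/setP => -[x y]; rewrite !inE cgE /=; case: (_ \in D).
  exact: leq_imset_card.
apply/eqP; rewrite eqn_leq le /=.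
have {1}-> : GG = [set cg G | G in [set cg G | G in GG]].
  by rewrite -imset_comp (eq_imset _ (_ : _ =1 id)) ?imset_id // => G /=; rewrite cgK.
exact: le.
Qed.

Definition p3 G x y z : bool := [&& adj G x y, adj G y z, x != z & ~~ adj G x z].
Definition isP3 G S : bool := [exists x, exists y, exists z, (S == [set x; y; z]) && p3 G x y z].
Definition isE G S : bool := [exists x, exists y, (S == [set x; y]) && adj G x y].

Lemma isP3P G S : reflect (exists x y z, S = [set x; y; z] /\ p3 G x y z) (isP3 G S).
Proof.
apply: (iffP existsP) => [[x /existsP [y /existsP [z /andP [/eqP e h]]]]|[x [y [z [e h]]]]].
  by exists x, y, z.
by exists x; apply/existsP; exists y; apply/existsP; exists z; rewrite e eqxx.
Qed.

Lemma isEP G S : reflect (exists x y, S = [set x; y] /\ adj G x y) (isE G S).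
Proof.
apply: (iffP existsP) => [[x /existsP [y /andP [/eqP e h]]]|[x [y [e h]]]].
  by exists x, y.
by exists x; apply/existsP; exists y; rewrite e eqxx.
Qed.

Lemma adj_neq G x y : adj G x y -> x != y.
Proof. by apply: contraTneq => ->; rewrite adj_irrefl. Qed.

Lemma p3_neq G x y z : p3 G x y z -> [/\ x != y, y != z & x != z].
Proof. by case/and4P => /adj_neq ? /adj_neq ? ? _. Qed.

Lemma card_isP3 G S : isP3 G S -> #|S| = 3.
Proof.
case/isP3P => x [y [z [-> /p3_neq [n1 n2 n3]]]].
by rewrite setUC cardsU1 !inE cards2 negb_or n1 eq_sym n3 eq_sym n2.
Qed.

Lemma card_isE G S : isE G S -> #|S| = 2.
Proof. by case/isEP => x [y [-> /adj_neq n]]; rewrite cards2 n. Qed.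

(** The one excluded pattern, with exactly the edges [x u] and [z w], closes the induced cycle
    [x y z w u]. *)
Lemma cost_p3 x y z u w GG : [disjoint [set x; y; z] & [set u; w]] ->
  (forall G, G \in GG -> [/\ C5free G, p3 G x y z & adj G u w]) ->
  nt (setX [set x; y; z] [set u; w]) GG <= 63.
Proof.
move=> dj h; have [->|/set0Pn [G0 /h [_ p0 e0]]] := eqVneq GG set0.
  by rewrite /nt imset0 cards0.
have cS : #|setX [set x; y; z] [set u; w]| = 6.
  have := @card_isP3 G0 [set x; y; z]; have := @card_isE G0 [set u; w].
  rewrite cardsX => -> ; last by apply/isEP; exists u, w.
  by move=> ->; last by apply/isP3P; exists x, y, z.
have [n1 n2 n3] := p3_neq p0; have n4 := adj_neq e0.
apply: leq_trans (_ : (2 ^ 6).-1 <= _) => //; rewrite -cS.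
apply: (@nt_avoid _ _ _ [set (x, u); (z, w)]).
  by apply/subsetP => -[p q]; rewrite !inE /= => /orP [] /eqP [-> ->]; rewrite !eqxx ?orbT.
move=> G /h [c5 /and4P [axy ayz _ nxz] auw]; apply/negP => /eqP /setP e.
have ev p q : p \in [set x; y; z] -> q \in [set u; w] ->
    adj G p q = ((p == x) && (q == u)) || ((p == z) && (q == w)).
  by move=> hp hq; have := e (p, q); rewrite !inE /= -!in_set1 in hp hq *; rewrite !inE in hp hq *; rewrite hp hq /= => ->; rewrite !xpair_eqE.
have mx : x \in [set x; y; z] by rewrite !inE eqxx.
have my : y \in [set x; y; z] by rewrite !inE eqxx orbT.
have mz : z \in [set x; y; z] by rewrite !inE eqxx !orbT.
have mu : u \in [set u; w] by rewrite !inE eqxx.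
have mw : w \in [set u; w] by rewrite !inE eqxx orbT.
apply: (c5 x y z w u) => //.
- by rewrite ev // !eqxx orbT.
- by rewrite adj_sym.
- by rewrite adj_sym ev // !eqxx.
- by rewrite ev // [w == u]eq_sym (negbTE n4) (negbTE n3) andbF.
- by rewrite ev // [y == x]eq_sym (negbTE n1) (negbTE n2).
- by rewrite ev // [y == x]eq_sym (negbTE n1) (negbTE n2).
- by rewrite ev // [z == x]eq_sym (negbTE n3) (negbTE n4) andbF.
Qed.

Lemma cost_product c1 c2 b X Y GG (P Q : {set {set T}}) :
  trivIset P -> trivIset Q ->
  (forall S, S \in P -> S \subset X /\ #|S| = c1) ->
  (forall S, S \in Q -> S \subset Y /\ #|S| = c2) ->
  (forall S R, S \in P -> R \in Q -> nt (setX S R) GG <= b) ->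
  nt (setX X Y) GG * 2 ^ (c1 * c2 * (#|P| * #|Q|)) <= 2 ^ (#|X| * #|Y|) * b ^ (#|P| * #|Q|).
Proof.
move=> tP tQ hP hQ le_b; pose C := setX (cover P) (cover Q).
have sC : C \subset setX X Y.
  apply/subsetP => -[x y]; rewrite !in_setX => /andP [/bigcupP [S SP xS] /bigcupP [R RQ yR]].
  by rewrite (subsetP (hP _ SP).1 _ xS) (subsetP (hQ _ RQ).1 _ yR).
have ccP : #|cover P| = #|P| * c1.
  by move/eqP: tP => <-; rewrite (eq_bigr (fun=> c1)) ?sum_nat_const // => S /hP [].
have ccQ : #|cover Q| = #|Q| * c2.
  by move/eqP: tQ => <-; rewrite (eq_bigr (fun=> c2)) ?sum_nat_const // => S /hQ [].
have cC : #|C| = c1 * c2 * (#|P| * #|Q|) by rewrite cardsX ccP ccQ; lia.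
have e : setX X Y = (setX X Y :\: C) :|: \bigcup_(SR in setX P Q) setX SR.1 SR.2.
  apply/setP => -[x y]; rewrite in_setU in_setD; apply/idP/orP => [xy|].
    case: (boolP ((x, y) \in C)) => [|_]; last by left; rewrite xy.
    rewrite in_setX => /andP [/bigcupP [S SP xS] /bigcupP [R RQ yR]]; right.
    by apply/bigcupP; exists (S, R); rewrite in_setX ?SP ?RQ //= xS yR.
  case=> [/andP [] //|/bigcupP [[S R]]]; rewrite !in_setX /= => /andP [SP RQ] /andP [xS yR].
  by rewrite (subsetP (hP _ SP).1 _ xS) (subsetP (hQ _ RQ).1 _ yR).
have le1 : nt (setX X Y) GG <= 2 ^ (#|X| * #|Y| - #|C|) * b ^ (#|P| * #|Q|).
  rewrite {1}e; apply: leq_trans (nt_U _ _ _) _; apply: leq_mul.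
    by apply: leq_trans (nt_exp _ _) _; rewrite leq_exp2l // cardsD (setIidPr sC) cardsX.
  apply: leq_trans (nt_bigU _ _ _) _; rewrite -cardsX -prod_nat_const.
  by apply: leq_prod => -[S R]; rewrite in_setX => /andP [SP RQ]; apply: le_b.
have leC : #|C| <= #|X| * #|Y| by rewrite -cardsX; apply: subset_leq_card.
rewrite -cC; apply: leq_trans (leq_mul le1 (leqnn _)) _.
by rewrite mulnAC -expnD subnK.
Qed.

End Complement.

(** From [2 * 63 ^ 45 <= 64 ^ 45]: a bit is gained for every 45 boxes in which one of 64 patterns is
    excluded. *)
Lemma exp63 m : 63 ^ m * 2 ^ (m %/ 45) <= 64 ^ m.
Proof.
rewrite {1 3}(divn_eq m 45) !expnD mulnAC; apply: leq_mul; last by apply: leq_expW.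
by rewrite mulnC [_ * 45]mulnC !expnM -expnMn; apply: leq_expW; lia.
Qed.

Lemma exp15' m : 15 ^ m * 2 ^ (m %/ 11) <= 16 ^ m.
Proof.
rewrite {1 3}(divn_eq m 11) !expnD mulnAC; apply: leq_mul; last by apply: leq_expW.
by rewrite mulnC [_ * 11]mulnC !expnM -expnMn; apply: leq_expW; lia.
Qed.

(** * A clique and a disjoint union of cliques *)

Section Structure.
Variable T : finType.
Implicit Types (G : sgraph T) (GG : {set sgraph T}) (A B K S U V W X Y : {set T}) (P Q : {set {set T}}).

(** Without induced paths on three vertices the graph on [X] is a disjoint union of cliques; in this
    form the property passes to subsets and its failure has small witnesses. *)
Definition P3free G X : Prop := forall x y z, x \in X -> y \in X -> z \in X -> ~~ p3 G x y z.

Lemma P3free_sub G X Y : X \subset Y -> P3free G Y -> P3free G X.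
Proof. by move=> /subsetP s h x y z /s ? /s ? /s ?; apply: h. Qed.

Lemma isP3_set0 G : ~~ isP3 G set0.
Proof. by apply/negP => /card_isP3; rewrite cards0. Qed.

Lemma isE_set0 G : ~~ isE G set0.
Proof. by apply/negP => /card_isE; rewrite cards0. Qed.

Lemma cover_card c P : trivIset P -> (forall S, S \in P -> #|S| = c) -> #|cover P| = #|P| * c.
Proof.
by move=> /eqP <- h; rewrite (eq_bigr (fun=> c)) ?sum_nat_const.
Qed.

Lemma packP3 G X : exists P, [/\ trivIset P, forall S, S \in P -> S \subset X /\ isP3 G S,
  #|cover P| = #|P| * 3 & P3free G (X :\: cover P)].
Proof.
have [P [tP hP mP]] := maximal_packing X (isP3_set0 G); exists P; split=> //.
- by move=> S /hP /andP [].
- by apply: cover_card => // S /hP /andP [/card_isP3].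
- move=> x y z xX yX zX; apply/negP => pp.
  have s : [set x; y; z] \subset X :\: cover P.
    by apply/subsetP => w; rewrite !inE -!orbA => /or3P [] /eqP ->; rewrite -in_setD.
  by have /negP [] := mP _ s; apply/isP3P; exists x, y, z.
Qed.

Lemma packE G X : exists P, [/\ trivIset P, forall S, S \in P -> S \subset X /\ isE G S,
  #|cover P| = #|P| * 2 & indep G (X :\: cover P)].
Proof.
have [P [tP hP mP]] := maximal_packing X (isE_set0 G); exists P; split=> //.
- by move=> S /hP /andP [].
- by apply: cover_card => // S /hP /andP [/card_isE].
- apply/indepP => x y xX yX; apply/negP => pp.
  have s : [set x; y] \subset X :\: cover P.
    by apply/subsetP => w; rewrite !inE => /orP [] /eqP ->; rewrite -in_setD.
  by have /negP [] := mP _ s; apply/isEP; exists x, y.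
Qed.

(** If [x y] is a non-edge, a neighbour of [x] in [X] would give an induced path with [x] and [y] in
    the graph or in the complement. So [x] is isolated in [X], and then any edge of [X] gives a path
    through [x] in the complement. *)
Lemma homog_of_P3free G X : P3free G X -> P3free (cg G) X -> homog G X.
Proof.
move=> h h'; rewrite /homog; case: (boolP (clique G X)) => //= nc.
have [x [y [xX yX ne nxy]]] : exists x y, [/\ x \in X, y \in X, x != y & ~~ adj G x y].
  apply: contrapT => no; move/negP: nc; apply; apply/cliqueP => x y xX yX ne.
  by apply: contrapT => /negP na; apply: no; exists x, y.
have nz z : z \in X -> ~~ adj G z x.
  move=> zX; apply/negP => azx; have nzx := adj_neq azx.
  have := h x z y xX zX yX; rewrite /p3 adj_sym azx ne nxy !andbT /= => nzy.
  have nzy' : z != y by apply: contraTneq azx => ->; rewrite adj_sym.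
  have := h' z y x zX yX xX; rewrite /p3 !cgE nzy' nzy nzx azx [y == x]eq_sym ne adj_sym nxy.
  by [].
apply/indepP => z w zX wX; apply/negP => azw; have n1 := nz _ zX; have n2 := nz _ wX.
have zx : z != x by apply: contraTneq azw => ->; rewrite adj_sym.
have wx : w != x by apply: contraTneq azw => ->.
have := h' z x w zX xX wX; rewrite /p3 !cgE zx n1 [x == w]eq_sym wx adj_sym n2 (adj_neq azw) azw.
by [].
Qed.

(** Both sides have about half of the vertices, and at most [e] vertices belong to neither. *)
Definition struct e G : Prop := exists K X,
  [/\ [disjoint K & X], clique G K, P3free G X, #|T| <= 2 * #|K| + e & #|T| <= 2 * #|X| + e].

Lemma isP3_tr G G' S X : S \subset X -> tr (setX X X) G = tr (setX X X) G' ->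
  forall x y z, S = [set x; y; z] -> p3 G x y z -> p3 G' x y z.
Proof.
move=> sS /eqP /trP e x y z eS; have iS w : w \in S -> w \in X by apply: (subsetP sS).
have hx : x \in X by apply: iS; rewrite eS !inE eqxx.
have hy : y \in X by apply: iS; rewrite eS !inE eqxx orbT.
have hz : z \in X by apply: iS; rewrite eS !inE eqxx !orbT.
by rewrite /p3 !e // inE /= ?hx ?hy ?hz.
Qed.

Lemma box_saving X Y GG G0 P Q : [disjoint X & Y] -> G0 \in GG ->
  (forall G, G \in GG -> [/\ C5free G, tr (setX X X) G0 = tr (setX X X) G & tr (setX Y Y) G0 = tr (setX Y Y) G]) ->
  trivIset P -> (forall S, S \in P -> S \subset X /\ isP3 G0 S) ->
  trivIset Q -> (forall S, S \in Q -> S \subset Y /\ isE G0 S) ->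
  nt (setX X Y) GG * 2 ^ (#|P| * #|Q| %/ 45) <= 2 ^ (#|X| * #|Y|).
Proof.
move=> dXY G0G hG tP hP tQ hQ.
have hP' S : S \in P -> S \subset X /\ #|S| = 3 by move=> /hP [s /card_isP3].
have hQ' S : S \in Q -> S \subset Y /\ #|S| = 2 by move=> /hQ [s /card_isE].
have := cost_product (b := 63) tP tQ hP' hQ' _.
have le_b S R : S \in P -> R \in Q -> nt (setX S R) GG <= 63.
  move=> SP RQ; have [sS /isP3P [x [y [z [eS pp]]]]] := hP _ SP.
  have [sR /isEP [u [w [eR ae]]]] := hQ _ RQ; rewrite eS eR; apply: cost_p3.
    by rewrite -eS -eR; apply: disjointWl sS _; apply: disjointWr sR _.
  move=> G /hG [c5 e1 e2]; split=> //; first exact: isP3_tr sS e1 _ _ _ eS pp.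
  move/eqP/trP: e2 => <- //; rewrite inE /= !(subsetP sR) // eR !inE eqxx ?orbT //.
move=> /(_ _ le_b); move: (#|P| * #|Q|) => p le1.
rewrite -(leq_pmul2r (_ : 0 < 63 ^ p)) ?expn_gt0 //.
apply: leq_trans le1; rewrite -mulnA leq_mul2l; apply/orP; right.
rewrite mulnC [X in _ <= X]expnM; exact: exp63.
Qed.

Lemma card_indep_clique G A B : clique G A -> indep G B -> #|A :&: B| <= 1.
Proof.
move=> /cliqueP c /indepP i; rewrite leqNgt; apply/negP => /card_gt1P [x [y [/setIP [xA xB] /setIP [yA yB] ne]]].
by have /negP [] := i _ _ xB yB; apply: c.
Qed.

(** Up to [6 * c] vertices [X] is a clique, hence full of disjoint edges; as the two packings are
    not both large, [Y] then has fewer than [c] disjoint induced paths and becomes [P3free] after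
    losing at most [3 * c] vertices. *)
Lemma struct_half G X Y K e c (EX PY : {set {set T}}) : [disjoint X & Y] -> K \subset X -> clique G K ->
  #|X| <= #|K| + 6 * c -> #|T| <= 2 * #|X| + e -> #|T| <= 2 * #|Y| + e -> 2 * c < #|K| ->
  #|cover EX| = #|EX| * 2 -> indep G (X :\: cover EX) ->
  #|cover PY| = #|PY| * 3 -> P3free G (Y :\: cover PY) ->
  ~~ ((c <= #|PY|) && (c <= #|EX|)) -> struct (e + 12 * c) G.
Proof.
move=> dXY sK cK leK nX nY cgt cE iE cP fP nn.
have leE : c <= #|EX|.
  have := card_indep_clique cK iE; rewrite setIDA (setIidPl sK) => le1.
  have := cardsID (cover EX) K; have : #|K :&: cover EX| <= #|cover EX| by apply/subset_leq_card/subsetIr.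
  lia.
rewrite leE andbT -ltnNge in nn; exists K, (Y :\: cover PY); split=> //; last 2 first.
- lia.
- have := cardsID (cover PY) Y; have : #|Y :&: cover PY| <= #|cover PY| by apply/subset_leq_card/subsetIr.
  lia.
apply: disjointWl sK _; apply: disjointWr _ dXY; exact: subsetDl.
Qed.

(** Four kinds of boxes save bits: induced paths on either side against edges on the other, in the
    graph or in its complement. If no kind is abundant, one side is nearly homogeneous and the other
    one nearly a union of cliques, in the graph or in its complement. *)
Lemma fiber_saving X Y GG G0 e c : [disjoint X & Y] -> G0 \in GG ->
  (forall G, G \in GG -> [/\ C5free G, tr (setX X X) G0 = tr (setX X X) G & tr (setX Y Y) G0 = tr (setX Y Y) G]) ->
  #|T| <= 2 * #|X| + e -> #|T| <= 2 * #|Y| + e -> e + 16 * c < #|T| ->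
  ~ struct (e + 12 * c) G0 -> ~ struct (e + 12 * c) (cg G0) ->
  nt (setX X Y) GG * 2 ^ (c * c %/ 45) <= 2 ^ (#|X| * #|Y|).
Proof.
move=> dXY G0G hG nX nY gtc ns nsc.
have hC : forall G, G \in [set cg G | G in GG] -> [/\ C5free G, tr (setX X X) (cg G0) = tr (setX X X) G & tr (setX Y Y) (cg G0) = tr (setX Y Y) G].
  move=> _ /imsetP [G /hG [c5 /eqP/trP e1 /eqP/trP e2] ->]; split; first exact: C5free_cg.
    by apply/eqP/trP => x y xy; rewrite !cgE e1.
  by apply/eqP/trP => x y xy; rewrite !cgE e2.
have C0 : cg G0 \in [set cg G | G in GG] by apply: imset_f.
have dYX : [disjoint Y & X] by rewrite disjoint_sym.
have hG' : forall G, G \in GG -> [/\ C5free G, tr (setX Y Y) G0 = tr (setX Y Y) G & tr (setX X X) G0 = tr (setX X X) G].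
  by move=> G /hG [].
have hC' : forall G, G \in [set cg G | G in GG] -> [/\ C5free G, tr (setX Y Y) (cg G0) = tr (setX Y Y) G & tr (setX X X) (cg G0) = tr (setX X X) G].
  by move=> G /hC [].
have sw HH : nt (setX X Y) HH <= nt (setX Y X) HH.
  by apply: nt_mono => x y; rewrite !inE /= => /andP [-> ->]; rewrite !orbT.
have use p q N : N * 2 ^ (p * q %/ 45) <= 2 ^ (#|X| * #|Y|) -> (c <= p) && (c <= q) ->
    N * 2 ^ (c * c %/ 45) <= 2 ^ (#|X| * #|Y|).
  move=> le1 /andP [cp cq]; apply: leq_trans le1; rewrite leq_mul2l leq_exp2l //.
  by rewrite leq_div2r ?orbT // leq_mul.
have [PX [tPX hPX cPX fPX]] := packP3 G0 X; have [PY [tPY hPY cPY fPY]] := packP3 G0 Y.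
have [EX [tEX hEX cEX fEX]] := packE G0 X; have [EY [tEY hEY cEY fEY]] := packE G0 Y.
have [QX [tQX hQX cQX fQX]] := packP3 (cg G0) X; have [QY [tQY hQY cQY fQY]] := packP3 (cg G0) Y.
have [FX [tFX hFX cFX fFX]] := packE (cg G0) X; have [FY [tFY hFY cFY fFY]] := packE (cg G0) Y.
case: (boolP ((c <= #|PX|) && (c <= #|EY|))) => [h1|n1].
  exact: use (box_saving dXY G0G hG tPX hPX tEY hEY) h1.
case: (boolP ((c <= #|QX|) && (c <= #|FY|))) => [h1|n2].
  by have := use _ _ _ (box_saving dXY C0 hC tQX hQX tFY hFY) h1; rewrite nt_cg.
case: (boolP ((c <= #|PY|) && (c <= #|EX|))) => [h1|n3].
  have := box_saving dYX G0G hG' tPY hPY tEX hEX; rewrite [#|Y| * _]mulnC => h2.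
  by have := use _ _ _ h2 h1; apply: leq_trans; rewrite leq_mul2r sw orbT.
case: (boolP ((c <= #|QY|) && (c <= #|FX|))) => [h1|n4].
  have := box_saving dYX C0 hC' tQY hQY tFX hFX; rewrite [#|Y| * _]mulnC nt_cg => h2.
  by have := use _ _ _ h2 h1; apply: leq_trans; rewrite leq_mul2r sw orbT.
exfalso.
have cov (Z : {set T}) (P0 : {set {set T}}) d : #|cover P0| = #|P0| * d -> #|P0| < c -> #|Z| <= #|Z :\: cover P0| + d * c.
  move=> e1 l1; have i1 := cardsID (cover P0) Z.
  have i2 : #|Z :&: cover P0| <= #|cover P0| by apply/subset_leq_card/subsetIr.
  have i3 : #|P0| * d <= c * d by rewrite leq_mul2r ltnW ?orbT.
  by clear - e1 i1 i2 i3; lia.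
(* Few disjoint edges, or few disjoint non-edges, make [Y] nearly homogeneous, and the sides
   exchange their roles. *)
case: (leqP c #|EY|) => [eY|eY]; last first.
  have h := cov Y _ _ cEY eY; apply: nsc.
  by apply: (struct_half (X := Y) (Y := X) (K := Y :\: cover EY) (EX := FY) (PY := QX)) => //;
    rewrite ?subsetDl ?cg_clique //; clear - h nX nY gtc; lia.
case: (leqP c #|FY|) => [fY|fY]; last first.
  have h := cov Y _ _ cFY fY; apply: ns.
  by apply: (struct_half (X := Y) (Y := X) (K := Y :\: cover FY) (EX := EY) (PY := PX)) => //;
    rewrite ?subsetDl // -?cg_indep //; clear - h nX nY gtc; lia.
rewrite eY andbT -ltnNge in n1; rewrite fY andbT -ltnNge in n2.
have h1 := cov X _ _ cPX n1; have h2 := cov (X :\: cover PX) _ _ cQX n2.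
(* Here [Y] has many disjoint edges and non-edges, so [X] has few disjoint induced paths in the
   graph and in the complement; without them it is homogeneous. *)
have /orP [cK|iK] : homog G0 (X :\: cover PX :\: cover QX).
  apply: homog_of_P3free; first exact: P3free_sub (subsetDl _ _) fPX.
  by apply: P3free_sub fQX; rewrite setDAC subsetDl || apply/setSD/subsetDl.
- apply: ns.
  by apply: (struct_half (X := X) (Y := Y) (K := X :\: cover PX :\: cover QX) (EX := EX) (PY := PY)) => //;
    rewrite ?(subset_trans (subsetDl _ _) (subsetDl _ _)) //; clear - h1 h2 nX nY gtc; lia.
- apply: nsc.
  by apply: (struct_half (X := X) (Y := Y) (K := X :\: cover PX :\: cover QX) (EX := FX) (PY := QY)) => //;
    rewrite ?(subset_trans (subsetDl _ _) (subsetDl _ _)) ?cg_clique //; clear - h1 h2 nX nY gtc; lia.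
Qed.

End Structure.

Lemma structure_count N : 1 < N -> exists n0 De2, 0 < De2 /\ forall T : finType, n0 <= #|T| ->
  forall GG : {set sgraph T},
  (forall G, G \in GG -> [/\ C5free G, EH G, ~ struct (#|T| %/ N) G & ~ struct (#|T| %/ N) (cg G)]) ->
  #|GG| * 2 ^ (#|T| * #|T| %/ De2) <= 2 ^ (#|T| * #|T| %/ 4).
Proof.
move=> N1; have N0 := ltnW N1; have [D DE] : exists D, D = 60 * (60 * (60 * (N * N))) by exists (60 * (60 * (60 * (N * N)))).
have NN0 : 0 < N * N by rewrite muln_gt0 N0.
have D0 : 0 < D by rewrite DE !muln_gt0 N0.
have D80 : 0 < 8 * D by clear - D0; lia.
have [a [k [n1 [D1 [D10 hn1]]]]] := coarse D80.
exists (n1 + 60 * N + 60 * N + 2 * D + 2 * D1 + 16 * D), (2 * D1 + 2 * D); split; first by clear - D10; lia.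
move=> T; set n := #|T| => le_n GG hG.
have [|h1 h2] := hn1 T; first by rewrite -/n; clear - le_n; lia.
have [q qE] : exists q, q = n * n by exists (n * n).
rewrite -/n -qE in h1 h2 *.
pose BG := [set G in GG | `[< bad a k (n %/ (8 * D)) G setT >]].
pose NG := [set G in GG | ~~ `[< bad a k (n %/ (8 * D)) G setT >]].
have eGG : GG = BG :|: NG by apply/setP => G; rewrite !inE; case: (G \in GG); case: (`[< _ >]).
have n0 : 0 < n by clear - le_n D0; lia.
have qn : n * (2 * D + 2 * D1 + 16 * D) <= q by rewrite qE leq_mul2l; apply/orP; right; clear - le_n; lia.
have le1 : #|BG| * 2 ^ (q %/ (2 * D1 + 2 * D)).+1 <= 2 ^ (q %/ 4).
  apply: leq_trans (h1 BG _); last first.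
    by move=> G; rewrite inE => /andP [/hG [c5 eh _ _] /asboolP].
  rewrite leq_mul2l leq_exp2l //; apply/orP; right; rewrite leq_divRL //.
  have hq : q %/ (2 * D1 + 2 * D) * (2 * D1 + 2 * D) <= q by apply: leq_trunc_div.
  move: (q %/ (2 * D1 + 2 * D)) hq => x hq.
  have l1 : 2 * D1 <= q by apply: leq_trans qn; rewrite -[2 * D1]mul1n; apply: leq_mul => //; clear; lia.
  clear - l1 hq; nia.
suff le2 : #|NG| * 2 ^ (q %/ (2 * D1 + 2 * D)).+1 <= 2 ^ (q %/ 4).
  apply: leq_trans (_ : (#|BG| + #|NG|) * 2 ^ (q %/ (2 * D1 + 2 * D)) <= _).
    by rewrite leq_mul2r eGG leq_card_setU orbT.
  move: le1 le2; rewrite expnS; move: (2 ^ _) (2 ^ _) #|BG| #|NG| => u v x y; clear; nia.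
pose c := n %/ (24 * N); pose e := n %/ (2 * N).
(* An imbalance of [e] between the sides wastes [e * e / 4] of the crossing bits, abundant boxes
   waste [c * c / 45]. The choice of [D] makes the entropy inside the low sides smaller than
   either. *)
pose sv := minn (c * c %/ 45) (e * e %/ 4).
have hce : e + 12 * c <= n %/ N.
  rewrite leq_divRL //.
  have i1 : e * (2 * N) <= n by apply: leq_trunc_div.
  have i2 : c * (24 * N) <= n by apply: leq_trunc_div.
  clearbody c e; clear - i1 i2; lia.
have struct_le e1 e2 (G : sgraph T) : e1 <= e2 -> struct e1 G -> struct e2 G.
  by move=> le [K [X [h3 h4 h5 h6 h7]]]; exists K, X; split=> //; clear - le h6 h7; lia.
have boxes X : nt setT [set G in NG | `[< low a k (n %/ (8 * D)) G X /\ low a k (n %/ (8 * D)) G (~: X) >]] <=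
    2 ^ (3 * (q %/ (8 * D))) * (2 ^ (3 * (q %/ (8 * D))) * (2 ^ (q %/ 4) %/ 2 ^ sv)).
  set CC := [set G in NG | _].
  have hCC G : G \in CC -> [/\ G \in GG, low a k (n %/ (8 * D)) G X & low a k (n %/ (8 * D)) G (~: X)].
    by rewrite !inE => /andP [/andP [-> _] /asboolP []].
  apply: leq_trans (@nt_fiber _ setT (setX X X) CC (2 ^ (3 * (q %/ (8 * D))) * (2 ^ (q %/ 4) %/ 2 ^ sv)) _) _; last first.
    by apply: leq_mul => //; apply: h2 => G /hCC [/hG [_ eh _ _] l1 _].
  move=> t; set CC1 := [set G in CC | _].
  have hC1 G : G \in CC1 -> G \in CC /\ tr (setX X X) G = t by rewrite inE => /andP [-> /eqP].
  apply: leq_trans (@nt_fiber _ setT (setX (~: X) (~: X)) CC1 (2 ^ (q %/ 4) %/ 2 ^ sv) _) _; last first.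
    by apply: leq_mul => //; apply: h2 => G /hC1 [/hCC [/hG [_ eh _ _] _ l1] _].
  move=> t'; set CC2 := [set G in CC1 | _].
  have hC2 G : G \in CC2 -> [/\ G \in CC, tr (setX X X) G = t & tr (setX (~: X) (~: X)) G = t'].
    by rewrite inE => /andP [/hC1 [? ?] /eqP].
  have [->|/set0Pn [G0 G0C]] := eqVneq CC2 set0; first by rewrite /nt imset0 cards0.
  have [G0CC e0 e0'] := hC2 _ G0C; have [G0G _ _] := hCC _ G0CC; have [_ _ ns nsc] := hG _ G0G.
  rewrite leq_divRL ?expn_gt0 //.
  apply: leq_trans (_ : nt (setX X (~: X)) CC2 * 2 ^ sv <= _).
    rewrite leq_mul2r; apply/orP; right.
    apply: leq_trans (_ : nt (setX X (~: X) :|: (setX X X :|: setX (~: X) (~: X))) CC2 <= _).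
      by apply: nt_mono => x y _; rewrite !inE /=; case: (x \in X); case: (y \in X); rewrite ?orbT.
    apply: leq_trans (nt_U _ _ _) _; rewrite -[X in _ <= X]muln1; apply: leq_mul => //.
    apply: leq_trans (nt_U _ _ _) _; rewrite -[1]muln1; apply: leq_mul.
      by apply: (nt1 (t := t)) => G /hC2 [].
    by apply: (nt1 (t := t')) => G /hC2 [].
  have cX : #|X| + #|~: X| = n by rewrite cardsC.
  have xy4 : #|X| * #|~: X| <= q %/ 4.
    rewrite leq_divRL // qE -cX; move: #|X| #|~: X| => x y; have := (nat_AGM2 x y).1; rewrite -mulnn; clear; lia.
  have small : (n <= 2 * #|X| + e) && (n <= 2 * #|~: X| + e) \/ #|X| * #|~: X| + e * e %/ 4 <= q %/ 4.
    case: (boolP ((n <= 2 * #|X| + e) && (n <= 2 * #|~: X| + e))) => [|nn]; [by left|right].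
    rewrite leq_divRL //; have i4 : e * e %/ 4 * 4 <= e * e by apply: leq_trunc_div.
    have : 4 * (#|X| * #|~: X|) + e * e <= q.
      rewrite qE; move: nn; rewrite -cX; move: #|X| #|~: X| => x y; clear; clearbody e.
      rewrite negb_and -!ltnNge => /orP [h|h].
        have [d ->] : exists d, y = x + e + d by exists (y - (x + e)); lia.
        by clear; nia.
      have [d ->] : exists d, x = y + e + d by exists (x - (y + e)); lia.
      by clear; nia.
    by move: (e * e %/ 4) i4 => z i4; clear - i4; lia.
  case: small => [/andP [nX nY]|le]; last first.
    apply: leq_trans (leq_mul (nt_exp _ _) (leqnn _)) _; rewrite -expnD leq_exp2l // cardsX.
    apply: leq_trans le; rewrite leq_add2l; exact: geq_minr.
  apply: leq_trans (_ : 2 ^ (#|X| * #|~: X|) <= _); last by rewrite leq_exp2l.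
  apply: leq_trans (_ : nt (setX X (~: X)) CC2 * 2 ^ (c * c %/ 45) <= _).
    by rewrite leq_mul2l leq_exp2l // geq_minl orbT.
  apply: (fiber_saving (G0 := G0) (e := e)) => //.
  - by rewrite -setI_eq0 setICr.
  - by move=> G /hC2 [/hCC [/hG [c5 _ _ _] _ _] -> ->].
  - have i1 : e * (2 * N) <= n by apply: leq_trunc_div.
    have i2 : c * (24 * N) <= n by apply: leq_trunc_div.
    have i3 : e * 4 <= e * (2 * N) by rewrite leq_mul2l; apply/orP; right; clear - N1; lia.
    have i4 : c * 24 <= c * (24 * N) by rewrite leq_mul2l; apply/orP; right; clear - N0; lia.
    rewrite -/n; clearbody c e; clear - i1 i2 i3 i4 n0; lia.
  - by move=> st; apply: ns; apply: struct_le st.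
  - by move=> st; apply: nsc; apply: struct_le st.
have le3 : #|NG| <= 2 ^ n * (2 ^ (3 * (q %/ (8 * D))) * (2 ^ (3 * (q %/ (8 * D))) * (2 ^ (q %/ 4) %/ 2 ^ sv))).
  rewrite -nt_setT -card_setTE.
  apply: (nt_union (P := predT) (CC := fun X => [set G in NG | `[< low a k (n %/ (8 * D)) G X /\ low a k (n %/ (8 * D)) G (~: X) >]])) => [G GN|X _]; last exact: boxes.
  have : ~ bad a k (n %/ (8 * D)) G setT by move: (GN); rewrite inE => /andP [_ /asboolP].
  move=> /contrapT [X [_ l1 l2]]; exists X => //; rewrite inE GN; apply/asboolP; split=> //.
  by rewrite setTD in l2.
rewrite -(leq_pmul2r (expn_gt0 2 0)) !muln1.
apply: leq_trans (leq_mul le3 (leqnn _)) _.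
have hsv : 2 ^ (q %/ 4) %/ 2 ^ sv * 2 ^ sv <= 2 ^ (q %/ 4) by apply: leq_trunc_div.
apply: leq_trans hsv.
have sum : n + 6 * (q %/ (8 * D)) + (q %/ (2 * D1 + 2 * D)).+1 <= sv.
  have i1 : n * (18 * D) <= q by apply: leq_trans qn; rewrite leq_mul2l; apply/orP; right; clear; lia.
  have i2 : q %/ (8 * D) * (8 * D) <= q by apply: leq_trunc_div.
  have i3 : q %/ (2 * D1 + 2 * D) * (2 * D1 + 2 * D) <= q by apply: leq_trunc_div.
  have i4 : D <= n * D by rewrite leq_pmull.
  have F2 : (n + 6 * (q %/ (8 * D)) + (q %/ (2 * D1 + 2 * D)).+1) * D <= 2 * q.
    move: (q %/ (8 * D)) (q %/ (2 * D1 + 2 * D)) i2 i3 => x y i2 i3.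
    have i5 : y * (2 * D) <= y * (2 * D1 + 2 * D) by rewrite leq_mul2l leq_addl orbT.
    by clear - i1 i2 i3 i4 i5; lia.
  move: (n + _ + _) F2 => F F2; rewrite leq_min !leq_divRL //.
  have c30 : n <= 30 * N * c.
    have i5 : n < c.+1 * (24 * N) by apply: ltn_ceil; clear - N0; lia.
    by clearbody c; clear - i5 le_n; lia.
  have e3 : n <= 3 * N * e.
    have i5 : n < e.+1 * (2 * N) by apply: ltn_ceil; clear - N0; lia.
    by clearbody e; clear - i5 le_n; lia.
  have qc : q <= 30 * 30 * (N * N) * (c * c).
    by rewrite qE; apply: leq_trans (leq_mul c30 c30) _; apply: eq_leq; clear; lia.
  have qe : q <= 9 * (N * N) * (e * e).
    by rewrite qE; apply: leq_trans (leq_mul e3 e3) _; apply: eq_leq; clear; lia.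
  rewrite -(leq_pmul2r D0) -[X in _ && X](leq_pmul2r D0); move: F2 qc qe; rewrite DE.
  move: (N * N) (c * c) (e * e) => u v w; clear => F2 qc qe.
  have -> : v * (60 * (60 * (60 * u))) = 4 * 60 * (30 * 30 * u * v) by lia.
  have -> : w * (60 * (60 * (60 * u))) = 20 * 20 * 60 * (9 * u * w) by lia.
  move: (30 * 30 * u * v) (9 * u * w) qc qe => vv ww qc qe.
  have {F2} : F * 45 * (60 * (60 * (60 * u))) <= 45 * (2 * q) by lia.
  have : F * 4 * (60 * (60 * (60 * u))) <= F * 45 * (60 * (60 * (60 * u))) by rewrite leq_mul2r leq_mul2l !orbT.
  move: (F * 45 * _) (F * 4 * _) => f g i1 i2; apply/andP; split; lia.
apply: leq_trans (_ : (2 ^ (q %/ 4) %/ 2 ^ sv) * 2 ^ (n + 6 * (q %/ (8 * D)) + (q %/ (2 * D1 + 2 * D)).+1) <= _); last first.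
  by rewrite leq_mul2l leq_exp2l // sum orbT.
move: (q %/ (8 * D)) (q %/ (2 * D1 + 2 * D)).+1 {sum} => w v.
have -> : 2 ^ (n + 6 * w + v) = 2 ^ n * (2 ^ (3 * w) * 2 ^ (3 * w)) * 2 ^ v.
  by rewrite -!expnD; congr (2 ^ _); clear; lia.
apply: eq_leq; move: (2 ^ _ %/ _) (2 ^ n) (2 ^ (3 * _)) (2 ^ v) => x y z u; clear; lia.
Qed.

(** * Blocks of a disjoint union of cliques *)

(* A set of size at most [k] meets at most [k] of the [n/s + 1] blocks of length [s]. *)
Lemma card_sparse_sets (T : finType) s k : 0 < s ->
  #|[set A : {set T} | #|A| <= k]| <= 2 ^ (#|T| %/ s).+1 * 2 ^ (s * k).
Proof.
move=> s0; pose m := (#|T| %/ s).+1.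
have lt (x : T) : enum_rank x %/ s < m.
  by rewrite ltnS; apply: leq_div2r; apply/ltnW/ltn_ord.
pose b (x : T) : 'I_m := Ordinal (lt x).
pose t (A : {set T}) : {set 'I_m} := b @: A.
pose F (B : {set 'I_m}) := [set A : {set T} | A \subset b @^-1: B].
have sub : [set A : {set T} | #|A| <= k] \subset \bigcup_(B : {set 'I_m} | #|B| <= k) F B.
  apply/subsetP => A; rewrite inE => cA; apply/bigcupP; exists (t A).
    by apply: leq_trans (leq_imset_card _ _) cA.
  by rewrite inE; apply/subsetP => x xA; rewrite inE imset_f.
apply: leq_trans (subset_leq_card sub) _.
have fib (i : 'I_m) : #|b @^-1: [set i]| <= s.
  have [x0|no] := pickP (mem (b @^-1: [set i])); last first.
    by rewrite (eq_card0 no).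
  move=> _; rewrite -[X in _ <= X](card_ord s) -(card_imset _ (@enum_rank_inj T)).
  apply: leq_trans (_ : #|[set w : 'I_#|T| | w %/ s == i]| <= _).
    apply/subset_leq_card/subsetP => _ /imsetP [x + ->]; rewrite !inE => /eqP <-.
    exact/eqP.
  pose f (w : 'I_#|T|) : 'I_s := Ordinal (ltn_pmod w s0).
  rewrite -(@card_in_imset _ _ f); first exact: max_card.
  move=> u v; rewrite !inE => /eqP eu /eqP ev /(congr1 val) /= e.
  by apply: val_inj; rewrite /= (divn_eq u s) (divn_eq v s) eu ev e.
have cF (B : {set 'I_m}) : #|B| <= k -> #|F B| <= 2 ^ (s * k).
  move=> cB; have -> : F B = powerset (b @^-1: B) by apply/setP => A; rewrite !inE.
  rewrite card_powerset leq_exp2l //.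
  have -> : b @^-1: B = \bigcup_(i in B) b @^-1: [set i].
    apply/setP => x; rewrite inE; apply/idP/bigcupP => [h|[i iB]]; first by exists (b x); rewrite ?inE.
    by rewrite !inE => /eqP ->.
  apply: leq_trans (_ : \sum_(i in B) s <= _); last by rewrite sum_nat_const mulnC leq_mul2l cB orbT.
  apply: leq_trans (_ : \sum_(i in B) #|b @^-1: [set i]| <= _); last by apply: leq_sum.
  elim/big_ind2: _ => [|A x A' y hx hy|//]; first by rewrite cards0.
  by apply: leq_trans (leq_card_setU _ _) _; apply: leq_add.
apply: leq_trans (_ : \sum_(B : {set 'I_m} | #|B| <= k) 2 ^ (s * k) <= _).
  apply: leq_trans (_ : \sum_(B : {set 'I_m} | #|B| <= k) #|F B| <= _); last by apply: leq_sum => B; apply: cF.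
  elim/big_ind2: _ => [|A x A' y hx hy|//]; first by rewrite cards0.
  by apply: leq_trans (leq_card_setU _ _) _; apply: leq_add.
rewrite sum_nat_const leq_mul2r; apply/orP; right.
by apply: leq_trans (max_card _) _; rewrite card_setTE card_ord.
Qed.

Section Blocks.
Variable T : finType.
Implicit Types (G : sgraph T) (GG : {set sgraph T}) (A B K S U V W X Y : {set T}) (P Q : {set {set T}}).

Definition blkof G X c : {set T} := [set x in X | (x == c) || adj G c x].

Lemma blkof_self G X c : c \in X -> c \in blkof G X c.
Proof. by move=> cX; rewrite inE cX eqxx. Qed.

Lemma blkof_sub G X c : blkof G X c \subset X.
Proof. by apply/subsetP => x; rewrite inE => /andP []. Qed.

Lemma blkof_eq G X x y : P3free G X -> x \in X -> y \in X -> adj G x y ->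
  blkof G X x = blkof G X y.
Proof.
move=> fX xX yX a; have half u v : u \in X -> v \in X -> adj G u v -> blkof G X u \subset blkof G X v.
  move=> uX vX auv; apply/subsetP => w; rewrite !inE => /andP [wX /orP [/eqP ->|auw]].
    by rewrite uX adj_sym auv orbT.
  rewrite wX /=; case: (eqVneq w v) => //= nwv.
  have := fX v u w vX uX wX; rewrite /p3 adj_sym auv auw eq_sym nwv /=.
  by rewrite negbK.
by apply/eqP; rewrite eqEsubset !half // adj_sym.
Qed.

Lemma blkofP G X x y : P3free G X -> x \in X -> y \in X -> x != y ->
  adj G x y = (blkof G X x == blkof G X y).
Proof.
move=> fX xX yX ne; apply/idP/eqP => [|e]; first exact: blkof_eq.
by have := blkof_self G yX; rewrite -e inE eq_sym (negbTE ne) => /andP [].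
Qed.

(** [[pick ...]] depends on the block as a set only, so all vertices of a block share one
    representative and the partition is encoded by a function. *)
Definition brep G X x : T := odflt x [pick w in blkof G X x].

Lemma brepP G X x y : P3free G X -> x \in X -> y \in X ->
  (brep G X x == brep G X y) = (blkof G X x == blkof G X y).
Proof.
move=> fX xX yX; apply/eqP/eqP => [|e]; last first.
  by rewrite /brep e; case: pickP => // /(_ y); rewrite blkof_self.
have mem z : z \in X -> brep G X z \in X /\ blkof G X (brep G X z) = blkof G X z.
  move=> zX; rewrite /brep; case: pickP => [w|/(_ z)]; last by rewrite blkof_self.
  rewrite inE => /andP [wX /orP [/eqP ->//|a]]; split=> //=.
  by rewrite -(blkof_eq fX zX wX a).
by move=> e; have [_ <-] := mem _ xX; have [_ <-] := mem _ yX; rewrite e.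
Qed.

Lemma brep_in G X x : P3free G X -> x \in X ->
  brep G X x \in X /\ blkof G X (brep G X x) = blkof G X x.
Proof.
move=> fX zX; rewrite /brep; case: pickP => [w|/(_ x)]; last by rewrite blkof_self.
rewrite inE => /andP [wX /orP [/eqP ->//|a]]; split=> //=.
by rewrite -(blkof_eq fX zX wX a).
Qed.

Lemma tr_of_rep G G' X : P3free G X -> P3free G' X ->
  (forall x y, x \in X -> y \in X -> (brep G X x == brep G X y) = (brep G' X x == brep G' X y)) ->
  tr (setX X X) G = tr (setX X X) G'.
Proof.
move=> fX fX' e; apply/eqP/trP => x y; rewrite inE /= => /andP [xX yX].
case: (eqVneq x y) => [->|ne]; first by rewrite !adj_irrefl.
by rewrite (blkofP fX) // (blkofP fX') // -!brepP // e.
Qed.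

Lemma nt_P3free X GG : (forall G, G \in GG -> P3free G X) -> nt (setX X X) GG <= #|T| ^ #|T|.
Proof.
move=> h; pose f G : {ffun T -> T} := [ffun x => brep G X x].
apply: leq_trans (_ : #|f @: GG| <= _); last first.
  by apply: leq_trans (max_card _) _; rewrite card_ffun.
apply: nt_le_im => G G' GGG GGG' /ffunP e; apply: tr_of_rep; [exact: h|exact: h|].
by move=> x y _ _; have := e x; have := e y; rewrite !ffunE => -> ->.
Qed.

(** The excluded pattern is the matching [x k], [x' k'], which closes the cycle [x z x' k' k]. *)
Lemma cost_a z x x' k k' GG : x != x' -> k != k' -> [disjoint [set x; x'] & [set k; k']] ->
  (forall G, G \in GG -> [/\ C5free G, p3 G x z x', adj G k k', ~~ adj G z k & ~~ adj G z k']) ->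
  nt (setX [set x; x'] [set k; k']) GG <= 15.
Proof.
move=> nx nk dj h; have cS : #|setX [set x; x'] [set k; k']| = 4 by rewrite cardsX !cards2 nx nk.
apply: leq_trans (_ : (2 ^ 4).-1 <= _) => //; rewrite -cS.
apply: (@nt_avoid _ _ _ [set (x, k); (x', k')]).
  by apply/subsetP => -[p q]; rewrite !inE /= => /orP [] /eqP [-> ->]; rewrite !eqxx ?orbT.
move=> G /h [c5 /and4P [axz azx' _ nxx'] akk' nzk nzk']; apply/negP => /eqP /setP e.
have ev p q : p \in [set x; x'] -> q \in [set k; k'] ->
    adj G p q = ((p == x) && (q == k)) || ((p == x') && (q == k')).
  by move=> hp hq; have := e (p, q); rewrite in_tr in_setX hp hq /= => ->; rewrite !inE !xpair_eqE.
have mx : x \in [set x; x'] by rewrite !inE eqxx.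
have mx' : x' \in [set x; x'] by rewrite !inE eqxx orbT.
have mk : k \in [set k; k'] by rewrite !inE eqxx.
have mk' : k' \in [set k; k'] by rewrite !inE eqxx orbT.
apply: (c5 x z x' k' k) => //.
- by rewrite ev // !eqxx orbT.
- by rewrite adj_sym.
- by rewrite adj_sym ev // !eqxx.
- by rewrite ev // [k' == k]eq_sym (negbTE nk) (negbTE nx) andbF.
- by rewrite ev // [x' == x]eq_sym (negbTE nx) (negbTE nk) andbF.
Qed.

(** The excluded pattern is the single edge [x' k'], which closes the cycle [z x x' k' k]. *)
Lemma cost_b z x x' k k' GG : x != x' -> k != k' -> [disjoint [set x; x'] & [set k; k']] ->
  (forall G, G \in GG -> [/\ C5free G, p3 G z x x', adj G k k', adj G z k & ~~ adj G z k']) ->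
  nt (setX [set x; x'] [set k; k']) GG <= 15.
Proof.
move=> nx nk dj h; have cS : #|setX [set x; x'] [set k; k']| = 4 by rewrite cardsX !cards2 nx nk.
apply: leq_trans (_ : (2 ^ 4).-1 <= _) => //; rewrite -cS.
apply: (@nt_avoid _ _ _ [set (x', k')]).
  by apply/subsetP => -[p q]; rewrite !inE /= => /eqP [-> ->]; rewrite !eqxx ?orbT.
move=> G /h [c5 /and4P [azx axx' _ nzx'] akk' azk nzk']; apply/negP => /eqP /setP e.
have ev p q : p \in [set x; x'] -> q \in [set k; k'] ->
    adj G p q = (p == x') && (q == k').
  by move=> hp hq; have := e (p, q); rewrite in_tr in_setX hp hq /= => ->; rewrite !inE !xpair_eqE.
have mx : x \in [set x; x'] by rewrite !inE eqxx.
have mx' : x' \in [set x; x'] by rewrite !inE eqxx orbT.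
have mk : k \in [set k; k'] by rewrite !inE eqxx.
have mk' : k' \in [set k; k'] by rewrite !inE eqxx orbT.
apply: (c5 z x x' k' k) => //.
- by rewrite ev // !eqxx.
- by rewrite adj_sym.
- by rewrite adj_sym.
- by rewrite ev // (negbTE nx).
- by rewrite ev // (negbTE nx).
- by rewrite ev // (negbTE nk) andbF.
Qed.

Definition symd A B : {set T} := (A :\: B) :|: (B :\: A).

(** The bound [4 * h] is what two packings of at most [h] pairs can cover. *)
Definition nearblk h G X z : Prop := exists B : {set T},
  (B = set0 \/ exists2 c, c \in X & B = blkof G X c) /\ #|symd (nb G z :&: X) B| <= 4 * h.

Lemma pack_pairs (r : rel T) X : exists P : {set {set T}},
  [/\ trivIset P, forall S, S \in P -> S \subset X /\ exists x y, [/\ S = [set x; y], x != y & r x y],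
      #|cover P| = #|P| * 2 &
      forall x y, x \in X :\: cover P -> y \in X :\: cover P -> x != y -> ~~ r x y].
Proof.
pose c S := [exists x, exists y, [&& S == [set x; y], x != y & r x y]].
have cP S : c S -> exists x y, [/\ S = [set x; y], x != y & r x y].
  by move=> /existsP [x /existsP [y /and3P [/eqP e ne h]]]; exists x, y.
have c0 : ~~ c set0.
  by apply/negP => /cP [x [y [e ne _]]]; have := cards2 x y; rewrite -e cards0.
have [P [tP hP mP]] := maximal_packing X c0; exists P; split=> //.
- by move=> S /hP /andP [/cP h1 h2].
- by apply: cover_card => // S /hP /andP [/cP [x [y [-> ne _]]] _]; rewrite cards2 ne.
- move=> x y xX yX ne; apply/negP => rxy.
  have s : [set x; y] \subset X :\: cover P.
    by apply/subsetP => w; rewrite !inE => /orP [] /eqP ->; rewrite -in_setD.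
  have /negP [] := mP _ s; apply/existsP; exists x; apply/existsP; exists y.
  by rewrite eqxx ne.
Qed.

(** Outside the two packings the neighbours of [z] in [X] form a clique, and no edge of [X] leads
    from them to a non-neighbour; so up to the covered vertices they are empty or one block. *)
Lemma nearblk_of_packings h G X z (P Q : {set {set T}}) : P3free G X ->
  #|P| <= h -> #|Q| <= h -> #|cover P| = #|P| * 2 -> #|cover Q| = #|Q| * 2 ->
  (forall x y, x \in (nb G z :&: X) :\: cover P -> y \in (nb G z :&: X) :\: cover P -> x != y -> adj G x y) ->
  (forall x y, x \in X :\: cover Q -> y \in X :\: cover Q -> x != y -> adj G z x -> ~~ adj G z y -> ~~ adj G x y) ->
  nearblk h G X z.
Proof.
move=> fX lP lQ cP cQ hP hQ.
set N := nb G z :&: X in hP *.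
have [e0|/set0Pn [c]] := eqVneq (N :\: cover P :\: cover Q) set0.
  exists set0; split; first by left.
  rewrite /symd setD0 set0D setU0; apply: leq_trans (_ : #|cover P :|: cover Q| <= _).
    apply: subset_leq_card; apply/subsetP => x xN; have := in_set0 x; rewrite -e0 !inE in xN *.
    by rewrite xN; case: (x \in cover P); case: (x \in cover Q).
  apply: leq_trans (leq_card_setU _ _) _; rewrite cP cQ; lia.
move=> /setDP [/setDP [cN cnP] cnQ]; have cX : c \in X by move: cN; rewrite inE => /andP [].
exists (blkof G X c); split; first by right; exists c.
apply: leq_trans (_ : #|cover P :|: cover Q| <= _); last first.
  apply: leq_trans (leq_card_setU _ _) _; rewrite cP cQ; lia.
apply: subset_leq_card; apply/subsetP => x; rewrite !in_setU !in_setD => /orP [/andP [xB xN]|/andP [xN xB]].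
  case: (boolP (x \in cover P)) => //= xP; exfalso; move/negP: xB; apply.
  have xX : x \in X by move: xN; rewrite inE => /andP [].
  rewrite inE xX /=; case: (eqVneq x c) => //= ne; apply: hP; rewrite ?in_setD ?cnP ?xP //.
  by rewrite eq_sym.
case: (boolP (x \in cover Q)) => [|xQ]; first by rewrite orbT.
exfalso; move: xB; rewrite inE => /andP [xX /orP [/eqP e|a]].
  by move: xN; rewrite e cN.
have azc : adj G z c by move: cN; rewrite !inE => /andP [].
have nzx : ~~ adj G z x by move: xN; rewrite !inE xX andbT.
have := hQ c x; rewrite !inE cX xX xQ cnQ azc nzx (adj_neq a) a; by move=> /(_ isT isT isT isT isT).
Qed.


Lemma pack_in_clique G K : clique G K -> exists Q : {set {set T}},
  [/\ trivIset Q, forall S, S \in Q -> S \subset K /\ exists k k', [/\ S = [set k; k'], k != k' & adj G k k'] &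
      #|K| <= 2 * #|Q| + 1].
Proof.
move=> cK; have [Q [tQ hQ cQ mQ]] := pack_pairs (adj G) K; exists Q; split=> //.
have : #|K :\: cover Q| <= 1.
  rewrite leqNgt; apply/negP => /card_gt1P [x [y [xK yK ne]]]; have := mQ _ _ xK yK ne.
  by move/setDP: xK => [xK _]; move/setDP: yK => [yK _]; move/cliqueP: cK => -> .
have := cardsID (cover Q) K; have : #|K :&: cover Q| <= #|cover Q| by apply/subset_leq_card/subsetIr.
rewrite cQ; clear; lia.
Qed.

Lemma pack_across A B : [disjoint A & B] -> exists Q : {set {set T}},
  [/\ trivIset Q, forall S, S \in Q -> exists k k', [/\ S = [set k; k'], k \in A & k' \in B] &
      minn #|A| #|B| <= #|Q|].
Proof.
move=> dAB; set m := minn _ _.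
have [A' sA cA] : exists2 A' : {set T}, A' \subset A & #|A'| = m by apply: subset_of_card; apply: geq_minl.
have [B' sB cB] : exists2 B' : {set T}, B' \subset B & #|B'| = m by apply: subset_of_card; apply: geq_minr.
have [f fA] := bij_sets cA cB.
have fB x : x \in A' -> f x \in B by move=> xA; apply: (subsetP sB); rewrite -fA imset_f.
have fi : {in A' &, injective f} by apply/imset_injP; rewrite fA cA cB.
have nf x y : x \in A -> y \in A' -> x != f y.
  by move=> xA yA; apply: contraTneq xA => ->; rewrite (disjointFl dAB (fB _ yA)).
pose Q := [set [set x; f x] | x in A']; exists Q; split.
- apply/trivIsetP => _ _ /imsetP [x xA ->] /imsetP [y yA ->] ne.
  have nxy : x != y by apply: contraNneq ne => ->.
  apply/pred0P => w /=; rewrite !inE; apply/negP => /andP [/orP [] /eqP -> /orP []].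
  + by rewrite (negbTE nxy).
  + by apply/negP/nf => //; apply: (subsetP sA).
  + by rewrite eq_sym; apply/negP/nf => //; apply: (subsetP sA).
  + by move=> /eqP /(fi _ _ xA yA) e; rewrite e eqxx in nxy.
- by move=> _ /imsetP [x xA ->]; exists x, (f x); split=> //; [apply: (subsetP sA)|apply: fB].
- rewrite card_in_imset ?cA // => x y xA yA /setP /(_ x); rewrite !inE eqxx /= => /esym /orP [/eqP //|].
  by move=> h; have := nf x y (subsetP sA _ xA) yA; rewrite h.
Qed.

(** If the neighbours of [z] in [X] contain many disjoint non-adjacent pairs, these are played
    against pairs of [K] outside the neighbourhood by [cost_a]. If many disjoint edges of [X] leave
    the neighbourhood, they are played against pairs of [K] with one neighbour and one non-neighbour
    of [z] by [cost_b]. Otherwise [nearblk_of_packings] applies. *)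
Lemma tame_saving h K X z GG G0 : [disjoint K & X] -> z \notin K :|: X -> G0 \in GG ->
  (forall G, G \in GG -> [/\ C5free G, tr (setX X X) G0 = tr (setX X X) G,
     clique G K & tr (setX [set z] setT) G0 = tr (setX [set z] setT) G]) ->
  P3free G0 X -> ~~ nearhom h G0 z K -> ~ nearblk h G0 X z ->
  nt (setX X K) GG * 2 ^ (h * (h %/ 2) %/ 11) <= 2 ^ (#|X| * #|K|).
Proof.
move=> dKX zKX G0G hG fX nh nb0.
have zadj G x : G \in GG -> adj G z x = adj G0 z x.
  by move=> /hG [_ _ _ /eqP /trP e]; rewrite e // !inE eqxx.
have xadj G x y : G \in GG -> x \in X -> y \in X -> adj G x y = adj G0 x y.
  by move=> /hG [_ /eqP /trP e _ _] xX yX; rewrite e // !inE xX.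
move: nh; rewrite /nearhom negb_or -!leqNgt => /andP [h1 h2].
have fin (P Q : {set {set T}}) : trivIset P -> trivIset Q ->
    (forall S, S \in P -> S \subset X /\ #|S| = 2) -> (forall S, S \in Q -> S \subset K /\ #|S| = 2) ->
    (forall S R, S \in P -> R \in Q -> nt (setX S R) GG <= 15) -> h <= #|P| -> h %/ 2 <= #|Q| ->
    nt (setX X K) GG * 2 ^ (h * (h %/ 2) %/ 11) <= 2 ^ (#|X| * #|K|).
  move=> tP tQ hP hQ le_b lP lQ; have := cost_product tP tQ hP hQ le_b.
  have lm : h * (h %/ 2) <= #|P| * #|Q| by apply: leq_mul.
  move: (#|P| * #|Q|) lm => p lm le1.
  rewrite -(leq_pmul2r (_ : 0 < 15 ^ p)) ?expn_gt0 //; apply: leq_trans le1.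
  rewrite -mulnA leq_mul2l; apply/orP; right; rewrite mulnC [X in _ <= X]expnM.
  by apply: leq_trans (exp15' p); rewrite leq_mul2l leq_exp2l // leq_div2r ?orbT.
have [P [tP hP cP mP]] := pack_pairs (fun x y => ~~ adj G0 x y) (nb G0 z :&: X).
have [R [tR hR cR mR]] := pack_pairs (fun x y => adj G0 x y && (adj G0 z x != adj G0 z y)) X.
have [lP|gP] := leqP h #|P|.
  have cK' : clique G0 (K :\: nb G0 z).
    have [_ _ /cliqueP c _] := hG _ G0G; apply/cliqueP => x y /setDP [xK _] /setDP [yK _]; exact: c.
  have [Q [tQ hQ cQ]] := pack_in_clique cK'.
  apply: (fin P Q) => //.
  - move=> S /hP [s [x [y [eS ne _]]]]; rewrite [in X in _ /\ X]eS cards2 ne; split=> //.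
    exact: subset_trans s (subsetIr _ _).
  - move=> S /hQ [s [x [y [eS ne _]]]]; rewrite [in X in _ /\ X]eS cards2 ne; split=> //.
    exact: subset_trans s (subsetDl _ _).
  - move=> S S' /hP [s [x [y [eS ne nxy]]]] /hQ [s' [k [k' [eS' nk akk']]]]; rewrite eS eS'.
    rewrite eS in s; rewrite eS' in s'.
    have xm : x \in nb G0 z :&: X by apply: (subsetP s); rewrite !inE eqxx.
    have ym : y \in nb G0 z :&: X by apply: (subsetP s); rewrite !inE eqxx orbT.
    have km : k \in K :\: nb G0 z by apply: (subsetP s'); rewrite !inE eqxx.
    have km' : k' \in K :\: nb G0 z by apply: (subsetP s'); rewrite !inE eqxx orbT.
    move: xm ym km km'; rewrite !inE => /andP [zx xX] /andP [zy yX] /andP [zk kK] /andP [zk' kK'].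
    apply: (cost_a (z := z)) => //.
      apply/pred0P => w /=; rewrite !inE; apply/negP => /andP [/orP [] /eqP -> /orP [] /eqP e];
      by move: (disjointFr dKX kK) (disjointFr dKX kK'); rewrite -?e ?xX ?yX.
    move=> G GGG; have [c5 _ /cliqueP cl _] := hG _ GGG.
    by rewrite /p3 !(zadj _ _ GGG) [adj G x z]adj_sym !(zadj _ _ GGG) zx zy ne (xadj _ _ _ GGG xX yX) nxy zk zk' cl.
  - by move: cQ h2; clear; move: #|K :\: _| => w; lia.
have [lR|gR] := leqP h #|R|.
  have dK : [disjoint K :&: nb G0 z & K :\: nb G0 z].
    by apply/pred0P => w /=; rewrite !inE; case: (adj G0 z w); rewrite ?andbF.
  have [Q [tQ hQ cQ]] := pack_across dK.
  have hQ2 S : S \in Q -> S \subset K /\ #|S| = 2.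
    move=> /hQ [k [k' [-> /setIP [kK zk] /setDP [kK' zk']]]]; split.
      by apply/subsetP => w; rewrite !inE => /orP [] /eqP ->.
    by rewrite cards2; have -> : k != k' by apply: contraNneq zk' => <-.
  apply: (fin R Q) => //.
  - by move=> S /hR [s [x [y [eS ne _]]]]; rewrite [in X in _ /\ X]eS cards2 ne.
  - move=> S S' /hR [s [x0 [y0 [eS0 ne0 /andP [axy0 dz0]]]]] /hQ [k [k' [eS' /setIP [kK zk] /setDP [kK' zk']]]].
    rewrite !inE in zk zk'.
    have [x [y [eS ne axy zx zy]]] : exists x y, [/\ S = [set x; y], x != y, adj G0 x y, adj G0 z x & ~~ adj G0 z y].
      case: (boolP (adj G0 z x0)) dz0 => zx0 dz0; first by exists x0, y0; split=> //; case: (adj G0 z y0) dz0.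
      exists y0, x0; rewrite setUC eq_sym adj_sym; split=> //; by case: (adj G0 z y0) dz0.
    rewrite eS in s; rewrite eS eS'.
    have xX : x \in X by apply: (subsetP s); rewrite !inE eqxx.
    have yX : y \in X by apply: (subsetP s); rewrite !inE eqxx orbT.
    have nk : k != k' by apply: contraNneq zk' => <-.
    apply: (cost_b (z := z)) => //.
      apply/pred0P => w /=; rewrite !inE; apply/negP => /andP [/orP [] /eqP -> /orP [] /eqP e];
      by move: (disjointFr dKX kK) (disjointFr dKX kK'); rewrite -?e ?xX ?yX.
    move=> G GGG; have [c5 _ /cliqueP cl _] := hG _ GGG.
    have nzy : z != y by apply: contraNneq zKX => ->; rewrite inE yX orbT.
    by rewrite /p3 !(zadj _ _ GGG) zx (negbTE zy) nzy (xadj _ _ _ GGG xX yX) axy zk zk' cl.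
  - by move: cQ h1 h2; rewrite setIC; clear; move: #|_ :&: _| #|_ :\: _| => u v; lia.
exfalso; apply: nb0; apply: (nearblk_of_packings (P := P) (Q := R)) => //.
- exact: ltnW.
- exact: ltnW.
- by move=> x y xX yX ne; have := mP x y xX yX ne; rewrite negbK.
- by move=> x y xX yX ne zx zy; have := mR x y xX yX ne; rewrite zx (negbTE zy) andbT.
Qed.

End Blocks.

(** * Exceptional vertices *)

Section S3.
Variable T : finType.
Implicit Types (G : sgraph T) (GG : {set sgraph T}) (A B K S U V W X Y : {set T}) (P Q : {set {set T}}).
Let n := #|T|.

Definition sdata e G K X : Prop :=
  [/\ [disjoint K & X], clique G K, P3free G X, n <= 2 * #|K| + e & n <= 2 * #|X| + e].

Lemma sdata_rest e G K X : sdata e G K X -> #|~: (K :|: X)| <= e.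
Proof.
move=> [d _ _ h1 h2]; have := cardsC (K :|: X); rewrite cardsU (disjoint_setI0 d) cards0 subn0 -/n.
move: #|~: _| #|K| #|X| h1 h2; clear; lia.
Qed.

Definition wild h G K X : Prop :=
  exists z, [/\ z \notin K :|: X, ~~ nearhom h G z K & ~ nearblk h G X z].

Lemma wild_class e h K X z GG :
  (forall G, G \in GG -> [/\ C5free G, sdata e G K X, z \notin K :|: X, ~~ nearhom h G z K & ~ nearblk h G X z]) ->
  #|GG| * 2 ^ (h * (h %/ 2) %/ 11) <= n ^ n * 2 ^ (e * n) * 2 * 2 ^ (n * n %/ 4).
Proof.
move=> hG; have [->|/set0Pn [G1 G1G]] := eqVneq GG set0; first by rewrite cards0.
have [_ sd1 zKX _ _] := hG _ G1G; have [dKX _ _ _ _] := sd1.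
pose Z := ~: (K :|: X); have zZ : z \in Z by rewrite inE.
have cZ := sdata_rest sd1; set s := h * _ %/ 11.
rewrite -nt_setT.
have fib1 t : nt setT [set G in GG | tr (setX X X) G == t] <= 2 ^ (e * n) * (2 * (2 ^ (n * n %/ 4) %/ 2 ^ s)).
  set G2 := [set G in GG | _].
  apply: leq_trans (@nt_fiber _ setT (setX Z setT) G2 (2 * (2 ^ (n * n %/ 4) %/ 2 ^ s)) _) _; last first.
    apply: leq_mul => //; apply: leq_trans (nt_exp _ _) _; rewrite leq_exp2l // cardsX cardsT leq_mul2r.
    by rewrite cZ orbT.
  move=> t'; set G3 := [set G in G2 | _].
  have hG3 G : G \in G3 -> [/\ G \in GG, tr (setX X X) G = t & tr (setX Z setT) G = t'].
    by rewrite !inE => /andP [/andP [-> /eqP ->] /eqP ->].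
  have [->|/set0Pn [G0 G0G]] := eqVneq G3 set0; first by rewrite /nt imset0 cards0.
  apply: leq_trans (_ : nt ((setX X X :|: setX Z setT) :|: (setX K K :|: setX X K)) G3 <= _).
    apply: nt_mono => x y _; rewrite !inE /=.
    by case: (x \in X); case: (y \in X); case: (x \in K); case: (y \in K); rewrite ?orbT.
  apply: leq_trans (nt_U _ _ _) _; rewrite -[X in _ <= X]mul1n; apply: leq_mul.
    apply: leq_trans (nt_U _ _ _) _; rewrite -[1]muln1; apply: leq_mul.
      by apply: (nt1 (t := t)) => G /hG3 [].
    by apply: (nt1 (t := t')) => G /hG3 [].
  apply: leq_trans (nt_U _ _ _) _; apply: leq_mul.
    by apply: nt_homog => G /hG3 [/hG [_ [_ c _ _ _] _ _ _] _ _]; rewrite /homog c.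
  have [G0GG e0 e0'] := hG3 _ G0G; have [c5 [_ _ fX _ _] _ nh nk] := hG _ G0GG.
  rewrite leq_divRL ?expn_gt0 //.
  apply: leq_trans (_ : 2 ^ (#|X| * #|K|) <= _); last first.
    rewrite leq_exp2l // leq_divRL //; have := (nat_AGM2 #|X| #|K|).1; rewrite -mulnn.
    have lXK : #|X| + #|K| <= n.
      have := max_card [in K :|: X]; rewrite cardsU (disjoint_setI0 dKX) cards0 subn0 addnC; exact: leq_trans.
    have := leq_mul lXK lXK; move: #|X| #|K|; clear; move=> a b; lia.
  apply: (tame_saving (z := z) (G0 := G0)) => // G /hG3 [GGG e1 e1']; have [c5' [_ cK _ _ _] _ _ _] := hG _ GGG.
  split=> //; first by rewrite e0 e1.
  apply: (tr_mono (D' := setX Z setT)); last by rewrite e0' e1'.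
  by move=> x y /setXP [/set1P -> _]; apply/orP; right; apply/orP; left; rewrite in_setX zZ inE.
apply: leq_trans (leq_mul (nt_fiber fib1) (leqnn _)) _.
apply: leq_trans (_ : n ^ n * (2 ^ (e * n) * (2 * (2 ^ (n * n %/ 4) %/ 2 ^ s))) * 2 ^ s <= _).
  rewrite !leq_mul2r; apply/orP; right; apply/orP; right; apply: nt_P3free => G /hG [_ [_ _ fX _ _] _ _ _] //.
have := leq_trunc_div (2 ^ (n * n %/ 4)) (2 ^ s).
move: (2 ^ (n * n %/ 4) %/ 2 ^ s) (2 ^ (n * n %/ 4)) (2 ^ s) (n ^ n) (2 ^ (e * n)) => a b c d f le.
have := leq_mul (leqnn (d * f * 2)) le; clear; lia.
Qed.

(* Vertices outside [K] and [X] are distributed to the sides; [CP] and [CQ] cover maximal packings of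
   obstructions, and [fe], [ff] record whether the [X] side has many disjoint edges and non-edges. *)
Record s3 (e h w : nat) G K X (Xs CP CQ : {set T}) (fe ff : bool) : Prop := S3 {
  s3_data : sdata e G K X;
  s3_X : X \subset Xs;
  s3_K : [disjoint K & Xs];
  s3_nearX : forall v, v \in Xs -> nearblk h G X v;
  s3_nearY : forall v, v \notin Xs -> nearhom h G v K;
  s3_P : exists P, [/\ trivIset P, forall S, S \in P -> S \subset Xs /\ isP3 G S, cover P = CP & #|P| * 3 = #|CP|];
  s3_CP : #|CP| <= 3 * e;
  s3_X2 : P3free G (Xs :\: CP);
  s3_fe : if fe then exists P, [/\ trivIset P, forall S, S \in P -> S \subset Xs :\: CP /\ isE G S & w <= #|P|]
          else exists I : {set T}, [/\ I \subset Xs :\: CP, indep G I & #|(Xs :\: CP) :\: I| <= 2 * w];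
  s3_ff : if ff then exists P, [/\ trivIset P, forall S, S \in P -> S \subset Xs :\: CP /\ isE (cg G) S & w <= #|P|]
          else exists I : {set T}, [/\ I \subset Xs :\: CP, clique G I & #|(Xs :\: CP) :\: I| <= 2 * w];
  s3_Q : exists Q, [/\ trivIset Q, forall S, S \in Q -> S \subset ~: Xs /\ (fe && isP3 G S || ff && isP3 (cg G) S),
     cover Q = CQ & #|Q| * 3 = #|CQ|];
  s3_CQ : #|CQ| <= 3 * e;
  s3_Y2 : fe -> P3free G (~: Xs :\: CQ);
  s3_Y2' : ff -> P3free (cg G) (~: Xs :\: CQ) }.

Lemma packing_small (P : {set {set T}}) Z : trivIset P -> (forall S, S \in P -> S :&: Z != set0) -> #|P| <= #|Z|.
Proof.
move=> tP h; have [P0|/set0Pn [S0 S0P]] := eqVneq P set0; first by rewrite P0 cards0.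
have /set0Pn [x0 _] := h _ S0P.
pose f S := odflt x0 [pick x in S :&: Z].
have fP S : S \in P -> f S \in S /\ f S \in Z.
  by move=> /h /set0Pn [x xS]; rewrite /f; case: pickP => [y /setIP []|/(_ x)] //=; rewrite xS.
rewrite -(@card_in_imset _ _ f).
  by apply/subset_leq_card/subsetP => _ /imsetP [S /fP [_ fZ] ->].
move=> S S' SP SP' e; have [m1 _] := fP _ SP; have [m2 _] := fP _ SP'; rewrite -e in m2.
by rewrite -(def_pblock tP SP m1) (def_pblock tP SP' m2).
Qed.

Lemma isP3_sub_clique G S K : clique G K -> S \subset K -> ~~ isP3 G S.
Proof.
move=> /cliqueP c s; apply/negP => /isP3P [x [y [z [eS /and4P [_ _ ne /negP]]]]]; apply.
by apply: c => //; apply: (subsetP s); rewrite eS !inE eqxx ?orbT.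
Qed.

Lemma isP3_sub_indep G S K : indep G K -> S \subset K -> ~~ isP3 G S.
Proof.
move=> /indepP c s; apply/negP => /isP3P [x [y [z [eS /and4P [a _ _ _]]]]].
have := c x y; rewrite a => /(_ _ _)/negP; case=> //; apply: (subsetP s); rewrite eS !inE eqxx ?orbT //.
Qed.

(** An exceptional vertex that is not nearly homogeneous to [K] joins the [X] side, where it is
    close to a block because no vertex is wild. The bounds [3 * e] hold since every path of a
    packing contains one of the at most [e] vertices outside [K] and [X]. *)
Lemma s3_exists e h w G K X : 1 < h -> sdata e G K X -> ~ wild h G K X ->
  exists Xs CP CQ fe ff, s3 e h w G K X Xs CP CQ fe ff.
Proof.
move=> h1 sd nw; have [dKX cK fX nK nX] := sd; have cZ := sdata_rest sd.
pose Xs := X :|: [set z in ~: (K :|: X) | ~~ nearhom h G z K].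
have XsX : X \subset Xs by apply: subsetUl.
have dK : [disjoint K & Xs].
  apply/pred0P => x /=; apply/negP => /andP [xK]; rewrite !inE xK /= orbF.
  by rewrite (disjointFr dKX xK).
have nearX v : v \in Xs -> nearblk h G X v.
  rewrite inE => /orP [vX|].
    exists (blkof G X v); split; first by right; exists v.
    apply: leq_trans (_ : #|[set v]| <= _); last by rewrite cards1; lia.
    apply: subset_leq_card; apply/subsetP => x; rewrite !inE.
    by case: (x \in X); case: (adj G v x); rewrite ?orbF ?andbF ?orbT //= ?andbT.
  rewrite !inE => /andP [vKX nh]; apply: contrapT => nb'; apply: nw; exists v.
  by rewrite inE; split.
have nearY v : v \notin Xs -> nearhom h G v K.
  rewrite !inE !negb_or !negb_and !negbK => /andP [vX /orP [/orP [vK|vX']|//]]; last by rewrite vX' in vX.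
  apply/orP; right; apply: leq_ltn_trans (_ : #|[set v]| < _); last by rewrite cards1.
  apply: subset_leq_card; apply/subsetP => x; rewrite !inE => /andP [na xK].
  by apply: contraNT na => ne; move/cliqueP: cK; apply=> //; rewrite eq_sym.
have [P [tP hP cP fP]] := packP3 G Xs; pose CP := cover P.
pose X2 := Xs :\: CP.
have [EX [tEX hEX cEX iEX]] := packE G X2; have [FX [tFX hFX cFX iFX]] := packE (cg G) X2.
pose fe := w <= #|EX|; pose ff := w <= #|FX|.
have c0 : ~~ ((fe && isP3 G set0) || (ff && isP3 (cg G) set0)).
  by rewrite !(negbTE (isP3_set0 _)) !andbF.
(* On the side of [K] a path counts as an obstruction only if the [X] side has many partners for it:
   disjoint edges for a path of the graph, disjoint non-edges for a path of the complement. *)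
have [Q [tQ hQ mQ]] := maximal_packing (c := fun S => (fe && isP3 G S) || (ff && isP3 (cg G) S)) (~: Xs) c0.
have cQ3 S : S \in Q -> #|S| = 3 by move=> /hQ /andP [/orP [] /andP [_ /card_isP3]].
have cZ' (P0 : {set {set T}}) : trivIset P0 -> (forall S, S \in P0 -> S :&: ~: (K :|: X) != set0) -> #|P0| <= e.
  by move=> t0 h0; apply: leq_trans (packing_small t0 h0) cZ.
have mX2 (H : sgraph T) : (forall S, S \subset ~: Xs :\: cover Q -> ~~ isP3 H S) -> P3free H (~: Xs :\: cover Q).
  move=> hS x y z xY yY zY; apply/negP => pp.
  have s : [set x; y; z] \subset ~: Xs :\: cover Q.
    by apply/subsetP => u /setUP [/set2P [->|->]|/set1P ->].
  by have /negP [] := hS _ s; apply/isP3P; exists x, y, z.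
exists Xs, CP, (cover Q), fe, ff; split=> //.
- by exists P; split.
- rewrite /CP cP mulnC leq_mul2l /=; apply: cZ' => // S SP; have [sS pS] := hP _ SP.
  apply/negP => /eqP e0; have sX : S \subset X.
    apply/subsetP => x xS; have := subsetP sS _ xS; rewrite inE => /orP [//|].
    rewrite inE => /andP [xZ _]; have : x \in S :&: ~: (K :|: X) by rewrite inE xS.
    by rewrite e0 inE.
  case/isP3P: pS => x [y [z [eS pp]]]; have : ~~ p3 G x y z.
    by apply: fX; apply: (subsetP sX); rewrite eS !inE eqxx ?orbT.
  by rewrite pp.
- rewrite /fe; case: leqP => [lw|gw]; first by exists EX.
  exists (X2 :\: cover EX); rewrite subsetDl; split=> //.
  rewrite setDDr setDv set0U; apply: leq_trans (subset_leq_card (subsetIr _ _)) _; rewrite cEX; clear - gw; lia.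
- rewrite /ff; case: leqP => [lw|gw]; first by exists FX.
  exists (X2 :\: cover FX); rewrite subsetDl -cg_indep; split=> //.
  rewrite setDDr setDv set0U; apply: leq_trans (subset_leq_card (subsetIr _ _)) _; rewrite cFX; clear - gw; lia.
- exists Q; split=> //; first by move=> S /hQ /andP [].
  by rewrite (cover_card tQ cQ3).
- rewrite (cover_card tQ cQ3) mulnC leq_mul2l /=; apply: cZ' => // S SQ; have /andP [pS sS] := hQ _ SQ.
  apply/negP => /eqP e0; have sK : S \subset K.
    apply/subsetP => x xS; have := subsetP sS _ xS; rewrite inE => xn.
    case: (boolP (x \in K)) => // xK; have : x \in S :&: ~: (K :|: X).
      by rewrite !inE xS (negbTE xK) /=; apply: contra xn; apply: (subsetP XsX).
    by rewrite e0 inE.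
  case/orP: pS => /andP [_]; apply/negP; first exact: isP3_sub_clique cK sK.
  by apply: isP3_sub_indep sK; rewrite cg_indep.
- by move=> fe1; apply: mX2 => S sS; have := mQ _ sS; rewrite fe1 negb_or => /andP [].
- by move=> ff1; apply: mX2 => S sS; have := mQ _ sS; rewrite ff1 negb_or => /andP [].
Qed.

End S3.

(** A wild vertex saves about [h ^ 2 / 22] bits with [h = n / E], that is [n ^ 2 / (22 * E ^ 2)],
    while the vertices outside [K] and [X] cost at most [n ^ 2 / (200 * E ^ 2)] bits and everything
    else costs [O(n log n)]. *)
Lemma wild_count E N : 0 < E -> 200 * (E * E) <= N -> exists n0 De3, 0 < De3 /\ forall T : finType, n0 <= #|T| ->
  forall GG : {set sgraph T},
  (forall G, G \in GG -> C5free G /\ exists K X, sdata (#|T| %/ N) G K X /\ wild (#|T| %/ E) G K X) ->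
  #|GG| * 2 ^ (#|T| * #|T| %/ De3) <= 2 ^ (#|T| * #|T| %/ 4).
Proof.
move=> E0 EN; have EE0 : 0 < E * E by rewrite muln_gt0 E0.
have N0 : 0 < N by clear - EN EE0; lia.
have M0 : 0 < 200 * (E * E) by clear - EE0; lia.
have [n1 hn1] := succ_le_exp_div M0.
exists (n1 + 100 * E + 4 * (200 * (E * E)) + 1), (200 * (E * E)); split=> // T; set n := #|T| => le_n GG hG.
pose h := n %/ E; pose e := n %/ N; pose s := h * (h %/ 2) %/ 11.
pose L := ({set T} * {set T} * T)%type.
pose CC (l : L) := [set G in GG | `[< [/\ sdata e G l.1.1 l.1.2, l.2 \notin l.1.1 :|: l.1.2,
   ~~ nearhom h G l.2 l.1.1 & ~ nearblk h G l.1.2 l.2] >]].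
pose B := n ^ n * 2 ^ (e * n) * 2 * 2 ^ (n * n %/ 4) %/ 2 ^ s.
have le1 : #|GG| <= #|{: L}| * B.
  rewrite -nt_setT; apply: (nt_union (P := predT) (CC := CC)) => [G GGG|[[K X] z] _].
    have [_ [K [X [sd [z [h1 h2 h3]]]]]] := hG _ GGG; exists (K, X, z) => //.
    by rewrite inE GGG; apply/asboolP.
  rewrite nt_setT leq_divRL ?expn_gt0 //; apply: (wild_class (K := K) (X := X) (z := z)).
  by move=> G; rewrite inE => /andP [/hG [c5 _] /asboolP [? ? ? ?]].
have cL : #|{: L}| = 2 ^ n * 2 ^ n * n by rewrite !card_prod !card_setTE.
have hB : B * 2 ^ s <= n ^ n * 2 ^ (e * n) * 2 * 2 ^ (n * n %/ 4) by apply: leq_trunc_div.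
pose x := n %/ (200 * (E * E)).
have ln : n <= 2 ^ x by apply: ltnW; apply: hn1; clear - le_n; lia.
have hs : n * n %/ (200 * (E * E)) + (n + n + x + x * n + e * n + 1) <= s.
  have [q qE] : exists q, q = n * n by exists (n * n).
  have i1 : x * (200 * (E * E)) <= n by apply: leq_trunc_div.
  have i2 : e * N <= n by apply: leq_trunc_div.
  have i3 : q %/ (200 * (E * E)) * (200 * (E * E)) <= q by apply: leq_trunc_div.
  have i4 : n * (4 * (200 * (E * E))) <= q by rewrite qE leq_mul2l; apply/orP; right; clear - le_n; lia.
  have i5 : 24 * n <= 25 * (h * E).
    have i : n < h.+1 * E by apply: ltn_ceil.
    by clearbody h; clear - i le_n; lia.
  have i6 : h %/ 2 * 2 + 1 >= h by have := ltn_ceil h (isT : 0 < 2); clear; lia.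
  have h25 : 90 <= h by rewrite leq_divRL //; clear - le_n; lia.
  have i7 : 22 * h <= 45 * (h %/ 2) by clear - i6 h25; lia.
  rewrite -qE /s leq_divRL // -(leq_pmul2r M0).
  apply: leq_trans (_ : 5 * (11 * q) <= _).
    have j1 : x * n * (200 * (E * E)) <= q by rewrite qE mulnAC leq_mul2r i1 orbT.
    have j2 : e * n * (200 * (E * E)) <= q.
      rewrite qE mulnAC leq_mul2r; apply/orP; right; apply: leq_trans i2.
      by rewrite leq_mul2l EN orbT.
    have j3 : x * (200 * (E * E)) <= q by apply: leq_trans j1; rewrite mulnAC -[X in X <= _]muln1 leq_mul2l; apply/orP; right; clear - le_n; lia.
    have j4 : 200 * (E * E) <= n * (200 * (E * E)) by rewrite leq_pmull //; clear - le_n; lia.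
    move: (q %/ (200 * (E * E))) i3 => y i3; clearbody x e.
    move: (200 * (E * E)) i3 i4 j1 j2 j3 j4 => M i3 i4 j1 j2 j3 j4.
    move: (x * n) (e * n) j1 j2 => u v j1 j2; clear - i3 i4 j1 j2 j3 j4; lia.
  have k1 : 22 * 24 * 24 * q <= 25 * 25 * 45 * (h * (h %/ 2) * (E * E)).
    have a1 := leq_mul i5 i5; have a2 := leq_mul (leqnn h) i7.
    have a3 := leq_mul a2 (leqnn (E * E)); rewrite qE.
    clear - a1 a3; clearbody h; move: a1 a3; move: (h %/ 2) => g; clear.
    have -> : 24 * n * (24 * n) = 24 * 24 * (n * n) by lia.
    have -> : 25 * (h * E) * (25 * (h * E)) = 25 * 25 * (h * h * (E * E)) by lia.
    have -> : h * (22 * h) * (E * E) = 22 * (h * h * (E * E)) by lia.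
    have -> : h * (45 * g) * (E * E) = 45 * (h * g * (E * E)) by lia.
    move: (n * n) (h * h * (E * E)) (h * g * (E * E)) => a b c; lia.
  move: k1; move: (E * E) (h * (h %/ 2)) => u v; clear.
  have -> : v * (200 * u) = 200 * (v * u) by lia.
  move: (v * u) => c; lia.
rewrite -(leq_pmul2r (expn_gt0 2 (n + n + x + x * n + e * n + 1))) -mulnA -expnD.
apply: leq_trans (_ : #|GG| * 2 ^ s <= _); first by rewrite leq_mul2l leq_exp2l // hs orbT.
apply: leq_trans (leq_mul le1 (leqnn _)) _; rewrite -mulnA.
apply: leq_trans (leq_mul (leqnn _) hB) _; rewrite cL.
have nn : n ^ n <= 2 ^ (x * n) by rewrite expnM; apply: leq_expW.
rewrite !expnD expn1; have := leq_mul ln nn.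
move: (2 ^ (n * n %/ 4)) (2 ^ n) (2 ^ x) (2 ^ (x * n)) (2 ^ (e * n)) (n ^ n) => a b c d f g le.
have := leq_mul le (leqnn (b * b * f * 2 * a)); clear; lia.
Qed.

(** * Counting with few exceptional vertices *)

Section S3count.
Variable T : finType.
Implicit Types (G : sgraph T) (GG : {set sgraph T}) (A B K S U V W X Y : {set T}) (P Q : {set {set T}}).
Let n := #|T|.
Variables (e h w m1 Ga : nat) (K X Xs CP CQ : {set T}) (fe ff : bool).
Hypothesis hGa : #|[set A : {set T} | #|A| <= 4 * h]| <= Ga.
Let X2 := Xs :\: CP.
Let Y2 := ~: Xs :\: CQ.
Let p := #|CP|.
Let q := #|CQ|.

Lemma symdK A B : symd (symd A B) B = A.
Proof. by apply/setP => x; rewrite !inE; case: (x \in A); case: (x \in B). Qed.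

Lemma card_near (FB : {set {set T}}) :
  #|[set A : {set T} | [exists B in FB, #|symd A B| <= 4 * h]]| <= #|FB| * Ga.
Proof.
apply: leq_trans (_ : #|[set symd C B | C in [set A : {set T} | #|A| <= 4 * h], B in FB]| <= _).
  apply: subset_leq_card; apply/subsetP => A; rewrite inE => /exists_inP [B BF le].
  by apply/imset2P; exists (symd A B) B; rewrite ?inE ?symdK.
rewrite curry_imset2X; apply: leq_trans (leq_imset_card _ _) _.
by rewrite cardsX mulnC leq_mul2l hGa orbT.
Qed.

(** Once the blocks of [X2] are known, the set approximated by the row of [v] is empty or one of at
    most [n] blocks, which gives [n.+1]; [Ga] accounts for the difference. *)
Lemma row_nearX v GG t : X \subset Xs ->
  (forall G, G \in GG -> [/\ P3free G X, nearblk h G X v & tr (setX X2 X2) G = t]) ->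
  nt (setX [set v] (X :&: X2)) GG <= n.+1 * Ga.
Proof.
move=> sX hG; have [->|/set0Pn [G0 G0G]] := eqVneq GG set0; first by rewrite /nt imset0 cards0.
pose V := X :&: X2.
pose FB : {set {set T}} := set0 |: [set blkof G0 V c | c in T].
apply: leq_trans (_ : #|FB| * Ga <= _); last first.
  rewrite leq_mul2r; apply/orP; right; rewrite cardsU1 -add1n leq_add ?leq_b1 //.
  by apply: leq_trans (leq_imset_card _ _) _.
apply: leq_trans (card_near FB); apply: nt_row => G GGG; rewrite inE.
have [fX [B [hB le]] et] := hG _ GGG; have [_ _ et0] := hG _ G0G.
have ev x y : x \in V -> y \in V -> adj G x y = adj G0 x y.
  move=> /setIP [_ xX] /setIP [_ yX]; have /eqP /trP := etrans et (esym et0).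
  by apply; rewrite in_setX xX.
have key (B' : {set T}) : B' = B :&: V -> #|symd (nb G v :&: V) B'| <= 4 * h.
  move=> ->; apply: leq_trans le; apply: subset_leq_card; apply/subsetP => x.
  by rewrite !inE; case: (x \in X); case: (x \in Xs); case: (x \in CP); case: (x \in B); case: (adj G v x).
apply/exists_inP.
have [e0|/set0Pn [c /setIP [cB cV]]] := eqVneq (B :&: V) set0.
  by exists set0; [rewrite !inE eqxx|apply: key].
exists (blkof G0 V c); first by rewrite !inE imset_f ?orbT.
apply: key; case: hB => [B0|[d dX eB]]; first by rewrite B0 inE in cB.
have cX : c \in X by case/setIP: cV.
have eBc : B = blkof G X c.
  move: cB; rewrite eB inE cX /= => /orP [/eqP ->//|a]; exact: blkof_eq.
apply/setP => x; rewrite eBc; rewrite [in LHS]inE in_setI [x \in blkof G X c]inE.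
case: (boolP (x \in V)) => xV; rewrite ?andbF //= andbT; have xX : x \in X by case/setIP: xV.
by rewrite xX (ev c x).
Qed.

Lemma row_nearY v GG : (forall G, G \in GG -> nearhom h G v K) ->
  nt (setX [set v] K) GG <= 2 * Ga.
Proof.
move=> hG; apply: leq_trans (_ : #|[set set0; K]| * Ga <= _); last first.
  by rewrite leq_mul2r cards2 ltnS leq_b1 orbT.
apply: leq_trans (card_near _); apply: nt_row => G /hG; rewrite inE => nh; apply/exists_inP.
case/orP: nh => le; [exists set0|exists K]; rewrite ?inE ?eqxx ?orbT //.
  by rewrite /symd setD0 set0D setU0; lia.
apply: leq_trans (_ : #|K :\: nb G v| <= _); last by lia.
apply: subset_leq_card; apply/subsetP => x; rewrite !inE.
by case: (x \in K); case: (adj G v x).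
Qed.

(** [CP] consists of [p / 3] paths, each facing [m1] disjoint edges of [Y2]. Of the [q / 3] paths in
    [CQ] at least half belong to the graph or at least half to its complement, whence [q / 6] in
    [s2]. *)
Definition s1 := (p %/ 3) * m1 %/ 45.
Definition s2 := (q %/ 6) * w %/ 45.

Lemma cross_saving GG G0 : G0 \in GG -> 2 * m1 + 1 <= #|K :&: Y2| ->
  (forall G, G \in GG -> [/\ C5free G, s3 e h w G K X Xs CP CQ fe ff,
     tr (setX Xs Xs) G0 = tr (setX Xs Xs) G & tr (setX (~: Xs) (~: Xs)) G0 = tr (setX (~: Xs) (~: Xs)) G]) ->
  nt (setX CP Y2) GG * 2 ^ s1 <= 2 ^ (p * #|Y2|) /\
  nt (setX CQ X2) GG * 2 ^ s2 <= 2 ^ (q * #|X2|).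
Proof.
move=> G0G hm1 hG; have [c5 S0 _ _] := hG _ G0G.
have [P [tP hP cP c3]] := s3_P S0; have [Q [tQ hQ cQ d3]] := s3_Q S0.
have subt (A B : {set T}) (G : sgraph T) (H : sgraph T) : A \subset B -> tr (setX B B) H = tr (setX B B) G -> tr (setX A A) H = tr (setX A A) G.
  move=> s; apply: tr_mono => x y; rewrite !in_setX => /andP [xA yA].
  by rewrite !(subsetP s) ?orbT.
have sCP : CP \subset Xs.
  by rewrite -cP; apply/subsetP => x /bigcupP [S /hP [s _] xS]; apply: (subsetP s).
have sCQ : CQ \subset ~: Xs.
  by rewrite -cQ; apply/subsetP => x /bigcupP [S /hQ [s _] xS]; apply: (subsetP s).
have sX2 : X2 \subset Xs by apply: subsetDl.
have sY2 : Y2 \subset ~: Xs by apply: subsetDl.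
have dXY (A B : {set T}) : A \subset Xs -> B \subset ~: Xs -> [disjoint A & B].
  by move=> sA sB; apply: disjointWl sA _; apply: disjointWr sB _; rewrite -setI_eq0 setICr.
split.
  have [EY [tEY hEY cEY iEY]] := packE G0 Y2.
  have lE : m1 <= #|EY|.
    have [_ cK _ _ _] := s3_data S0.
    have cKY : clique G0 (K :&: Y2) by apply/cliqueP => x y /setIP [xK _] /setIP [yK _]; move/cliqueP: cK; apply.
    have := card_indep_clique cKY iEY; rewrite setIDA -setIA setIid => le1.
    have := cardsID (cover EY) (K :&: Y2); have : #|K :&: Y2 :&: cover EY| <= #|cover EY| by apply/subset_leq_card/subsetIr.
    rewrite cEY; move: le1 hm1; clear; lia.
  have := @box_saving T CP Y2 GG G0 P EY (dXY _ _ sCP sY2) G0G.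
  move=> /(_ _ tP _ tEY hEY) /= bs.
  apply: leq_trans (bs _ _).
  - rewrite leq_mul2l leq_exp2l //; apply/orP; right; apply: leq_div2r; apply: leq_mul => //.
    by rewrite /p -c3 mulnK.
  - by move=> G /hG [c5' _ e1 e2]; split=> //; [apply: subt sCP e1|apply: subt sY2 e2].
  - move=> S SP; split; last by have [] := hP _ SP.
    by rewrite -cP; apply/subsetP => x xS; apply/bigcupP; exists S.
have sQC S : S \in Q -> S \subset CQ.
  by move=> SQ; rewrite -cQ; apply/subsetP => x xS; apply/bigcupP; exists S.
pose Q1 := [set S in Q | fe && isP3 G0 S]; pose Q2 := [set S in Q | ff && isP3 (cg G0) S].
have cQ12 : #|Q| <= #|Q1| + #|Q2|.
  apply: leq_trans (leq_card_setU _ _); apply: subset_leq_card; apply/subsetP => S SQ.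
  by rewrite !inE SQ /=; have [_] := hQ _ SQ.
have tsub (Q' : {set {set T}}) : Q' \subset Q -> trivIset Q'.
  by move=> s; apply: trivIsetS s tQ.
have q6 : q %/ 6 <= #|Q1| \/ q %/ 6 <= #|Q2|.
  have : q = #|Q| * 3 by rewrite d3.
  by move: cQ12; clear; move: q #|Q| #|Q1| #|Q2| => a b c d; lia.
have fin N c : (q %/ 6) <= c -> N * 2 ^ (c * w %/ 45) <= 2 ^ (#|CQ| * #|X2|) -> N * 2 ^ s2 <= 2 ^ (q * #|X2|).
  move=> le1; apply: leq_trans; rewrite leq_mul2l leq_exp2l //; apply/orP; right.
  by apply: leq_div2r; rewrite leq_mul2r le1 orbT.
case: q6 => le6.
  have [/eqP q0|qp] := posnP (q %/ 6).
    rewrite /s2 (eqP q0) mul0n div0n muln1; apply: leq_trans (nt_exp _ _) _; by rewrite cardsX.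
  have fe1 : fe.
    have /card_gt0P [S] : 0 < #|Q1| by apply: leq_trans le6.
    by rewrite inE => /and3P [].
  have := s3_fe S0; rewrite fe1 => -[EX [tEX hEX lEX]].
  apply: (fin _ #|Q1| le6); apply: leq_trans (_ : nt (setX CQ X2) GG * 2 ^ (#|Q1| * #|EX| %/ 45) <= _).
    by rewrite leq_mul2l leq_exp2l //; apply/orP; right; apply: leq_div2r; rewrite leq_mul2l lEX orbT.
  apply: (box_saving (G0 := G0)) => //.
  - by rewrite disjoint_sym; apply: dXY.
  - by move=> G /hG [c5' _ e1 e2]; split=> //; [apply: subt sCQ e2|apply: subt sX2 e1].
  - by apply: tsub; apply/subsetP => S; rewrite inE => /andP [].
  - by move=> S; rewrite inE => /and3P [SQ _ pS]; split=> //; apply: sQC.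
have [/eqP q0|qp] := posnP (q %/ 6).
  rewrite /s2 (eqP q0) mul0n div0n muln1; apply: leq_trans (nt_exp _ _) _; by rewrite cardsX.
have ff1 : ff.
  have /card_gt0P [S] : 0 < #|Q2| by apply: leq_trans le6.
  by rewrite inE => /and3P [].
have := s3_ff S0; rewrite ff1 => -[EX [tEX hEX lEX]].
apply: (fin _ #|Q2| le6); apply: leq_trans (_ : nt (setX CQ X2) GG * 2 ^ (#|Q2| * #|EX| %/ 45) <= _).
  by rewrite leq_mul2l leq_exp2l //; apply/orP; right; apply: leq_div2r; rewrite leq_mul2l lEX orbT.
rewrite -nt_cg; apply: (box_saving (G0 := cg G0)) => //.
- by rewrite disjoint_sym; apply: dXY.
- by apply: imset_f.
- move=> _ /imsetP [G /hG [c5' _ e1 e2] ->].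
  have cgt (A : {set T}) : tr (setX A A) G0 = tr (setX A A) G -> tr (setX A A) (cg G0) = tr (setX A A) (cg G).
    by move=> /eqP /trP ee; apply/eqP/trP => x y xy; rewrite !cgE ee.
  split; first exact: C5free_cg.
    by apply: cgt; apply: subt sCQ e2.
  by apply: cgt; apply: subt sX2 e1.
- by apply: tsub; apply/subsetP => S; rewrite inE => /andP [].
- by move=> S; rewrite inE => /and3P [SQ _ pS]; split=> //; apply: sQC.
Qed.

(** The pairs are exposed in this order: inside [X2], on the rest of the side [Xs], on the other
    side, across. Rows of exceptional vertices inside their own side are cheap because they follow a
    known block or [K]; the crossing pairs at [CP] and [CQ] yield the gain [s1 + s2]. *)
Lemma s3_count GG b : 2 * m1 + 1 <= #|K :&: Y2| ->
  (forall G, G \in GG -> C5free G /\ s3 e h w G K X Xs CP CQ fe ff) ->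
  (forall t, nt (setX X2 Y2) [set G in GG | tr (setX X2 X2) G == t] <= b) ->
  #|GG| * 2 ^ (s1 + s2) <=
  nt (setX X2 X2) GG * nt (setX Y2 Y2) GG * b * 2 ^ (p * #|Y2| + q * #|X2| + p * q) *
  ((n.+1 * Ga * 2 ^ e * 2 ^ p) ^ p * (2 * Ga * 2 ^ e) ^ q).
Proof.
move=> hm1 hG hb; have [->|/set0Pn [G1 G1G]] := eqVneq GG set0; first by rewrite cards0.
have [_ S1] := hG _ G1G; have sX := s3_X S1; have dK := s3_K S1.
have [dKX _ _ _ _] := s3_data S1.
have restX : #|Xs :\: X| <= e.
  apply: leq_trans (sdata_rest (s3_data S1)); apply: subset_leq_card; apply/subsetP => x.
  by rewrite !inE => /andP [xX xs]; rewrite negb_or xX andbT; apply: contraL xs => xK; rewrite (disjointFr dK xK).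
have restY : #|~: Xs :\: K| <= e.
  apply: leq_trans (sdata_rest (s3_data S1)); apply: subset_leq_card; apply/subsetP => x.
  by rewrite !inE => /andP [xK xs]; rewrite negb_or xK; apply: contra xs; apply: (subsetP sX).
have [P [_ hP cP _]] := s3_P S1; have [Q [_ hQ cQ _]] := s3_Q S1.
have sCP : CP \subset Xs.
  by rewrite -cP; apply/subsetP => x /bigcupP [S /hP [s _] xS]; apply: (subsetP s).
have sCQ : CQ \subset ~: Xs.
  by rewrite -cQ; apply/subsetP => x /bigcupP [S /hQ [s _] xS]; apply: (subsetP s).
pose FX := (n.+1 * Ga * 2 ^ e * 2 ^ p) ^ p; pose FY := (2 * Ga * 2 ^ e) ^ q.
pose A1 := 2 ^ (p * #|Y2|) %/ 2 ^ s1; pose A2 := 2 ^ (q * #|X2|) %/ 2 ^ s2.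
pose NY := nt (setX Y2 Y2) GG.
have expr v B : nt (setX [set v] B) =1 nt (setX [set v] B) by [].
have rowexp v (B : {set T}) (HH : {set sgraph T}) : nt (setX [set v] B) HH <= 2 ^ #|B|.
  by apply: leq_trans (nt_exp _ _) _; rewrite cardsX cards1 mul1n.
have split3 v (B1 B2 B : {set T}) (HH : {set sgraph T}) : B \subset B1 :|: B2 ->
    nt (setX [set v] B) HH <= nt (setX [set v] B1) HH * nt (setX [set v] B2) HH.
  move=> s; apply: leq_trans (nt_U _ _ _); apply: nt_sub; apply/subsetP => -[x y]; rewrite !inE /= => /andP [-> yB].
  by have := subsetP s _ yB; rewrite inE.
have lvl3 (HH : {set sgraph T}) : HH \subset GG ->
    (forall G, G \in HH -> forall H, H \in HH -> tr (setX Xs Xs) G = tr (setX Xs Xs) H /\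
       tr (setX (~: Xs) (~: Xs)) G = tr (setX (~: Xs) (~: Xs)) H) ->
    nt setT HH <= b * (A1 * (A2 * 2 ^ (p * q))).
  move=> sH eqH; have [->|/set0Pn [G0 G0H]] := eqVneq HH set0; first by rewrite /nt imset0 cards0.
  have hH G : G \in HH -> [/\ C5free G, s3 e h w G K X Xs CP CQ fe ff,
     tr (setX Xs Xs) G0 = tr (setX Xs Xs) G & tr (setX (~: Xs) (~: Xs)) G0 = tr (setX (~: Xs) (~: Xs)) G].
    by move=> GH; have [c5 S3] := hG _ (subsetP sH _ GH); have [h1 h2] := eqH _ G0H _ GH.
  have [c1 c2] := cross_saving G0H hm1 hH.
  apply: leq_trans (_ : nt ((setX Xs Xs :|: setX (~: Xs) (~: Xs)) :|:
      (setX X2 Y2 :|: (setX CP Y2 :|: (setX CQ X2 :|: setX CP CQ)))) HH <= _).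
    apply: nt_mono => x y _; rewrite !inE /=.
    by case: (x \in Xs); case: (y \in Xs); case: (x \in CP); case: (y \in CP); case: (x \in CQ); case: (y \in CQ); rewrite ?orbT.
  apply: leq_trans (nt_U _ _ _) _; rewrite -[X in _ <= X]mul1n; apply: leq_mul.
    apply: leq_trans (nt_U _ _ _) _; rewrite -[1]muln1; apply: leq_mul.
      by apply: (nt1 (t := tr (setX Xs Xs) G0)) => G /hH [].
    by apply: (nt1 (t := tr (setX (~: Xs) (~: Xs)) G0)) => G /hH [].
  apply: leq_trans (nt_U _ _ _) _; apply: leq_mul.
    apply: leq_trans (hb (tr (setX X2 X2) G0)); apply: nt_subset; apply/subsetP => G GH.
    rewrite inE (subsetP sH _ GH) /=; have [_ _ e1 _] := hH _ GH; apply/eqP/esym.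
    apply: tr_mono e1 => x y; rewrite !in_setX !inE => /andP [/andP [_ ->] /andP [_ ->]]; by rewrite orbT.
  apply: leq_trans (nt_U _ _ _) _; apply: leq_mul; first by rewrite leq_divRL ?expn_gt0.
  apply: leq_trans (nt_U _ _ _) _; apply: leq_mul; first by rewrite leq_divRL ?expn_gt0.
  by apply: leq_trans (nt_exp _ _) _; rewrite cardsX.
have lvl2 (HH : {set sgraph T}) : HH \subset GG ->
    (forall G, G \in HH -> forall H, H \in HH -> tr (setX Xs Xs) G = tr (setX Xs Xs) H) ->
    nt setT HH <= NY * FY * (b * (A1 * (A2 * 2 ^ (p * q)))).
  move=> sH eqH; apply: leq_trans (@nt_fiber _ setT (setX (~: Xs) (~: Xs)) HH (b * (A1 * (A2 * 2 ^ (p * q)))) _) _.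
    move=> t; apply: lvl3; first by apply: subset_trans sH; apply/subsetP => G; rewrite inE => /andP [].
    by move=> G; rewrite inE => /andP [GH /eqP e1] H; rewrite inE => /andP [HH' /eqP e2]; rewrite e1 e2; split=> //; apply: eqH.
  rewrite leq_mul2r; apply/orP; right.
  apply: leq_trans (_ : nt (setX Y2 Y2 :|: setX CQ (~: Xs)) HH <= _).
    apply: nt_mono => x y; rewrite !inE /= => /andP [-> ->].
    by case: (x \in CQ); case: (y \in CQ); rewrite ?orbT.
  apply: leq_trans (nt_U _ _ _) _; apply: leq_mul; first exact: nt_subset.
  apply: nt_rows => v vC; apply: leq_trans (split3 v K (~: Xs :\: K) _ _ _) _.
    by apply/subsetP => x xs; rewrite in_setU in_setD xs andbT; case: (x \in K).
  apply: leq_mul; last by apply: leq_trans (rowexp _ _ _) _; rewrite leq_exp2l.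
  apply: row_nearY => G GH; have [_ S3] := hG _ (subsetP sH _ GH); apply: (s3_nearY S3).
  by have := subsetP sCQ _ vC; rewrite inE.
have lvl1 t : nt setT [set G in GG | tr (setX X2 X2) G == t] <= FX * (NY * FY * (b * (A1 * (A2 * 2 ^ (p * q))))).
  set HH := [set G in GG | _].
  have sH : HH \subset GG by apply/subsetP => G; rewrite inE => /andP [].
  apply: leq_trans (@nt_fiber _ setT (setX Xs Xs) HH (NY * FY * (b * (A1 * (A2 * 2 ^ (p * q))))) _) _.
    move=> t'; apply: lvl2; first by apply: subset_trans sH; apply/subsetP => G; rewrite inE => /andP [].
    by move=> G; rewrite inE => /andP [GH /eqP e1] H; rewrite inE => /andP [HH' /eqP e2]; rewrite e1 e2.
  rewrite leq_mul2r; apply/orP; right.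
  apply: leq_trans (_ : nt (setX X2 X2 :|: setX CP Xs) HH <= _).
    apply: nt_mono => x y; rewrite !inE /= => /andP [-> ->].
    by case: (x \in CP); case: (y \in CP); rewrite ?orbT.
  apply: leq_trans (nt_U _ _ _) _; rewrite -[X in _ <= X]mul1n; apply: leq_mul.
    by apply: (nt1 (t := t)) => G; rewrite inE => /andP [_ /eqP].
  apply: nt_rows => v vC; apply: leq_trans (split3 v (X :&: X2 :|: (Xs :\: X)) CP _ _ _) _.
    by apply/subsetP => x xs; rewrite !inE xs; case: (x \in X); case: (x \in CP).
  apply: leq_mul; last exact: rowexp.
  apply: leq_trans (split3 v (X :&: X2) (Xs :\: X) _ _ (subxx _)) _.
  apply: leq_mul; last by apply: leq_trans (rowexp _ _ _) _; rewrite leq_exp2l.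
  apply: (row_nearX (t := t)) => // G; rewrite inE => /andP [GGG /eqP et]; have [_ S3] := hG _ GGG.
  have [_ _ fX _ _] := s3_data S3; split=> //; apply: (s3_nearX S3); exact: (subsetP sCP).
rewrite -nt_setT; apply: leq_trans (leq_mul (nt_fiber lvl1) (leqnn _)) _.
have d1 : A1 * 2 ^ s1 <= 2 ^ (p * #|Y2|) by apply: leq_trunc_div.
have d2 : A2 * 2 ^ s2 <= 2 ^ (q * #|X2|) by apply: leq_trunc_div.
rewrite !expnD -/NY -/FX -/FY; clear lvl1 lvl2 lvl3; clearbody FX FY A1 A2 NY.
move: (nt (setX X2 X2) GG) (2 ^ s1) (2 ^ s2) d1 d2 => c1 u1 u2 d1 d2.
have := leq_mul (leqnn (c1 * FX * FY * NY * b * 2 ^ (p * q))) (leq_mul d1 d2).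
move: (2 ^ (p * #|Y2|)) (2 ^ (q * #|X2|)) (2 ^ (p * q)) => f1 f2 f3; clear; lia.
Qed.

End S3count.

(** * Partitions into blocks *)

Section Partitions.
Variable T : finType.
Implicit Types (G : sgraph T) (GG : {set sgraph T}) (A B I K S U V W X Y R : {set T}).
Let n := #|T|.

Lemma brep_idem G X x : P3free G X -> x \in X -> brep G X (brep G X x) = brep G X x.
Proof.
move=> fX xX; have [bX be] := brep_in fX xX; apply/eqP; rewrite brepP //; exact/eqP.
Qed.

Lemma family_card (rT : finType) (F : T -> {set rT}) : #|family F| = \prod_x #|F x|.
Proof. by rewrite card_family foldrE big_map big_enum. Qed.

(** With the set [R] of representatives and the class [pt] of every vertex fixed, a
    non-representative can only choose among the representatives of its own class. *)
Lemma nt_parts X R (J : finType) (pt : T -> J) GG : R \subset X ->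
  (forall G, G \in GG -> [/\ P3free G X, forall x, x \in X -> brep G X x \in R,
     forall x, x \in R -> brep G X x = x & forall x, x \in X -> pt (brep G X x) = pt x]) ->
  nt (setX X X) GG <= \prod_(j : J) #|[set r in R | pt r == j]| ^ (#|[set x in X | pt x == j]| - #|[set r in R | pt r == j]|).
Proof.
move=> sR hG; pose f G : {ffun T -> T} := [ffun x => if x \in X then brep G X x else x].
apply: leq_trans (_ : #|f @: GG| <= _).
  apply: nt_le_im => G G' GGG GGG' /ffunP e; have [fX _ _ _] := hG _ GGG; have [fX' _ _ _] := hG _ GGG'.
  apply: tr_of_rep => // x y xX yX; have := e x; have := e y; rewrite !ffunE xX yX => -> ->.
  by [].
pose F x : {set T} := if x \in X :\: R then [set r in R | pt r == pt x] else [set x].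
apply: leq_trans (_ : #|family F| <= _).
  apply/subset_leq_card/subsetP => _ /imsetP [G GGG ->]; apply/familyP => x; rewrite ffunE /F in_setD.
  have [_ h1 h2 h3] := hG _ GGG.
  case: (boolP (x \in R)) => [xR|xnR] /=; first by rewrite (subsetP sR) // h2 // inE.
  by case: ifP => xX; rewrite !inE ?h1 ?h3 ?eqxx.
rewrite family_card (bigID (fun x => x \in X :\: R)) /= [X in _ * X <= _]big1 ?muln1; last first.
  by move=> x /negbTE h; rewrite /F h cards1.
rewrite (partition_big pt predT) //=; apply: leq_prod => j _.
rewrite (eq_bigr (fun=> #|[set r in R | pt r == j]|)); last first.
  by move=> x /andP [h /eqP <-]; rewrite /F h.
rewrite prod_nat_const; apply: eq_leq; congr (_ ^ _).
have -> : #|[set x in X | pt x == j]| - #|[set r in R | pt r == j]| = #|[set x in X | pt x == j] :\: [set r in R | pt r == j]|.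
  rewrite cardsD (setIidPr _) //; apply/subsetP => x; rewrite !inE => /andP [/(subsetP sR) -> ->] //.
by apply: eq_card => x; rewrite [in LHS]unfold_in !inE; case: (x \in R); case: (x \in X); case: (pt x == j).
Qed.

(** Each vertex outside [I] names a vertex of its block, taken from [I] if possible. This also
    settles adjacency to [I]: a block that meets a clique [I] contains all of it, and a block meets
    an independent [I] in at most one vertex. *)
Lemma nt_homog_part X I GG : I \subset X ->
  (forall G, G \in GG -> P3free G X /\ clique G I) \/ (forall G, G \in GG -> P3free G X /\ indep G I) ->
  nt (setX X X) GG <= n ^ #|X :\: I|.
Proof.
move=> sI hG.
pose rho G x := if [pick i in blkof G X x :&: I] is Some i then i else brep G X x.
have fX G : G \in GG -> P3free G X by case: hG => h /h [].
pose f G : {ffun T -> T} := [ffun x => if x \in X :\: I then rho G x else x].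
apply: leq_trans (_ : #|f @: GG| <= _); last first.
  pose F x : {set T} := if x \in X :\: I then setT else [set x].
  apply: leq_trans (_ : #|family F| <= _).
    apply/subset_leq_card/subsetP => _ /imsetP [G GGG ->]; apply/familyP => x; rewrite ffunE /F.
    by case: ifP => _; rewrite inE.
  rewrite family_card (bigID (fun x => x \in X :\: I)) /= [X in _ * X <= _]big1 ?muln1; last first.
    by move=> x /negbTE h; rewrite /F h cards1.
  rewrite (eq_bigr (fun=> n)) ?prod_nat_const // => x h; by rewrite /F h cardsT.
have rhoB G x y : G \in GG -> x \in X -> y \in X -> (rho G x == rho G y) = (blkof G X x == blkof G X y).
  move=> GGG xX yX; have fG := fX _ GGG; apply/eqP/eqP => [|e]; last first.
    rewrite /rho e; case: pickP => // _; apply/eqP; rewrite brepP //; exact/eqP.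
  have mem z : z \in X -> rho G z \in X /\ blkof G X (rho G z) = blkof G X z.
    move=> zX; rewrite /rho; case: pickP => [i|_]; last exact: brep_in.
    rewrite !inE => /andP [/andP [iX /orP [/eqP ->//|a]] _]; split=> //.
    by rewrite -(blkof_eq fG zX iX a).
  by move=> e; have [_ <-] := mem _ xX; have [_ <-] := mem _ yX; rewrite e.
have rhoI G x i : G \in GG -> x \in X -> i \in I -> adj G x i -> rho G x \in I.
  move=> GGG xX iI a; rewrite /rho; case: pickP => [j /setIP []//|/(_ i)].
  by rewrite !inE (subsetP sI _ iI) iI a orbT.
have rhoI' G x : G \in GG -> x \in X -> rho G x \in I -> (rho G x == x) || adj G x (rho G x).
  move=> GGG xX; rewrite /rho; case: pickP => [j /setIP [+ _] _|no].
    by rewrite inE => /andP [].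
  move=> bI; have [bX be] := brep_in (fX _ GGG) xX.
  by have := no (brep G X x); rewrite in_setI bI andbT -be blkof_self.
apply: nt_le_im => G G' GGG GGG' /ffunP e; apply/eqP/trP => x y /setXP [xX yX].
have ef z : z \in X -> z \notin I -> rho G z = rho G' z.
  by move=> zX zI; have := e z; rewrite !ffunE in_setD zX zI.
case: (eqVneq x y) => [->|ne]; first by rewrite !adj_irrefl.
have mix u i : u \in X -> u \notin I -> i \in I -> adj G u i = adj G' u i.
  move=> uX uI iI; have iX := subsetP sI _ iI.
  have half H H' : H \in GG -> H' \in GG -> rho H u = rho H' u -> adj H u i -> adj H' u i.
    move=> HG HG' er a; have rI := rhoI _ _ _ HG uX iI a.
    have a' : adj H' u (rho H' u).
      rewrite er in rI; have := rhoI' _ _ HG' uX rI; case: eqP => // e0; by rewrite e0 (negbTE uI) in rI.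
    have a0 : adj H u (rho H u).
      have := rhoI' _ _ HG uX rI; case: eqP => // e0; by rewrite e0 (negbTE uI) in rI.
    case: (eqVneq i (rho H u)) => [->|ni]; first by rewrite er.
    case: hG => hh; last first.
      have [fH /indepP iH] := hh _ HG; have := fH i u (rho H u) iX uX (subsetP sI _ rI).
      by rewrite /p3 adj_sym a a0 ni iH.
    have [fH /cliqueP cH] := hh _ HG'; rewrite er in rI ni.
    have ai := cH _ _ rI iI; rewrite eq_sym in ai; have {}ai := ai ni.
    have := fH u (rho H' u) i uX (subsetP sI _ rI) iX; rewrite /p3 a' ai /=.
    have -> : u != i by apply: contraNneq uI => ->.
    by rewrite negbK.
  by apply/idP/idP; apply: half; rewrite ?ef.
case: (boolP (x \in I)) => xI; case: (boolP (y \in I)) => yI.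
- case: hG => hh; have [_ h1] := hh _ GGG; have [_ h2] := hh _ GGG'.
    by rewrite (cliqueP _ _ h1 _ _ xI yI ne) (cliqueP _ _ h2 _ _ xI yI ne).
  by rewrite (negbTE (indepP _ _ h1 _ _ xI yI)) (negbTE (indepP _ _ h2 _ _ xI yI)).
- by rewrite adj_sym mix // adj_sym.
- exact: mix.
- by rewrite (blkofP (fX _ GGG)) // (blkofP (fX _ GGG')) // -!rhoB // !ef.
Qed.

Definition reps G X : {set T} := [set x in X | brep G X x == x].

Lemma repsP G X : P3free G X -> [/\ reps G X \subset X, forall x, x \in X -> brep G X x \in reps G X &
  forall x, x \in reps G X -> brep G X x = x].
Proof.
move=> fX; split; first by apply/subsetP => x; rewrite inE => /andP [].
  by move=> x xX; rewrite inE brep_idem // eqxx (brep_in fX xX).1.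
by move=> x; rewrite inE => /andP [_ /eqP].
Qed.

Lemma nt_P3free_reps X b GG : (forall k, k <= #|X| -> k ^ (#|X| - k) <= b) ->
  (forall G, G \in GG -> P3free G X) -> nt (setX X X) GG <= 2 ^ n * b.
Proof.
move=> hb hG; rewrite -card_setTE.
pose P R := R \subset X.
apply: leq_trans (_ : #|P| * b <= _); last by rewrite leq_mul2r max_card orbT.
apply: (nt_union (CC := fun R => [set G in GG | reps G X == R])) => [G GGG|R sR].
  by exists (reps G X); rewrite ?inE ?GGG ?eqxx //; have [] := repsP (hG _ GGG).
apply: leq_trans (@nt_parts X R unit (fun=> tt) _ sR _) _.
  move=> G; rewrite inE => /andP [/hG fX /eqP <-]; have [h1 h2 h3] := repsP fX; by split.
rewrite (big_pred1 tt); last by case.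
have -> : [set r in R | tt == tt] = R by apply/setP => x; rewrite inE andbT.
have -> : [set x in X | tt == tt] = X by apply/setP => x; rewrite inE andbT.
by apply: hb; apply: subset_leq_card.
Qed.

(* Size classes of blocks: 0 small, 1 medium, 2 large. *)
Definition szcl (lo hi k : nat) : 'I_3 := 
  if k < lo then ord0 else if k <= hi then lift ord0 ord0 else lift ord0 (lift ord0 ord0).

Definition medium lo hi G X : {set T} := [set x in X | lo <= #|blkof G X x| <= hi].

Lemma sum_blocks G X A c : P3free G X -> A \subset X ->
  (forall x, x \in A -> brep G X x \in A) -> (forall x, x \in A -> #|blkof G X x| <= c) ->
  #|A| <= #|[set r in reps G X | r \in A]| * c.
Proof.
move=> fX sA hA hc; set R := [set r in _ | _].
have -> : #|A| = \sum_(r in R) #|[set x in A | brep G X x == r]|.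
  rewrite -sum1_card (partition_big (brep G X) (mem R)) /=.
    by apply: eq_bigr => r _; rewrite sum1dep_card; apply: eq_card => x; rewrite !inE.
  by move=> x xA; rewrite inE hA // andbT; have [_ h _] := repsP fX; apply: h; apply: (subsetP sA).
rewrite -sum_nat_const; apply: leq_sum => r; rewrite inE => /andP [rR rA].
apply: leq_trans (hc _ rA); apply: subset_leq_card; apply/subsetP => x; rewrite !inE => /andP [xA /eqP e].
have xX := subsetP sA _ xA; have rX := subsetP sA _ rA; rewrite xX /=.
case: (eqVneq x r) => //= ne; rewrite (blkofP fX) 1?eq_sym //.
by rewrite -e; have [_ ->] := brep_in fX xX.
Qed.

Lemma sum_blocks_ge G X A c : P3free G X -> A \subset X ->
  (forall x, x \in A -> blkof G X x \subset A) -> (forall x, x \in A -> c <= #|blkof G X x|) ->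
  #|[set r in reps G X | r \in A]| * c <= #|A|.
Proof.
move=> fX sA hA hc; set R := [set r in _ | _].
have -> : #|A| = \sum_(r in R) #|[set x in A | brep G X x == r]|.
  rewrite -sum1_card (partition_big (brep G X) (mem R)) /=.
    by apply: eq_bigr => r _; rewrite sum1dep_card; apply: eq_card => x; rewrite !inE.
  move=> x xA; have xX := subsetP sA _ xA; rewrite inE; have [_ h _] := repsP fX; rewrite h //=.
  apply: (subsetP (hA _ xA)); have [bX be] := brep_in fX xX.
  by rewrite -be blkof_self.
rewrite -sum_nat_const; apply: leq_sum => r; rewrite inE => /andP [rR rA].
apply: leq_trans (hc _ rA) _; apply: subset_leq_card; apply/subsetP => x xB.
have xA := subsetP (hA _ rA) _ xB; have xX := subsetP sA _ xA; have rX := subsetP sA _ rA.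
rewrite inE xA /=; have [_ _ h3] := repsP fX; rewrite -[X in _ == X](h3 r rR) brepP //.
move: xB; rewrite inE => /andP [_ /orP [/eqP ->//|a]].
by apply/eqP/esym; apply: blkof_eq.
Qed.

End Partitions.

(** * Dependence of the number of partitions on the number of blocks *)

Section Growth.
Variables (n lam g : nat).
Hypotheses (lam1 : 0 < lam) (nlam : 2 ^ lam <= n) (glam : g * lam <= n) (glam' : n < g.+1 * lam)
  (g4 : 2 ^ (lam %/ 2) <= g) (lam8 : 8 <= lam) (n2 : 2 * lam <= n).

Lemma succ_exp12 y : y.+1 <= 2 ^ (y %/ 12 + 5).
Proof.
rewrite expnD; have h : (y %/ 12).+1 <= 2 ^ (y %/ 12) by apply: ltn_expl.
have := leq_mul h (leqnn (2 ^ 5)); apply: leq_trans.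
have := ltn_ceil y (isT : 0 < 12); rewrite -[2 ^ 5]/32; move: (y %/ 12) => z; clear; lia.
Qed.

(** [k ^ (a - k)] bounds the number of partitions with [k] given representatives; up to [2 ^ O(n)]
    it is largest for [k] of order [g]. With [y = k / g], passing from [k ^ a] to [g ^ a] costs at
    most [y * n / 12 + 5 * n] bits by [succ_exp12], while division by [k ^ k] gains [y * n / 6]. *)
Lemma kpow k a : k <= a -> a <= n -> k ^ (a - k) * 2 ^ (k %/ g * n %/ 12) <= g ^ a * 2 ^ (5 * n).
Proof.
move=> ka an; have g0 : 0 < g by apply: leq_trans g4; rewrite expn_gt0.
have [->|k0] := posnP k.
  rewrite div0n mul0n div0n muln1; apply: leq_trans (_ : 1 <= _); last by rewrite muln_gt0 !expn_gt0 g0.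
  by case: (a - 0) => [//|b]; rewrite exp0n.
have [y yE] : exists y, y = k %/ g by exists (k %/ g).
rewrite -yE; have ky : k < y.+1 * g by rewrite yE; apply: ltn_ceil.
have yk : y * g <= k by rewrite yE; apply: leq_trunc_div.
rewrite -(leq_pmul2r (_ : 0 < k ^ k)) ?expn_gt0 ?k0 //.
have -> : k ^ (a - k) * 2 ^ (y * n %/ 12) * k ^ k = k ^ a * 2 ^ (y * n %/ 12).
  by rewrite mulnAC -expnD subnK.
have [y0|y0] := posnP y.
  rewrite y0 mul0n div0n muln1; rewrite y0 mul1n in ky.
  apply: leq_trans (_ : g ^ a <= _); first by apply: leq_expW; apply: ltnW.
  by rewrite -mulnA leq_pmulr // muln_gt0 !expn_gt0 k0.
have kk : 2 ^ (y * n %/ 6) <= k ^ k.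
  apply: leq_trans (_ : (2 ^ (lam %/ 2)) ^ k <= _); last first.
    by apply: leq_expW; apply: leq_trans g4 _; apply: leq_trans yk; rewrite leq_pmull.
  rewrite -expnM leq_exp2l //; apply: leq_trans (_ : lam %/ 2 * (y * g) <= _); last by rewrite leq_mul2l yk orbT.
  apply: leq_trans (leq_div2r 6 (_ : _ <= lam %/ 2 * (y * g) * 6)) _; last by rewrite mulnK.
  have n2gl : n <= 2 * (g * lam) by have := glam'; have := n2; rewrite (mulSn g); move: (g * lam) => u; lia.
  have lL : lam <= 2 * (lam %/ 2) + 1 by clear; lia.
  have L1 : 0 < lam %/ 2 by clear - lam8; lia.
  have : n <= 6 * (lam %/ 2 * g).
    apply: leq_trans n2gl _; apply: leq_trans (leq_mul (leqnn 2) (leq_mul (leqnn g) lL)) _.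
    by move: (lam %/ 2) L1 => L L1; clear - L1; nia.
  move=> h; have := leq_mul (leqnn y) h; move: (lam %/ 2) => L; clear; nia.
have ya : k ^ a <= g ^ a * 2 ^ (y * n %/ 12 + 5 * n).
  apply: leq_trans (_ : (y.+1 * g) ^ a <= _); first by apply: leq_expW; apply: ltnW.
  rewrite expnMn mulnC leq_mul2l; apply/orP; right.
  apply: leq_trans (_ : y.+1 ^ n <= _); first by rewrite leq_pexp2l.
  apply: leq_trans (leq_expW n (succ_exp12 y)) _; rewrite -expnM leq_exp2l // mulnDl leq_add2r.
  by rewrite leq_divRL // mulnAC leq_mul2r leq_trunc_div orbT.
apply: leq_trans (leq_mul ya (leqnn _)) _; rewrite -!mulnA leq_mul2l; apply/orP; right.
rewrite -expnD; apply: leq_trans (leq_mul (leqnn _) kk); rewrite -expnD leq_exp2l //.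
have : y * n %/ 12 + y * n %/ 12 <= y * n %/ 6.
  by rewrite leq_divRL //; have := leq_trunc_div (y * n) 12; move: (y * n %/ 12) (y * n) => u v; clear; lia.
by move: (y * n %/ 12) (y * n %/ 6) => u v; clear; lia.
Qed.

End Growth.

Section FewMedium.
Variable T : finType.
Implicit Types (G : sgraph T) (GG : {set sgraph T}) (X R : {set T}).
Let n := #|T|.
Variables (lam g : nat).
Hypotheses (lam1 : 0 < lam) (nlam : 2 ^ lam <= n) (glam : g * lam <= n) (glam' : n < g.+1 * lam)
  (g4 : 2 ^ (lam %/ 2) <= g) (lam8 : 8 <= lam) (n2 : 2 * lam <= n).

Lemma all_partitions X GG : (forall G, G \in GG -> P3free G X) ->
  nt (setX X X) GG <= g ^ #|X| * 2 ^ (6 * n).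
Proof.
move=> h; apply: leq_trans (nt_P3free_reps (b := g ^ #|X| * 2 ^ (5 * n)) _ h) _.
  move=> k kX; apply: leq_trans (kpow lam1 nlam glam glam' g4 lam8 n2 kX (max_card _)).
  by rewrite leq_pmulr // expn_gt0.
by rewrite mulnCA -expnD leq_mul2l leq_exp2l // -mulSn leqnn orbT.
Qed.

(** At least [n / 12] vertices lie in small blocks or in large ones. Small blocks covering that many
    number at least [12 * (C + 20) * g], which [kpow] punishes; large blocks number at most
    [g / 2 ^ D], so that each of at least [n / 24] non-representatives loses [D] bits. The constants
    144 and 24 come from these fractions, and 20 covers the error terms [5 * n] of [kpow] and the
    labels. *)
Lemma few_medium C lo X GG : lo * (144 * (C + 20)) <= lam -> n <= 3 * #|X| ->
  (forall G, G \in GG -> P3free G X /\ 2 * #|medium lo (2 ^ (24 * (C + 20)) * lam) G X| <= #|X|) ->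
  nt (setX X X) GG * 2 ^ (C * n) <= g ^ #|X|.
Proof.
set D := 24 * (C + 20); set hi := 2 ^ D * lam => lolam nX hG.
have n0 : 0 < n by apply: leq_trans nlam; rewrite expn_gt0.
pose L := ({set T} * {ffun T -> 'I_3})%type.
pose lab G : L := (reps G X, [ffun x => szcl lo hi #|blkof G X x|]).
pose P (l : L) := [exists G in GG, lab G == l].
(* A label consists of a set of representatives and a size class for every vertex; there are at most
   [2 ^ (3 * n)] labels, hence [C + 3]. *)
pose b := g ^ #|X| %/ 2 ^ ((C + 3) * n).
suff ub : nt (setX X X) GG <= #|P| * b.
  apply: leq_trans (_ : 2 ^ (3 * n) * b * 2 ^ (C * n) <= _).
    rewrite leq_mul2r; apply/orP; right; apply: leq_trans ub _; rewrite leq_mul2r; apply/orP; right.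
    apply: leq_trans (max_card _) _; rewrite card_prod card_setTE card_ffun card_ord -/n.
    rewrite mulSn expnD leq_mul2l (expnM 2 2); apply/orP; right; exact: leq_expW.
  rewrite mulnAC mulnC -expnD -mulnDl [3 + C]addnC; exact: leq_trunc_div.
apply: (nt_union (CC := fun l => [set G in GG | lab G == l])) => [G GGG|[R pt] /existsP [G0 /andP [GG0 /eqP lab0]]].
  exists (lab G); last by rewrite inE GGG eqxx.
  by apply/existsP; exists G; rewrite GGG eqxx.
rewrite leq_divRL ?expn_gt0 //.
have [fX0 med] := hG _ GG0; have [h1 h2 h3] := repsP fX0.
have [eR ept] : reps G0 X = R /\ pt = [ffun x => szcl lo hi #|blkof G0 X x|] by case: lab0 => -> <-.
pose A j : {set T} := [set x in X | pt x == j].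
pose B j : {set T} := [set r in R | pt r == j].
have sR : R \subset X by rewrite -eR.
have BE j : B j = [set r in reps G0 X | r \in A j].
  apply/setP => x; rewrite !inE -eR inE; by case: (x \in X); rewrite ?andbF.
have sA j : A j \subset X by apply/subsetP => x; rewrite inE => /andP [].
have sB j : B j \subset A j.
  by apply/subsetP => x; rewrite !inE => /andP [/(subsetP sR) -> ->].
have kp j := kpow lam1 nlam glam glam' g4 lam8 n2 (subset_leq_card (sB j)) (max_card (A j)).
have kp' j : #|B j| ^ (#|A j| - #|B j|) <= g ^ #|A j| * 2 ^ (5 * n).
  by apply: leq_trans (kp j); rewrite leq_pmulr // expn_gt0.
have brA j x : x \in A j -> brep G0 X x \in A j.
  rewrite !inE => /andP [xX]; have [bX be] := brep_in fX0 xX; by rewrite bX ept !ffunE be.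
have blA j x : x \in A j -> blkof G0 X x \subset A j.
  rewrite inE => /andP [xX px]; apply/subsetP => y yB.
  have yX : y \in X by move: yB; rewrite inE => /andP [].
  rewrite inE yX /=; move: px; rewrite ept !ffunE; move: yB; rewrite inE yX /= => /orP [/eqP -> //|a].
  by rewrite (blkof_eq fX0 xX yX a).
pose o0 : 'I_3 := ord0; pose o1 : 'I_3 := lift ord0 ord0; pose o2 : 'I_3 := lift ord0 (lift ord0 ord0).
have aX : #|X| = #|A o0| + #|A o1| + #|A o2|.
  have -> : #|X| = \sum_(j : 'I_3) #|A j|.
    rewrite -sum1_card (partition_big pt predT) //=.
    by apply: eq_bigr => j _; rewrite sum1dep_card; apply: eq_card => x; rewrite !inE.
  by rewrite !big_ord_recl big_ord0 addn0 addnA.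
have a1 : 2 * #|A o1| <= #|X|.
  have szP k : szcl lo hi k = o1 -> lo <= k <= hi.
    move=> e; have {e} : val (szcl lo hi k) == 1 by rewrite e.
    by have := leqNgt lo k; rewrite /szcl; case: (k < lo) => [_|->]; [|case: (k <= hi)].
  apply: leq_trans med; rewrite leq_mul2l /=; apply: subset_leq_card; apply/subsetP => x.
  by rewrite [in X in X -> _]inE ept ffunE => /andP [xX /eqP /szP]; rewrite inE xX.
have a0 : #|A o0| <= #|B o0| * lo.
  rewrite BE; apply: sum_blocks => // [x /brA //|x]; rewrite inE ept ffunE /szcl => /andP [_].
  by case: ltnP => [/ltnW //|_]; case: ifP.
have a2 : #|B o2| * hi <= #|A o2|.
  rewrite BE; apply: sum_blocks_ge => // [x /blA //|x]; rewrite inE ept ffunE /szcl => /andP [_].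
  by case: ltnP => // _; case: leqP => // /ltnW.
have ub : nt (setX X X) [set G in GG | lab G == (R, pt)] <=
    #|B o0| ^ (#|A o0| - #|B o0|) * (#|B o1| ^ (#|A o1| - #|B o1|) * #|B o2| ^ (#|A o2| - #|B o2|)).
  apply: leq_trans (nt_parts (pt := pt) sR _) _; last by rewrite !big_ord_recl big_ord0 muln1.
  move=> G; rewrite inE => /andP [GGG /eqP [e1 e2]]; have [fX _] := hG _ GGG; have [g1 g2 g3] := repsP fX.
  split=> // [x xX|x xR|x xX]; [by rewrite -e1; apply: g2|by apply: g3; rewrite e1|].
  by have [bX be] := brep_in fX xX; rewrite -e2 !ffunE be.
apply: leq_trans (leq_mul ub (leqnn _)) _; rewrite aX !expnD.
have [c0|c0] := leqP n (12 * #|A o0|).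
  have lo0 : 0 < lo by case: (posnP lo) a0 => // ->; rewrite muln0 leqn0 => /eqP e; rewrite e in c0; clear - c0 n0; lia.
  have kg : 12 * (C + 20) <= #|B o0| %/ g.
    rewrite leq_divRL; last by apply: leq_trans g4; rewrite expn_gt0.
    rewrite -(leq_pmul2r lo0); apply: leq_trans a0; rewrite -(leq_pmul2l (isT : 0 < 12)); apply: leq_trans c0.
    apply: leq_trans glam; apply: leq_trans (leq_mul (leqnn g) lolam); apply: eq_leq; clear; lia.
  have sv : #|B o0| ^ (#|A o0| - #|B o0|) * 2 ^ ((C + 20) * n) <= g ^ #|A o0| * 2 ^ (5 * n).
    apply: leq_trans (kp o0); rewrite leq_mul2l leq_exp2l //; apply/orP; right.
    rewrite leq_divRL // -mulnA [n * 12]mulnC mulnA [_ * 12]mulnC; by rewrite leq_mul2r kg orbT.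
  have := leq_mul sv (leq_mul (kp' o1) (kp' o2)).
  move: (#|B o0| ^ _) (#|B o1| ^ _) (#|B o2| ^ _) (g ^ #|A o0|) (g ^ #|A o1|) (g ^ #|A o2|) => u0 u1 u2 v0 v1 v2 h.
  rewrite -(leq_pmul2r (_ : 0 < 2 ^ (15 * n))) ?expn_gt0 //.
  apply: leq_trans (_ : u0 * 2 ^ ((C + 20) * n) * (u1 * u2) <= _).
    rewrite -[X in X <= _]mulnA -expnD [X in _ <= X]mulnAC leq_mul2l leq_exp2l // -mulnDl leq_mul2r; apply/orP; right; apply/orP; right; clear; lia.
  apply: leq_trans h _; apply: eq_leq; have -> : 15 * n = 5 * n + (5 * n + 5 * n) by clear; lia.
  by rewrite !expnD; move: (2 ^ (5 * n)) => z; clear; lia.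
have c2 : n <= 12 * #|A o2| by clear - c0 a1 aX nX; lia.
have hi2 : 2 <= hi.
  rewrite /hi /D mulnDr; apply: leq_trans (_ : 2 * 1 <= _); first by [].
  apply: leq_mul => //; rewrite -{1}[2]expn1 leq_exp2l //; clear; lia.
have kB : #|B o2| * 2 <= #|A o2| by apply: leq_trans a2; rewrite leq_mul2l hi2 orbT.
have kg : #|B o2| * 2 ^ D <= g.
  rewrite -ltnS -(ltn_pmul2r lam1); apply: leq_ltn_trans glam'; rewrite -mulnA.
  by apply: leq_trans a2 (max_card _).
have g0 : 0 < g by apply: leq_trans g4; rewrite expn_gt0.
have sv : #|B o2| ^ (#|A o2| - #|B o2|) * 2 ^ ((C + 20) * n) <= g ^ #|A o2|.
  apply: leq_trans (_ : (#|B o2| * 2 ^ D) ^ (#|A o2| - #|B o2|) <= _); last first.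
    apply: leq_trans (leq_expW _ kg) _; rewrite leq_pexp2l // leq_subr //.
  rewrite expnMn leq_mul2l -expnM leq_exp2l //; apply/orP; right; rewrite /D -mulnA [24 * _]mulnC -mulnA leq_mul2l.
  apply/orP; right; clear - c2 kB; lia.
have := leq_mul (kp' o0) (leq_mul (kp' o1) sv).
move: (#|B o0| ^ _) (#|B o1| ^ _) (#|B o2| ^ _) (g ^ #|A o0|) (g ^ #|A o1|) (g ^ #|A o2|) => u0 u1 u2 v0 v1 v2 h.
rewrite -(leq_pmul2r (_ : 0 < 2 ^ (10 * n))) ?expn_gt0 //.
apply: leq_trans (_ : u0 * u1 * u2 * 2 ^ ((C + 20) * n) <= _).
  rewrite !mulnA -[X in X <= _]mulnA -expnD.
  rewrite leq_mul2l leq_exp2l // -mulnDl leq_mul2r; apply/orP; right; apply/orP; right; clear; lia.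
apply: leq_trans (_ : u0 * (u1 * (u2 * 2 ^ ((C + 20) * n))) <= _); first by rewrite !mulnA.
apply: leq_trans h _; apply: eq_leq; have -> : 10 * n = 5 * n + 5 * n by clear; lia.
by rewrite !expnD; move: (2 ^ (5 * n)) => z; clear; lia.
Qed.

End FewMedium.

(** * Random-like crossing edges *)

Lemma bernoulli N A m : N ^ m * (N + m * A) <= N * (N + A) ^ m.
Proof.
elim: m => [|m IH]; first by rewrite !expn0 mul0n addn0 mul1n muln1.
rewrite !expnS [X in _ <= X]mulnCA; apply: leq_trans (leq_mul (leqnn (N + A)) IH).
move: (N ^ m) => z; clear; nia.
Qed.

(** [(1 - A/N) * (1 + A/N) <= 1], and [(1 + A/N) ^ M >= 2] by [bernoulli]. *)
Lemma pow_half N A M : 0 < N -> A <= N -> N <= M * A -> (N - A) ^ M * 2 <= N ^ M.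
Proof.
move=> N0 AN NM; rewrite -(leq_pmul2r (_ : 0 < N ^ M)) ?expn_gt0 ?N0 //.
have h : 2 * N ^ M <= (N + A) ^ M.
  rewrite -(leq_pmul2l N0); apply: leq_trans (bernoulli N A M).
  by rewrite mulnCA mulnA mulnC leq_mul2l; apply/orP; right; clear - NM; lia.
rewrite -mulnA; apply: leq_trans (leq_mul (leqnn _) h) _; rewrite -!expnMn; apply: leq_expW.
by move: N0 AN; clear; nia.
Qed.

Lemma pow_half_div N A M k : 0 < N -> A <= N -> N <= M * A -> (N - A) ^ k * 2 ^ (k %/ M) <= N ^ k.
Proof.
move=> N0 AN NM; have [->|M0] := posnP M; first by rewrite divn0 muln1; apply: leq_expW; apply: leq_subr.
rewrite [k in X in X * _]((divn_eq k M)) [k in X in _ <= X]((divn_eq k M)) !expnD [_ %/ M * M]mulnC !expnM mulnAC -expnMn.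
by apply: leq_mul; apply: leq_expW; [apply: pow_half | apply: leq_subr].
Qed.

(** An estimate in the opposite direction: [(1 - 1/P) ^ m >= 1 - m/P >= 1/2]. *)
Lemma pred_pow_half P m : 2 * m <= P -> P ^ m <= 2 * P.-1 ^ m.
Proof.
case: P => [|P] h; first by have -> : m = 0 by clear - h; lia.
have b k : k <= P.+1 -> P.+1 ^ k * (P.+1 - k) <= P ^ k * P.+1.
  elim: k => [|k IH] kP; first by rewrite subn0.
  rewrite !expnS; apply: leq_trans (_ : P * (P.+1 ^ k * (P.+1 - k)) <= _); last first.
    by rewrite -mulnA leq_mul2l IH ?orbT // ltnW.
  have h' : P.+1 * (P.+1 - k.+1) <= P * (P.+1 - k) by clear - kP; nia.
  by move: (P.+1 ^ k) => z; clear - h'; nia.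
rewrite -(leq_pmul2r (ltn0Sn P)) /=; have := b m (ltac:(clear - h; lia)).
by move: (P.+1 ^ m) (P ^ m) => u v; clear - h; nia.
Qed.

Lemma pred_pow_le P m u a : 0 < P -> 2 * m <= P -> a <= m * u -> P ^ a <= 2 ^ u * P.-1 ^ a.
Proof.
move=> P0 mP au; have [->|a0] := posnP a; first by rewrite muln1 expn_gt0.
rewrite -(leq_pmul2r (_ : 0 < P ^ (m * u - a))) ?expn_gt0 ?P0 // -expnD subnKC //.
have h := leq_expW u (pred_pow_half mP); rewrite expnMn -!expnM in h.
apply: leq_trans h _; rewrite -mulnA leq_mul2l; apply/orP; right.
rewrite -[X in _ ^ X <= _](subnKC au) expnD leq_mul2l; apply/orP; right; apply: leq_expW; apply: leq_pred.
Qed.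

Section Cross.
Variable T : finType.
Implicit Types (G : sgraph T) (GG HH : {set sgraph T}) (A B C Ct D E S U V W X Y : {set T}) (BB : {set {set T}}).
Let n := #|T|.

Lemma nt_setXC A B GG : nt (setX A B) GG = nt (setX B A) GG.
Proof.
have h A' B' : nt (setX A' B') GG <= nt (setX B' A') GG.
  by apply: nt_mono => x y; rewrite !inE /= => /andP [-> ->]; rewrite !orbT.
by apply/eqP; rewrite eqn_leq !h.
Qed.

(** Union bound over the set of blocks that fail, at least [#|BB| - r] in number. The rows in
    disjoint blocks are independent, so each failing block contributes its own factor [2 ^ -s]. *)
Lemma many_fail BB (bad : sgraph T -> {set T} -> bool) s r GG X Y : trivIset BB ->
  (forall C, C \in BB -> C \subset X) ->
  (forall C HH, C \in BB -> (forall G, G \in HH -> bad G C) -> HH \subset GG -> nt (setX C Y) HH * 2 ^ s <= 2 ^ (#|C| * #|Y|)) ->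
  (forall G, G \in GG -> #|BB| <= #|[set C in BB | bad G C]| + r) ->
  nt (setX X Y) GG * 2 ^ (s * (#|BB| - r)) <= 2 ^ #|BB| * 2 ^ (#|X| * #|Y|).
Proof.
move=> tB sB hb hG; pose P (F : {set {set T}}) := (F \subset BB) && (#|BB| - r <= #|F|).
pose b := 2 ^ (#|X| * #|Y|) %/ 2 ^ (s * (#|BB| - r)).
suff ub : nt (setX X Y) GG <= #|P| * b.
  apply: leq_trans (leq_mul ub (leqnn _)) _; rewrite -mulnA; apply: leq_mul; last exact: leq_trunc_div.
  by rewrite -card_powerset; apply: subset_leq_card; apply/subsetP => F; rewrite unfold_in powersetE => /andP [].
apply: (nt_union (CC := fun F : {set {set T}} => [set G in GG | [forall C in F, bad G C]])) => [G GGG|F /andP [FB cF]].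
  exists [set C in BB | bad G C].
    rewrite /P leq_subLR addnC hG // andbT; by apply/subsetP => C; rewrite inE => /andP [].
  by rewrite inE GGG; apply/forall_inP => C; rewrite inE => /andP [].
rewrite leq_divRL ?expn_gt0 //; set HH := [set G in GG | _].
have sH : HH \subset GG by apply/subsetP => G; rewrite inE => /andP [].
apply: leq_trans (_ : nt (setX X Y) HH * 2 ^ (s * #|F|) <= _).
  by rewrite leq_mul2l leq_exp2l // leq_mul2l cF !orbT.
have tF : trivIset F by apply: trivIsetS tB.
have XE : setX X Y = (\bigcup_(C in F) setX C Y) :|: setX (X :\: cover F) Y.
  apply/setP => -[x y]; rewrite !inE /=; apply/andP/orP => [[xX yY]|[/bigcupP [C CF]|/andP [/andP [_ ->] ->]//]].
    case: (boolP (x \in cover F)) => [/bigcupP [C CF xC]|_]; last by right; rewrite xX.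
    by left; apply/bigcupP; exists C; rewrite // inE /= xC.
  by rewrite inE /= => /andP [xC ->]; rewrite (subsetP (sB _ (subsetP FB _ CF))).
rewrite XE; apply: leq_trans (leq_mul (nt_U _ _ _) (leqnn _)) _.
have h1 : nt (\bigcup_(C in F) setX C Y) HH * 2 ^ (s * #|F|) <= 2 ^ (#|cover F| * #|Y|).
  apply: leq_trans (leq_mul (nt_bigU _ _ _) (leqnn _)) _; rewrite expnM -prod_nat_const -big_split /=.
  apply: leq_trans (_ : \prod_(C in F) 2 ^ (#|C| * #|Y|) <= _).
    apply: leq_prod => C CF; apply: hb => //; first exact: (subsetP FB).
    by move=> G; rewrite inE => /andP [_ /forall_inP h]; apply: h.
  by rewrite -expn_sum -big_distrl /= -(eqP tF).
have h2 := nt_exp (setX (X :\: cover F) Y) HH; rewrite cardsX in h2.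
rewrite mulnAC; apply: leq_trans (leq_mul h1 h2) _; rewrite -expnD leq_exp2l // -mulnDl leq_mul2r; apply/orP; right.
rewrite -(cardsID (cover F) X) leq_add2r; apply: subset_leq_card; apply/subsetP => x xc; rewrite inE xc andbT.
by case/bigcupP: xc => C CF; apply: (subsetP (sB _ (subsetP FB _ CF))).
Qed.

Definition capn G C U : {set T} := [set x in C | [forall u in U, adj G x u]].

(** The subtracted term counts the bipartite patterns that do cut out [D]: rows in [D] are full, all
    other rows are arbitrary but not full. *)
Lemma nt_cap C U D GG : D \subset C -> (forall G, G \in GG -> capn G C U != D) ->
  nt (setX C U) GG <= 2 ^ (#|C| * #|U|) - (2 ^ #|U|).-1 ^ (#|C| - #|D|).
Proof.
move=> sD hG.
pose F x : {set {set T}} := if x \in C then (if x \in D then [set U] else powerset U :\ U) else [set set0].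
pose f (v : {ffun T -> {set T}}) : {set T * T} := [set p | (p.1 \in C) && (p.2 \in v p.1)].
pose Bad := [set f v | v in family F].
have vF v x : v \in family F -> v x \in F x by move=> /familyP.
have cF v x : v \in family F -> x \in C -> x \in D -> v x = U.
  by move=> vf xC xD; have := vF v x vf; rewrite /F xC xD inE => /eqP.
have nF v x : v \in family F -> x \in C -> x \notin D -> v x \subset U /\ v x != U.
  by move=> vf xC xD; have := vF v x vf; rewrite /F xC (negbTE xD) !inE => /andP [-> ->].
have sF v x : v \in family F -> x \in C -> v x \subset U.
  by move=> vf xC; case: (boolP (x \in D)) => xD; [rewrite (cF _ _ vf xC xD)|have [] := nF _ _ vf xC xD].
have cB : #|Bad| = (2 ^ #|U|).-1 ^ (#|C| - #|D|).
  rewrite card_in_imset => [|v v' vf vf' /setP e].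
    rewrite family_card (bigID (fun x => x \in C :\: D)) /= [X in _ * X]big1 ?muln1 => [|x]; last first.
      move=> h; rewrite /F; case: (boolP (x \in C)) => xC; last by rewrite cards1.
      have -> : x \in D by apply: contraNT h => xD; rewrite inE xD.
      by rewrite cards1.
    rewrite (eq_bigr (fun=> (2 ^ #|U|).-1)) => [|x]; last first.
      rewrite in_setD /F => /andP [/negbTE -> ->].
      by rewrite -card_powerset (cardsD1 U (powerset U)) powersetE subxx.
    by rewrite prod_nat_const cardsD (setIidPr sD).
  apply/ffunP => x; case: (boolP (x \in C)) => xC.
    by apply/setP => y; have := e (x, y); rewrite !inE /= xC.
  by have := vF _ x vf; have := vF _ x vf'; rewrite /F (negbTE xC) !inE => /eqP -> /eqP ->.
have sBad : Bad \subset powerset (setX C U).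
  apply/subsetP => _ /imsetP [v vf ->]; rewrite powersetE; apply/subsetP => -[x y]; rewrite !inE /= => /andP [xC].
  by rewrite xC; apply: (subsetP (sF _ _ vf xC)).
apply: leq_trans (nt_family (F := powerset (setX C U) :\: Bad) _) _.
  move=> G GGG; rewrite in_setD powersetE tr_sub andbT; apply/negP => /imsetP [v vf e].
  have {}e x y : x \in C -> y \in U -> adj G x y = (y \in v x).
    by move=> xC yU; have := congr1 (fun S : {set T * T} => (x, y) \in S) e; rewrite in_tr !inE /= xC yU.
  have /negP [] := hG _ GGG; apply/eqP/setP => x; rewrite inE.
  case: (boolP (x \in C)) => xC /=; last by apply/esym/negbTE; apply: contra xC; apply: (subsetP sD).
  case: (boolP (x \in D)) => xD.
    by apply/forall_inP => u uU; rewrite e // (cF _ _ vf).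
  have [s1 s2] := nF _ _ vf xC xD; apply/negbTE; apply: contra s2 => /forall_inP a.
  by rewrite eqEsubset s1; apply/subsetP => u uU; rewrite -e // a.
by rewrite cardsD (setIidPr sBad) card_powerset cardsX cB.
Qed.

Lemma groups Y t : 0 < t -> exists P : {set {set T}}, [/\ trivIset P,
  forall S : {set T}, S \in P -> S \subset Y /\ #|S| = t & #|P| = #|Y| %/ t].
Proof.
move=> t0; have [|P [tP sP mP]] := @maximal_packing T (fun S => #|S| == t) Y.
  by rewrite cards0 eq_sym -lt0n.
have cP : #|cover P| = #|P| * t.
  by rewrite -(eqP tP) -sum_nat_const; apply: eq_bigr => S /sP /andP [/eqP].
have sY : cover P \subset Y by apply/bigcupsP => S /sP /andP [].
exists P; split=> // [S /sP /andP [/eqP]//|].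
have lt : #|Y :\: cover P| < t.
  rewrite ltnNge; apply/negP => le; have [S sS cS] := subset_of_card le.
  by have := mP _ sS; rewrite cS eqxx.
have := cardsID (cover P) Y; rewrite (setIidPr sY) cP => <-.
by rewrite divnMDl // divn_small // addn0.
Qed.

(** [Y] is divided into groups of [t] vertices, and a random group cuts out [D] with probability at
    least [2 ^ -(u + t * #|Ct|)]: full rows on [D] take at most [t * #|Ct|] bits, and
    [2 * #|C| <= 2 ^ t * u] leaves probability [2 ^ -u] for no other row to be full. The factor
    [2 ^ #|Ct|] is the union bound over [D]. *)
Lemma subfull_fail C Ct Y t u GG : 0 < t -> Ct \subset C -> 2 * #|C| <= 2 ^ t * u ->
  (forall G, G \in GG -> exists2 D : {set T}, D \subset Ct & forall U : {set T}, U \subset Y -> #|U| = t -> capn G C U != D) ->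
  nt (setX C Y) GG * 2 ^ (#|Y| %/ t %/ 2 ^ (u + t * #|Ct|)) <= 2 ^ #|Ct| * 2 ^ (#|C| * #|Y|).
Proof.
move=> t0 sC cC hG; set s := _ %/ 2 ^ _; pose b := 2 ^ (#|C| * #|Y|) %/ 2 ^ s.
suff ub : nt (setX C Y) GG <= #|[in powerset Ct]| * b.
  by apply: leq_trans (leq_mul ub (leqnn _)) _; rewrite card_powerset -mulnA leq_mul2l leq_trunc_div orbT.
apply: (nt_union (CC := fun D => [set G in GG | [forall U : {set T}, (U \subset Y) && (#|U| == t) ==> (capn G C U != D)]])).
  move=> G GGG; have [D sD h] := hG _ GGG; exists D; first by rewrite powersetE.
  by rewrite inE GGG; apply/forallP => U; apply/implyP => /andP [sU /eqP]; apply: h.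
move=> D; rewrite powersetE => sD; rewrite leq_divRL ?expn_gt0 //; set HH := [set G in GG | _].
have [P [tP sP cP]] := groups Y t0.
pose N := 2 ^ (#|C| * t); pose A := (2 ^ t).-1 ^ (#|C| - #|D|).
have N0 : 0 < N by rewrite expn_gt0.
have AN : A <= N.
  apply: leq_trans (leq_expW _ (leq_pred _)) _; rewrite -expnM leq_exp2l // mulnC leq_mul2r leq_subr orbT //.
have sDC := subset_trans sD sC.
have NM : N <= 2 ^ (u + t * #|Ct|) * A.
  rewrite /N -{1}(subnK (subset_leq_card sDC)) mulnDl !expnD -mulnA [_ * A]mulnC mulnA.
  apply: leq_mul; last by rewrite leq_exp2l // mulnC leq_mul2l subset_leq_card ?orbT.
  rewrite mulnC expnM; apply: (@pred_pow_le _ (2 ^ t.-1)); rewrite ?expn_gt0 //.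
    by rewrite -expnS prednK.
  rewrite -(leq_pmul2l (isT : 0 < 2)) mulnA -expnS prednK //; apply: leq_trans cC.
  by rewrite leq_mul2l leq_subr.
have cov : setX C Y = (\bigcup_(U in P) setX C U) :|: setX C (Y :\: cover P).
  apply/setP => -[x y]; rewrite !inE /=; apply/andP/orP => [[xX yY]|[/bigcupP [U UP]|/andP [-> /andP [_ ->]]//]].
    case: (boolP (y \in cover P)) => [/bigcupP [U UP yU]|_]; last by right; rewrite xX.
    by left; apply/bigcupP; exists U; rewrite // inE /= xX.
  by rewrite inE /= => /andP [-> yU]; split=> //; apply: (subsetP (sP _ UP).1).
rewrite cov; apply: leq_trans (leq_mul (nt_U _ _ _) (leqnn _)) _.
have h1 : nt (\bigcup_(U in P) setX C U) HH <= (N - A) ^ #|P|.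
  apply: leq_trans (nt_bigU _ _ _) _; rewrite -prod_nat_const; apply: leq_prod => U UP.
  have [sU cU] := sP _ UP; rewrite /N /A -cU; apply: nt_cap => // G; rewrite inE => /andP [_ /forallP /(_ U)].
  by rewrite sU cU eqxx.
have h2 := nt_exp (setX C (Y :\: cover P)) HH; rewrite cardsX in h2.
have cP' : #|cover P| = #|P| * t.
  by rewrite -(eqP tP) -sum_nat_const; apply: eq_bigr => S /sP [].
have sY : cover P \subset Y by apply/bigcupsP => S /sP [].
rewrite mulnAC; apply: leq_trans (leq_mul (leq_mul h1 (leqnn _)) h2) _.
have := pow_half_div #|P| N0 AN NM; rewrite {2}cP -/s => h3.
apply: leq_trans (leq_mul h3 (leqnn _)) _; rewrite /N -expnM -expnD leq_exp2l //.
rewrite -mulnA [t * _]mulnC -cP' -mulnDr leq_mul2l; apply/orP; right.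
by rewrite -[X in _ <= X](cardsID (cover P) Y) (setIidPr sY).
Qed.

(** The row of [y] vanishes on the blocks except for two of them, which are chosen in at most
    [#|BB|.+1 ^ 2] ways. *)
Lemma row_fail BB X y GG hi : trivIset BB -> (forall C, C \in BB -> C \subset X /\ #|C| <= hi) ->
  (forall G, G \in GG -> #|[set C in BB | nb G y :&: C != set0]| <= 2) ->
  nt (setX [set y] X) GG <= #|BB|.+1 ^ 2 * 2 ^ (#|X| - #|cover BB| + 2 * hi).
Proof.
move=> tB sB hG; pose P := [in [set A : {set {set T}} | (A \subset BB) && (#|A| <= 2)]].
apply: leq_trans (_ : #|P| * 2 ^ (#|X| - #|cover BB| + 2 * hi) <= _); last first.
  by rewrite leq_mul2r card_small_subsets orbT.
apply: (nt_union (CC := fun L => [set G in GG | [set C in BB | nb G y :&: C != set0] == L])) => [G GGG|L].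
  exists [set C in BB | nb G y :&: C != set0]; last by rewrite inE GGG eqxx.
  by rewrite /P /= inE hG // andbT; apply/subsetP => C; rewrite inE => /andP [].
rewrite /P /= inE => /andP [sL cL].
have sM : cover BB \subset X by apply/bigcupsP => C /sB [].
apply: leq_trans (nt_row (F := powerset ((X :\: cover BB) :|: cover L)) _) _.
  move=> G; rewrite inE => /andP [GGG /eqP eL]; rewrite powersetE; apply/subsetP => x; rewrite !inE => /andP [a ->].
  rewrite andbT; case: (boolP (x \in cover BB)) => //= /bigcupP [C CB xC]; apply/bigcupP; exists C => //.
  by rewrite -eL inE CB; apply/set0Pn; exists x; rewrite !inE a.
rewrite card_powerset leq_exp2l //; apply: leq_trans (leq_card_setU _ _) _; apply: leq_add.
  by rewrite cardsD (setIidPr sM).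
apply: leq_trans (leq_card_cover L) _; apply: leq_trans (_ : \sum_(C in L) hi <= _).
  by apply: leq_sum => C CL; have [] := sB _ (subsetP sL _ CL).
by rewrite sum_nat_const leq_mul2r cL orbT.
Qed.

Definition shat G A S : bool := [forall R : {set T}, (R \subset S) ==> [exists x in A, nb G x :&: S == R]].

(** Some [R] is missed by every row; for a given [R] a random row misses it with probability
    [1 - 2 ^ -#|S|]. *)
Lemma shat_fail A S GG : (forall G, G \in GG -> ~~ shat G A S) ->
  nt (setX S A) GG * 2 ^ (#|A| %/ 2 ^ #|S|) <= 2 ^ #|S| * 2 ^ (#|S| * #|A|).
Proof.
move=> hG; rewrite nt_setXC.
suff ub : nt (setX A S) GG <= #|[in powerset S]| * (2 ^ #|S| - 1) ^ #|A|.
  apply: leq_trans (leq_mul ub (leqnn _)) _; rewrite card_powerset -mulnA leq_mul2l; apply/orP; right.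
  by rewrite [X in _ <= X]expnM; apply: pow_half_div; rewrite ?expn_gt0 ?muln1.
apply: (nt_union (CC := fun R => [set G in GG | [forall x in A, nb G x :&: S != R]])) => [G GGG|R].
  have := hG _ GGG; rewrite negb_forall => /existsP [R]; rewrite negb_imply => /andP [sR /exists_inPn h].
  by exists R; rewrite ?powersetE // inE GGG; apply/forall_inP.
rewrite powersetE => sR; apply: nt_rows => x xA.
apply: leq_trans (nt_row (F := powerset S :\ R) _) _.
  move=> G; rewrite inE => /andP [_ /forall_inP h]; rewrite !inE h //=; exact: subsetIr.
by rewrite -card_powerset [X in _ <= X - 1](cardsD1 R) powersetE sR add1n subn1.
Qed.

End Cross.

(** * Rich crossing edges *)

Section Classes.
Variable T : finType.
Implicit Types (G : sgraph T) (GG HH : {set sgraph T}) (A B C D E S U V X : {set T}) (BB : {set {set T}}).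
Let n := #|T|.
Variables (W C0 Y : {set T}) (sg c4 : nat).
Let s1 := 8 * sg * 2 ^ c4.

(** The trace on [W] serves as a hash value. As [2 ^ #|W|] is within a factor of two of
    [#|Y| / (4 * sg)], a class has between [4 * sg] and [8 * sg] elements on average. *)
Definition cls G E : {set T} := [set y in Y | nb G y :&: W == E].

Definition goodcls G : bool :=
  [exists E : {set T}, [&& E \subset W, sg <= #|cls G E|, #|cls G E| <= s1 & shat G C0 (cls G E)]].

Definition heavy G : {set T} := [set y in Y | s1 < #|cls G (nb G y :&: W)|].

Lemma cls_sum G BB : #|[set y in Y | nb G y :&: W \in BB]| = \sum_(E in BB) #|cls G E|.
Proof.
rewrite -sum1_card (partition_big (fun y => nb G y :&: W) (mem BB)) /=.
  apply: eq_bigr => E EB; rewrite sum1dep_card; apply: eq_card => y; rewrite !inE.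
  by case: eqP => [->|]; rewrite ?EB ?andbF ?andbT.
by move=> y; rewrite inE => /andP [].
Qed.

Hypotheses (sg0 : 0 < sg) (Yge : 4 * sg * 2 ^ #|W| <= #|Y|) (Yle : #|Y| <= 8 * sg * 2 ^ #|W|).

(** At most [#|Y| / s1], hence at most [2 ^ (#|W| - c4)], traces belong to heavy classes, so each
    heavy vertex loses [c4] bits. The factor [2 ^ (2 * n)] pays for the heavy set and the set of its
    traces. *)
Lemma heavy_count GG : (forall G, G \in GG -> #|Y| <= 2 * #|heavy G|) ->
  nt (setX Y W) GG * 2 ^ (c4 * (#|Y| %/ 2)) <= 2 ^ (2 * n) * 2 ^ (#|Y| * #|W|).
Proof.
move=> hG; pose L := ({set T} * {set {set T}})%type.
pose P (l : L) := [&& l.1 \subset Y, l.2 \subset powerset W, #|l.2| * s1 <= #|Y| & #|Y| <= 2 * #|l.1|].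
pose b := 2 ^ (#|Y| * #|W|) %/ 2 ^ (c4 * (#|Y| %/ 2)).
suff ub : nt (setX Y W) GG <= #|P| * b.
  apply: leq_trans (leq_mul ub (leqnn _)) _; rewrite -mulnA; apply: leq_mul; last exact: leq_trunc_div.
  apply: leq_trans (_ : #|setX (powerset Y) (powerset (powerset W))| <= _).
    by apply: subset_leq_card; apply/subsetP => -[H V]; rewrite unfold_in inE /= !powersetE => /and4P [-> ->].
  rewrite cardsX !card_powerset -expnD leq_exp2l // mul2n -addnn leq_add ?max_card //.
  apply: leq_trans (max_card Y); apply: leq_trans Yge; rewrite leq_pmull // muln_gt0 sg0 //.
apply: (nt_union (CC := fun l : L => [set G in GG | (heavy G == l.1) && [forall y in l.1, nb G y :&: W \in l.2]])).
  move=> G GGG; pose V := [set E in powerset W | s1 < #|cls G E|]; exists (heavy G, V) => /=; last first.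
    rewrite inE GGG eqxx /=; apply/forall_inP => y; rewrite inE => /andP [yY h].
    by rewrite inE powersetE subsetIr.
  rewrite /P /= hG // andbT; apply/and3P; split.
  - by apply/subsetP => y; rewrite inE => /andP [].
  - by apply/subsetP => y; rewrite inE => /andP [].
  - apply: leq_trans (_ : #|[set y in Y | nb G y :&: W \in V]| <= _).
      rewrite cls_sum -sum_nat_const; apply: leq_sum => E; rewrite inE => /andP [_ /ltnW //].
    by apply: subset_leq_card; apply/subsetP => y; rewrite inE => /andP [].
move=> [H V] /and4P /= [sH sV cV cH]; rewrite leq_divRL ?expn_gt0 //; set HH := [set G in GG | _].
have cV' : #|V| * 2 ^ c4 <= 2 ^ #|W|.
  have := leq_trans cV Yle; rewrite /s1; move: #|V| (2 ^ c4) (2 ^ #|W|) => x y z.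
  by rewrite mulnC -!mulnA leq_pmul2l // leq_pmul2l // mulnC.
have YE : setX Y W = setX H W :|: setX (Y :\: H) W.
  apply/setP => -[x y]; rewrite !inE /=; case: (boolP (x \in H)) => [xH|_] //=; by rewrite (subsetP sH _ xH) orbF.
have h1 : nt (setX H W) HH <= #|V| ^ #|H|.
  apply: nt_rows => y yH; apply: nt_row => G; rewrite inE => /andP [_ /andP [_ /forall_inP]]; exact.
have h2 := nt_exp (setX (Y :\: H) W) HH; rewrite cardsX in h2.
apply: leq_trans (_ : nt (setX Y W) HH * 2 ^ (c4 * #|H|) <= _).
  rewrite leq_mul2l leq_exp2l // leq_mul2l; apply/orP; right; apply/orP; right; clear - cH; lia.
rewrite {1}YE; apply: leq_trans (leq_mul (nt_U _ _ _) (leqnn _)) _; rewrite mulnAC.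
apply: leq_trans (leq_mul (leq_mul h1 (leqnn _)) h2) _; rewrite [2 ^ (c4 * _)]expnM -expnMn.
apply: leq_trans (leq_mul (leq_expW _ cV') (leqnn _)) _; rewrite -expnM -expnD leq_exp2l //.
by rewrite [#|W| * _]mulnC -mulnDl leq_mul2r -[X in _ <= X](cardsID H Y) (setIidPr sH) leqnn orbT.
Qed.

(** Fixing the trace on [Y] and [W] fixes all classes. Those that are too small contain at most a
    quarter of [Y] and the heavy ones at most half, so at least [#|Y| / (4 * s1)] classes of medium
    size remain, and each of them independently fails to be shattered from [C0]. *)
Lemma light_count GG t s : (forall G, G \in GG -> [/\ tr (setX Y W) G = t, ~~ goodcls G & 2 * #|heavy G| <= #|Y|]) ->
  s + s1 <= #|C0| %/ 2 ^ s1 -> exists2 m, #|Y| <= 4 * s1 * m &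
  nt (setX Y C0) GG * 2 ^ (s * m) <= 2 ^ m * 2 ^ (#|Y| * #|C0|).
Proof.
move=> hG hs; have s10 : 0 < s1 by rewrite /s1 !muln_gt0 sg0 expn_gt0.
have [->|/set0Pn [G0 GG0]] := eqVneq GG set0.
  exists #|Y|; first by rewrite leq_pmull // muln_gt0 s10.
  by rewrite /nt imset0 cards0.
have [tr0 ng0 nh0] := hG _ GG0.
have same G E : G \in GG -> cls G E = cls G0 E.
  move=> /hG [+ _ _]; rewrite -tr0 => /eqP/trP ee; apply/setP => y; rewrite !inE; case: (boolP (y \in Y)) => //= yY.
  suff -> : nb G y :&: W = nb G0 y :&: W by [].
  apply/setP => x; rewrite !inE; case: (boolP (x \in W)) => xW; rewrite ?andbF // !andbT.
  by apply: ee; rewrite inE /= yY.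
pose V := [set E in powerset W | (sg <= #|cls G0 E|) && (#|cls G0 E| <= s1)].
pose M := cls G0 @: V.
have clsE E y : y \in cls G0 E -> nb G0 y :&: W = E by rewrite inE => /andP [_ /eqP].
have cM : #|M| = #|V|.
  apply: card_in_imset => E E'; rewrite inE => /and3P [_ h _] _ e.
  have /card_gt0P [y yE] : 0 < #|cls G0 E| by apply: leq_trans h.
  by rewrite -(clsE _ _ yE); rewrite e in yE; apply: clsE.
have tM : trivIset M.
  apply/trivIsetP => _ _ /imsetP [E _ ->] /imsetP [E' _ ->] ne; apply/pred0P => y /=; apply/negP => /andP [h h'].
  by case/eqP: ne; rewrite -(clsE _ _ h) -(clsE _ _ h').
exists #|V|.
  have h1 : #|[set y in Y | nb G0 y :&: W \in V]| <= #|V| * s1.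
    by rewrite cls_sum -sum_nat_const; apply: leq_sum => E; rewrite inE => /and3P [].
  pose V0 := [set E in powerset W | #|cls G0 E| < sg].
  have h0 : #|[set y in Y | nb G0 y :&: W \in V0]| <= 2 ^ #|W| * sg.
    apply: leq_trans (_ : #|V0| * sg <= _); last first.
      rewrite leq_mul2r -card_powerset; apply/orP; right; apply: subset_leq_card.
      by apply/subsetP => E; rewrite inE => /andP [].
    by rewrite cls_sum -sum_nat_const; apply: leq_sum => E; rewrite inE => /andP [_ /ltnW].
  have : #|Y| <= #|[set y in Y | nb G0 y :&: W \in V0]| + #|[set y in Y | nb G0 y :&: W \in V]| + #|heavy G0|.
    apply: leq_trans (_ : #|([set y in Y | nb G0 y :&: W \in V0] :|: [set y in Y | nb G0 y :&: W \in V]) :|: heavy G0| <= _).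
      apply: subset_leq_card; apply/subsetP => y yY; rewrite !inE !yY /= subsetIr /=.
      case: (leqP sg) => //= _; by case: leqP; rewrite ?orbT.
    apply: leq_trans (leq_card_setU _ _) _; rewrite leq_add2r; exact: leq_card_setU.
  move: h0 h1 nh0 Yge; move: #|_| #|_| #|_| (2 ^ _) (#|Y|) (#|V|) => a b c d e f; rewrite -!mulnA; clear; nia.
rewrite -cM; have := @many_fail _ M (fun G S => ~~ shat G C0 S) s 0 GG Y C0 tM; rewrite subn0; apply.
- by move=> _ /imsetP [E _ ->]; apply/subsetP => y; rewrite inE => /andP [].
- move=> C HH /imsetP [E]; rewrite inE => /and3P [_ _ c1] -> hH _.
  rewrite -(leq_pmul2r (_ : 0 < 2 ^ #|cls G0 E|)) ?expn_gt0 //.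
  rewrite [X in _ <= X]mulnC; apply: leq_trans (shat_fail hH); rewrite -mulnA leq_mul2l -expnD leq_exp2l //.
  apply/orP; right; apply: leq_trans (_ : s + s1 <= _); first by rewrite leq_add2l.
  by apply: leq_trans hs _; apply: leq_div2l; rewrite ?expn_gt0 // leq_exp2l.
- move=> G GGG; rewrite addn0; apply: subset_leq_card; apply/subsetP => _ /imsetP [E EV ->].
  rewrite inE imset_f //=; have [_ ng _] := hG _ GGG; apply: contra ng => sh; apply/existsP; exists E.
  by move: EV; rewrite !inE same // => /and3P [-> -> ->].
Qed.

Lemma class_fail GG s a : (forall G, G \in GG -> ~~ goodcls G) -> s + s1 <= #|C0| %/ 2 ^ s1 -> 0 < s ->
  a + 2 * n <= c4 * (#|Y| %/ 2) -> 4 * s1 * a <= s.-1 * #|Y| ->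
  nt (setX Y W :|: setX Y C0) GG * 2 ^ a <= 2 * 2 ^ (#|Y| * #|W| + #|Y| * #|C0|).
Proof.
move=> hG hs s0 ha1 ha2; have s10 : 0 < s1 by rewrite /s1 !muln_gt0 sg0 expn_gt0.
pose b := 2 ^ (#|Y| * #|W| + #|Y| * #|C0|) %/ 2 ^ a.
suff ub : nt (setX Y W :|: setX Y C0) GG <= #|xpredT : pred bool| * b.
  apply: leq_trans (leq_mul ub (leqnn _)) _; rewrite card_bool -mulnA leq_mul2l leq_trunc_div orbT //.
apply: (nt_union (CC := fun k => [set G in GG | (#|Y| <= 2 * #|heavy G|) == k])) => [G GGG|k _].
  by exists (#|Y| <= 2 * #|heavy G|); rewrite // inE GGG eqxx.
rewrite leq_divRL ?expn_gt0 //; set HH := [set G in GG | _]; case: k @HH => HH.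
  have h1 : nt (setX Y W) HH * 2 ^ (c4 * (#|Y| %/ 2)) <= 2 ^ (2 * n) * 2 ^ (#|Y| * #|W|).
    by apply: heavy_count => G; rewrite inE => /andP [_ /eqP].
  have h1' : nt (setX Y W) HH * 2 ^ a <= 2 ^ (#|Y| * #|W|).
    rewrite -(leq_pmul2l (_ : 0 < 2 ^ (2 * n))) ?expn_gt0 //; apply: leq_trans h1.
    by rewrite mulnCA leq_mul2l -expnD leq_exp2l // addnC ha1 orbT.
  have h2 := nt_exp (setX Y C0) HH; rewrite cardsX in h2.
  apply: leq_trans (leq_mul (nt_U _ _ _) (leqnn _)) _; rewrite mulnAC expnD; exact: leq_mul.
apply: leq_trans (_ : nt (setX Y W) HH * (2 ^ (#|Y| * #|C0|) %/ 2 ^ a) * 2 ^ a <= _).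
  rewrite leq_mul2r; apply/orP; right; apply: nt_fiber => t.
  set HT := [set G in HH | _].
  have [|m hm ub] := @light_count HT t s _ hs.
    move=> G; rewrite !inE => /andP [/andP [GGG /eqP h] /eqP ht]; split=> //; first exact: hG.
    by apply: ltnW; rewrite ltnNge h.
  rewrite leq_divRL ?expn_gt0 //.
  apply: leq_trans (_ : nt (setX Y C0) HT * 2 ^ a <= _).
    rewrite leq_mul2r; apply/orP; right; apply: leq_trans (nt_U _ _ _) _.
    rewrite -[X in _ <= X]mul1n leq_mul2r; apply/orP; right; apply: (nt1 (t := t)) => G.
    by rewrite inE => /andP [_ /eqP].
  have am : a <= s.-1 * m.
    have s14 : 0 < 4 * s1 by rewrite muln_gt0.
    rewrite -(leq_pmul2l s14); apply: leq_trans ha2 _.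
    by rewrite mulnCA leq_mul2l hm orbT.
  rewrite -(leq_pmul2l (_ : 0 < 2 ^ m)) ?expn_gt0 //; apply: leq_trans ub.
  rewrite mulnCA leq_mul2l -expnD leq_exp2l //; apply/orP; right.
  by rewrite -[X in _ <= X * _](prednK s0) mulSn leq_add2l.
rewrite -mulnA; have h := nt_exp (setX Y W) HH; rewrite cardsX in h; rewrite expnD.
by apply: leq_mul => //; exact: leq_trunc_div.
Qed.

End Classes.

(** * Failure of the crossing properties of medium blocks *)

Section Rich.
Variable T : finType.
Implicit Types (G : sgraph T) (GG HH : {set sgraph T}) (A B C D E S U V X Y : {set T}) (BB : {set {set T}}).
Let n := #|T|.

Definition medblocks lo hi G X : {set {set T}} := [set blkof G X x | x in medium lo hi G X].

(** [enum] makes the choice depend on the set alone; graphs with the same blocks therefore share the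
    chosen parts. *)
Definition pickn k A : {set T} := [set x in take k (enum A)].

Lemma pickn_sub k A : pickn k A \subset A.
Proof. by apply/subsetP => x; rewrite inE => /mem_take; rewrite mem_enum. Qed.

Lemma card_pickn k A : k <= #|A| -> #|pickn k A| = k.
Proof.
move=> h; rewrite cardsE (card_uniqP _) ?take_uniq ?enum_uniq // size_take -cardE.
by case: ltnP => // h'; apply/eqP; rewrite eqn_leq h h'.
Qed.

Definition subfull t G C (Ct : {set T}) Y : bool :=
  [forall D : {set T}, (D \subset Ct) ==> [exists U : {set T}, [&& U \subset Y, #|U| == t & capn G C U == D]]].

(** The last property is stated for all tuples of medium blocks, because the blocks to which it is
    applied are selected only afterwards, among those with the second property. The first one makes
    most of [Y] recognisable by three independent neighbours. *)
Definition xrich lo hi t r J1 w sg c4 G X Y : bool :=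
  let BB := medblocks lo hi G X in
  [&& #|[set y in Y | #|[set C in BB | nb G y :&: C != set0]| <= 2]| <= J1,
   r < #|[set C in BB | subfull t G C (pickn lo C) Y]| &
   [forall f : {ffun 'I_r.+1 -> {set T}}, injectiveb f && [forall i, f i \in BB] ==>
     goodcls (pickn w (\bigcup_(i | i != ord0) pickn lo (f i))) (pickn lo (f ord0)) Y sg c4 G]].

Lemma medblocksP lo hi G X : P3free G X -> [/\ trivIset (medblocks lo hi G X),
  forall C, C \in medblocks lo hi G X -> [/\ C \subset X, lo <= #|C| <= hi & C != set0], cover (medblocks lo hi G X) = medium lo hi G X &
  #|medblocks lo hi G X| <= n].
Proof.
move=> fX; have inB x z : z \in blkof G X x -> x \in X -> z \in X /\ blkof G X z = blkof G X x.
  rewrite inE => /andP [zX /orP [/eqP ->//|a]] xX; split=> //; exact/esym/blkof_eq.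
split.
- apply/trivIsetP => _ _ /imsetP [x xM ->] /imsetP [y yM ->] ne.
  have xX : x \in X by move: xM; rewrite inE => /andP [].
  have yX : y \in X by move: yM; rewrite inE => /andP [].
  apply/pred0P => z /=; apply/negP => /andP [/inB /(_ xX) [_ e1] /inB /(_ yX) [_ e2]].
  by case/eqP: ne; rewrite -e1 -e2.
- move=> _ /imsetP [x xM ->]; move: xM; rewrite inE => /andP [xX ->]; split=> //; first exact: blkof_sub.
  by apply/set0Pn; exists x; apply: blkof_self.
- apply/setP => z; apply/bigcupP/idP => [[_ /imsetP [x xM ->]]|zM].
    move: xM; rewrite inE => /andP [xX h] /inB /(_ xX) [zX e]; by rewrite inE zX e.
  exists (blkof G X z); first by apply/imsetP; exists z.
  by apply: blkof_self; move: zM; rewrite inE => /andP [].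
- by apply: leq_trans (leq_imset_card _ _) (max_card _).
Qed.

Lemma medblocks_tr lo hi G G' X : tr (setX X X) G = tr (setX X X) G' -> medblocks lo hi G X = medblocks lo hi G' X.
Proof.
move=> /eqP/trP e; have be x : x \in X -> blkof G X x = blkof G' X x.
  move=> xX; apply/setP => y; rewrite !inE; case: (boolP (y \in X)) => //= yX; rewrite e // inE /=; by rewrite xX yX.
have -> : medblocks lo hi G X = [set blkof G' X x | x in medium lo hi G X].
  by apply: eq_in_imset => x; rewrite inE => /andP [xX _]; apply: be.
have -> : medium lo hi G X = medium lo hi G' X; last by [].
apply/setP => x; rewrite !inE; case: (boolP (x \in X)) => //= xX; by rewrite be.
Qed.

Variables (X Y : {set T}) (lo hi t r J1 w sg c4 u Cp lam s : nat) (t0 : {set T * T}).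
Let s1 := 8 * sg * 2 ^ c4.
Hypotheses (n1 : n.+1 <= 2 ^ lam.+1) (nX : n <= 3 * #|X|) (nY : n <= 3 * #|Y|) (n20 : 20 <= n)
  (H1 : 20 * (2 * lam.+1 + 2 * hi) <= n) (J1E : J1 = 40 * (Cp + 4)) (J1n : 3 * J1 <= n)
  (H2 : (12 * (Cp + 4) * hi + lo) * 2 ^ (u + t * lo) * t <= #|Y|) (t0' : 0 < t) (H2u : 2 * hi <= 2 ^ t * u)
  (H2r : 12 * (r * hi) <= n)
  (sg0 : 0 < sg) (Yge : 4 * sg * 2 ^ w <= #|Y|) (Yle : #|Y| <= 8 * sg * 2 ^ w) (wr : w <= r * lo)
  (hs : s + s1 <= lo %/ 2 ^ s1) (s0 : 0 < s) (H3 : (Cp + 4) * n + 2 * n <= c4 * (#|Y| %/ 2))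
  (H3' : 4 * s1 * ((Cp + 4) * n) <= s.-1 * #|Y|) (H3r : n ^ r.+1 <= 2 ^ n).

Lemma cross_count GG : (forall G, G \in GG -> [/\ tr (setX X X) G = t0, P3free G X,
    #|X| <= 2 * #|medium lo hi G X| & ~~ xrich lo hi t r J1 w sg c4 G X Y]) ->
  nt (setX X Y) GG * 2 ^ (Cp * n) <= 2 ^ (#|X| * #|Y|).
Proof.
move=> hG; have [->|/set0Pn [G0 GG0]] := eqVneq GG set0; first by rewrite /nt imset0 cards0.
have [tr0 fX0 med0 _] := hG _ GG0; pose BB := medblocks lo hi G0 X.
have [tB sB cB nB] := medblocksP lo hi fX0; rewrite -/BB in tB sB cB nB.
have BE G : G \in GG -> medblocks lo hi G X = BB by move=> /hG [e _ _ _]; apply: medblocks_tr; rewrite e.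
have MX : n <= 6 * #|cover BB| by rewrite cB; clear - med0 nX; lia.
pose c1 G := #|[set y in Y | #|[set C in BB | nb G y :&: C != set0]| <= 2]| <= J1.
pose c2 G := r < #|[set C in BB | subfull t G C (pickn lo C) Y]|.
pose b := 2 ^ (#|X| * #|Y|) %/ 2 ^ ((Cp + 2) * n).
suff ub : nt (setX X Y) GG <= #|xpredT : pred 'I_3| * b.
  apply: leq_trans (leq_mul ub (leqnn _)) _; rewrite card_ord; apply: leq_trans (_ : 2 ^ (2 * n) * b * 2 ^ (Cp * n) <= _).
    rewrite leq_mul2r leq_mul2r; apply/orP; right; apply/orP; right; apply: leq_trans (_ : 2 ^ 2 <= _) => //.
    by rewrite leq_exp2l // -[X in X <= _]muln1 leq_mul2l /=; clear - n20; lia.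
  by rewrite mulnAC -expnD -mulnDl [2 + Cp]addnC mulnC leq_trunc_div.
pose CC (k : 'I_3) := [set G in GG | if val k is 0 then ~~ c1 G else if val k is 1 then ~~ c2 G else c1 G && c2 G].
apply: (nt_union (CC := CC)) => [G GGG|k _].
  rewrite /CC; case h1: (c1 G); last by exists ord0; rewrite // inE GGG /= h1.
  case h2: (c2 G); last by exists (lift ord0 ord0); rewrite // inE GGG /= h2.
  by exists (lift ord0 (lift ord0 ord0)); rewrite // inE GGG /= h1 h2.
rewrite leq_divRL ?expn_gt0 //; have sC : CC k \subset GG by apply/subsetP => G; rewrite inE => /andP [].
have nn : 2 ^ n * 2 ^ (#|X| * #|Y|) * 2 ^ ((Cp + 2) * n) <= 2 ^ ((Cp + 4) * n) * 2 ^ (#|X| * #|Y|).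
  rewrite mulnAC leq_mul2r -expnD leq_exp2l // -mulSn leq_mul2r; apply/orP; right; apply/orP; right; clear; lia.
have fin z a : a <= 2 ^ n -> nt (setX X Y) (CC k) * 2 ^ z <= a * 2 ^ (#|X| * #|Y|) -> (Cp + 4) * n <= z ->
    nt (setX X Y) (CC k) * 2 ^ ((Cp + 2) * n) <= 2 ^ (#|X| * #|Y|).
  move=> ha hz zz; rewrite -(leq_pmul2r (_ : 0 < 2 ^ ((Cp + 4) * n))) ?expn_gt0 // mulnAC.
  rewrite [X in _ <= X]mulnC; apply: leq_trans nn; rewrite leq_mul2r; apply/orP; right.
  apply: leq_trans (_ : nt (setX X Y) (CC k) * 2 ^ z <= _); first by rewrite leq_mul2l leq_exp2l ?zz ?orbT.
  by apply: leq_trans hz _; rewrite leq_mul2r ha orbT.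
have [k0|k0] := eqVneq (val k) 0.
  (* For the first property the sides are exchanged, and the singletons of [Y] serve as the blocks
     of [many_fail]. *)
  pose YY := [set [set y] | y in Y].
  have cY : #|YY| = #|Y| by apply: card_imset; apply: set1_inj.
  have J1Y : J1 <= #|Y| by clear - J1n nY; lia.
  apply: (fin (n %/ 20 * J1) (2 ^ #|YY|)); first by rewrite cY leq_exp2l // max_card.
    rewrite nt_setXC [#|X| * _]mulnC.
    have := @many_fail _ YY (fun G S => [exists y, (S == [set y]) && (#|[set C in BB | nb G y :&: C != set0]| <= 2)])
      (n %/ 20) (#|Y| - J1) (CC k) Y X; rewrite [in #|YY| - _]cY subKn //; apply.
    - apply/trivIsetP => _ _ /imsetP [x _ ->] /imsetP [y _ ->] ne.
      by rewrite disjoints1 inE; apply: contraNneq ne => ->.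
    - by move=> _ /imsetP [x xY ->]; rewrite sub1set.
    - move=> _ HH /imsetP [y yY ->] hH _; rewrite cards1 mul1n.
      have /= := @row_fail _ BB X y HH hi tB _ _; rewrite -/n; move=> /(_ _ _) h.
      apply: leq_trans (leq_mul (h _ _) (leqnn _)) _.
      + by move=> C /sB [? /andP [_ ?] _].
      + by move=> G /hH /existsP [y' /andP [/eqP /set1_inj ->]].
      have bb : #|BB|.+1 ^ 2 <= 2 ^ (2 * lam.+1).
        by rewrite [2 * _]mulnC expnM; apply: leq_expW; apply: leq_trans n1.
      apply: leq_trans (leq_mul (leq_mul bb (leqnn _)) (leqnn _)) _; rewrite -!expnD leq_exp2l //.
      have cX : #|cover BB| <= #|X| by apply: subset_leq_card; apply/bigcupsP => C /sB [].
      by move: MX H1 cX; move: #|cover BB| #|X|; clear; lia.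
    - move=> G; rewrite inE => /andP [_]; rewrite k0 -ltnNge => h; rewrite cY.
      apply: leq_trans (_ : J1 + (#|Y| - J1) <= _); first by rewrite subnKC.
      rewrite leq_add2r; apply: leq_trans (ltnW h) _; rewrite -(card_imset _ set1_inj).
      apply: subset_leq_card; apply/subsetP => _ /imsetP [y yB ->].
      move: yB; rewrite inE => /andP [yY cy]; rewrite inE imset_f //=; apply/existsP; exists y.
      by rewrite eqxx cy.
  rewrite J1E; have : n <= n %/ 20 * 40 by clear - n20; lia.
  by move: (n %/ 20) => z; clear; nia.
have [k1|k1] := eqVneq (val k) 1.
  apply: (fin (12 * (Cp + 4) * hi * (#|BB| - r)) (2 ^ #|BB|)); first by rewrite leq_exp2l.
    apply: (@many_fail _ BB (fun G C => ~~ subfull t G C (pickn lo C) Y)) => //.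
    - by move=> C /sB [].
    - move=> C HH /sB [sCX /andP [c1' c2'] _] hH _.
      have cp := card_pickn c1'.
      have hf := @subfull_fail _ C (pickn lo C) Y t u HH t0' (pickn_sub _ _).
      rewrite cp in hf; rewrite -(leq_pmul2l (_ : 0 < 2 ^ lo)) ?expn_gt0 //; apply: leq_trans (hf _ _).
      + rewrite mulnCA leq_mul2l -expnD leq_exp2l //; apply/orP; right.
        by rewrite leq_divRL ?expn_gt0 // leq_divRL // [lo + _]addnC.
      + by apply: leq_trans H2u; rewrite leq_mul2l c2'.
      + move=> G /hH; rewrite negb_forall => /existsP [D]; rewrite negb_imply => /andP [sD /existsPn h].
        exists D => // U sU cU; have := h U; by rewrite sU cU eqxx.
    - move=> G; rewrite inE => /andP [_]; rewrite k1 /= -leqNgt => h.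
      rewrite -(cardsID [set C | subfull t G C (pickn lo C) Y] BB) addnC leq_add //.
        apply: subset_leq_card; apply/subsetP => C; rewrite !inE => /andP [-> ->] //.
      apply: leq_trans h; apply: subset_leq_card; apply/subsetP => C; rewrite !inE => /andP [-> ->] //.
  have hc : #|cover BB| <= #|BB| * hi.
    apply: leq_trans (leq_card_cover BB) _; rewrite -sum_nat_const; apply: leq_sum => C /sB [_ /andP [] //].
  have : n <= 12 * (hi * (#|BB| - r)).
    by rewrite mulnBr; move: hc MX H2r; rewrite [#|BB| * _]mulnC [r * _]mulnC; move: (hi * #|BB|) (hi * r) #|cover BB|; clear; lia.
  by move=> h; rewrite -[X in _ <= X]mulnA; move: (hi * (#|BB| - r)) h => z; clear; nia.
have k2 : CC k = [set G in GG | c1 G && c2 G].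
  apply/setP => G; rewrite !inE; case: k k0 k1 {sC nn fin} => [[|[|[|m]]] hm] //.
(* For the third property, a union bound over the at most [n ^ r.+1] tuples of blocks. *)
pose P (f : {ffun 'I_r.+1 -> {set T}}) := injectiveb f && [forall i, f i \in BB].
have cP : #|P| <= 2 ^ n.
  apply: leq_trans H3r; apply: leq_trans (_ : #|ffun_on (mem BB) : {pred {ffun 'I_r.+1 -> {set T}}}| <= _).
    by apply: subset_leq_card; apply/subsetP => f /andP [_ /forallP h]; apply/ffun_onP.
  by rewrite card_ffun_on card_ord; apply: leq_expW.
pose b' := 2 * 2 ^ (#|X| * #|Y|) %/ 2 ^ ((Cp + 4) * n).
suff ub : nt (setX X Y) (CC k) <= #|P| * b'.
  apply: leq_trans (leq_mul ub (leqnn _)) _.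
  rewrite -(leq_pmul2r (_ : 0 < 2 ^ (2 * n))) ?expn_gt0 // -mulnA -expnD -mulnDl.
  have -> : Cp + 2 + 2 = Cp + 4 by clear; lia.
  rewrite -mulnA; apply: leq_trans (leq_mul cP (leq_trunc_div _ _)) _.
  rewrite mulnA [X in _ <= X]mulnC leq_mul2r; apply/orP; right; rewrite -expnSr leq_exp2l //; clear - n20; lia.
apply: (nt_union (CC := fun f : {ffun 'I_r.+1 -> {set T}} => [set G in GG |
  ~~ goodcls (pickn w (\bigcup_(i | i != ord0) pickn lo (f i))) (pickn lo (f ord0)) Y sg c4 G])) => [G|f].
  rewrite k2 inE => /andP [GGG /andP [h1 h2]]; have [_ _ _] := hG _ GGG; rewrite /xrich BE // -/(c1 G) -/(c2 G) h1 h2 /=.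
  by rewrite negb_forall => /existsP [f]; rewrite negb_imply => /andP [Pf ng]; exists f; rewrite // inE GGG.
move=> /andP [/injectiveP fi /forallP fB]; set W := pickn w _; set C0 := pickn lo (f ord0); set HH := [set G in GG | _].
have cl i : #|pickn lo (f i)| = lo by have [_ /andP [h _] _] := sB _ (fB i); apply: card_pickn.
have dj i j : i != j -> [disjoint f i & f j].
  by move=> ij; move/trivIsetP: tB; apply=> //; apply: contra ij => /eqP /fi ->.
have cU : #|\bigcup_(i | i != ord0) pickn lo (f i)| = r * lo.
  rewrite big_mkcond /= -sum1_card partition_disjoint_bigcup /=; last first.
    move=> i j /dj h; case: (i != ord0); last by rewrite disjoints_subset sub0set.
    case: (j != ord0); last by rewrite disjoints_subset setC0 subsetT.
    apply/pred0P => x /=; apply/negP => /andP [xi xj].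
    by have := disjointFr h (subsetP (pickn_sub _ _) _ xi); rewrite (subsetP (pickn_sub _ _) _ xj).
  rewrite (eq_bigr (fun i => if i != ord0 then lo else 0)) => [|i _]; last first.
    by rewrite sum1_card; case: ifP => _; rewrite ?cl ?cards0.
  rewrite -big_mkcond /=.
  rewrite sum_nat_const; congr (_ * _); rewrite (eq_card (_ : _ =i predC1 ord0)) // cardC1 card_ord //.
have cW : #|W| = w by apply: card_pickn; rewrite cU.
have sf i : pickn lo (f i) \subset X by apply: subset_trans (pickn_sub _ _) _; have [] := sB _ (fB i).
have sW : W \subset X by apply: subset_trans (pickn_sub _ _) _; apply/bigcupsP => i _.
have dW : [disjoint W & C0].
  apply/pred0P => x /=; apply/negP => /andP [/(subsetP (pickn_sub _ _)) /bigcupP [i i0 xi] xC].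
  have := dj _ _ i0; rewrite disjoint_subset => /subsetP /(_ x (subsetP (pickn_sub _ _) _ xi)).
  by rewrite inE (subsetP (pickn_sub _ _) _ xC).
have := @class_fail _ W C0 Y sg c4 sg0; rewrite cW /C0 cl -/C0 -/n -/s1 => /(_ Yge Yle HH s ((Cp + 4) * n)) cf.
have {cf} cf := cf _ hs s0 H3 H3'.
rewrite leq_divRL ?expn_gt0 //.
have XE : setX Y X = (setX Y W :|: setX Y C0) :|: setX Y (X :\: (W :|: C0)).
  apply/setP => -[y x]; rewrite in_setU in_setU !in_setX in_setD in_setU; case: (y \in Y) => //=.
  case: (boolP (x \in W)) => xW /=; first by rewrite (subsetP sW).
  by case: (boolP (x \in C0)) => xC //=; rewrite (subsetP (sf ord0)).
rewrite nt_setXC XE; apply: leq_trans (leq_mul (nt_U _ _ _) (leqnn _)) _; rewrite mulnAC.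
have h2 := nt_exp (setX Y (X :\: (W :|: C0))) HH; rewrite cardsX in h2.
apply: leq_trans (leq_mul (cf _) h2) _; first by move=> G; rewrite inE => /andP [].
rewrite -mulnA -expnD leq_mul2l /= leq_exp2l // -!mulnDr [#|X| * _]mulnC leq_mul2l; apply/orP; right.
rewrite cardsD (setIidPr _) ?subUset ?sW ?sf // cardsU (disjoint_setI0 dW) cards0 subn0 cW cl.
have : #|W :|: C0| <= #|X| by apply: subset_leq_card; rewrite subUset sW sf.
by rewrite cardsU (disjoint_setI0 dW) cards0 subn0 cW cl; clear; lia.
Qed.

End Rich.

(** * Combination of the counts *)

(** Moving [A] by [d] away from [n / 2] gains at most [lam.+1 * d] bits in the power of [g] and
    loses [d * d - d] crossing bits; the difference never exceeds [n] because [lam + 2] is at most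
    the square root of [n]. *)
Lemma balance n lam g A B : g <= 2 ^ lam.+1 -> 0 < g -> (lam + 2) * (lam + 2) <= n -> A + B = n ->
  g ^ A * 2 ^ (A * B) <= g ^ (n %/ 2) * 2 ^ (n * n %/ 4) * 2 ^ n.
Proof.
move=> gl g0 ln AB; have AB4 : A * B <= n * n %/ 4.
  by rewrite leq_divRL // mulnC mulnn -AB; exact: nat_AGM2.
have [le|lt] := leqP A (n %/ 2).
  rewrite -mulnA; apply: leq_mul; first by rewrite leq_pexp2l.
  by rewrite -expnD leq_exp2l // (leq_trans AB4) // leq_addr.
have [d dE] : exists d, A = n %/ 2 + d by exists (A - n %/ 2); rewrite subnKC // ltnW.
rewrite {1}dE expnD -!mulnA leq_mul2l; apply/orP; right.
apply: leq_trans (_ : 2 ^ (lam.+1 * d) * 2 ^ (A * B) <= _).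
  by rewrite leq_mul2r; apply/orP; right; rewrite [X in _ <= X]expnM; apply: leq_expW.
rewrite -!expnD leq_exp2l //.
have h : A * B + d * d <= n * n %/ 4 + d.
  rewrite -(leq_add2r 1) -ltnS; have -> : n * n %/ 4 = (n %/ 2) * (n - n %/ 2).
    have [k [kE|kE]] : exists k, n = 2 * k \/ n = 2 * k + 1 by exists (n %/ 2); clear; lia.
      rewrite kE mulKn // (_ : 2 * k * (2 * k) = k * k * 4) ?mulnK //; first by clear; nia.
      by clear; nia.
    have -> : n %/ 2 = k by clear - kE; lia.
    rewrite kE (_ : (2 * k + 1) * (2 * k + 1) = k * (k + 1) * 4 + 1); last by clear; nia.
    by rewrite divnMDl // divn_small // addn0; congr (_ * _); clear; lia.
  have : n - n %/ 2 <= n %/ 2 + 1 by clear; lia.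
  have := leq_divM n 2; move: dE AB; clear; move: (n %/ 2) => h; nia.
have h2 : lam.+1 * d + d <= d * d + n.
  have [dl|dl] := leqP d (lam + 2); last by clear - dl; nia.
  have := leq_trans (leq_mul dl (leqnn (lam + 2))) ln; clear; nia.
move: h h2; move: (A * B) (d * d) (n * n %/ 4) (lam.+1 * d); clear; lia.
Qed.

(** * Graphs with a prescribed label for sides and exceptional vertices *)

Section Labels.
Variable T : finType.
Implicit Types (G : sgraph T) (GG HH : {set sgraph T}) (A B C I K S U V X Y : {set T}).
Let n := #|T|.
Variables (K4 E N lam g C2 lo hi t r J1 sg c4 J0 : nat).
(** A hierarchy of scales: [e] bounds the vertices outside [K] and [X], [h] the deviation from
    homogeneity or from a block, [w] is the number of disjoint edges or non-edges that counts as
    many, and [d] is the net gain of an exceptional vertex. [N] is large against [E], and [E]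
    against [K4]. *)
Let e := n %/ N.
Let h := n %/ E.
Let w := n %/ 40.
Let d := n %/ K4.
Let wY Y := trunc_log 2 (#|Y| %/ (4 * sg)).

Definition good G : Prop := exists X Y, [/\ clique G Y, P3free G X, [disjoint X & Y],
  #|~: (X :|: Y)| <= J0 & [/\ n <= 3 * #|X|, n <= 3 * #|Y| & xrich lo hi t r J1 (wY Y) sg c4 G X Y]].

Hypotheses (lam1 : 0 < lam) (nlam : 2 ^ lam <= n) (glam : g * lam <= n) (glam' : n < g.+1 * lam)
  (g4 : 2 ^ (lam %/ 2) <= g) (lam8 : 8 <= lam) (n2 : 2 * lam <= n) (n1 : n.+1 <= 2 ^ lam.+1)
  (hK4 : K4 = 200 * 200) (hE : E = 256 * (K4 * K4)) (hN : N = 200 * (E * E))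
  (hlam : 8 * K4 * (lam + 4) <= n) (lam2 : (lam + 2) * (lam + 2) <= n) (lamL : 50 * 50 <= lam)
  (J0E : J0 = 2 * K4 * 23) (C2E : C2 = 19) (loE : lo * (144 * (C2 + 20)) <= lam) (hiE : hi = 2 ^ (24 * (C2 + 20)) * lam).
Hypothesis cross : forall X Y t0 GG, n <= 3 * #|X| -> n <= 3 * #|Y| ->
  (forall G, G \in GG -> [/\ tr (setX X X) G = t0, P3free G X,
    #|X| <= 2 * #|medium lo hi G X| & ~~ xrich lo hi t r J1 (wY Y) sg c4 G X Y]) ->
  nt (setX X Y) GG * 2 ^ (26 * n) <= 2 ^ (#|X| * #|Y|).

Lemma eN : 100 * (100 * e) <= n.
Proof.
have := leq_divM n N; rewrite -/e => h0; apply: leq_trans h0; rewrite mulnA mulnC leq_mul2l; apply/orP; right.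
rewrite hN hE hK4; clear; lia.
Qed.

Lemma en : 32 * K4 * e <= n.
Proof.
have := leq_divM n N; rewrite -/e => h0; apply: leq_trans h0; rewrite mulnC leq_mul2l; apply/orP; right.
have K40 : 0 < K4 by rewrite hK4.
have h1 : 256 * K4 <= E by rewrite hE leq_mul2l leq_pmull.
have h2 : E <= E * E by rewrite leq_pmull //; apply: leq_trans h1; rewrite muln_gt0.
by rewrite hN; clear - h1 h2; lia.
Qed.

Lemma dn : n <= d * (2 * K4) /\ d * K4 <= n.
Proof.
have K40 : 0 < K4 by rewrite hK4.
split; last exact: leq_divM.
have := ltn_ceil n K40; rewrite -/d => h1; have : 0 < d.
  by rewrite divn_gt0 //; apply: leq_trans hlam; rewrite addn4; clear; nia.
by move: h1; clear; nia.
Qed.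

(** The bound of [card_sparse_sets] for sets of size at most [4 * h]. Both exponents are about
    [n / (8 * K4)] since [E = 256 * (K4 * K4)]. *)
Let Ga := 2 ^ (n %/ (8 * K4)).+1 * 2 ^ (8 * K4 * (4 * h)).

Lemma cost_le p : p <= 3 * e -> n.+1 * Ga * 2 ^ e * 2 ^ p <= 2 ^ d.
Proof.
move=> pe; apply: leq_trans (_ : 2 ^ lam.+1 * Ga * 2 ^ e * 2 ^ p <= _); first by rewrite !leq_mul2r n1 !orbT.
rewrite /Ga -!expnD leq_exp2l //.
have K40 : 0 < K4 by rewrite hK4.
have a1 := leq_divM n (8 * K4); have a2 := ltn_ceil n K40; rewrite -/d in a2; have a3 := en.
have a4 : 8 * K4 * (8 * K4 * (4 * h)) <= n.
  by have := leq_divM n E; rewrite -/h; apply: leq_trans; rewrite hE; clear; nia.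
move: hlam pe a1 a2 a3 a4; move: (n %/ (8 * K4)) (8 * K4 * (4 * h)) => a b hl pe a1 a2 a3 a4.
rewrite -ltnS -(ltn_pmul2r (_ : 0 < 8 * K4)) ?muln_gt0 //.
clear - hl pe a1 a2 a3 a4 K40; nia.
Qed.

(** An exceptional vertex costs at most [d] bits by [cost_le] and gains about [2 * d] through its
    boxes, which leaves a net gain of [d]. The factor [2 ^ n] absorbs the roundings. *)
Lemma s3_count' K X Xs CP CQ fe ff GG b :
  let X2 := Xs :\: CP in let Y2 := ~: Xs :\: CQ in
  (forall G, G \in GG -> C5free G /\ s3 e h w G K X Xs CP CQ fe ff) ->
  (forall t0, nt (setX X2 Y2) [set G in GG | tr (setX X2 X2) G == t0] <= b) ->
  #|GG| * 2 ^ (d * (#|CP| + #|CQ|)) <= 2 ^ n * (nt (setX X2 X2) GG * nt (setX Y2 Y2) GG * b *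
    2 ^ (#|CP| * #|Y2| + #|CQ| * #|X2| + #|CP| * #|CQ|)).
Proof.
move=> X2 Y2 hG hb; have [->|/set0Pn [G0 GG0]] := eqVneq GG set0; first by rewrite cards0.
have [_ S0] := hG _ GG0; have K40 : 0 < K4 by rewrite hK4.
have [dKX cK _ nK nX] := s3_data S0; have p3e := s3_CP S0; have q3e := s3_CQ S0.
have eN' := eN; pose m1 := n %/ 5.
have hm1 : 2 * m1 + 1 <= #|K :&: Y2|.
  have : #|K| <= #|K :&: Y2| + #|CQ|.
    rewrite -(cardsID Y2 K) leq_add2l; apply: subset_leq_card; apply/subsetP => x.
    rewrite !inE negb_and !negbK => /andP [/orP [//|xs] xK]; by rewrite (disjointFr (s3_K S0) xK) in xs.
  move: nK q3e eN' lamL n2; rewrite /m1; move: #|K| #|_ :&: _| #|CQ| => a1 a2 a3; rewrite -/e -/n.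
  move: e => e'; clear; lia.
have hGa : #|[set A : {set T} | #|A| <= 4 * h]| <= Ga by apply: card_sparse_sets; rewrite muln_gt0.
have := @s3_count T e h w m1 Ga K X Xs CP CQ fe ff hGa GG b hm1 hG hb; rewrite -/X2 -/Y2 -/n.
set bigm := nt _ _ * _ * _ * _ => cnt.
have c1 : (n.+1 * Ga * 2 ^ e * 2 ^ #|CP|) ^ #|CP| <= 2 ^ (d * #|CP|).
  by rewrite [2 ^ (d * _)]expnM; apply: leq_expW; apply: cost_le.
have c2 : (2 * Ga * 2 ^ e) ^ #|CQ| <= 2 ^ (d * #|CQ|).
  rewrite [2 ^ (d * _)]expnM; apply: leq_expW; apply: leq_trans (cost_le (leq0n _)); rewrite expn0 muln1 !leq_mul2r.
  apply/orP; right; apply/orP; right; apply: leq_trans (_ : 2 * lam <= _) => //; first by clear - lam1; lia.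
  by rewrite -/n; clear - n2; lia.
have {cnt} cnt : #|GG| * 2 ^ ((#|CP| %/ 3 * m1 %/ 45) + (#|CQ| %/ 6 * w %/ 45)) <= bigm * 2 ^ (d * (#|CP| + #|CQ|)).
  apply: leq_trans cnt _; rewrite leq_mul2l; apply/orP; right; rewrite mulnDr expnD; exact: leq_mul.
have sv : (#|CP| + #|CQ|) * (2 * d) <= (#|CP| %/ 3 * m1 %/ 45) + (#|CQ| %/ 6 * w %/ 45) + n.
  have [P [_ _ _ e1]] := s3_P S0; have [Q [_ _ _ e2]] := s3_Q S0; rewrite -e1 -e2 mulnK //.
  have [_ dn'] := dn; rewrite hK4 in dn'.
  have h1 : #|P| * 3 * (2 * d) <= #|P| * m1 %/ 45.
    rewrite leq_divRL // -!mulnA leq_mul2l; apply/orP; right; rewrite /m1 leq_divRL //; clear - dn'; lia.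
  (* This is the strongest demand on [K4 = 200 * 200], which must be at least [12 * 45 * 40]. *)
  have h2 : 12 * (#|Q| * 3 %/ 6) * d <= #|Q| * 3 %/ 6 * w %/ 45.
    rewrite leq_divRL // [12 * _]mulnC -!mulnA leq_mul2l; apply/orP; right; rewrite /w leq_divRL //; clear - dn'; lia.
  have h3 : #|Q| <= 2 * (#|Q| * 3 %/ 6) + 1 by clear; lia.
  rewrite mulnDl -addnA; apply: leq_add => //.
  have [z2 z2E] : exists z2, z2 = #|Q| * 3 %/ 6 by eexists.
  have [z1 z1E] : exists z1, z1 = z2 * w %/ 45 by eexists.
  rewrite -z2E -z1E in h2 *; rewrite -z2E in h3.
  by clear - h2 h3 dn'; nia.
rewrite -(leq_pmul2r (_ : 0 < 2 ^ (d * (#|CP| + #|CQ|)))) ?expn_gt0 // -[X in X <= _]mulnA -expnD.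
apply: leq_trans (_ : 2 ^ n * (#|GG| * 2 ^ ((#|CP| %/ 3 * m1 %/ 45) + (#|CQ| %/ 6 * w %/ 45))) <= _); last first.
  by rewrite -mulnA leq_mul2l cnt orbT.
rewrite mulnCA leq_mul2l -expnD leq_exp2l //; apply/orP; right.
by move: sv; rewrite addnn -mul2n mulnCA [(_ + _) * _]mulnC; clear; lia.
Qed.

Lemma s3_sizes K X Xs CP CQ fe ff G : s3 e h w G K X Xs CP CQ fe ff ->
  [/\ n <= 3 * #|Xs :\: CP|, n <= 3 * #|~: Xs :\: CQ|, #|~: Xs :\: CQ :\: K| <= e, 2 <= #|K :&: (~: Xs :\: CQ)| &
   [/\ #|Xs :\: CP| + #|CP| + (#|~: Xs :\: CQ| + #|CQ|) = n, CP \subset Xs & CQ \subset ~: Xs]].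
Proof.
move=> S0; have [dKX cK _ nK nX] := s3_data S0; have p3e := s3_CP S0; have q3e := s3_CQ S0.
have eN' := eN; have rs := sdata_rest (s3_data S0).
have [P [_ sP cP _]] := s3_P S0; have [Q [_ sQ cQ _]] := s3_Q S0.
have sCP : CP \subset Xs by rewrite -cP; apply/bigcupsP => S /sP [].
have sCQ : CQ \subset ~: Xs by rewrite -cQ; apply/bigcupsP => S /sQ [].
have a1 : #|X| <= #|Xs :\: CP| + #|CP|.
  by rewrite cardsD (setIidPr sCP) subnK ?subset_leq_card // (s3_X S0).
have a2 : #|K| <= #|K :&: (~: Xs :\: CQ)| + #|CQ|.
  rewrite -(cardsID (~: Xs :\: CQ) K) leq_add2l; apply: subset_leq_card; apply/subsetP => x.
  rewrite !inE negb_and !negbK => /andP [/orP [//|xs] xK]; by rewrite (disjointFr (s3_K S0) xK) in xs.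
have a3 : #|K :&: (~: Xs :\: CQ)| <= #|~: Xs :\: CQ| by apply: subset_leq_card; apply: subsetIr.
have n5 : 50 * 50 * 2 <= n by apply: leq_trans n2; rewrite mulnC leq_mul2l.
split.
- move: a1 p3e nX eN' n5; move: #|X| #|_ :\: _| #|CP| => z1 z2 z3; rewrite -/n; move: e; clear; lia.
- move: a2 a3 q3e nK eN' n5; move: #|K| #|_ :\: _| #|CQ| #|_ :&: _| => z1 z2 z3 z4; rewrite -/n; move: e; clear; lia.
- apply: leq_trans rs; apply: subset_leq_card; apply/subsetP => x; rewrite !inE => /andP [xK /andP [_ xs]].
  by rewrite negb_or xK; apply: contra xs; apply: (subsetP (s3_X S0)).
- move: a2 q3e nK eN' n5; move: #|K| #|CQ| #|_ :&: _| => z1 z2 z3; rewrite -/n; move: e; clear; lia.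
split=> //; rewrite !cardsD (setIidPr sCP) (setIidPr sCQ) !subnK ?subset_leq_card //; exact: cardsC.
Qed.

Let main := g ^ (n %/ 2) * 2 ^ (n * n %/ 4).

Lemma g_facts : g <= 2 ^ lam.+1 /\ 0 < g.
Proof.
split; last by apply: leq_trans g4; rewrite expn_gt0.
by apply: leq_trans (ltnW n1); apply: leq_trans glam; rewrite leq_pmulr.
Qed.

(** A graph that is not [good] has more than [J0] exceptional vertices, or few vertices in medium
    blocks, or violates [xrich]. The first case gains [d * J0 >= 23 * n] bits: the [15 * n] of the
    conclusion and the [8 * n] spent in the main estimate. [C2] and the 26 in [cross] are chosen in
    the same way. *)
Lemma label_U K X Xs CP CQ GG : (forall G, G \in GG -> [/\ C5free G, s3 e h w G K X Xs CP CQ true true & ~ good G]) ->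
  #|GG| * 2 ^ (15 * n) <= main.
Proof.
move=> hG; have [->|/set0Pn [G0 GG0]] := eqVneq GG set0; first by rewrite cards0.
have [_ S0 _] := hG _ GG0; have [nX nY _ K2 [cn sCP sCQ]] := s3_sizes S0; have [gl g0] := g_facts.
set X2 := Xs :\: CP in nX cn; set Y2 := ~: Xs :\: CQ in nY cn K2.
have fX G : G \in GG -> P3free G X2 by move=> /hG [_ S1 _]; apply: s3_X2 S1.
have cY G : G \in GG -> clique G Y2.
  move=> /hG [_ S1 _]; have := homog_of_P3free (s3_Y2 S1 isT) (s3_Y2' S1 isT); rewrite /homog => /orP [//|/indepP iY].
  have /card_gt1P [x [y [xK yK ne]]] := K2; have [_ /cliqueP cK _ _ _] := s3_data S1.
  move: xK yK; rewrite !(inE, in_setI) => /andP [xK xY] /andP [yK yY].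
  by have := iY x y; rewrite !inE cK // xY yY => /(_ isT isT).
have ntY HH : HH \subset GG -> nt (setX Y2 Y2) HH <= 1.
  move=> sH; apply: (nt1 (t := [set p in setX Y2 Y2 | p.1 != p.2])) => G /(subsetP sH) /cY /cliqueP c.
  apply/setP => -[x y]; rewrite in_tr [RHS]in_set /=; apply: andb_id2l => /setXP [xY yY].
  by apply/idP/idP => [a|ne]; [apply: contraTneq a => ->; rewrite adj_irrefl|apply: c].
have AB : #|X2| + #|CP| + (#|Y2| + #|CQ|) = n by [].
(* [kX] and [kb] are the gains inside [X2] and across. Of the [8 * n] bits lost, [n] stem from
   [s3_count'], [6 * n] from [all_partitions] and [n] from [balance]. *)
have bal HH b kX kb z : HH \subset GG -> (forall t0, nt (setX X2 Y2) [set G in HH | tr (setX X2 X2) G == t0] <= b) ->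
   nt (setX X2 X2) HH * 2 ^ kX <= g ^ #|X2| * 2 ^ (6 * n) -> b * 2 ^ kb <= 2 ^ (#|X2| * #|Y2|) ->
   z + 8 * n <= d * (#|CP| + #|CQ|) + kX + kb -> #|HH| * 2 ^ z <= main.
  move=> sH hb hX hbb hz.
  have hH G : G \in HH -> C5free G /\ s3 e h w G K X Xs CP CQ true true by move=> /(subsetP sH) /hG [].
  have := s3_count' hH hb; rewrite -/X2 -/Y2 => cnt.
  rewrite -(leq_pmul2r (_ : 0 < 2 ^ (8 * n))) ?expn_gt0 // -mulnA -expnD.
  apply: leq_trans (_ : #|HH| * 2 ^ (d * (#|CP| + #|CQ|)) * (2 ^ kX * 2 ^ kb) <= _).
    by rewrite -mulnA leq_mul2l -!expnD leq_exp2l // addnA hz orbT.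
  apply: leq_trans (leq_mul cnt (leqnn _)) _.
  apply: leq_trans (_ : 2 ^ n * ((g ^ #|X2| * 2 ^ (6 * n)) * (2 ^ (#|X2| * #|Y2|)) *
      2 ^ (#|CP| * #|Y2| + #|CQ| * #|X2| + #|CP| * #|CQ|)) <= _).
    rewrite -mulnA leq_mul2l; apply/orP; right.
    apply: leq_trans (_ : nt (setX X2 X2) HH * 2 ^ kX * (b * 2 ^ kb) *
        2 ^ (#|CP| * #|Y2| + #|CQ| * #|X2| + #|CP| * #|CQ|) <= _); last by rewrite leq_mul2r leq_mul ?orbT.
    have := ntY _ sH; move: (nt (setX X2 X2) HH) (nt (setX Y2 Y2) HH) (2 ^ kX) (2 ^ kb) (2 ^ (_ + _)) => v1 v2 v3 v4 v5 hv.
    apply: leq_trans (_ : v2 * (v1 * v3 * (b * v4) * v5) <= _); first by apply: eq_leq; clear; lia.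
    by rewrite -[X in _ <= X]mul1n leq_mul2r hv orbT.
  apply: leq_trans (_ : g ^ (#|X2| + #|CP|) * 2 ^ ((#|X2| + #|CP|) * (#|Y2| + #|CQ|)) * 2 ^ (7 * n) <= _).
    have [R RE] : exists R, R = #|CP| * #|Y2| + #|CQ| * #|X2| + #|CP| * #|CQ| by eexists.
    have -> : (#|X2| + #|CP|) * (#|Y2| + #|CQ|) = #|X2| * #|Y2| + R by rewrite RE; clear; lia.
    have -> : 7 * n = n + 6 * n by clear; lia.
    rewrite -RE (expnD 2 n) (expnD 2 _ R) (expnD g); have : 0 < g ^ #|CP| by rewrite expn_gt0 g0.
    move: (g ^ #|CP|) (2 ^ n) (2 ^ (6 * n)) (g ^ #|X2|) (2 ^ (#|X2| * #|Y2|)) (2 ^ R).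
    move=> y1 y2 y3 y4 y5 y6 y1p; apply: leq_trans (_ : y1 * (y2 * (y4 * y3 * y5 * y6)) <= _).
      by rewrite leq_pmull.
    by apply: eq_leq; clear; lia.
  apply: leq_trans (leq_mul (balance gl g0 lam2 AB) (leqnn _)) _.
  by rewrite -mulnA -expnD -mulSn.
have fX2 HH : HH \subset GG -> nt (setX X2 X2) HH * 2 ^ 0 <= g ^ #|X2| * 2 ^ (6 * n).
  move=> sH; rewrite muln1; apply: (all_partitions lam1 nlam glam glam' g4 lam8 n2) => G /(subsetP sH); exact: fX.
have [big|sml] := ltnP J0 (#|CP| + #|CQ|).
  apply: (bal GG (2 ^ (#|X2| * #|Y2|)) 0 0) => //.
  - by move=> t0; rewrite -cardsX; apply: nt_exp.
  - by apply: fX2.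
  - by rewrite muln1.
  rewrite !addn0 -mulnDl; apply: leq_trans (leq_mul (leqnn _) (ltnW big)); rewrite J0E mulnA.
  by rewrite mulnC leq_mul2r; have [-> _] := dn; rewrite orbT.
pose fw G := 2 * #|medium lo hi G X2| <= #|X2|.
rewrite -(cardsID [set G | fw G] GG) mulnDl.
suff [s1 s2] : #|GG :&: [set G | fw G]| * 2 ^ (15 * n) * 2 <= main /\ #|GG :\: [set G | fw G]| * 2 ^ (15 * n) * 2 <= main.
  by move: s1 s2; move: (_ * 2 ^ _) (_ * 2 ^ _); clear; lia.
have up z : z * 2 ^ (16 * n) <= main -> z * 2 ^ (15 * n) * 2 <= main.
  apply: leq_trans; rewrite -mulnA leq_mul2l -expnSr leq_exp2l //; apply/orP; right.
  by have : 0 < n by [apply: leq_trans nlam; rewrite expn_gt0]; clear; lia.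
split; apply: up.
  apply: (bal _ (2 ^ (#|X2| * #|Y2|)) (25 * n) 0) => //.
  - exact: subsetIl.
  - by move=> t0; rewrite -cardsX; apply: nt_exp.
  - rewrite (_ : 25 * n = C2 * n + 6 * n); last by rewrite C2E; clear; lia.
    rewrite expnD mulnA leq_mul2r; apply/orP; right.
    apply: (few_medium lam1 nlam glam glam' g4 lam8 n2 loE nX) => G; rewrite !inE => /andP [/fX fG fwG]; split=> //.
    by rewrite -hiE.
  - by rewrite muln1.
  - by clear; lia.
apply: (bal _ (2 ^ (#|X2| * #|Y2|) %/ 2 ^ (26 * n)) 0 (26 * n)) => //.
- exact: subsetDl.
- move=> t0; rewrite leq_divRL ?expn_gt0 //; apply: (cross (t0 := t0)) => // G.
  rewrite !inE => /andP [/andP [nf GGG] /eqP et]; split=> //; first exact: fX.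
    by rewrite ltnW // ltnNge.
  apply/negP => xr; have [_ _] := hG _ GGG; apply; exists X2, Y2; split=> //; [exact: cY|exact: fX| |].
    by rewrite disjoints_subset; apply/subsetP => x; rewrite !inE => /andP [_ ->]; rewrite andbF.
  apply: leq_trans sml; apply: leq_trans (_ : #|CP :|: CQ| <= _); last by apply: leq_card_setU.
  apply: subset_leq_card; apply/subsetP => x; rewrite !inE negb_or !negb_and !negbK.
  by case: (x \in Xs); case: (x \in CP); case: (x \in CQ).
- by apply: fX2; apply: subsetDl.
- exact: leq_divM.
by clear; lia.
Qed.

(** With few disjoint edges or few disjoint non-edges, the [X] side is homogeneous up to [2 * w]
    vertices. Then [nt_homog_part] leaves [n ^ (2 * w)] traces, and [w = n / 40] makes this far
    smaller than [g ^ (n / 2)]. *)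
Lemma label_notU K X Xs CP CQ fe ff GG : ~~ (fe && ff) ->
  (forall G, G \in GG -> C5free G /\ s3 e h w G K X Xs CP CQ fe ff) -> #|GG| * 2 ^ (15 * n) <= main.
Proof.
move=> nU hG; have [->|/set0Pn [G0 GG0]] := eqVneq GG set0; first by rewrite cards0.
have [_ S0] := hG _ GG0; have [nX nY cYe _ [cn sCP sCQ]] := s3_sizes S0; have [gl g0] := g_facts.
set X2 := Xs :\: CP in nX cn; set Y2 := ~: Xs :\: CQ in nY cn cYe.
have n5 : 50 * 50 * 2 <= n by apply: leq_trans n2; rewrite mulnC leq_mul2l.
have n0 : 0 < n by apply: leq_trans nlam; rewrite expn_gt0.
have fX G : G \in GG -> P3free G X2 by move=> /hG [_ S1]; apply: s3_X2 S1.
(* Otherwise a clique and an independent set would each cover most of the [X] side, but they share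
   at most one vertex. *)
have fef : fe || ff.
  apply/negPn/negP; rewrite negb_or => /andP [/negbTE ne /negbTE nf].
  have := s3_fe S0; have := s3_ff S0; rewrite ne nf -/X2 => -[I1 [s1 /cliqueP c1 m1]] [I2 [s2 /indepP c2 m2]].
  have : #|I1 :&: I2| <= 1.
    rewrite leqNgt; apply/negP => /card_gt1P [x [y [+ + ne']]]; rewrite !inE => /andP [x1 x2] /andP [y1 y2].
    by have := c2 x y x2 y2; rewrite c1.
  have : #|X2| <= #|X2 :\: I1| + #|X2 :\: I2| + #|I1 :&: I2|.
    apply: leq_trans (_ : #|(X2 :\: I1) :|: (X2 :\: I2) :|: (I1 :&: I2)| <= _).
      apply: subset_leq_card; apply/subsetP => x xX; rewrite in_setU in_setU.
      case: (boolP (x \in I1)) => x1; last by rewrite (_ : x \in X2 :\: I1) // in_setD x1.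
      case: (boolP (x \in I2)) => x2; last by rewrite (_ : x \in X2 :\: I2) ?orbT // in_setD x2.
      by rewrite [_ \in _ :&: _]in_setI x1 x2 orbT.
    by apply: leq_trans (leq_card_setU _ _) _; rewrite leq_add2r leq_card_setU.
  move: m1 m2 nX; rewrite /w; move: #|_| #|_| #|_| #|_| => v1 v2 v3 v4; clear - n5; lia.
have ntX : nt (setX X2 X2) GG <= 2 ^ n * n ^ (2 * w).
  rewrite -card_setTE; pose okI G I := [&& I \subset X2, (if ff then indep G I else clique G I) & #|X2 :\: I| <= 2 * w].
  apply: leq_trans (_ : #|(fun I => (I \subset X2) && (#|X2 :\: I| <= 2 * w) : bool)| * n ^ (2 * w) <= _); last first.
    by rewrite leq_mul2r max_card orbT.
  apply: (nt_union (CC := fun I => [set G in GG | okI G I])) => [G GGG|I /andP [sI cI]].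
    have [_ S1] := hG _ GGG; have [I [s1 hI c1]] : exists I, [/\ I \subset X2, (if ff then indep G I else clique G I) & #|X2 :\: I| <= 2 * w].
      have := s3_fe S1; have := s3_ff S1; move: nU fef; case: (ff); case: (fe) => //=.
    by exists I; rewrite ?s1 ?c1 // inE GGG /okI s1 hI c1.
  apply: leq_trans (_ : n ^ #|X2 :\: I| <= _); last by rewrite leq_pexp2l.
  apply: nt_homog_part => //; case ef: ff; [right|left] => G; rewrite inE /okI ef => /andP [GGG /and3P [_ ? _]]; split=> //; exact: fX.
have ntY : nt (setX Y2 Y2) GG <= n ^ e.
  have cD : #|Y2 :\: (K :&: Y2)| <= e.
    apply: leq_trans cYe; apply: subset_leq_card; apply/subsetP => x; rewrite in_setD in_setI negb_and => /andP [+ xY].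
    by rewrite xY orbF in_setD xY andbT.
  apply: leq_trans (_ : n ^ #|Y2 :\: (K :&: Y2)| <= _); last by rewrite leq_pexp2l.
  have cK G : G \in GG -> clique G (K :&: Y2).
    move=> /hG [_ S1]; have [_ /cliqueP c _ _ _] := s3_data S1; apply/cliqueP => x y; rewrite !in_setI => /andP [xK _] /andP [yK _].
    exact: c.
  case: (boolP fe) => fe1.
    apply: nt_homog_part; first exact: subsetIr.
    by left=> G GGG; split; [have [_ S1] := hG _ GGG; apply: s3_Y2 S1 fe1 | apply: cK].
  have ff1 : ff by rewrite (negbTE fe1) in fef.
  rewrite -nt_cg; apply: nt_homog_part; first exact: subsetIr.
  right=> _ /imsetP [G GGG ->]; split; first by have [_ S1] := hG _ GGG; apply: s3_Y2' S1 ff1.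
  by rewrite cg_indep; apply: cK.
have := s3_count' (b := 2 ^ (#|X2| * #|Y2|)) hG; rewrite -/X2 -/Y2 => /(_ _) cnt.
have {}cnt : #|GG| <= 2 ^ n * (nt (setX X2 X2) GG * nt (setX Y2 Y2) GG * 2 ^ (n * n %/ 4)).
  apply: leq_trans (_ : #|GG| * 2 ^ (d * (#|CP| + #|CQ|)) <= _); first by rewrite leq_pmulr // expn_gt0.
  apply: leq_trans (cnt _) _; first by move=> t0; rewrite -cardsX; apply: nt_exp.
  rewrite leq_mul2l -!mulnA !leq_mul2l -expnD leq_exp2l //; apply/orP; right; apply/orP; right; apply/orP; right.
  apply: leq_trans (_ : (#|X2| + #|CP|) * (#|Y2| + #|CQ|) <= _); first by apply: eq_leq; clear; lia.
  by rewrite leq_divRL // mulnC mulnn -cn; exact: nat_AGM2.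
apply: leq_trans (leq_mul (leq_trans cnt (leq_mul (leqnn _) (leq_mul (leq_mul ntX ntY) (leqnn _)))) (leqnn _)) _.
rewrite /main; have gg : 2 ^ (17 * n) * n ^ (2 * w + e) <= g ^ (n %/ 2).
  apply: leq_trans (_ : 2 ^ (17 * n) * 2 ^ (lam.+1 * (2 * w + e)) <= _).
    by rewrite leq_mul2l [2 ^ (lam.+1 * _)]expnM; apply/orP; right; apply: leq_expW; apply: ltnW.
  apply: leq_trans (leq_expW _ g4); rewrite -expnD -expnM leq_exp2l //.
  have w18 : 18 * (2 * w + e) <= n by have := eN; rewrite /w; clear; lia.
  have h1 : lam * n <= 16 * (lam %/ 2 * (n %/ 2)).
    have l3 : lam <= 3 * (lam %/ 2) by clear - lam8; lia.
    have n3 : n <= 3 * (n %/ 2) by clear - n5; lia.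
    by apply: leq_trans (leq_mul l3 n3) _; move: (lam %/ 2) (n %/ 2) => a b; clear; lia.
  have h2 : 16 * (17 * n + lam.+1 * (2 * w + e)) <= lam * n.
    by move: w18; move: (2 * w + e) => v; clear - lamL; nia.
  by move: h1 h2; move: (lam %/ 2 * _) (lam * n) (17 * n + _); clear; lia.
have e17 : 2 ^ (17 * n) = 2 ^ n * 2 ^ n * 2 ^ (15 * n) by rewrite -!expnD; congr (2 ^ _); clear; lia.
rewrite e17 in gg.
apply: leq_trans (leq_mul gg (leqnn _)); rewrite expnD; apply: eq_leq.
by move: (2 ^ n) (n ^ _) (n ^ _) (2 ^ _) (2 ^ _); clear; lia.
Qed.

End Labels.

(** * Coded structures *)

Section Coded.
Variable T : finType.
Implicit Types (G : sgraph T) (GG HH : {set sgraph T}) (A B C D U X Y Z S : {set T}).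
Let n := #|T|.

(* [Z] is the exceptional set; [Ct i] is a part of the block of [b i] all of whose subsets are
   cut out by common neighbourhoods of [t] vertices, and [Ct ord0] realises every trace on [S]. *)
Record codes (J t r sg : nat) G X Y Z (b : 'I_r.+1 -> T) (Ct W E : 'I_r.+1 -> {set T}) S : Prop := Codes {
  codes_cover : forall x, [|| x \in X, x \in Y | x \in Z];
  codes_XY : [disjoint X & Y];
  codes_Z : [disjoint Z & X :|: Y];
  codes_J : #|Z| <= J;
  codes_Y : clique G Y;
  codes_X : P3free G X;
  codes_3 : forall y, y \in Y -> exists x1 x2 x3, [/\ x1 \in X, x2 \in X & x3 \in X] /\
    [/\ adj G y x1, adj G y x2 & adj G y x3] /\ [/\ x1 != x2, x1 != x3 & x2 != x3] /\
    [/\ ~~ adj G x1 x2, ~~ adj G x1 x3 & ~~ adj G x2 x3];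
  codes_b : forall i, b i \in X;
  codes_C : forall i, Ct i \subset blkof G X (b i);
  codes_D : forall i D, D \subset Ct i -> exists2 U : {set T}, #|U| = t & capn G (blkof G X (b i)) U = D;
  codes_W : forall i, W i \subset Ct i;
  codes_E : forall i, E i \subset W i;
  codes_S : S = [set y in Y | [forall i, nb G y :&: W i == E i]];
  codes_sg : sg <= #|S|;
  codes_sh : forall R : {set T}, R \subset S -> exists2 x, x \in Ct ord0 & nb G x :&: S = R }.

Definition coded J t r sg G : Prop := exists X Y Z b Ct W E S, @codes J t r sg G X Y Z b Ct W E S.

(** Vertices of [Y] that meet at most two blocks are moved to the exceptional set. There are at most
    [J1] of them, which is why a class of size [sg + J1] is demanded and why [J0 + J1] bounds the
    exceptional set. *)
Lemma coded_of_good lo hi t r J1 sg c4 J0 G :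
  good lo hi t r J1 (sg + J1) c4 J0 G -> coded (J0 + J1) t r sg G.
Proof.
move=> [X [Y [cY fX dXY cZ [nX nY /and3P [p1 p2 /forallP p3]]]]].
have [tB sB cB nB] := medblocksP lo hi fX; set BB := medblocks lo hi G X in tB sB cB nB p1 p2 p3.
set SF := [set C in BB | _] in p2.
have [F sF cF] := subset_of_card p2; have [f0 fi fF] := enum_fun cF.
pose f : {ffun 'I_r.+1 -> {set T}} := [ffun i => f0 i].
have fSF i : f i \in SF by rewrite ffunE; apply: (subsetP sF); rewrite -fF imset_f // in_setT.
have fB i : f i \in BB by move: (fSF i); rewrite inE => /andP [].
have fsub i : subfull t G (f i) (pickn lo (f i)) Y by move: (fSF i); rewrite inE => /andP [].
have /implyP := p3 f; have -> : injectiveb f && [forall i, f i \in BB].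
  by apply/andP; split; [apply/injectiveP => i j; rewrite !ffunE => /fi | apply/forallP].
move=> /(_ isT); set W0 := pickn _ _ => /existsP [E0 /and4P [sE0 c1 c2 sh]].
set B := [set y in Y | _] in p1; set S0 := cls W0 Y G E0 in c1 c2 sh.
have bex i : exists b, b \in X /\ f i = blkof G X b.
  by have /imsetP [x xM ->] := fB i; exists x; split=> //; move: xM; rewrite inE => /andP [].
have [b hb] := fin_all_exists bex.
(* Block [ord0] is reserved for the shattering and carries no part of [W0]. *)
pose Ct i := pickn lo (f i); pose W i := if i == ord0 then set0 else W0 :&: Ct i.
exists X, (Y :\: B), (~: (X :|: (Y :\: B))), b, Ct, W, (fun i => E0 :&: W i), (S0 :\: B).
split=> //.
- by move=> x; rewrite in_setC in_setU; case: (x \in X); case: (x \in _ :\: _).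
- apply/pred0P => x /=; apply/negP => /andP [xX]; rewrite in_setD => /andP [_ xY].
  by rewrite (disjointFr dXY xX) in xY.
- by rewrite disjoints_subset subxx.
- apply: leq_trans (leq_add cZ p1); apply: leq_trans (leq_card_setU _ _); apply: subset_leq_card.
  apply/subsetP => x; rewrite in_setC in_setU in_setU in_setC in_setU in_setD !negb_or negb_and negbK.
  by case/andP => -> /orP [->|->]; rewrite ?orbT.
- by move/cliqueP: cY => cY; apply/cliqueP => x y; rewrite !in_setD => /andP [_ xY] /andP [_ yY]; apply: cY.
- move=> y; rewrite in_setD => /andP [yB yY].
  have : 2 < #|[set C in BB | nb G y :&: C != set0]| by rewrite ltnNge; apply: contra yB => h; rewrite inE yY.
  move=> /card_gt2P [C1 [C2 [C3 [[h1 h2 h3] [n12 n23 n31]]]]].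
  have pk C : C \in [set C in BB | nb G y :&: C != set0] -> exists x, [/\ x \in X, adj G y x & blkof G X x = C].
    rewrite inE => /andP [CB /set0Pn [x]]; rewrite !inE => /andP [a xC].
    have [sC _ _] := sB _ CB; exists x; split=> //; first exact: (subsetP sC).
    case/imsetP: CB xC => z zM -> ; have zX : z \in X by move: zM; rewrite inE => /andP [].
    by rewrite inE => /andP [xX /orP [/eqP ->//|a']]; apply/esym; apply: blkof_eq.
  have [x1 [x1X a1 e1]] := pk _ h1; have [x2 [x2X a2 e2]] := pk _ h2; have [x3 [x3X a3 e3]] := pk _ h3.
  have ne u v C C' : C != C' -> blkof G X u = C -> blkof G X v = C' -> u != v.
    by move=> nC e1' e2'; apply: contraNneq nC => euv; rewrite -e1' -e2' euv.
  have na u v C C' : u \in X -> v \in X -> C != C' -> blkof G X u = C -> blkof G X v = C' -> ~~ adj G u v.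
    move=> uX vX nC eu ev; rewrite (blkofP fX) //; first by rewrite eu ev.
    by apply: ne nC eu ev.
  rewrite eq_sym in n31; exists x1, x2, x3; split=> //; split=> //.
  by split; split; [apply: ne e1 e2|apply: ne e1 e3|apply: ne e2 e3|apply: na e1 e2|apply: na e1 e3|apply: na e2 e3].
- by move=> i; have [] := hb i.
- by move=> i; have [_ <-] := hb i; apply: pickn_sub.
- move=> i D sD; have := forallP (fsub i) D; rewrite sD => /existsP [U /and3P [_ /eqP cU /eqP eU]].
  by exists U; rewrite // -(hb i).2.
- by move=> i; rewrite /W; case: ifP => _; rewrite ?sub0set ?subsetIr.
- by move=> i; apply: subsetIr.
- apply/setP => y; rewrite in_setD [y \in S0]inE [RHS]inE in_setD; case: (boolP (y \in B)) => //= _.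
  case: (boolP (y \in Y)) => //= _; apply/eqP/forallP => [e i|h].
    have sW : W i \subset W0 by rewrite /W; case: ifP => _; rewrite ?sub0set ?subsetIl.
    by rewrite -e -setIA (setIidPr sW).
  apply/setP => x; apply/idP/idP => [|xE].
    rewrite in_setI => /andP [xN xW]; have /bigcupP [i i0 xi] := subsetP (pickn_sub _ _) _ xW.
    have /eqP/setP/(_ x) := h i; rewrite !in_setI xN /W (negbTE i0) in_setI xW xi /= andbT => /esym.
    by move=> ->.
  have xW := subsetP sE0 _ xE; have /bigcupP [i i0 xi] := subsetP (pickn_sub _ _) _ xW.
  by have /eqP/setP/(_ x) := h i; rewrite !in_setI xE /W (negbTE i0) in_setI xW xi /= andbT => ->.
- apply: leq_trans (_ : #|S0| - #|B| <= _); last first.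
    by rewrite cardsD leq_sub2l // subset_leq_card // subsetIr.
  by rewrite leq_subRL //; [rewrite addnC; apply: leq_trans c1; rewrite leq_add2l|
     apply: leq_trans p1 _; apply: leq_trans c1; rewrite leq_addl].
move=> R sR; have := forallP sh R; rewrite (subset_trans sR (subsetDl _ _)) => /exists_inP [x xC /eqP e].
have sN : nb G x :&: (S0 :\: B) \subset R by rewrite -e setIS // subsetDl.
exists x => //; apply/eqP; rewrite eqEsubset; apply/andP; split; first exact: sN.
by apply/subsetP => z zR; rewrite in_setI (subsetP sR _ zR) andbT; move: zR; rewrite -e in_setI => /andP [].
Qed.

End Coded.

Lemma lin_half A : exists L, forall lam, L <= lam -> A * lam.+1 <= 2 ^ (lam %/ 2).
Proof.
have [m0 hm] := linear_le_exp (2 * A); exists (2 * m0) => lam le.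
apply: leq_trans (hm (lam %/ 2) _); last by clear - le; lia.
rewrite [2 * A]mulnC -mulnA leq_mul2l; apply/orP; right; clear; lia.
Qed.

(** The demands of [cross_count] are met as follows. [t = D + 3] gives [2 * hi <= 2 ^ t * u] with
    [u = lam / 4 + 1]; [4 * t <= q0] keeps [t * lo] below [lam / 4], so that [2 ^ (u + t * lo)] is
    only of the order of the square root of [n]; [r = 2 * q0] blocks supply the at most [lam]
    vertices of the hashing set. *)
Lemma cross_ok D q0 sg c4 J1 : 4 * (D + 3) <= q0 -> 0 < sg -> c4 = 8 * 32 -> J1 = 40 * (26 + 4) ->
  exists L, forall (T : finType) lam, let n := #|T| in L <= lam -> 2 ^ lam <= n -> n.+1 <= 2 ^ lam.+1 ->
  forall (X Y : {set T}) t0 (GG : {set sgraph T}), n <= 3 * #|X| -> n <= 3 * #|Y| ->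
  (forall G, G \in GG -> [/\ tr (setX X X) G = t0, P3free G X,
    #|X| <= 2 * #|medium (lam %/ q0) (2 ^ D * lam) G X| &
    ~~ xrich (lam %/ q0) (2 ^ D * lam) (D + 3) (2 * q0) J1 (trunc_log 2 (#|Y| %/ (4 * sg))) sg c4 G X Y]) ->
  nt (setX X Y) GG * 2 ^ (26 * n) <= 2 ^ (#|X| * #|Y|).
Proof.
move=> tq sg0 c4E J1E; have q00 : 0 < q0 by clear - tq; lia.
have [s1 s1E] : exists s1, s1 = 8 * sg * 2 ^ c4 by eexists.
have [b1 b1E] : exists b1, b1 = 6 * (D + 3) * (360 * 2 ^ D + 1) by eexists.
have [b2 b2E] : exists b2, b2 = 12 * (2 * q0) * 2 ^ D by eexists.
have [A AE] : exists A, A = 40 + 40 * 2 ^ D + 3 * J1 + b1 + b2 + 12 * sg + 2 * q0 + 1 by eexists.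
have [L hL] := lin_half A; exists (L + q0 + 24 + q0 * (2 ^ s1 * (360 * s1 + 1 + s1))) => T lam n le nl n1 X Y t0 GG nX nY.
have lL : L <= lam by move: (q0 * _) le => z; clear; lia.
have lq : q0 <= lam by move: (q0 * _) le => z; clear; lia.
have l24 : 24 <= lam by move: (q0 * _) le => z; clear; lia.
have lbig : q0 * (2 ^ s1 * (360 * s1 + 1 + s1)) <= lam by move: (q0 * _) le => z; clear; lia.
have hA := hL _ lL; have hAn : A * lam.+1 <= n.
  by apply: leq_trans nl; apply: leq_trans hA _; rewrite leq_exp2l // leq_div.
have cA c : c <= A -> c * lam.+1 <= n by move=> h; apply: leq_trans hAn; rewrite leq_mul2r h orbT.
have cA1 c : c <= A -> c <= n by move=> /cA; apply: leq_trans; rewrite leq_pmulr.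
have Y4 : 4 * sg <= #|Y|.
  have : 12 * sg <= n by apply: cA1; rewrite AE; move: (2 ^ D) => z; clear; lia.
  by move: nY; clear; lia.
have sg4 : 0 < 4 * sg by rewrite muln_gt0.
have Yd : 0 < #|Y| %/ (4 * sg) by rewrite divn_gt0.
have /andP [w1 w2] := trunc_log_bounds (isT : 1 < 2) Yd; set w := trunc_log _ _ in w1 w2 *.
have n24 : 24 <= n by apply: leq_trans l24 _; apply: leq_trans nl; apply: ltnW; apply: ltn_expl.
have lo1 : lam <= 2 * q0 * (lam %/ q0).
  have := ltn_ceil lam q00; have : 0 < lam %/ q0 by rewrite divn_gt0.
  by move: (lam %/ q0) => z; clear; nia.
apply: (@cross_count T X Y (lam %/ q0) (2 ^ D * lam) (D + 3) (2 * q0) J1 w sg c4 (lam %/ 4 + 1) 26 lam (360 * s1 + 1) t0) => //.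
- by clear - n24; lia.
- apply: leq_trans (cA (40 + 40 * 2 ^ D) _); last by rewrite AE; move: (2 ^ D) => z; clear; lia.
  by move: (2 ^ D) => z; clear; nia.
- by apply: cA1; rewrite AE; move: (2 ^ D) => z; clear; lia.
- have ue : lam %/ 4 + 1 + (D + 3) * (lam %/ q0) <= lam %/ 2 + 1.
    have : (D + 3) * (lam %/ q0) <= lam %/ 4.
      rewrite leq_divRL // mulnAC; apply: leq_trans (leq_divM lam q0); rewrite mulnC leq_mul2l; apply/orP; right.
      by rewrite mulnC.
    by move: ((D + 3) * _) => z; clear; lia.
  rewrite -(leq_pmul2l (isT : 0 < 3)); apply: leq_trans nY; apply: leq_trans nl.
  apply: leq_trans (_ : 3 * ((12 * 30 * (2 ^ D * lam) + lam) * 2 ^ (lam %/ 2 + 1) * (D + 3)) <= _).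
    rewrite leq_mul2l leq_mul2r; apply/orP; right; apply/orP; right; apply: leq_mul.
      by rewrite leq_add2l leq_div.
    by rewrite leq_exp2l.
  apply: leq_trans (_ : A * lam.+1 * 2 ^ (lam %/ 2) <= _).
    rewrite expnD expn1; apply: leq_trans (_ : 6 * (D + 3) * (360 * 2 ^ D + 1) * lam.+1 * 2 ^ (lam %/ 2) <= _).
      move: (2 ^ D) (2 ^ (lam %/ 2)) => z1 z2; rewrite -[12 * 30]/360.
      apply: leq_trans (_ : 6 * (D + 3) * (360 * z1 + 1) * lam * z2 <= _); first by apply: eq_leq; clear; lia.
      by rewrite leq_mul2r leq_mul2l leqnSn !orbT.
    rewrite !leq_mul2r; apply/orP; right; apply/orP; right; rewrite -b1E AE; move: (2 ^ D) => z2; clear; lia.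
  apply: leq_trans (leq_mul hA (leqnn _)) _; rewrite -expnD leq_exp2l //; clear; lia.
- by rewrite addnC.
- rewrite expnD; have : lam <= 4 * (lam %/ 4 + 1) by clear; lia.
  by move: (2 ^ D) (lam %/ 4 + 1) => z1 z2; rewrite -[2 ^ 3]/8; clear; nia.
- apply: leq_trans (cA (12 * (2 * q0) * 2 ^ D) _); last by rewrite -b2E AE; move: (2 ^ D) => z2; clear; lia.
  by move: (2 ^ D) => z; clear; nia.
- by rewrite mulnC -leq_divRL.
- by rewrite ltn_divLR // in w2; move: w2; rewrite expnS; move: (2 ^ w) => z; clear; lia.
- apply: leq_trans lo1; rewrite -ltnS -(@ltn_exp2l 2) //; apply: leq_ltn_trans n1.
  by apply: leq_trans w1 _; apply: leq_trans (leq_div _ _) (max_card _).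
- rewrite -s1E leq_divRL ?expn_gt0 // leq_divRL // mulnC [_ * 2 ^ s1]mulnC; exact: lbig.
- by rewrite addn1.
- have : n <= 8 * (#|Y| %/ 2) by clear - nY n24; lia.
  by rewrite c4E; move: (#|Y| %/ 2) => z; clear; lia.
- rewrite -s1E addn1 /=; move: nY; rewrite -/n; move: #|Y| => z; clear; nia.
apply: leq_trans (_ : (2 ^ lam.+1) ^ (2 * q0).+1 <= _); first by apply: leq_expW; apply: ltnW.
by rewrite -expnM leq_exp2l // mulnC; apply: cA; rewrite AE; move: (2 ^ D) => z; clear; lia.
Qed.

(** The spare [8 * n] bits are spent later: [2 * n] for the union of three classes in [coded_count]
    and [2 * n] for the loss in [perfect_lower]. *)
Lemma half_count : exists J t r, forall sg, 0 < sg -> exists N n0, 1 < N /\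
  forall T : finType, n0 <= #|T| -> forall GG : {set sgraph T},
  (forall G, G \in GG -> [/\ C5free G, struct (#|T| %/ N) G & ~ coded J t r sg G]) ->
  #|GG| * 2 ^ (8 * #|T|) <= (#|T| %/ trunc_log 2 #|T|) ^ (#|T| %/ 2) * 2 ^ (#|T| * #|T| %/ 4).
Proof.
have [K4 hK4] : exists K4, K4 = 200 * 200 by eexists.
have [E hE] : exists E, E = 256 * (K4 * K4) by eexists.
have [N hN] : exists N, N = 200 * (E * E) by eexists.
have [C2 C2E] : exists C2, C2 = 19 by eexists.
have [D DE] : exists D, D = 24 * (C2 + 20) by eexists.
have [q0 q0E] : exists q0, q0 = 144 * (C2 + 20) + 4 * (D + 3) by eexists.
have [J1 J1E] : exists J1, J1 = 40 * (26 + 4) by eexists.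
have [J0 J0E] : exists J0, J0 = 2 * K4 * 23 by eexists.
have [c4 c4E] : exists c4, c4 = 8 * 32 by eexists.
exists (J0 + J1), (D + 3), (2 * q0) => sg sg0; exists N.
have K40 : 0 < K4 by rewrite hK4.
have E0 : 0 < E by rewrite hE !muln_gt0 K40.
have N1 : 1 < N by rewrite hN; have : 0 < E * E by [rewrite muln_gt0 E0]; clear; lia.
have [|n1 [De3 [De0 wc]]] := @wild_count E N E0; first by rewrite hN.
have [||L cr] := @cross_ok D q0 (sg + J1) c4 J1 _ _ c4E J1E.
- by rewrite q0E; clear; lia.
- by clear - sg0; lia.
have [L2 hL2] := lin_half (2 + 32 * K4).
have [L0 L0E] : exists L0, L0 = L + L2 + 50 * 50 by eexists.
exists (n1 + 2 ^ L0 + 9 * De3 + E * 2); split=> // T n0 GG hG.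
have [n nE] : exists n, n = #|T| by eexists.
have [lam lamE] : exists lam, lam = trunc_log 2 #|T| by eexists.
have np : 0 < #|T|.
  by apply: leq_trans n0; have : 0 < 2 ^ L0 by [rewrite expn_gt0]; move: (2 ^ L0) => z; clear; lia.
have nL0 : 2 ^ L0 <= #|T| by apply: leq_trans n0; move: (2 ^ L0) => z; clear; lia.
have nn1 : n1 <= #|T| by apply: leq_trans n0; move: (2 ^ L0) => z; clear; lia.
have nDe : 9 * De3 <= #|T| by apply: leq_trans n0; move: (2 ^ L0) => z; clear; lia.
have nE2 : E * 2 <= #|T| by apply: leq_trans n0; move: (2 ^ L0) => z; clear; lia.
have /andP [nl ng] := trunc_log_bounds (isT : 1 < 2) np; rewrite -lamE in nl ng.
have lL0 : L0 <= lam by rewrite -ltnS -(@ltn_exp2l 2) //; apply: leq_ltn_trans ng.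
have lL : L <= lam by clear - lL0 L0E; lia.
have lL2 : L2 <= lam by clear - lL0 L0E; lia.
have l50 : 50 * 50 <= lam by clear - lL0 L0E; lia.
have lam1 : 0 < lam by clear - l50; lia.
have hA := hL2 _ lL2.
have hAn : (2 + 32 * K4) * lam.+1 <= #|T|.
  by apply: leq_trans nl; apply: leq_trans hA _; rewrite leq_exp2l // leq_div.
have n2 : 2 * lam <= #|T| by apply: leq_trans hAn; clear; nia.
have hl4 : 8 * K4 * (lam + 4) <= #|T| by apply: leq_trans hAn; clear; nia.
have l2h : lam + 2 <= 2 ^ (lam %/ 2) by apply: leq_trans hA; clear; nia.
have lam2 : (lam + 2) * (lam + 2) <= #|T|.
  apply: leq_trans nl; apply: leq_trans (leq_mul l2h l2h) _; rewrite -expnD leq_exp2l //; clear; lia.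
set g := #|T| %/ trunc_log 2 #|T|; rewrite -lamE in g *.
have glam : g * lam <= #|T| by apply: leq_divM.
have glam' : #|T| < g.+1 * lam by apply: ltn_ceil.
have g4 : 2 ^ (lam %/ 2) <= g.
  rewrite leq_divRL //; apply: leq_trans nl; apply: leq_trans (leq_mul (leqnn _) (_ : lam <= 2 ^ (lam %/ 2))) _.
    by apply: leq_trans l2h; rewrite leq_addr.
  rewrite -expnD leq_exp2l //; clear; lia.
have g0 : 0 < g by apply: leq_trans g4; rewrite expn_gt0.
have lam8 : 8 <= lam by clear - l50; lia.
have n14 : #|T|.+1 <= 2 ^ lam.+1 by [].
have hi_eq : 2 ^ D * lam = 2 ^ (24 * (C2 + 20)) * lam by rewrite DE.
have loE : lam %/ q0 * (144 * (C2 + 20)) <= lam.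
  by apply: leq_trans (leq_divM lam q0); rewrite leq_mul2l q0E leq_addr orbT.
have cross := cr T lam lL nl n14.
pose main := g ^ (#|T| %/ 2) * 2 ^ (#|T| * #|T| %/ 4); rewrite -/main.
pose e := #|T| %/ N; pose h := #|T| %/ E; pose w := #|T| %/ 40.
pose WW := [set G in GG | `[< exists K X, sdata e G K X /\ wild h G K X >]].
have sub2 : #|GG| = #|GG :&: WW| + #|GG :\: WW| by rewrite cardsID.
have q1 : #|GG :&: WW| * 2 ^ (9 * #|T|) <= main.
  have := wc T nn1 (GG :&: WW); rewrite -/e -/h => /(_ _) hw.
  apply: leq_trans (_ : #|GG :&: WW| * 2 ^ (#|T| * #|T| %/ De3) <= _).
    rewrite leq_mul2l leq_exp2l // leq_divRL // mulnAC leq_mul2r nDe orbT //= orbT //.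
  apply: leq_trans (hw _) _; last by rewrite leq_pmull // expn_gt0 g0.
  move=> G; rewrite inE => /andP [GGG]; rewrite inE => /andP [_ /asboolP hh]; split=> //; by have [] := hG _ GGG.
have q2 : #|GG :\: WW| * 2 ^ (9 * #|T|) <= main.
  pose LT := ({set T} * {set T} * {set T} * {set T} * {set T} * bool * bool)%type.
  pose CC (l : LT) : {set sgraph T} := let: (K, X, Xs, CP, CQ, fe, ff) := l in
    [set G in GG :\: WW | `[< s3 e h w G K X Xs CP CQ fe ff >]].
  have ub : nt setT (GG :\: WW) <= #|xpredT : pred LT| * (main %/ 2 ^ (15 * #|T|)).
    apply: (nt_union (CC := CC)) => [G GD|[[[[[[K X] Xs] CP] CQ] fe] ff] _].
      move: (GD); rewrite in_setD => /andP [nW GGG]; have [c5 [K [X sd]] nc] := hG _ GGG.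
      have h1 : 1 < h by rewrite /h leq_divRL // mulnC.
      have [|Xs [CP [CQ [fe [ff s]]]]] := @s3_exists T e h w G K X h1 sd.
        by move=> wd; move/negP: nW; apply; rewrite inE GGG; apply/asboolP; exists K, X.
      by exists (K, X, Xs, CP, CQ, fe, ff) => //; rewrite /CC inE GD; apply/asboolP.
    rewrite nt_setT leq_divRL ?expn_gt0 //; case: (boolP (fe && ff)) => [/andP [fe1 ff1]|nU].
      apply: (@label_U T K4 E N lam g C2 (lam %/ q0) (2 ^ D * lam) (D + 3) (2 * q0) J1 (sg + J1) c4 J0) => //.
      move=> G; rewrite /CC fe1 ff1 inE in_setD => /andP [/andP [_ GGG] /asboolP s]; have [c5 _ nc] := hG _ GGG.
      by split=> //; first exact: s; move=> /coded_of_good.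
    apply: (@label_notU T K4 E N lam g) nU _ => //.
    move=> G; rewrite /CC inE in_setD => /andP [/andP [_ GGG] /asboolP s]; have [c5 _ nc] := hG _ GGG; split=> //; exact: s.
  rewrite nt_setT in ub; apply: leq_trans (leq_mul ub (leqnn _)) _.
  rewrite !card_prod card_setTE card_bool.
  apply: leq_trans (_ : 2 ^ (15 * #|T|) * (main %/ 2 ^ (15 * #|T|)) <= _); last by rewrite mulnC leq_divM.
  rewrite mulnAC leq_mul2r; apply/orP; right.
  (* The label consists of five sets and two truth values; with [9 * n] bits kept for the conclusion
     this stays below the [15 * n] bits gained for each label. *)
  have -> : 2 ^ #|T| * 2 ^ #|T| * 2 ^ #|T| * 2 ^ #|T| * 2 ^ #|T| * 2 * 2 * 2 ^ (9 * #|T|) = 2 ^ (14 * #|T| + 2).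
    have -> : 14 * #|T| + 2 = #|T| + #|T| + #|T| + #|T| + #|T| + 1 + 1 + 9 * #|T| by clear; lia.
    by rewrite !expnD expn1.
  by rewrite leq_exp2l //; clear - l50 n2; lia.
have : #|GG| * 2 ^ (9 * #|T|) <= 2 * main by rewrite sub2 mulnDl mul2n -addnn leq_add.
have -> : 9 * #|T| = 8 * #|T| + #|T| by clear; lia.
have gen (a b c : nat) : 2 <= b -> a * b <= 2 * c -> a <= c by clear; nia.
rewrite expnD mulnA; apply: gen; by rewrite -{1}[2]expn1 leq_exp2l.
Qed.

Theorem coded_count : exists J t r, forall sg, 0 < sg -> exists n0, forall T : finType, n0 <= #|T| ->
  forall GG : {set sgraph T},
  (forall G, G \in GG -> [/\ C5free G, EH G, ~ coded J t r sg G & ~ coded J t r sg (cg G)]) ->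
  #|GG| * 2 ^ (6 * #|T|) <= (#|T| %/ trunc_log 2 #|T|) ^ (#|T| %/ 2) * 2 ^ (#|T| * #|T| %/ 4).
Proof.
have [J [t [r hc]]] := half_count; exists J, t, r => sg sg0; have [N [n1 [N1 {}hc]]] := hc sg sg0.
have [n2 [De2 [De0 sc]]] := structure_count N1.
exists (n1 + n2 + 8 * De2 + 4) => T nT GG hG; set main := (X in _ <= X).
have nn1 : n1 <= #|T| by clear - nT; lia.
have nn2 : n2 <= #|T| by clear - nT; lia.
have nD : 8 * De2 <= #|T| by clear - nT; lia.
have n4 : 4 <= #|T| by clear - nT; lia.
have g0 : 0 < #|T| %/ trunc_log 2 #|T|.
  have np : 0 < #|T| by clear - n4; lia.
  rewrite divn_gt0; last by rewrite trunc_log_gt0 /= (leq_trans _ n4).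
  by apply: leq_trans (trunc_logP (isT : 1 < 2) np); apply: ltnW; apply: ltn_expl.
pose e := #|T| %/ N.
pose A := [set G in GG | `[< struct e G >]]; pose B := [set G in GG | `[< struct e (cg G) >]].
have hA : #|A| * 2 ^ (8 * #|T|) <= main.
  by apply: (hc T nn1 A) => G; rewrite inE => /andP [/hG [c5 _ nc _] /asboolP s].
have hB : #|B| * 2 ^ (8 * #|T|) <= main.
  have -> : #|B| = #|[set cg G | G in B]| by rewrite card_imset //; apply: can_inj; apply: cgK.
  apply: (hc T nn1 [set cg G | G in B]) => _ /imsetP [G + ->]; rewrite inE => /andP [/hG [c5 _ _ nc] /asboolP s]; split=> //; exact: C5free_cg.
have hC : #|GG :\: (A :|: B)| * 2 ^ (8 * #|T|) <= main.
  apply: leq_trans (_ : #|GG :\: (A :|: B)| * 2 ^ (#|T| * #|T| %/ De2) <= _).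
    by rewrite leq_mul2l leq_exp2l // leq_divRL // mulnAC leq_mul2r nD !orbT.
  apply: leq_trans (sc T nn2 _ _) _; last by rewrite /main leq_pmull // expn_gt0 g0.
  move=> G; rewrite in_setD in_setU !inE => /andP [+ GGG]; rewrite GGG /= negb_or => /andP [/asboolP s1 /asboolP s2].
  by have [c5 eh _ _] := hG _ GGG.
have : #|GG| <= #|A| + #|B| + #|GG :\: (A :|: B)|.
  rewrite -(cardsID (A :|: B) GG) leq_add2r; apply: leq_trans (leq_card_setU _ _); exact: subset_leq_card (subsetIr _ _).
move=> le; have : #|GG| * 2 ^ (8 * #|T|) <= 3 * main.
  apply: leq_trans (leq_mul le (leqnn _)) _; rewrite !mulnDl (_ : 3 * main = main + main + main); last by clear; lia.
  by rewrite !leq_add.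
have -> : 8 * #|T| = 6 * #|T| + 2 * #|T| by clear; lia.
have gen (a b c : nat) : 3 <= b -> a * b <= 3 * c -> a <= c by clear; nia.
rewrite expnD mulnA; apply: gen.
by apply: leq_trans (_ : 2 ^ 2 <= _) => //; rewrite leq_exp2l //; clear - n4; lia.
Qed.

(** * Perfect graphs *)

Section Hall.
Variables (L R : finType) (r : L -> R -> bool).
Implicit Types (C S : {set L}) (D : {set R}).

Definition hallN D S : {set R} := [set y in D | [exists x in S, r x y]].

(** The usual induction. If every nonempty proper subset has more neighbours than elements, one pair
    is matched arbitrarily; otherwise a critical set [S] and its complement are matched separately,
    the latter outside the neighbours of [S]. *)
Lemma hall C D : (forall S, S \subset C -> #|S| <= #|hallN D S|) ->
  exists f : L -> option R, (forall x, x \in C -> exists y, [/\ f x = Some y, y \in D & r x y]) /\ {in C &, injective f}.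
Proof.
have [m] := ubnP #|C|; elim: m C D => // m IH C D leC hC.
have [->|/set0Pn [x0 x0C]] := eqVneq C set0; first by exists (fun=> None); split=> x; rewrite inE.
have [tight|/forall_inPn [S]] := boolP [forall S in [set S : {set L} | (S \proper C) && (S != set0)], #|S| < #|hallN D S|].
  have /card_gt0P [y0] : 0 < #|hallN D [set x0]| by apply: leq_trans (hC _ _); rewrite ?cards1 ?sub1set.
  rewrite inE => /andP [y0D /exists_inP [x]]; rewrite inE => /eqP -> {x} a0.
  have [||f [h1 h2]] := IH (C :\ x0) (D :\ y0).
  - by move: leC; rewrite (cardsD1 x0 C) x0C.
  - move=> S sS; have [->|S0] := eqVneq S set0; first by rewrite cards0.
    have pS : S \proper C by apply: sub_proper_trans sS _; rewrite properD1.
    have /forall_inP /(_ S) := tight; rewrite inE pS S0 => /(_ isT).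
    have -> : hallN (D :\ y0) S = hallN D S :\ y0 by apply/setP => y; rewrite !inE andbA.
    by rewrite (cardsD1 y0 (hallN D S)); case: (_ \in _); rewrite ?add1n ?add0n // => /ltnW.
  have nf x : x \in C :\ x0 -> f x <> Some y0.
    by move=> /h1 [y [-> + _]]; rewrite !inE => /andP [/eqP ne _] [].
  exists (fun x => if x == x0 then Some y0 else f x); split=> [x xC|x y xC yC].
    case: eqP => [->|/eqP ne]; first by exists y0.
    by have [|y [e + a]] := h1 x; rewrite ?inE ?ne // => /andP [_ yD]; exists y.
  case: eqP => [->|/eqP nx]; case: eqP => [->|/eqP ny] //.
  - by move=> /esym e; case: (nf y) => //; rewrite !inE ny.
  - by move=> e; case: (nf x) => //; rewrite !inE nx.
  by apply: h2; rewrite !inE ?nx ?ny.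
rewrite inE -leqNgt => /andP [pS S0] cS; have sS := proper_sub pS.
have [||f [h1 h2]] := IH S D; first by apply: leq_trans (proper_card pS) _.
  by move=> S' sS'; apply: hC; apply: subset_trans sS.
have [||f' [h1' h2']] := IH (C :\: S) (D :\: hallN D S).
- rewrite cardsD (setIidPr sS); have : 0 < #|S| by rewrite card_gt0.
  by have := subset_leq_card sS; move: leC; clear; lia.
- move=> S' sS'; have dS : [disjoint S' & S].
    by rewrite disjoints_subset; apply: subset_trans sS' _; rewrite setDE subsetIr.
  have sU : S' :|: S \subset C by rewrite subUset sS (subset_trans sS') // subsetDl.
  have := hC _ sU; rewrite cardsU (disjoint_setI0 dS) cards0 subn0.
  have -> : hallN D (S' :|: S) = hallN (D :\: hallN D S) S' :|: hallN D S.
    apply/setP => y; rewrite !inE; case: (boolP (y \in D)) => //= yD; rewrite ?andbF //.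
    case: (boolP [exists x in S, r x y]) => [/exists_inP [x xS a]|/exists_inPn nS] /=.
      by rewrite ?orbT; apply/exists_inP; exists x; rewrite // inE xS orbT.
    rewrite orbF; apply/exists_inP/exists_inP => -[x]; last by move=> xS a; exists x; rewrite // inE xS.
    by rewrite inE => /orP [xS a|xS a]; [exists x | have := nS _ xS; rewrite a].
  move=> le; have := leq_trans le (leq_card_setU _ _).
  by move: cS; move: #|S'| #|S| #|hallN D S| #|hallN _ S'|; clear; lia.
have nf x y : x \in S -> y \in C :\: S -> f x <> f' y.
  move=> xS yS e; have [u [e1 uD a]] := h1 _ xS; have [v [e2 vD _]] := h1' _ yS.
  have uv : u = v by move: e; rewrite e1 e2 => -[].
  by move: vD; rewrite -uv inE => /andP [/negP []]; rewrite inE uD; apply/exists_inP; exists x.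
exists (fun x => if x \in S then f x else f' x); split=> [x xC|x y xC yC].
  case: ifP => xS; first exact: h1.
  by have [|y [e + a]] := h1' x; rewrite ?inE ?xS // => /andP [_ yD]; exists y.
case: ifP => xS; case: ifP => yS.
- exact: h2.
- by move=> /nf []; rewrite // inE yS.
- by move=> /esym /nf []; rewrite // inE xS.
by apply: h2'; rewrite inE ?xS ?yS.
Qed.

End Hall.

(** * Optimal colouring of unipolar graphs *)

Section Unipolar.
Variable T : finType.
Implicit Types (G : sgraph T) (A K S X Y I : {set T}).

Lemma clique_number_ge G K : clique G K -> #|K| <= clique_number G.
Proof. by move=> cK; apply: (@leq_bigmax_cond _ (clique G) (fun K : {set T} => #|K|)). Qed.

Lemma colorable_ge G k : colorable G k -> clique_number G <= k.
Proof.
move=> /existsP [c /forallP hc]; apply/bigmax_leqP => K /cliqueP cK.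
rewrite -[X in _ <= X]card_ord -cardsT -(card_in_imset (f := c)); first exact: subset_leq_card (subsetT _).
move=> x y xK yK e; apply/eqP; apply: contraT => ne.
by have /forallP /(_ y) := hc x; rewrite cK // e eqxx.
Qed.

(** [Y] is coloured injectively. Different blocks of [X] are not joined by edges, so each can be
    coloured separately, and Hall's theorem finds distinct colours in a block that respect the edges
    to [Y]. *)
Lemma unipolar_colorable G X : P3free G X -> clique G (~: X) -> colorable G (clique_number G).
Proof.
move=> fX cY; set k := clique_number G.
have [Y YE] : exists Y, Y = ~: X by eexists.
rewrite -YE in cY; have cYk := clique_number_ge cY; rewrite -/k in cYk.
have inY x : (x \in Y) = (x \notin X) by rewrite YE inE.
have [k0|kp] := posnP k.
  have e0 (x : T) : False.
    have c1 : clique G [set x] by apply/cliqueP => u v; rewrite !inE => /eqP -> /eqP ->; rewrite eqxx.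
    by have := clique_number_ge c1; rewrite cards1 -/k k0.
  by rewrite /colorable; apply/existsP; exists [ffun x => False_rect _ (e0 x)]; apply/forallP => x; case: (e0 x).
pose kap y : 'I_k := insubd (Ordinal kp) (index y (enum Y)).
have kapE y : y \in Y -> val (kap y) = index y (enum Y).
  move=> yY; rewrite /kap val_insubd (_ : _ < k) //; apply: leq_trans cYk; by rewrite cardE index_mem mem_enum.
have kapI x y : x \in Y -> y \in Y -> kap x = kap y -> x = y.
  move=> xY yY /(congr1 val); rewrite !kapE // => e.
  by rewrite -(nth_index x (_ : x \in enum Y)) ?mem_enum // e nth_index ?mem_enum.
pose ok x (i : 'I_k) := [forall y in Y, (kap y == i) ==> ~~ adj G x y].
have blockf x : exists f : T -> option 'I_k, x \in X -> (forall z, z \in blkof G X x -> exists i, f z = Some i /\ ok z i) /\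
    {in blkof G X x &, injective f}.
  have [xX|_] := boolP (x \in X); last by exists (fun=> None).
  have [|f [h1 h2]] := @hall _ _ ok (blkof G X x) setT; last first.
    by exists f => _; split=> // z /h1 [i [-> _ o]]; exists i.
  move=> S sS; have [->|S0] := eqVneq S set0; first by rewrite cards0.
  (* Hall's condition: a colour is forbidden for all of [S] only if the vertex of [Y]
     carrying it extends the clique [S]. *)
  pose B := [set y in Y | [forall z in S, adj G z y]].
  have SX z : z \in S -> z \in X by move=> /(subsetP sS); rewrite inE => /andP [].
  have dS : [disjoint S & B].
    by apply/pred0P => z /=; apply/negP => /andP [/SX zX]; rewrite inE inY zX.
  have cSB : clique G (S :|: B).
    apply/cliqueP => u v; rewrite !inE => /orP [uS|/andP [uY /forall_inP ua]] /orP [vS|/andP [vY /forall_inP va]] ne.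
    - have uB := subsetP sS _ uS; have vB := subsetP sS _ vS; rewrite (blkofP fX) ?SX //.
      have be w : w \in blkof G X x -> blkof G X w = blkof G X x.
        by rewrite inE => /andP [wX /orP [/eqP ->//|a]]; apply/esym; apply: blkof_eq.
      by rewrite !be.
    - exact: va.
    - by rewrite adj_sym; apply: ua.
    - by move/cliqueP: cY; apply.
  have := clique_number_ge cSB; rewrite cardsU (disjoint_setI0 dS) cards0 subn0 -/k => le.
  have cB : #|kap @: B| <= #|B| by apply: leq_imset_card.
  have : #|~: (kap @: B)| <= #|hallN ok setT S|.
    apply: subset_leq_card; apply/subsetP => i; rewrite inE => iB; rewrite !inE /=.
    apply: contraT => /exists_inPn no; case/negP: iB.
    have /set0Pn [z0 z0S] := S0; have := no _ z0S; rewrite negb_forall_in => /exists_inP [y yY].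
    rewrite negb_imply negbK => /andP [/eqP ki _]; apply/imsetP; exists y => //; rewrite inE yY.
    apply/forall_inP => z zS; have := no _ zS; rewrite negb_forall_in => /exists_inP [y' y'Y].
    by rewrite negb_imply negbK => /andP [/eqP ki' a]; rewrite (kapI y y') // ki ki'.
  have := cardsC (kap @: B); rewrite card_ord; move: le cB.
  by move: #|S| #|B| #|_ @: _| #|~: _| #|hallN _ _ _|; clear; lia.
have [F hF] := fin_all_exists blockf.
pose c x : 'I_k := if x \in X then odflt (Ordinal kp) (F (brep G X x) x) else kap x.
apply/existsP; exists [ffun x => c x]; apply/forallP => x; apply/forallP => y; apply/implyP => a; rewrite !ffunE.
have inb u : u \in X -> u \in blkof G X (brep G X u) /\ brep G X u \in X.
  by move=> uX; have [bX be] := brep_in fX uX; rewrite be blkof_self.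
have okx u : u \in X -> exists i, F (brep G X u) u = Some i /\ ok u i.
  by move=> uX; have [ub bX] := inb _ uX; have [h _] := hF _ bX; apply: h.
have ne := adj_neq a.
have cross u v : u \in X -> v \notin X -> adj G u v -> c u != c v.
  move=> uX vX auv; rewrite /c uX (negbTE vX); have [i [-> /forall_inP /(_ v)]] := okx _ uX.
  rewrite inY vX => /(_ isT); rewrite auv implybF /= => h; by rewrite eq_sym.
case: (boolP (x \in X)) => xX; case: (boolP (y \in X)) => yX.
- rewrite /c xX yX; have [i [ei _]] := okx _ xX; have [j [ej _]] := okx _ yX.
  have eb : brep G X x = brep G X y by apply/eqP; rewrite brepP // -(blkofP fX).
  rewrite ei ej /=; apply: contraNneq ne => ij; apply/eqP.
  have [xb bX] := inb _ xX; have [_ inj] := hF _ bX; apply: inj => //.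
    by have [] := inb _ yX; rewrite -eb.
  by rewrite ei ij eb ej.
- exact: cross.
- by rewrite eq_sym; apply: cross; rewrite // adj_sym.
rewrite /c (negbTE xX) (negbTE yX); apply: contraNneq ne => e; apply/eqP; apply: kapI => //; by rewrite inY.
Qed.

End Unipolar.

(** * Unipolar graphs are perfect; homogeneous sets and five-cycles in perfect graphs *)

Section PerfectFacts.
Variable T : finType.
Implicit Types (G : sgraph T) (A K S X Y I : {set T}).

Lemma unipolar_perfect G X : P3free G X -> clique G (~: X) -> perfect G.
Proof.
move=> fX cY; apply/forallP => S; apply/eqP; rewrite /chromatic_number; case: ex_minnP => m hm min.
apply/eqP; rewrite eqn_leq (colorable_ge hm) andbT; apply: min.
apply: (unipolar_colorable (X := [set x | val x \in X])).
  move=> x y z; rewrite !inE => xX yX zX; have := fX _ _ _ xX yX zX; rewrite /p3 /adj !ffunE /=; exact.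
apply/cliqueP => x y; rewrite !inE => xX yX ne; rewrite /adj ffunE /=.
by move/cliqueP: cY; apply; rewrite ?inE.
Qed.

(** A colouring with as many colours as a largest clique has vertices contains a class of at least
    average size. *)
Lemma perfect_product G S : perfect G -> exists K I : {set T},
  [/\ K \subset S, I \subset S, clique G K, indep G I & #|S| <= #|K| * #|I|].
Proof.
move=> /forallP /(_ S) /eqP; set H := (X in clique_number X) => pS.
have cH : colorable H (clique_number H) by rewrite -pS /chromatic_number; case: ex_minnP.
have [k kE] : exists k, k = clique_number H by eexists.
have [K0 cK0 cK] : exists2 K0, clique H K0 & #|K0| = k.
  have c0 : clique H set0 by apply/cliqueP => x y; rewrite inE.
  have cp : 0 < #|[pred K | clique H K]| by apply/card_gt0P; exists set0.
  have [K0 h1 h2] := @eq_bigmax_cond _ [pred K | clique H K] (fun K : {set {x | x \in S}} => #|K|) cp.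
  by exists K0; [exact: h1 | rewrite kE; exact: esym h2].
rewrite -kE in cH; case/existsP: cH => c /forallP hc.
have valinj := @val_inj _ _ {x | x \in S}.
have toS (A : {set {x | x \in S}}) : [set val x | x in A] \subset S.
  by apply/subsetP => _ /imsetP [x _ ->]; apply: valP.
have cS : #|S| = #|{: {x | x \in S}}| by rewrite card_sig; apply: eq_card => x; rewrite !inE.
have [k0|kp] := posnP k.
  exists set0, set0; split; rewrite ?sub0set //; [by apply/cliqueP => x y; rewrite inE|by apply/indepP => x y; rewrite inE|].
  rewrite cards0 leqn0 cS; apply/eqP; apply: eq_card0 => x.
  by have h : 0 < k := leq_ltn_trans (leq0n _) (ltn_ord (c x)); rewrite k0 in h.
have [i hi] : exists i : 'I_k, #|S| <= k * #|[set x | c x == i]|.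
  apply: contrapT => no; have {}no (i : 'I_k) : k * #|[set x | c x == i]| < #|S| by rewrite ltnNge; apply/negP => h; apply: no; exists i.
  have e : #|S| = \sum_(i < k) #|[set x | c x == i]|.
    rewrite cS -sum1_card (partition_big c predT) //=; apply: eq_bigr => j _; rewrite sum1dep_card; apply: eq_card => x.
    by rewrite !inE.
  have Sp : 0 < #|S| by apply: leq_ltn_trans (no (Ordinal kp)).
  have : k * #|S| < k * #|S|.
    rewrite {1}e big_distrr /=; apply: leq_ltn_trans (_ : \sum_(i < k) #|S|.-1 < _).
      by apply: leq_sum => j _; rewrite -ltnS prednK // no.
    by rewrite sum_nat_const card_ord ltn_pmul2l // prednK.
  by rewrite ltnn.
exists [set val x | x in K0], [set val x | x in [set x | c x == i]]; split; rewrite ?toS //.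
- apply/cliqueP => _ _ /imsetP [x xK ->] /imsetP [y yK ->] ne; move/cliqueP: cK0 => /(_ x y xK yK).
  rewrite /adj ffunE /=; apply; by apply: contraNneq ne => ->.
- apply/indepP => _ _ /imsetP [x + ->] /imsetP [y + ->]; rewrite !inE => /eqP cx /eqP cy.
  by have /forallP /(_ y) := hc x; rewrite cx cy eqxx implybF /adj ffunE.
by rewrite !card_imset // cK.
Qed.

Lemma perfect_EH G : perfect G -> EH G.
Proof.
move=> pG S; have [K [I [sK sI cK iI le]]] := perfect_product S pG.
have [h|h] := leqP #|K| #|I|.
  by exists I; rewrite // /homog iI orbT /=; apply: leq_trans le _; rewrite leq_mul2r h orbT.
by exists K; rewrite // /homog cK /=; apply: leq_trans le _; rewrite leq_mul2l ltnW ?orbT.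
Qed.

(** A clique or an independent set in a C5 has at most two vertices, and [2 * 2 < 5] contradicts
    [perfect_product]. *)
Lemma perfect_C5free G : perfect G -> C5free G.
Proof.
move=> pG v0 v1 v2 v3 v4 a01 a12 a23 a34 a40 n02 n03 n13 n14 n24.
have far u v w : adj G u w -> ~~ adj G v w -> v != u by move=> a; apply: contraNneq => ->.
have d02 : v0 != v2 := far _ _ _ a23 n03.
have d03 : v0 != v3 by apply: far n02; rewrite adj_sym.
have d13 : v1 != v3 := far _ _ _ a34 n14.
have d14 : v1 != v4 by apply: far n13; rewrite adj_sym.
have d24 : v2 != v4 by apply: (far _ _ v0); rewrite // adj_sym.
have d01 := adj_neq a01; have d12 := adj_neq a12; have d23 := adj_neq a23; have d34 := adj_neq a34; have d40 := adj_neq a40.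
pose s := [:: v0; v1; v2; v3; v4]; pose S := [set x in s].
have cS : #|S| = 5.
  rewrite cardsE (card_uniqP _) //= !inE !negb_or d01 d02 d03 d12 d13 d14 d23 d24 d34 /= eq_sym d40 //.
have [K [I [sK sI /cliqueP cK /indepP iI le]]] := perfect_product S pG.
have cnt A : A \subset S -> #|A| <= (v0 \in A) + ((v1 \in A) + ((v2 \in A) + ((v3 \in A) + ((v4 \in A) + 0)))).
  move=> sA; rewrite (_ : _ + _ = count (mem A) s) // -size_filter cardE; apply: uniq_leq_size; first exact: enum_uniq.
  move=> x; rewrite mem_enum mem_filter => xA; apply/andP; split; first exact: xA.
  by have := subsetP sA _ xA; rewrite inE.
have K2 : #|K| <= 2.
  apply: leq_trans (cnt _ sK) _.
  have n u v : u != v -> ~~ adj G u v -> ~~ ((u \in K) && (v \in K)).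
    by move=> ne na; apply/negP => /andP [uK vK]; rewrite cK in na.
  move: (n _ _ d02 n02) (n _ _ d03 n03) (n _ _ d13 n13) (n _ _ d14 n14) (n _ _ d24 n24).
  by case: (v0 \in K); case: (v1 \in K); case: (v2 \in K); case: (v3 \in K); case: (v4 \in K).
have I2 : #|I| <= 2.
  apply: leq_trans (cnt _ sI) _.
  have n u v : adj G u v -> ~~ ((u \in I) && (v \in I)).
    by move=> na; apply/negP => /andP [uK vK]; have := iI _ _ uK vK; rewrite na.
  move: (n _ _ a01) (n _ _ a12) (n _ _ a23) (n _ _ a34) (n _ _ a40).
  by case: (v0 \in I); case: (v1 \in I); case: (v2 \in I); case: (v3 \in I); case: (v4 \in I).
by move: le; rewrite cS; move: K2 I2; clear; nia.
Qed.

End PerfectFacts.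

(** * A lower bound for the number of perfect graphs *)

Section LowerBound.
Variable T : finType.
Implicit Types (X Y R : {set T}).

Definition uni_adj X (f : {ffun T -> T}) (B : {set T * T}) (u v : T) : bool :=
  (u != v) && (if u \in X then (if v \in X then f u == f v else (u, v) \in B)
               else (if v \in X then (v, u) \in B else true)).

Lemma uni_simple X f B : simple_adj [ffun p : T * T => uni_adj X f B p.1 p.2].
Proof.
apply/andP; split; first by apply/forallP => x; rewrite ffunE /uni_adj eqxx.
apply/forallP => x; apply/forallP => y; rewrite !ffunE /uni_adj /=; apply/eqP; rewrite [x == y]eq_sym; congr (_ && _).
by case: (x \in X); case: (y \in X) => //; rewrite eq_sym.
Qed.

Definition uni X f B : sgraph T := SGraph (uni_simple X f B).

Lemma uniE X f B u v : adj (uni X f B) u v = uni_adj X f B u v.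
Proof. by rewrite /adj ffunE. Qed.

Lemma uni_perfect X f B : perfect (uni X f B).
Proof.
apply: (unipolar_perfect (X := X)).
  move=> x y z xX yX zX; rewrite /p3 !uniE /uni_adj xX yX zX.
  case: (eqVneq x z) => [->|]; rewrite ?andbF //= => _; apply/negP => /and3P [/andP [_ /eqP ->] /andP [_ /eqP ->]].
  by rewrite eqxx.
by apply/cliqueP => x y; rewrite !inE => /negbTE nx /negbTE ny ne; rewrite uniE /uni_adj ne nx ny.
Qed.

(** Fixed representatives make the parametrisation injective: [f] sends every other vertex of [X] to
    the representative of its block, and [B] is arbitrary. *)
Lemma many_perfect X R : R \subset X ->
  #|R| ^ (#|X| - #|R|) * 2 ^ (#|X| * #|~: X|) <= #|[set G : sgraph T | perfect G]|.
Proof.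
move=> sR; pose F x : {set T} := if x \in X :\: R then R else [set x].
pose D := setX [set f : {ffun T -> T} | f \in family F] (powerset (setX X (~: X))).
have fR f x : f \in family F -> x \in R -> f x = x.
  by move=> /familyP /(_ x) + xR; rewrite /F in_setD xR inE => /eqP.
have fX f x : f \in family F -> x \in X -> x \notin R -> f x \in R.
  by move=> /familyP /(_ x) + xX xR; rewrite /F in_setD xX xR.
have fC f x : f \in family F -> x \notin X -> f x = x.
  by move=> /familyP /(_ x) + xX; rewrite /F in_setD (negbTE xX) andbF inE => /eqP.
have cD : #|D| = #|R| ^ (#|X| - #|R|) * 2 ^ (#|X| * #|~: X|).
  rewrite cardsX card_powerset cardsX cardsE family_card; congr (_ * _).
  rewrite (bigID (fun x => x \in X :\: R)) /= [X in _ * X]big1 ?muln1; last by move=> x /negbTE h; rewrite /F h cards1.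
  rewrite (eq_bigr (fun=> #|R|)) => [|x h]; last by rewrite /F h.
  by rewrite prod_nat_const cardsD (setIidPr sR).
rewrite -cD -(card_in_imset (f := fun p => uni X p.1 p.2)).
  by apply: subset_leq_card; apply/subsetP => _ /imsetP [p _ ->]; rewrite inE uni_perfect.
move=> [f B] [f' B']; rewrite !inE /= => /andP [ff sB] /andP [ff' sB'] e.
have {}e u v : uni_adj X f B u v = uni_adj X f' B' u v by rewrite -!uniE e.
congr (_, _).
  apply/ffunP => x; case: (boolP (x \in X)) => xX; last by rewrite !fC.
  case: (boolP (x \in R)) => xR; first by rewrite !fR.
  have rR := fX _ _ ff xX xR; have rX := subsetP sR _ rR; have := e x (f x).
  rewrite /uni_adj xX rX (fR f (f x) ff rR) (fR f' (f x) ff' rR) eqxx andbT.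
  case: (eqVneq x (f x)) => [ex|_] /=; last by move=> /esym /eqP ->.
  by rewrite -ex (negbTE xR) in rR.
apply/setP => -[u v]; case: (boolP ((u, v) \in setX X (~: X))) => [/setXP [uX]|no]; last first.
  by rewrite (negbTE (contra (subsetP sB _) no)) (negbTE (contra (subsetP sB' _) no)).
rewrite inE => vX; have := e u v; rewrite /uni_adj uX (negbTE vX).
by case: (eqVneq u v) => [ev|_] //=; rewrite -ev uX in vX.
Qed.

End LowerBound.

(** Balanced sides and [g] representatives are taken in [many_perfect]; the loss against the stated
    bound is [g ^ g], at most [2 ^ (2 * n)] because [g * lam <= n]. *)
Lemma perfect_lower : exists n0, forall T : finType, n0 <= #|T| ->
  (#|T| %/ trunc_log 2 #|T|) ^ (#|T| %/ 2) * 2 ^ (#|T| * #|T| %/ 4) <=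
  #|[set G : sgraph T | perfect G]| * 2 ^ (2 * #|T|).
Proof.
exists 4 => T n4; have [lam lE] : exists lam, lam = trunc_log 2 #|T| by eexists.
have [g gE] : exists g, g = #|T| %/ lam by eexists.
rewrite -lE -gE; have np : 0 < #|T| by apply: leq_trans n4.
have /andP [nl ng] := trunc_log_bounds (isT : 1 < 2) np; rewrite -lE in nl ng.
have l2 : 2 <= lam by rewrite -ltnS -(@ltn_exp2l 2) //; apply: leq_ltn_trans ng.
have lp : 0 < lam by apply: ltnW.
have gl : g * lam <= #|T| by rewrite gE leq_divM.
have gx : g <= #|T| %/ 2 by rewrite gE; apply: leq_div2l.
have hx : #|T| %/ 2 <= #|[set: T]| by rewrite cardsT leq_div.
have [X _ cX] := subset_of_card hx; rewrite -cX in gx; have [R sR cR] := subset_of_card gx.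
have := many_perfect sR; rewrite cR => mp.
have cC : #|X| * #|~: X| = #|T| * #|T| %/ 4.
  have := cardsC X; rewrite cX => <-; move: #|~: X| (cardsC X); rewrite cX => y hy.
  have [k [kE|kE]] : exists k, #|T| = 2 * k \/ #|T| = 2 * k + 1 by exists (#|T| %/ 2); clear; lia.
    have -> : #|T| %/ 2 = k by rewrite kE; clear; lia.
    have -> : y = k by move: hy; rewrite kE; clear; lia.
    by rewrite (_ : (k + k) * (k + k) = k * k * 4) ?mulnK //; clear; nia.
  have -> : #|T| %/ 2 = k by rewrite kE; clear; lia.
  have -> : y = k + 1 by move: hy; rewrite kE; clear; lia.
  rewrite (_ : (k + (k + 1)) * (k + (k + 1)) = k * (k + 1) * 4 + 1); last by clear; nia.
  have -> : (k + (k + 1)) %/ 2 = k by clear; lia.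
  by move: (k * (k + 1)) => z; clear; lia.
rewrite cC in mp; rewrite -cX -(subnK gx) expnD mulnAC; apply: leq_mul => //.
apply: leq_trans (_ : (2 ^ lam.+1) ^ g <= _).
  by apply: leq_expW; apply: leq_trans (ltnW ng); rewrite gE leq_div.
rewrite -expnM leq_exp2l // mulSn mul2n -addnn; apply: leq_add; last by rewrite mulnC.
by apply: leq_trans gl; rewrite leq_pmulr.
Qed.

Theorem perfect_coded : exists J t r, forall sg, 0 < sg -> exists n0, forall T : finType, n0 <= #|T| ->
  #|[set G : sgraph T | perfect G && ~~ `[< coded J t r sg G \/ coded J t r sg (cg G) >]]| * 2 ^ #|T| <=
  #|[set G : sgraph T | perfect G]|.
Proof.
have [J [t [r hc]]] := coded_count; exists J, t, r => sg /hc [n1 {}hc]; have [n2 lb] := perfect_lower.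
exists (n1 + n2) => T nT; have nn1 : n1 <= #|T| by clear - nT; lia.
have nn2 : n2 <= #|T| by clear - nT; lia.
set GG := [set G | _]; have := hc T nn1 GG; move=> /(_ _) h.
rewrite -(leq_pmul2r (_ : 0 < 2 ^ (2 * #|T|))) ?expn_gt0 //; apply: leq_trans (lb T nn2).
apply: leq_trans (h _); first by rewrite -mulnA leq_mul2l -expnD leq_exp2l //; apply/orP; right; clear; lia.
move=> G; rewrite inE => /andP [pG /asboolPn no]; split; [exact: perfect_C5free|exact: perfect_EH| |].
  by move=> c; apply: no; left.
by move=> c; apply: no; right.
Qed.

(** * Recursive functions and finite number systems *)

(** Induction through the list of a composition: each of its entries gets its own hypothesis. *)
Lemma recf_ind_nested (P : recf -> Prop) : P Zero -> P Succ -> (forall i, P (Proj i)) ->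
  (forall g hs, P g -> (forall i, i < size hs -> P (nth Zero hs i)) -> P (Comp g hs)) ->
  (forall g h, P g -> P h -> P (Prec g h)) -> (forall g, P g -> P (Mu g)) -> forall f, P f.
Proof.
move=> h0 h1 h2 h3 h4 h5; pose Q := foldr (fun h Q => P h /\ Q) True.
have aux hs : Q hs -> forall i, i < size hs -> P (nth Zero hs i).
  by elim: hs => // h hs IH [Ph Qhs] [|i] //=; apply: IH.
fix IH 1 => -[||i|g hs|g h|g]; [exact: h0|exact: h1|exact: h2| |exact: h4|exact: h5].
apply: h3; first exact: IH.
apply: aux; exact: ((fix IHs hs : Q hs := match hs with [::] => I | h :: hs' => conj (IH h) (IHs hs') end) hs).
Qed.

Definition computes_all (v : seq nat) := fix all (hs : seq recf) (ws : seq nat) {struct hs} : Prop :=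
  match hs, ws with
  | [::], [::] => True
  | h :: hs', w :: ws' => computes h v w /\ all hs' ws'
  | _, _ => False
  end.

Definition computes_iter (g h : recf) (v : seq nat) := fix iter (n z : nat) {struct n} : Prop :=
  if n is m.+1 then exists2 r, iter m r & computes h [:: m, r & v] z else computes g v z.

Lemma computes_Comp g hs v y : computes (Comp g hs) v y <-> exists2 ws, computes_all v hs ws & computes g ws y.
Proof. by []. Qed.

Lemma computes_Prec g h n v y : computes (Prec g h) (n :: v) y <-> computes_iter g h v n y.
Proof. by []. Qed.

Lemma computes_allP v hs ws : computes_all v hs ws <->
  size ws = size hs /\ forall i, i < size hs -> computes (nth Zero hs i) v (nth 0 ws i).
Proof.
elim: hs ws => [|h hs IH] [|w ws] //=; try by split=> // -[].
split=> [[c /IH [-> hi]]|[[e] hi]]; first by split=> // -[|i] //; apply: hi.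
by split; [apply: (hi 0)|apply/IH; split=> // i lt; apply: (hi i.+1)].
Qed.

Lemma computes_det f v y y' : computes f v y -> computes f v y' -> y = y'.
Proof.
elim/recf_ind_nested: f v y y' => [||i|g hs IHg IHh|g h IHg IHh|g IH] v y y'.
- by move=> -> ->.
- by case: v => // x v -> ->.
- by move=> [_ ->] [_ ->].
- move=> /computes_Comp [ws /computes_allP [e h] c] /computes_Comp [ws' /computes_allP [e' h'] c'].
  suff ew : ws = ws' by rewrite -ew in c'; apply: IHg c c'.
  apply: (@eq_from_nth _ 0); first by rewrite e e'.
  by move=> i; rewrite e => lt; apply: (IHh i) (h i lt) (h' i lt).
- case: v => // n v /computes_Prec + /computes_Prec; elim: n y y' => [|n IHn] y y' /=; first exact: IHg.
  by move=> [r hr c] [r' hr' c']; rewrite (IHn _ _ hr' hr) in c'; apply: IHh c c'.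
move=> [c l] [c' l']; case: (ltngtP y y') => // lt.
  by have [k] := l' _ lt => /IH /(_ c).
by have [k] := l _ lt => /IH /(_ c').
Qed.

Section NumberSystems.

Record numsys (T : finType) (num : {set T}) (lt : rel T) : Prop := NumSys {
  ns_irr : forall x, x \in num -> ~~ lt x x;
  ns_tr : forall x y z, x \in num -> y \in num -> z \in num -> lt x y -> lt y z -> lt x z;
  ns_tot : forall x y, x \in num -> y \in num -> [|| lt x y, x == y | lt y x] }.

(** This replaces the coding of sequences: the course of values of a primitive recursion is a binary
    relation, and it becomes available as a tuple of length [l]. *)
Definition full (T : finType) (num : {set T}) (l : nat) (hold : seq T -> rel T) : Prop :=
  forall R : rel T, exists2 u, size u = l & forall x y, x \in num -> y \in num -> hold u x y = R x y.

Variables (T : finType) (num : {set T}) (lt : rel T) (l : nat) (hold : seq T -> rel T).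

Definition zeroS x : Prop := ~ exists2 z, z \in num & lt z x.
Definition succS x y : Prop := lt x y /\ ~ exists z, [/\ z \in num, lt x z & lt z y].

(** The meaning of [computes] inside a finite system, with all intermediate values in [num]. For
    [Prec] the relation [u] is not asked to be functional or total; each pair in it has to be
    justified by a pair one step earlier. *)
Fixpoint Cs (f : recf) (v : seq T) (y : T) {struct f} : Prop :=
  match f with
  | Zero => zeroS y
  | Succ => if v is x :: _ then succS x y else False
  | Proj i => if i < size v then y = nth y v i else False
  | Comp g hs =>
      (fix all (hs : seq recf) (ws : seq T) {struct hs} : Prop :=
         if hs is h :: hs' then exists w, [/\ w \in num, Cs h v w & all hs' (rcons ws w)]
         else Cs g ws y) hs [::]
  | Prec g h =>
      if v is n :: v' then
        exists u, [/\ size u = l, hold u n y & forall i z, i \in num -> z \in num -> hold u i z ->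
          (zeroS i /\ Cs g v' z) \/
          exists m b, [/\ m \in num, b \in num, succS m i, hold u m b & Cs h [:: m, b & v'] z]]
      else False
  | Mu g =>
      exists o, [/\ o \in num, zeroS o, Cs g (y :: v) o &
        forall m, m \in num -> lt m y -> exists q, [/\ q \in num, ~ zeroS q & Cs g (m :: v) q]]
  end.

Definition Cs_all g (v : seq T) y := fix all (hs : seq recf) (ws : seq T) {struct hs} : Prop :=
  if hs is h :: hs' then exists w, [/\ w \in num, Cs h v w & all hs' (rcons ws w)] else Cs g ws y.

Lemma Cs_Comp g hs v y : Cs (Comp g hs) v y <-> Cs_all g v y hs [::].
Proof. by []. Qed.

Hypothesis ns : numsys num lt.

Definition rk x := #|[set z in num | lt z x]|.

Lemma lt_rk x y : x \in num -> y \in num -> lt x y = (rk x < rk y).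
Proof.
move=> xN yN; have half u v : u \in num -> v \in num -> lt u v -> rk u < rk v.
  move=> uN vN a; apply: proper_card; apply/properP; split.
    apply/subsetP => z; rewrite !inE => /andP [zN za]; rewrite zN; exact: (ns_tr ns zN uN vN za a).
  by exists u; rewrite !inE ?uN ?a //= (negbTE (ns_irr ns uN)).
apply/idP/idP; first exact: half.
case/or3P: (ns_tot ns xN yN) => [->//|/eqP ->|/(half _ _ yN xN)]; first by rewrite ltnn.
by move=> h1 h2; have := ltn_trans h1 h2; rewrite ltnn.
Qed.

Lemma rk_inj : {in num &, injective rk}.
Proof.
move=> x y xN yN e; case/or3P: (ns_tot ns xN yN) => [|/eqP//|]; by rewrite lt_rk // e ltnn.
Qed.

Lemma rk_lt x : x \in num -> rk x < #|num|.
Proof.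
move=> xN; apply: proper_card; apply/properP; split; first by apply/subsetP => z; rewrite inE => /andP [].
by exists x => //; rewrite inE xN /= (negbTE (ns_irr ns xN)).
Qed.

Lemma rk_onto m : m < #|num| -> exists2 x, x \in num & rk x = m.
Proof.
move=> lm; pose f x : 'I_(#|num|.+1) := inord (rk x).
have fv x : x \in num -> val (f x) = rk x by move=> xN; rewrite /f /= inordK // ltnW // ltnS rk_lt.
have fi : {in num &, injective f}.
  by move=> x y xN yN /(congr1 val); rewrite !fv // => /rk_inj; apply.
have sub : f @: num \subset [set i : 'I_#|num|.+1 | i < #|num|].
  by apply/subsetP => _ /imsetP [x xN ->]; rewrite inE fv // rk_lt.
have cI : #|[set i : 'I_#|num|.+1 | i < #|num|]| = #|num|.
  have -> : [set i : 'I_#|num|.+1 | i < #|num|] = ~: [set ord_max].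
    by apply/setP => i; rewrite !inE -val_eqE /= ltn_neqAle -ltnS ltn_ord andbT.
  by rewrite cardsC1 card_ord.
have /setP e : f @: num = [set i : 'I_#|num|.+1 | i < #|num|].
  by apply/eqP; rewrite eqEcard sub (card_in_imset fi) cI leqnn.
have := e (inord m); rewrite inE inordK; last by apply: ltnW; rewrite ltnS.
by rewrite lm => /imsetP [x xN ex]; exists x => //; rewrite -fv // -ex /= inordK // ltnW // ltnS.
Qed.

Lemma zero_rk x : x \in num -> zeroS x <-> rk x = 0.
Proof.
move=> xN; split=> [nz|e [z zN]]; last by rewrite lt_rk // e.
apply/eqP; rewrite cards_eq0; apply/eqP/setP => z; rewrite !inE; apply/negbTE/negP => /andP [zN a].
by apply: nz; exists z.
Qed.

Lemma succ_rk x y : x \in num -> y \in num -> succS x y <-> rk y = (rk x).+1.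
Proof.
move=> xN yN; split=> [[a no]|e]; last first.
  split; first by rewrite lt_rk // e.
  by move=> [z [zN]]; rewrite !lt_rk // e ltnS => h1 h2; have := leq_trans h1 h2; rewrite ltnn.
rewrite lt_rk // in a; apply/eqP; rewrite eqn_leq a andbT leqNgt; apply/negP => h.
have [z zN ez] := rk_onto (ltn_trans h (rk_lt yN)).
by apply: no; exists z; rewrite !lt_rk // ez.
Qed.

(** All witnesses lie in [num], and a justified pair of [u] can be followed back to argument 0. A
    number system of any size thus confirms true computations only; this makes the diagonal sentence
    false in every graph if the output is not 0. *)
Lemma Cs_sound f v y : all [in num] v -> y \in num -> Cs f v y -> computes f (map rk v) (rk y).
Proof.
elim/recf_ind_nested: f v y => [||i|g hs IHg IHh|g h IHg IHh|g IH] v y vN yN.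
- by move=> /(zero_rk yN).
- by case: v vN => // x v /andP [xN _] /(succ_rk xN yN).
- rewrite /=; case: ifP => // li; rewrite size_map => ey; split=> //; by rewrite (nth_map y) // -ey.
- move=> /Cs_Comp h; apply/computes_Comp.
  suff: forall hs' ws0, (forall i, i < size hs' -> forall v y, all [in num] v -> y \in num ->
      Cs (nth Zero hs' i) v y -> computes (nth Zero hs' i) (map rk v) (rk y)) -> all [in num] ws0 ->
      Cs_all g v y hs' ws0 -> exists2 ws, computes_all (map rk v) hs' ws & computes g (map rk ws0 ++ ws) (rk y).
    by move=> /(_ hs [::] IHh isT h).
  elim=> [|h' hs' IHs] ws0 IH' w0N /=.
    by move=> c; exists [::] => //; rewrite cats0; apply: IHg.
  move=> [w [wN c r]]; have [||ws c1 c2] := IHs (rcons ws0 w) _ _ r.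
  + by move=> i lti; apply: (IH' i.+1).
  + by rewrite all_rcons wN.
  exists (rk w :: ws); last by rewrite map_rcons cat_rcons in c2.
  by split=> //; apply: (IH' 0).
- case: v vN => // n v /= /andP [nN vN] [u [_ hu hall]]; change (computes_iter g h (map rk v) (rk n) (rk y)).
  have [m mE] : exists m, m = rk n by eexists.
  rewrite -mE; elim: m n y nN yN hu mE => [|m IHm] n y nN yN hu mE /=.
    have [[_ c]|[m' [b [m'N bN /(succ_rk m'N nN) e _ _]]]] := hall _ _ nN yN hu; first exact: IHg.
    by rewrite -mE in e.
  have [[/(zero_rk nN) e _]|[m' [b [m'N bN /(succ_rk m'N nN) e hb c]]]] := hall _ _ nN yN hu.
    by rewrite e in mE.
  have em : m = rk m' by move: mE; rewrite e => -[].
  exists (rk b); first exact: IHm em.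
  by have := IHh [:: m', b & v] y; rewrite /= m'N bN vN em; apply.
move=> [ o [ oN /(zero_rk oN) zo c hall]]; split; first by have := IH (y :: v) o; rewrite /= yN vN zo; apply.
move=> m lm; have [x xN ex] := rk_onto (ltn_trans lm (rk_lt yN)).
have [|q [qN nz cq]] := hall _ xN; first by rewrite lt_rk // ex.
have := IH (x :: v) q; rewrite /= xN vN ex => /(_ isT qN cq).
by case e: (rk q) => [|k] cc; [case: nz; apply/zero_rk | exists k].
Qed.

End NumberSystems.

(** A halting computation uses finitely many numbers. [B] exceeds all of them, and fullness supplies
    the graph of every primitive recursion involved. *)
Lemma Cs_complete f v y : computes f v y -> exists B, forall (T : finType) (num : {set T}) lt l hold,
  numsys num lt -> full num l hold -> B <= #|num| -> forall v' y', all [in num] v' -> y' \in num ->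
  map (rk num lt) v' = v -> rk num lt y' = y -> Cs num lt l hold f v' y'.
Proof.
elim/recf_ind_nested: f v y => [||i|g hs IHg IHh|g h IHg IHh|g IH] v y.
- by move=> -> ; exists 0 => T num lt l hold ns _ _ v' y' _ yN _ e; apply/zero_rk.
- case: v => // x v e; exists 0 => T num lt l hold ns _ _ [//|x' v'] y' /andP [xN _] yN [ex _] ey.
  by apply/succ_rk => //; rewrite ey ex e.
- move=> [lti ->]; exists 0 => T num lt l hold ns _ _ v' y' vN yN ev ey /=.
  rewrite -ev size_map in lti; rewrite lti; apply: (rk_inj ns) => //.
    by apply: (allP vN); apply: mem_nth.
  by rewrite ey -ev (nth_map y').
- move=> /computes_Comp [ws ca cg]; have [Bg hg] := IHg _ _ cg.
  suff: forall hs' ws0 ws1, (forall i, i < size hs' -> forall v y, computes (nth Zero hs' i) v y -> exists B, forall (T : finType) (num : {set T}) lt l hold,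
      numsys num lt -> full num l hold -> B <= #|num| -> forall v' y', all [in num] v' -> y' \in num ->
      map (rk num lt) v' = v -> rk num lt y' = y -> Cs num lt l hold (nth Zero hs' i) v' y') ->
      computes_all v hs' ws1 -> ws0 ++ ws1 = ws -> exists B, forall (T : finType) (num : {set T}) lt l hold,
      numsys num lt -> full num l hold -> B <= #|num| -> forall v' y' w0, all [in num] v' -> y' \in num -> all [in num] w0 ->
      map (rk num lt) v' = v -> rk num lt y' = y -> map (rk num lt) w0 = ws0 -> Cs_all num lt l hold g v' y' hs' w0.
    move=> /(_ hs [::] ws IHh ca erefl) [B hB]; exists B => T num lt l hold ns fu le v' y' vN yN ev ey.
    by apply/Cs_Comp; apply: hB.
  elim=> [|h' hs' IHs] ws0 [|w ws1] IH' //=.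
    by move=> _ e; exists Bg => T num lt l hold ns fu le v' y' w0 vN yN wN ev ey ew; apply: hg => //; rewrite ew -e cats0.
  move=> [c1 c2] e; have [B1 h1] := IH' 0 isT _ _ c1.
  have [||B2 h2] := IHs (rcons ws0 w) ws1 _ c2.
  + by move=> i lti; apply: (IH' i.+1).
  + by rewrite cat_rcons.
  exists (B1 + B2 + w.+1) => T num lt l hold ns fu le v' y' w0 vN yN wN ev ey ew.
  have lw : w < #|num| by apply: leq_trans le; rewrite leq_addl.
  have [x xN ex] := rk_onto ns lw.
  exists x; split=> //; first by apply: h1 => //; move: le; clear; lia.
  by apply: h2; rewrite ?all_rcons ?xN ?map_rcons ?ew ?ex //; move: le; clear; lia.
- case: v => // n v /computes_Prec c.
  (* [F] is the course of values up to [n]; it is kept explicit because the witness relation will be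
     its graph. *)
  suff [F [B [hF hB]]] : exists (F : nat -> nat) B, F n = y /\ forall (T : finType) (num : {set T}) lt l hold,
      numsys num lt -> full num l hold -> B <= #|num| -> forall v' i, i <= n -> all [in num] v' -> map (rk num lt) v' = v ->
      F i < B /\ forall z, z \in num -> rk num lt z = F i -> if i is m.+1 then
       forall m' b, m' \in num -> b \in num -> rk num lt m' = m -> rk num lt b = F m -> Cs num lt l hold h [:: m', b & v'] z
       else Cs num lt l hold g v' z.
    exists (B + n.+1) => T num lt l hold ns fu le [//|n' v'] y' /= /andP [nN vN] yN [en ev] ey.
    have [u su hu] := fu (fun i z => (rk num lt i <= n) && (rk num lt z == F (rk num lt i))).
    have leB : B <= #|num| by move: le; clear; lia.
    exists u; split=> // [|i z iN zN]; first by rewrite hu // en leqnn hF ey /=.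
    rewrite hu // => /andP [lei /eqP ez]; have [Fi hi] := hB T num lt l hold ns fu leB v' _ lei vN ev.
    have := hi z zN ez; case e: (rk num lt i) => [|m] hz; first by left; split=> //; apply/zero_rk.
    right; have lm : m <= n by rewrite ltnW // -e.
    have lm' : m < #|num| by rewrite ltnW // -e rk_lt.
    have [x xN ex] := rk_onto ns lm'.
    have [Fm _] := hB T num lt l hold ns fu leB v' _ lm vN ev.
    have [b bN eb] := rk_onto ns (leq_trans Fm leB).
    exists x, b; split=> //; [by apply/succ_rk => //; rewrite e ex | by rewrite hu // ex lm eb /= | exact: hz].
  elim: n y c => [|n IHn] y /= c.
    have [B hB] := IHg _ _ c; exists (fun=> y), (B + y.+1); split=> // T num lt l hold ns fu le v' i.
    rewrite leqn0 => /eqP -> vN ev; split; first by rewrite addnS ltnS leq_addl.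
    by move=> z zN ez; apply: hB => //; move: le; clear; lia.
  case: c => r c1 c2; have [F [B [hF hB]]] := IHn _ c1; have [B2 hB2] := IHh _ _ c2.
  exists (fun i => if i == n.+1 then y else F i), (B + B2 + y.+1); split; first by rewrite eqxx.
  move=> T num lt l hold ns fu le v' i lei vN ev; have leB : B <= #|num| by move: le; clear; lia.
  case: eqP => [->|ne].
    split; first by clear; lia.
    move=> z zN ez m' b m'N bN em eb; apply: hB2 => //=; rewrite ?m'N ?bN ?vN //; first by move: le; clear; lia.
    by rewrite em ev eb ltn_eqF ?hF.
  have {}lei : i <= n by move: lei ne; clear; lia.
  have [h1 h2] := hB T num lt l hold ns fu leB v' i lei vN ev; split; first by move: h1; clear; lia.
  by case: i lei h1 h2 {ne} => [//|m] lm h1 h2; rewrite ltn_eqF // ltnW.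
move=> [c hl]; have [B1 hB1] := IH _ _ c.
(* The search tests finitely many [m < y], and the bounds for these tests are added up. *)
suff [B2 hB2] : exists B2, forall (T : finType) (num : {set T}) lt l hold,
    numsys num lt -> full num l hold -> B2 <= #|num| -> forall v' m', all [in num] v' -> m' \in num -> map (rk num lt) v' = v ->
    rk num lt m' < y -> exists q, [/\ q \in num, ~ zeroS num lt q & Cs num lt l hold g (m' :: v') q].
  exists (B1 + B2 + 1) => T num lt l hold ns fu le v' y' vN yN ev ey.
  have l0 : 0 < #|num| by move: le; clear; lia.
  have [ o oN eo] := rk_onto ns l0.
  exists o; split=> //; first by apply/zero_rk.
    by apply: hB1 => //=; rewrite ?yN ?vN ?ey ?ev //; move: le; clear; lia.
  move=> m mN; rewrite (lt_rk ns) // ey => lm; apply: hB2 => //; move: le; clear; lia.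
elim: y hl {c hB1} => [|y IHy] hl; first by exists 0.
have [|B hB] := IHy; first by move=> m lm; apply: hl; apply: ltnW.
have [k ck] := hl y (leqnn _); have [B' hB'] := IH _ _ ck.
exists (B + B' + k.+2) => T num lt l hold ns fu le v' m' vN m'N ev; rewrite ltnS leq_eqVlt => /orP [/eqP em|lm].
  have lk : k.+1 < #|num| by move: le; clear; lia.
  have [q qN eq] := rk_onto ns lk.
  exists q; split=> //; first by move/(zero_rk ns qN); rewrite eq.
  by apply: hB' => //=; rewrite ?m'N ?vN ?em ?ev //; move: le; clear; lia.
by apply: hB => //; move: le; clear; lia.
Qed.

(** * Formulas *)

Definition fvlt k (p : graph_formula) : bool := all (fun i => i < k) (free_vars p).

Lemma fvlt_W k k' p : k <= k' -> fvlt k p -> fvlt k' p.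
Proof. by move=> le /allP h; apply/allP => i /h /leq_trans; apply. Qed.

Lemma fvlt_filter k (s : seq nat) : all (fun i => i < k.+1) s -> all (fun i => i < k) [seq j <- s | j != k].
Proof.
move=> /allP h; apply/allP => i; rewrite mem_filter => /andP [ne /h]; by rewrite ltnS leq_eqVlt (negbTE ne).
Qed.

Lemma fvlt_Ex k p : fvlt k.+1 p -> fvlt k (FEx k p).
Proof. exact: fvlt_filter. Qed.

Lemma fvlt_All k p : fvlt k.+1 p -> fvlt k (FAll k p).
Proof. exact: fvlt_filter. Qed.

Lemma fvlt_Ex' k j p : fvlt k p -> fvlt k (FEx j p).
Proof. by move=> /allP h; apply/allP => i; rewrite mem_filter => /andP [_ /h]. Qed.

Lemma fvlt_And k p q : fvlt k p -> fvlt k q -> fvlt k (FAnd p q).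
Proof. by move=> h1 h2; rewrite /fvlt /= all_cat; apply/andP. Qed.

Lemma fvlt_Or k p q : fvlt k p -> fvlt k q -> fvlt k (FOr p q).
Proof. by move=> h1 h2; rewrite /fvlt /= all_cat; apply/andP. Qed.

Lemma fvlt_Imp k p q : fvlt k p -> fvlt k q -> fvlt k (FImp p q).
Proof. by move=> h1 h2; rewrite /fvlt /= all_cat; apply/andP. Qed.

Lemma fvlt_Iff k p q : fvlt k p -> fvlt k q -> fvlt k (FIff p q).
Proof. by move=> h1 h2; rewrite /fvlt /= all_cat; apply/andP. Qed.

Lemma fvlt_Not k p : fvlt k p -> fvlt k (FNot p).
Proof. by []. Qed.

Lemma fvlt_Eq k i j : i < k -> j < k -> fvlt k (FEq i j).
Proof. by rewrite /fvlt /= => -> ->. Qed.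

Lemma fvlt_Adj k i j : i < k -> j < k -> fvlt k (FAdj i j).
Proof. by rewrite /fvlt /= => -> ->. Qed.

Definition ffalse := FNot (FEq 0 0).
Definition fands (s : seq nat) (F : nat -> graph_formula) := foldr (fun a p => FAnd (F a) p) (FEq 0 0) s.

Lemma fvlt_ands k s F : 0 < k -> (forall a, a \in s -> fvlt k (F a)) -> fvlt k (fands s F).
Proof.
move=> k0; elim: s => [|a s IH] h; first exact: fvlt_Eq.
apply: fvlt_And; first by apply: h; rewrite inE eqxx.
by apply: IH => b bs; apply: h; rewrite inE bs orbT.
Qed.

Fixpoint fexs k m p := if m is m'.+1 then FEx k (fexs k.+1 m' p) else p.

Lemma fvlt_exs k m p : fvlt (k + m) p -> fvlt k (fexs k m p).
Proof.
elim: m k => [|m IH] k /=; first by rewrite addn0.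
by move=> h; apply: fvlt_Ex; apply: IH; rewrite addSnnS.
Qed.

Section Upd.
Variables (T : finType) (G : sgraph T).
Implicit Types (e : nat -> T).

Lemma upd_eq e k a : update e k a k = a.
Proof. by rewrite /update eqxx. Qed.

Lemma upd_lt e k a j : j < k -> update e k a j = e j.
Proof. by move=> h; rewrite /update ltn_eqF. Qed.

Lemma sat_ands e s F : sat G e (fands s F) = (forall a, a \in s -> sat G e (F a)).
Proof.
apply/propext; elim: s => [|a s IH]; first by split.
split=> [[h /IH hs] b|h]; first by rewrite inE => /orP [/eqP ->|/hs].
by split; [apply: h; rewrite inE eqxx|apply/IH => b bs; apply: h; rewrite inE bs orbT].
Qed.

Fixpoint upds e k (u : seq T) := if u is a :: u' then upds (update e k a) k.+1 u' else e.

Lemma upds_lt e k u j : j < k -> upds e k u j = e j.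
Proof.
elim: u e k => [//|a u IH] e k h /=; rewrite IH; last exact: ltnW.
exact: upd_lt.
Qed.

Lemma upds_iota e k u : map (upds e k u) (iota k (size u)) = u.
Proof.
elim: u e k => [//|a u IH] e k /=; congr (_ :: _); last exact: IH.
by rewrite upds_lt // upd_eq.
Qed.

Lemma sat_exs e k m p : sat G e (fexs k m p) = (exists2 u, size u = m & sat G (upds e k u) p).
Proof.
apply/propext; elim: m e k => [|m IH] e k /=.
  by split=> [h|[[|a u] // _ h]]; first by exists [::].
split=> [[a /IH [u su h]]|[[|a u] // [su] h]]; first by exists (a :: u); rewrite /= ?su.
by exists a; apply/IH; exists u.
Qed.

End Upd.

Section Formulas.
Variables (J t rr : nat).
Let M := J + rr + 3.

(* Parameter variables, all below [PP]; a tag and two indices are packed into one number. *)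
Definition pos tag i l := tag + 8 * (i + M * l).
Definition PP := 8 * (M * t.+1).
Definition vz i := pos 0 i 0.
Definition vm1 := pos 1 0 0.
Definition vm2 := pos 2 0 0.
Definition vb i := pos 3 i 0.
Definition vw i := [seq pos 4 i l | l <- iota 0 t].
Definition ve i := [seq pos 5 i l | l <- iota 0 t].
Definition vu := [seq pos 6 0 l | l <- iota 0 t].

Lemma pos_lt tag i l : tag < 8 -> i < M -> l <= t -> pos tag i l < PP.
Proof.
move=> h1 h2 h3; rewrite /pos /PP; have : i + M * l < M * t.+1.
  by apply: leq_trans (_ : M + M * l <= _); [rewrite ltn_add2r|rewrite -mulnS leq_mul2l ltnS h3 orbT].
by move: h1; clear; move: (i + M * l) (M * t.+1) => a b; lia.
Qed.

(** Adjacency in the graph if the parameters [vm1] and [vm2] are adjacent, in its complement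
    otherwise. One formula thus serves both cases of [perfect_coded]. *)
Definition fE x y := FAnd (FNot (FEq x y)) (FIff (FAdj x y) (FAdj vm1 vm2)).
Definition fnexc v := fands (iota 0 J) (fun i => FOr (FNot (FEq v (vz i))) (FEq v vm1)).
(** An independent triple of neighbours separates the two sides: vertices of [Y] have one by
    [codes_3], whereas the unexceptional neighbours of a vertex of [X] are covered by two
    cliques. *)
Definition ftri k v := FEx k (FEx k.+1 (FEx k.+2
  (FAnd (FAnd (fnexc k) (FAnd (fnexc k.+1) (fnexc k.+2)))
  (FAnd (FAnd (fE v k) (FAnd (fE v k.+1) (fE v k.+2)))
  (FAnd (FAnd (FNot (FEq k k.+1)) (FAnd (FNot (FEq k k.+2)) (FNot (FEq k.+1 k.+2))))
   (FAnd (FNot (fE k k.+1)) (FAnd (FNot (fE k k.+2)) (FNot (fE k.+1 k.+2))))))))).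
Definition finX k v := FAnd (fnexc v) (FNot (ftri k v)).
Definition finY k v := FAnd (fnexc v) (ftri k v).
(** Common neighbours of [us] in the block of [b]; by [codes_D] every subset of the coded part of
    the block has this form. *)
Definition fblk k b us x := FAnd (finX k x) (FAnd (FOr (FEq x b) (fE x b)) (fands us (fun u => fE x u))).
Definition fS k y := FAnd (finY k y) (fands (iota 0 rr.+1) (fun i =>
  FAll k (FImp (fblk k.+1 (vb i) (vw i) k) (FIff (fE k y) (fblk k.+1 (vb i) (ve i) k))))).
(** The tuple [vu] cuts out of block 0 the vertices whose neighbourhoods among the numbers are
    initial segments; [x] precedes [y] if such a segment contains [x] but not [y]. *)
Definition flt k x y := FEx k (FAnd (fblk k.+1 (vb 0) vu k) (FAnd (fE k x) (FNot (fE k y)))).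
Definition fpair k us x y := FEx k (FAnd (fblk k.+1 (vb 0) us k) (FAnd (fE k x) (fE k y))).
(** A vertex of block 0 with neighbours [x] and [y] stands for an unordered pair. The three parts of
    [us], for ascending, descending and diagonal pairs, restore the order; this is why relations
    take [3 * t] parameters. *)
Definition fhold k us x y := FOr (FAnd (flt k x y) (fpair k (take t us) x y))
  (FOr (FAnd (flt k y x) (fpair k (take t (drop t us)) x y)) (FAnd (FEq x y) (fpair k (drop (2 * t) us) x y))).
Definition fzero k x := FNot (FEx k (FAnd (fS k.+1 k) (flt k.+1 k x))).
Definition fsucc k x y := FAnd (flt k x y) (FNot (FEx k (FAnd (fS k.+1 k) (FAnd (flt k.+1 x k) (flt k.+1 k y))))).

(** It mirrors [Cs] clause by clause, with [k] as the next free variable number. *)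
Fixpoint comp (f : recf) (vs : seq nat) (y k : nat) {struct f} : graph_formula :=
  match f with
  | Zero => fzero k y
  | Succ => if vs is x :: _ then fsucc k x y else ffalse
  | Proj i => if i < size vs then FEq y (nth 0 vs i) else ffalse
  | Comp g hs =>
      (fix all (hs : seq recf) (ws : seq nat) (k : nat) {struct hs} : graph_formula :=
         if hs is h :: hs' then FEx k (FAnd (fS k.+1 k) (FAnd (comp h vs k k.+1) (all hs' (rcons ws k) k.+1)))
         else comp g ws y k) hs [::] k
  | Prec g h =>
      if vs is n :: vs' then
        let us := iota k (3 * t) in let k1 := k + 3 * t in
        fexs k (3 * t) (FAnd (fhold k1 us n y) (FAll k1 (FAll k1.+1
          (FImp (fS k1.+2 k1) (FImp (fS k1.+2 k1.+1) (FImp (fhold k1.+2 us k1 k1.+1)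
            (FOr (FAnd (fzero k1.+2 k1) (comp g vs' k1.+1 k1.+2))
              (FEx k1.+2 (FEx k1.+3 (FAnd (fS k1.+4 k1.+2) (FAnd (fS k1.+4 k1.+3) (FAnd (fsucc k1.+4 k1.+2 k1)
                (FAnd (fhold k1.+4 us k1.+2 k1.+3) (comp h [:: k1.+2, k1.+3 & vs'] k1.+1 k1.+4))))))))))))))
      else ffalse
  | Mu g =>
      FEx k (FAnd (fS k.+1 k) (FAnd (fzero k.+1 k) (FAnd (comp g (y :: vs) k k.+1)
        (FAll k.+1 (FImp (fS k.+2 k.+1) (FImp (flt k.+2 k.+1 y)
          (FEx k.+2 (FAnd (fS k.+3 k.+2) (FAnd (FNot (fzero k.+3 k.+2)) (comp g (k.+1 :: vs) k.+2 k.+3))))))))))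
  end.

Definition comp_all g vs y := fix all (hs : seq recf) (ws : seq nat) (k : nat) {struct hs} : graph_formula :=
  if hs is h :: hs' then FEx k (FAnd (fS k.+1 k) (FAnd (comp h vs k k.+1) (all hs' (rcons ws k) k.+1)))
  else comp g ws y k.

Lemma vlt : [/\ forall i, i < J -> vz i < PP, vm1 < PP, vm2 < PP, forall i, i < rr.+1 -> vb i < PP &
  [/\ forall i u, i < rr.+1 -> u \in vw i -> u < PP, forall i u, i < rr.+1 -> u \in ve i -> u < PP & forall u, u \in vu -> u < PP]].
Proof.
have M0 : 0 < M by rewrite /M addn3.
split=> [i h|||i h|]; try (by apply: pos_lt => //; rewrite /M; move: h; clear; lia); try by apply: pos_lt.
by split=> [i u h|i u h|u] /mapP [l]; rewrite mem_iota => /andP [_ hl] ->; apply: pos_lt => //;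
  try (by apply: ltnW); rewrite /M; move: h; clear; lia.
Qed.

Section FV.
Variable k : nat.
Hypothesis Pk : PP <= k.

Lemma k_gt0 : 0 < k.
Proof. by apply: leq_trans Pk; rewrite /PP /M !muln_gt0 addn3. Qed.

Lemma fv_E j x y : k <= j -> x < j -> y < j -> fvlt j (fE x y).
Proof.
move=> kj hx hy; have [_ h1 h2 _ _] := vlt; have Pj := leq_trans Pk kj.
by apply: fvlt_And; [apply: fvlt_Not; apply: fvlt_Eq|apply: fvlt_Iff; apply: fvlt_Adj] => //; apply: leq_trans Pj.
Qed.

Lemma fv_nexc j x : k <= j -> x < j -> fvlt j (fnexc x).
Proof.
move=> kj hx; have [h0 h1 h2 _ _] := vlt; have Pj := leq_trans Pk kj.
apply: fvlt_ands; first exact: leq_trans k_gt0 kj.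
move=> i; rewrite mem_iota => /andP [_ hi]; apply: fvlt_Or; [apply: fvlt_Not|]; apply: fvlt_Eq => //; apply: leq_trans Pj => //.
exact: h0.
Qed.

Lemma fv_tri j x : k <= j -> x < j -> fvlt j (ftri j x).
Proof.
move=> kj hx; do 3 apply: fvlt_Ex.
have a3 : k <= j.+3 by apply: leq_trans kj _; clear; lia.
have x3 : x < j.+3 by apply: leq_trans hx _; clear; lia.
have j3 : j < j.+3 by clear; lia.
have j13 : j.+1 < j.+3 by clear; lia.
have j23 : j.+2 < j.+3 by clear; lia.
apply: fvlt_And; first by apply: fvlt_And; [|apply: fvlt_And]; apply: fv_nexc.
apply: fvlt_And; first by apply: fvlt_And; [|apply: fvlt_And]; apply: fv_E.
apply: fvlt_And; first by apply: fvlt_And; [|apply: fvlt_And]; apply: fvlt_Not; apply: fvlt_Eq.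
by apply: fvlt_And; [|apply: fvlt_And]; apply: fvlt_Not; apply: fv_E.
Qed.

Lemma fv_blk j b us x : k <= j -> b < j -> x < j -> (forall u, u \in us -> u < j) -> fvlt j (fblk j b us x).
Proof.
move=> kj hb hx hu; apply: fvlt_And; first by apply: fvlt_And; [apply: fv_nexc|apply: fvlt_Not; apply: fv_tri].
apply: fvlt_And; first by apply: fvlt_Or; [apply: fvlt_Eq|apply: fv_E].
by apply: fvlt_ands; [exact: leq_trans k_gt0 kj|move=> u /hu h; apply: fv_E].
Qed.

Lemma fv_S j y : k <= j -> y < j -> fvlt j (fS j y).
Proof.
move=> kj hy; have [_ _ _ hb [hw he _]] := vlt; have Pj := leq_trans Pk kj; have kj1 := leqW kj.
have Pj1 := leqW Pj.
apply: fvlt_And; first by apply: fvlt_And; [apply: fv_nexc|apply: fv_tri].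
apply: fvlt_ands; first exact: leq_trans k_gt0 kj.
move=> i; rewrite mem_iota => /andP [_ hi]; apply: fvlt_All; apply: fvlt_Imp; last apply: fvlt_Iff.
- by apply: fv_blk => // [|u /(hw _ _ hi) h]; [apply: leq_trans (hb _ hi) Pj1|apply: leq_trans h Pj1].
- by apply: fv_E => //; apply: leqW.
- by apply: fv_blk => // [|u /(he _ _ hi) h]; [apply: leq_trans (hb _ hi) Pj1|apply: leq_trans h Pj1].
Qed.

Lemma fv_lt j x y : k <= j -> x < j -> y < j -> fvlt j (flt j x y).
Proof.
move=> kj hx hy; have [_ _ _ hb [_ _ hu]] := vlt; have Pj1 := leqW (leq_trans Pk kj); have kj1 := leqW kj.
apply: fvlt_Ex; apply: fvlt_And; last by apply: fvlt_And; [|apply: fvlt_Not]; apply: fv_E => //; apply: leqW.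
by apply: fv_blk => // [|u /hu h]; [apply: leq_trans (hb _ (ltn0Sn _)) Pj1|apply: leq_trans h Pj1].
Qed.

Lemma fv_pair j us x y : k <= j -> x < j -> y < j -> (forall u, u \in us -> u < j) -> fvlt j (fpair j us x y).
Proof.
move=> kj hx hy hu; have [_ _ _ hb _] := vlt; have Pj1 := leqW (leq_trans Pk kj); have kj1 := leqW kj.
apply: fvlt_Ex; apply: fvlt_And; last by apply: fvlt_And; apply: fv_E => //; apply: leqW.
by apply: fv_blk => // [|u /hu h]; [apply: leq_trans (hb _ (ltn0Sn _)) Pj1|apply: leqW].
Qed.

Lemma fv_hold j us x y : k <= j -> x < j -> y < j -> (forall u, u \in us -> u < j) -> fvlt j (fhold j us x y).
Proof.
move=> kj hx hy hu; apply: fvlt_Or; [|apply: fvlt_Or]; apply: fvlt_And; rewrite ?fv_lt ?fvlt_Eq //;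
  apply: fv_pair => // u h; apply: hu.
- exact: mem_take h.
- exact: mem_drop (mem_take h).
- exact: mem_drop h.
Qed.

Lemma fv_zero j x : k <= j -> x < j -> fvlt j (fzero j x).
Proof.
move=> kj hx; have kj1 := leqW kj; apply: fvlt_Not; apply: fvlt_Ex; apply: fvlt_And; first exact: fv_S.
by apply: fv_lt => //; apply: leqW.
Qed.

Lemma fv_succ j x y : k <= j -> x < j -> y < j -> fvlt j (fsucc j x y).
Proof.
move=> kj hx hy; have kj1 := leqW kj; apply: fvlt_And; first exact: fv_lt.
apply: fvlt_Not; apply: fvlt_Ex; apply: fvlt_And; first exact: fv_S.
by apply: fvlt_And; apply: fv_lt => //; apply: leqW.
Qed.

End FV.

Lemma fv_comp f vs y k : PP <= k -> (forall x, x \in vs -> x < k) -> y < k -> fvlt k (comp f vs y k).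
Proof.
have ff j : PP <= j -> fvlt j ffalse by move=> Pj; apply: fvlt_Not; apply: fvlt_Eq; apply: k_gt0.
elim/recf_ind_nested: f vs y k => [||i|g hs IHg IHh|g h IHg IHh|g IH] vs y k Pk hv hy.
- exact: (fv_zero (k := k)).
- case: vs hv => [|x vs] hv; first exact: ff.
  by apply: (fv_succ (k := k)) => //; apply: hv; rewrite inE eqxx.
- rewrite /=; case: ifP => hi; last exact: ff.
  by apply: fvlt_Eq => //; apply: hv; apply: mem_nth.
- change (fvlt k (comp_all g vs y hs [::] k)).
  suff: forall hs' ws k', (forall i, i < size hs' -> forall vs y k, PP <= k -> (forall x, x \in vs -> x < k) -> y < k ->
     fvlt k (comp (nth Zero hs' i) vs y k)) -> k <= k' -> (forall x, x \in ws -> x < k') -> fvlt k' (comp_all g vs y hs' ws k').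
    by move=> h; apply: h.
  elim=> [|h' hs' IHs] ws k' IH' kk hw /=.
    by apply: IHg => //; [apply: leq_trans Pk kk|apply: leq_trans hy kk].
  have Pk' := leq_trans Pk kk; apply: fvlt_Ex; apply: fvlt_And; first exact: (fv_S (k := k'.+1) (leqW Pk')).
  apply: fvlt_And; first by apply: (IH' 0) => //; [apply: leqW|move=> x /hv h; apply: leqW; apply: leq_trans h kk].
  apply: IHs; [by move=> i hi; apply: (IH' i.+1)|exact: leqW|].
  by move=> x; rewrite mem_rcons inE => /orP [/eqP ->//|/hw]; apply: leqW.
- case: vs hv => [|x vs] hv; first exact: ff.
  rewrite /=; set k1 := k + 3 * t; apply: fvlt_exs; rewrite -/k1.
  have Pk1 : PP <= k1 by apply: leq_trans Pk (leq_addr _ _).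
  have kk1 : k <= k1 by apply: leq_addr.
  have hv1 z : z \in x :: vs -> z < k1 by move=> /hv hz; apply: leq_trans hz kk1.
  have hx : x < k1 by apply: hv1; rewrite inE eqxx.
  have hvs z : z \in vs -> z < k1 by move=> hz; apply: hv1; rewrite inE hz orbT.
  have hy1 : y < k1 by apply: leq_trans hy kk1.
  have hu j z : k1 <= j -> z \in iota k (3 * t) -> z < j.
    by rewrite mem_iota -/k1 => hz /andP [_ h']; apply: leq_trans h' hz.
  have P2 : PP <= k1.+2 by do 2 apply: leqW.
  have P4 : PP <= k1.+4 by do 4 apply: leqW.
  have l02 : k1 < k1.+2 by clear; lia.
  have l04 : k1 < k1.+4 by clear; lia.
  have l14 : k1.+1 < k1.+4 by clear; lia.
  have l24 : k1.+2 < k1.+4 by clear; lia.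
  apply: fvlt_And; first by apply: (fv_hold (k := k1)) => // z; apply: hu.
  do 2 apply: fvlt_All; apply: fvlt_Imp; first exact: (fv_S (k := k1.+2)).
  apply: fvlt_Imp; first exact: (fv_S (k := k1.+2)).
  apply: fvlt_Imp; first by apply: (fv_hold (k := k1.+2)) => // z; apply: hu; apply: ltnW.
  apply: fvlt_Or; first apply: fvlt_And; first exact: (fv_zero (k := k1.+2)).
    by apply: IHg => // z /hvs hz; apply: leq_trans hz (ltnW l02).
  do 2 apply: fvlt_Ex; apply: fvlt_And; first exact: (fv_S (k := k1.+4)).
  apply: fvlt_And; first exact: (fv_S (k := k1.+4)).
  apply: fvlt_And; first exact: (fv_succ (k := k1.+4)).
  apply: fvlt_And; first by apply: (fv_hold (k := k1.+4)) => // z; apply: hu; apply: ltnW.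
  apply: IHh => // z; rewrite !inE => /or3P [/eqP ->|/eqP ->|/hvs hz] //; apply: leq_trans hz (ltnW l04).
have P1 := leqW Pk; have P2 := leqW P1; have P3 := leqW P2.
have l02 : k < k.+2 by clear; lia.
have hv1 x : x \in vs -> x < k.+1 by move=> /hv; apply: leqW.
apply: fvlt_Ex; apply: fvlt_And; first exact: (fv_S (k := k.+1)).
apply: fvlt_And; first exact: (fv_zero (k := k.+1)).
apply: fvlt_And; first by apply: IH => // x; rewrite inE => /orP [/eqP ->|/hv1//]; apply: leqW.
apply: fvlt_All; apply: fvlt_Imp; first exact: (fv_S (k := k.+2)).
apply: fvlt_Imp; first by apply: (fv_lt (k := k.+2)) => //; do 2 apply: leqW.
apply: fvlt_Ex; apply: fvlt_And; first exact: (fv_S (k := k.+3)).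
apply: fvlt_And; first by apply: fvlt_Not; apply: (fv_zero (k := k.+3)).
by apply: IH => // x; rewrite inE => /orP [/eqP ->|/hv1 h] //; do 2 apply: leqW.
Qed.

End Formulas.

(** * Satisfaction *)

Section Semantics.
Variables (J t rr : nat) (T : finType) (G : sgraph T) (e0 : nat -> T).
Local Notation vz := (vz J rr).
Local Notation vm1 := (vm1 J rr).
Local Notation vm2 := (vm2 J rr).
Local Notation vb := (vb J rr).
Local Notation vw := (vw J t rr).
Local Notation ve := (ve J t rr).
Local Notation vu := (vu J t rr).
Local Notation PP := (PP J t rr).
Local Notation fE := (fE J rr).

Definition Hg : sgraph T := if adj G (e0 vm1) (e0 vm2) then G else cg G.
Definition nexcS v : bool := [forall i : 'I_J, (v != e0 (vz i)) || (v == e0 vm1)].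
Definition triS v : bool := [exists a, exists b, exists c,
  [&& [&& nexcS a, nexcS b & nexcS c], [&& adj Hg v a, adj Hg v b & adj Hg v c],
      [&& a != b, a != c & b != c] & [&& ~~ adj Hg a b, ~~ adj Hg a c & ~~ adj Hg b c]]].
Definition inXS v := nexcS v && ~~ triS v.
Definition inYS v := nexcS v && triS v.
Definition blkS b (us : seq T) : {set T} := [set x | inXS x && (((x == b) || adj Hg x b) && all (adj Hg x) us)].
Definition numS : {set T} := [set y | inYS y && [forall i : 'I_rr.+1, [forall x in blkS (e0 (vb i)) (map e0 (vw i)),
  adj Hg x y == (x \in blkS (e0 (vb i)) (map e0 (ve i)))]]].
Definition ltS x y : bool := [exists p, (p \in blkS (e0 (vb 0)) (map e0 vu)) && (adj Hg p x && ~~ adj Hg p y)].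
Definition pairS us x y : bool := [exists p, (p \in blkS (e0 (vb 0)) us) && (adj Hg p x && adj Hg p y)].
Definition holdS us x y : bool := (ltS x y && pairS (take t us) x y) ||
  ((ltS y x && pairS (take t (drop t us)) x y) || ((x == y) && pairS (drop (2 * t) us) x y)).

Definition agree e := forall i, i < PP -> e i = e0 i.

Lemma agree_upd e k a : PP <= k -> agree e -> agree (update e k a).
Proof. by move=> Pk ag i hi; rewrite upd_lt ?ag //; apply: leq_trans Pk. Qed.

Lemma agree_upds e k u : PP <= k -> agree e -> agree (upds e k u).
Proof. by move=> Pk ag i hi; rewrite upds_lt ?ag //; apply: leq_trans Pk. Qed.

Lemma sat_E e x y : agree e -> sat G e (fE x y) = adj Hg (e x) (e y).
Proof.
move=> ag; have [_ h1 h2 _ _] := vlt J t rr; apply/propext; rewrite /= (ag _ h1) (ag _ h2) /Hg.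
case: (boolP (adj G (e0 vm1) (e0 vm2))) => am; last rewrite cgE.
  split=> [[_ [_ h]]|a]; first exact: h.
  by split; [move=> e'; rewrite e' adj_irrefl in a|split].
split=> [[/eqP ne [h _]]|/andP [/eqP ne /negP na]]; first by rewrite ne; apply/negP => /h.
by split=> //; split.
Qed.

Lemma sat_nexc e x : agree e -> sat G e (fnexc J rr x) = nexcS (e x).
Proof.
move=> ag; have [h0 h1 _ _ _] := vlt J t rr; rewrite /fnexc sat_ands; apply/propext; split=> [h|/forallP h i].
  apply/forallP => i; have := h i; rewrite mem_iota ltn_ord => /(_ isT) /=; rewrite (ag _ h1) (ag _ (h0 _ (ltn_ord i))).
  by case=> [/eqP ->//|->]; rewrite eqxx orbT.
rewrite mem_iota => /andP [_ hi] /=; have := h (Ordinal hi); rewrite (ag _ h1) (ag _ (h0 _ hi)) /=.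
by case/orP => /eqP ?; [left|right].
Qed.

Lemma sat_tri e k x : agree e -> PP <= k -> x < k -> sat G e (ftri J rr k x) = triS (e x).
Proof.
move=> ag Pk xk; have P1 := leqW Pk; have P2 := leqW P1.
have go a b c : let e' := update (update (update e k a) k.+1 b) k.+2 c in
    [/\ agree e', e' x = e x, e' k = a, e' k.+1 = b & e' k.+2 = c].
  move=> e'; have k2 : k < k.+2 by clear; lia.
  have x1 := leqW xk; have x2 := leqW x1.
  split; rewrite /e'.
  - by do 3 apply: agree_upd => //.
  - by rewrite !upd_lt.
  - by rewrite (@upd_lt _ _ k.+2 c k) // (@upd_lt _ _ k.+1 b k) // upd_eq.
  - by rewrite (@upd_lt _ _ k.+2 c k.+1) // upd_eq.
  - by rewrite upd_eq.
(* The quantified variables are instantiated and the updated assignment is abstracted before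
   rewriting; several of the satisfaction lemmas below follow this pattern. *)
have bridge a b c : sat G (update (update (update e k a) k.+1 b) k.+2 c)
  (FAnd (FAnd (fnexc J rr k) (FAnd (fnexc J rr k.+1) (fnexc J rr k.+2)))
  (FAnd (FAnd (fE x k) (FAnd (fE x k.+1) (fE x k.+2)))
  (FAnd (FAnd (FNot (FEq k k.+1)) (FAnd (FNot (FEq k k.+2)) (FNot (FEq k.+1 k.+2))))
   (FAnd (FNot (fE k k.+1)) (FAnd (FNot (fE k k.+2)) (FNot (fE k.+1 k.+2))))))) <->
   [&& [&& nexcS a, nexcS b & nexcS c], [&& adj Hg (e x) a, adj Hg (e x) b & adj Hg (e x) c],
      [&& a != b, a != c & b != c] & [&& ~~ adj Hg a b, ~~ adj Hg a c & ~~ adj Hg b c]].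
  have [ag' ex ea eb ec] := go a b c; move: ag' ex ea eb ec; move: (update _ k.+2 c) => e' ag' ex ea eb ec.
  cbn [sat].
  rewrite !sat_nexc // !sat_E // ex ea eb ec; split.
    move=> [[-> [-> ->]] [[-> [-> ->]] [[/eqP -> [/eqP -> /eqP ->]] [/negP -> [/negP -> /negP ->]]]]] //.
  case/and4P => /and3P [-> -> ->] /and3P [-> -> ->] /and3P [/eqP n1 /eqP n2 /eqP n3] /and3P [/negP m1 /negP m2 /negP m3].
  by do !split.
apply/propext; split=> [[a [b [c /bridge h]]]|/existsP [a /existsP [b /existsP [c /bridge h]]]].
  by apply/existsP; exists a; apply/existsP; exists b; apply/existsP; exists c.
by exists a, b, c.
Qed.

Lemma sat_blk e k b us x : agree e -> PP <= k -> x < k ->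
  sat G e (fblk J rr k b us x) = (e x \in blkS (e b) (map e us)).
Proof.
move=> ag Pk xk; rewrite /fblk /finX; cbn [sat]; rewrite sat_nexc // sat_tri // sat_E // sat_ands inE /inXS.
have -> : (forall a, a \in us -> sat G e (fE x a)) = all (adj Hg (e x)) (map e us).
  apply/propext; split=> [h|/allP h a au]; last by rewrite sat_E //; apply: h; apply: map_f.
  by apply/allP => _ /mapP [a au ->]; have := h a au; rewrite sat_E.
apply/propext; split=> [[[-> /negP ->] [ o ->]]|/andP [/andP [-> /negP nt] /andP [ o ->]]].
  by rewrite andbT; case: o => [->|->]; rewrite ?eqxx ?orbT.
by do !split=> //; case/orP: o => [/eqP|]; [left|right].
Qed.

Lemma agree_map e us : agree e -> (forall u, u \in us -> u < PP) -> map e us = map e0 us.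
Proof. by move=> ag h; apply/eq_in_map => u /h; apply: ag. Qed.

Lemma sat_S e k y : agree e -> PP <= k -> y < k -> sat G e (fS J t rr k y) = (e y \in numS).
Proof.
move=> ag Pk yk; have [_ _ _ hb [hw he _]] := vlt J t rr; rewrite /fS /finY; cbn [sat].
rewrite sat_nexc // sat_tri // sat_ands inE /inYS.
have bridge i x : i < rr.+1 -> sat G (update e k x) (FImp (fblk J rr k.+1 (vb i) (vw i) k) (FIff (fE k y) (fblk J rr k.+1 (vb i) (ve i) k))) <->
   (x \in blkS (e0 (vb i)) (map e0 (vw i)) -> adj Hg x (e y) == (x \in blkS (e0 (vb i)) (map e0 (ve i)))).
  move=> hi; have ag' := agree_upd x Pk ag; cbn [sat].
  rewrite !sat_blk ?sat_E // ?(leqW Pk) // (ag' _ (hb _ hi)) !upd_eq upd_lt //.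
  rewrite !(agree_map ag') => [|u|u]; [|exact: he|exact: hw].
  split=> h hx; last by rewrite (eqP (h hx)).
  by have [h1 h2] := h hx; apply/eqP; apply/idP/idP; [exact: h1|exact: h2].
apply/propext; split=> [[[-> ->] h]|/andP [/andP [-> ->] /forallP h]].
  rewrite /=; apply/forallP => i; apply/forall_inP => x xB.
  have hm : (i : nat) \in iota 0 rr.+1 by rewrite mem_iota ltn_ord.
  exact: (proj1 (bridge i x (ltn_ord i)) (h i hm x) xB).
split=> // i; rewrite mem_iota => /andP [_ hi] x; apply/(bridge i x hi) => xB.
by have /forall_inP := h (Ordinal hi); apply.
Qed.

Lemma sat_lt e k x y : agree e -> PP <= k -> x < k -> y < k -> sat G e (flt J t rr k x y) = ltS (e x) (e y).
Proof.
move=> ag Pk xk yk; have [_ _ _ hb [_ _ hu]] := vlt J t rr.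
have bridge p : sat G (update e k p) (FAnd (fblk J rr k.+1 (vb 0) vu k) (FAnd (fE k x) (FNot (fE k y)))) <->
   (p \in blkS (e0 (vb 0)) (map e0 vu)) && (adj Hg p (e x) && ~~ adj Hg p (e y)).
  have ag' := agree_upd p Pk ag; cbn [sat].
  rewrite sat_blk ?sat_E // ?(leqW Pk) // (ag' _ (hb _ (ltn0Sn _))) (agree_map ag' hu) !upd_eq !upd_lt //.
  by split=> [[-> [-> /negP ->]]|/and3P [-> -> /negP]].
apply/propext; split=> [[p /bridge h]|/existsP [p /bridge h]]; first by apply/existsP; exists p.
by exists p.
Qed.

Lemma sat_pair e k us x y : agree e -> PP <= k -> x < k -> y < k -> (forall u, u \in us -> u < k) ->
  sat G e (fpair J rr k us x y) = pairS (map e us) (e x) (e y).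
Proof.
move=> ag Pk xk yk hu; have [_ _ _ hb _] := vlt J t rr.
have bridge p : sat G (update e k p) (FAnd (fblk J rr k.+1 (vb 0) us k) (FAnd (fE k x) (fE k y))) <->
   (p \in blkS (e0 (vb 0)) (map e us)) && (adj Hg p (e x) && adj Hg p (e y)).
  have ag' := agree_upd p Pk ag; cbn [sat].
  rewrite sat_blk ?sat_E // ?(leqW Pk) // (ag' _ (hb _ (ltn0Sn _))) !upd_eq !upd_lt //.
  have -> : map (update e k p) us = map e us by apply/eq_in_map => u /hu; apply: upd_lt.
  by split=> [[-> [-> ->]]|/and3P [-> -> ->]].
apply/propext; split=> [[p /bridge h]|/existsP [p /bridge h]]; first by apply/existsP; exists p.
by exists p.
Qed.

Lemma sat_hold e k us x y : agree e -> PP <= k -> x < k -> y < k -> (forall u, u \in us -> u < k) ->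
  sat G e (fhold J t rr k us x y) = holdS (map e us) (e x) (e y).
Proof.
move=> ag Pk xk yk hu; rewrite /fhold; cbn [sat].
rewrite !sat_lt // !sat_pair // => [|u h|u h|u h]; try (apply: hu; apply: mem_take h || apply: mem_drop (mem_take h) || apply: mem_drop h).
rewrite !map_take !map_drop /holdS; apply/propext; split.
  by move=> [[-> ->]|[[-> ->]|[-> ->]]]; rewrite ?eqxx ?orbT.
by case/or3P => /andP [h1 h2]; [left|right; left|right; right; move/eqP: h1].
Qed.

Lemma sat_zero e k x : agree e -> PP <= k -> x < k -> sat G e (fzero J t rr k x) = zeroS numS ltS (e x).
Proof.
move=> ag Pk xk; rewrite /fzero; cbn [sat]; congr (~ _); apply/propext.
have bridge z : sat G (update e k z) (fS J t rr k.+1 k) /\ sat G (update e k z) (flt J t rr k.+1 k x) <-> z \in numS /\ ltS z (e x).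
  have ag' := agree_upd z Pk ag.
  by rewrite sat_S ?sat_lt // ?(leqW Pk) ?(leqW xk) // upd_eq upd_lt.
by split=> [[z /bridge [h1 h2]]|[z h1 h2]]; exists z => //; apply/bridge.
Qed.

Lemma sat_succ e k x y : agree e -> PP <= k -> x < k -> y < k ->
  sat G e (fsucc J t rr k x y) = succS numS ltS (e x) (e y).
Proof.
move=> ag Pk xk yk; rewrite /fsucc; cbn [sat]; rewrite sat_lt //; congr (_ /\ ~ _); apply/propext.
have bridge z : sat G (update e k z) (FAnd (fS J t rr k.+1 k) (FAnd (flt J t rr k.+1 x k) (flt J t rr k.+1 k y))) <->
   [/\ z \in numS, ltS (e x) z & ltS z (e y)].
  have ag' := agree_upd z Pk ag; cbn [sat].
  rewrite sat_S ?sat_lt // ?(leqW Pk) ?(leqW xk) ?(leqW yk) // upd_eq !upd_lt //.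
  by split=> [[? []]|[]].
by split=> -[z /bridge h]; exists z.
Qed.

Local Notation CsS := (Cs numS ltS (3 * t) holdS).
Local Notation compf := (comp J t rr).

Lemma sat_comp f vs y k e : agree e -> PP <= k -> (forall x, x \in vs -> x < k) -> y < k ->
  sat G e (compf f vs y k) = CsS f (map e vs) (e y).
Proof.
have mapu vs' k' (e' : nat -> T) a : (forall x, x \in vs' -> x < k') -> map (update e' k' a) vs' = map e' vs'.
  by move=> h; apply/eq_in_map => u /h; apply: upd_lt.
elim/recf_ind_nested: f vs y k e => [||i|g hs IHg IHh|g h IHg IHh|g IH] vs y k e ag Pk hv hy.
- exact: sat_zero.
- case: vs hv => [|x vs] hv /=; first by apply/propext; split=> // h; case: h.
  by apply: sat_succ => //; apply: hv; rewrite inE eqxx.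
- rewrite /= size_map; case: ifP => hi; last by apply/propext; split=> // h; case: h.
  by rewrite /= (nth_map 0).
- change (sat G e (comp_all J t rr g vs y hs [::] k) = Cs_all numS ltS (3 * t) holdS g (map e vs) (e y) hs (map e [::])).
  have : forall x, x \in [::] -> x < k by [].
  move: [::] => ws; elim: hs ws k e ag Pk hv hy IHh => [|h hs IHs] ws k e ag Pk hv hy IHh hw /=; first exact: IHg.
  have bridge a : sat G (update e k a) (FAnd (fS J t rr k.+1 k) (FAnd (compf h vs k k.+1) (comp_all J t rr g vs y hs (rcons ws k) k.+1))) <->
    [/\ a \in numS, CsS h (map e vs) a & Cs_all numS ltS (3 * t) holdS g (map e vs) (e y) hs (rcons (map e ws) a)].
    have ag' := agree_upd a Pk ag; have Pk' := leqW Pk; cbn [sat].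
    have hv' x : x \in vs -> x < k.+1 by move=> /hv; apply: leqW.
    rewrite sat_S // (IHh 0 isT) // (IHs (rcons ws k)) //; first last.
    + by move=> x; rewrite mem_rcons inE => /orP [/eqP ->//|/hw]; apply: leqW.
    + by move=> i hi; apply: (IHh i.+1).
    + exact: leqW.
    rewrite map_rcons !mapu // upd_eq upd_lt //; by split=> [[? []]|[]].
  apply/propext; split=> [[a /bridge h0]|[a /bridge h0]]; by exists a.
- case: vs hv => [|x vs] hv; first by apply/propext; split=> // h0; case: h0.
  have hx : x < k by apply: hv; rewrite inE eqxx.
  have hvs z : z \in vs -> z < k by move=> hz; apply: hv; rewrite inE hz orbT.
  cbn [comp]; set us := iota k (3 * t); set k1 := k + 3 * t; rewrite sat_exs.
  have kk1 : k <= k1 by apply: leq_addr.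
  have Pk1 : PP <= k1 by apply: leq_trans Pk kk1.
  have hus u : u \in us -> u < k1 by rewrite mem_iota => /andP [].
  have big u : size u = 3 * t -> sat G (upds e k u) (FAnd (fhold J t rr k1 us x y) (FAll k1 (FAll k1.+1
          (FImp (fS J t rr k1.+2 k1) (FImp (fS J t rr k1.+2 k1.+1) (FImp (fhold J t rr k1.+2 us k1 k1.+1)
            (FOr (FAnd (fzero J t rr k1.+2 k1) (compf g vs k1.+1 k1.+2))
              (FEx k1.+2 (FEx k1.+3 (FAnd (fS J t rr k1.+4 k1.+2) (FAnd (fS J t rr k1.+4 k1.+3) (FAnd (fsucc J t rr k1.+4 k1.+2 k1)
                (FAnd (fhold J t rr k1.+4 us k1.+2 k1.+3) (compf h [:: k1.+2, k1.+3 & vs] k1.+1 k1.+4)))))))))))))) <->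
      holdS u (e x) (e y) /\ forall i z, i \in numS -> z \in numS -> holdS u i z ->
          (zeroS numS ltS i /\ CsS g (map e vs) z) \/
          exists m b, [/\ m \in numS, b \in numS, succS numS ltS m i, holdS u m b & CsS h [:: m, b & map e vs] z].
    move=> su; have ag1 := agree_upds u Pk ag.
    have e1 z : z < k -> upds e k u z = e z by move=> hz; rewrite upds_lt.
    have eu : map (upds e k u) us = u by rewrite /us -su upds_iota.
    have ev : map (upds e k u) vs = map e vs by apply/eq_in_map => z /hvs; apply: e1.
    move: (upds e k u) ag1 e1 eu ev => e' ag1 e1 eu ev.
    have hvs1 z : z \in vs -> z < k1 by move=> /hvs hz; apply: leq_trans kk1.
    have l02 : k1 < k1.+2 by clear; lia.
    have l04 : k1 < k1.+4 by clear; lia.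
    have l14 : k1.+1 < k1.+4 by clear; lia.
    have l24 : k1.+2 < k1.+4 by clear; lia.
    have P2 : PP <= k1.+2 by apply: leq_trans Pk1 (ltnW l02).
    have P4 : PP <= k1.+4 by apply: leq_trans Pk1 (ltnW l04).
    have hold1 : sat G e' (fhold J t rr k1 us x y) = holdS u (e x) (e y).
      by rewrite sat_hold // ?eu ?e1 //; [apply: leq_trans hx kk1|apply: leq_trans hy kk1].
    have two i z : let e2 := update (update e' k1 i) k1.+1 z in
        [/\ agree e2, e2 k1 = i, e2 k1.+1 = z, map e2 us = u & map e2 vs = map e vs].
      move=> e2; have m2 s : (forall w, w \in s -> w < k1) -> map e2 s = map e' s.
        by move=> hs; rewrite /e2 !mapu // => w /hs; apply: leqW.
      split; rewrite ?m2 //.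
        by rewrite /e2; apply: agree_upd; [apply: leqW|apply: agree_upd].
        by rewrite /e2 upd_lt // upd_eq.
      by rewrite /e2 upd_eq.
    have four i z m b : let e4 := update (update (update (update e' k1 i) k1.+1 z) k1.+2 m) k1.+3 b in
        [/\ agree e4, e4 k1 = i, e4 k1.+1 = z & [/\ e4 k1.+2 = m, e4 k1.+3 = b, map e4 us = u & map e4 vs = map e vs]].
      move=> e4; have [a2 x1 x2 x3 x4] := two i z.
      have m4 s : (forall w, w \in s -> w < k1) -> map e4 s = map (update (update e' k1 i) k1.+1 z) s.
        by move=> hs; rewrite /e4 !mapu // => w /hs hw; do ?apply: leqW.
      have l03 : k1 < k1.+3 by clear; lia.
      split; first by rewrite /e4; apply: agree_upd; [apply: leqW P2|apply: agree_upd].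
      - by rewrite /e4 (@upd_lt _ _ k1.+3 b) // (@upd_lt _ _ k1.+2 m) // x1.
      - by rewrite /e4 (@upd_lt _ _ k1.+3 b) // (@upd_lt _ _ k1.+2 m) // x2.
      by split; rewrite ?m4 //; rewrite /e4 ?upd_eq // (@upd_lt _ _ k1.+3 b) // upd_eq.
    have inner i z m b : sat G (update (update (update (update e' k1 i) k1.+1 z) k1.+2 m) k1.+3 b)
       (FAnd (fS J t rr k1.+4 k1.+2) (FAnd (fS J t rr k1.+4 k1.+3) (FAnd (fsucc J t rr k1.+4 k1.+2 k1)
                (FAnd (fhold J t rr k1.+4 us k1.+2 k1.+3) (compf h [:: k1.+2, k1.+3 & vs] k1.+1 k1.+4))))) <->
       [/\ m \in numS, b \in numS, succS numS ltS m i, holdS u m b & CsS h [:: m, b & map e vs] z].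
      have [a4 x1 x2 [x3 x4 x5 x6]] := four i z m b; move: (update _ k1.+3 b) a4 x1 x2 x3 x4 x5 x6 => e4 a4 x1 x2 x3 x4 x5 x6.
      cbn [sat]; rewrite !sat_S // sat_succ // sat_hold //; last by move=> w /hus hw; apply: leq_trans hw (ltnW l04).
      rewrite IHh //; last by move=> w; rewrite !inE => /or3P [/eqP ->|/eqP ->|/hvs1 hw] //; apply: leq_trans hw (ltnW l04).
      by rewrite /= x1 x2 x3 x4 x5 x6; split=> [[? [? [? []]]]|[]].
    have outer i z : sat G (update (update e' k1 i) k1.+1 z)
          (FImp (fS J t rr k1.+2 k1) (FImp (fS J t rr k1.+2 k1.+1) (FImp (fhold J t rr k1.+2 us k1 k1.+1)
            (FOr (FAnd (fzero J t rr k1.+2 k1) (compf g vs k1.+1 k1.+2))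
              (FEx k1.+2 (FEx k1.+3 (FAnd (fS J t rr k1.+4 k1.+2) (FAnd (fS J t rr k1.+4 k1.+3) (FAnd (fsucc J t rr k1.+4 k1.+2 k1)
                (FAnd (fhold J t rr k1.+4 us k1.+2 k1.+3) (compf h [:: k1.+2, k1.+3 & vs] k1.+1 k1.+4))))))))))) <->
       (i \in numS -> z \in numS -> holdS u i z ->
          (zeroS numS ltS i /\ CsS g (map e vs) z) \/
          exists m b, [/\ m \in numS, b \in numS, succS numS ltS m i, holdS u m b & CsS h [:: m, b & map e vs] z]).
      have inn := inner i z; have [a2 x1 x2 x3 x4] := two i z.
      move: (update _ k1.+1 z) a2 x1 x2 x3 x4 inn => e2 a2 x1 x2 x3 x4 inn.
      change ((sat G e2 (fS J t rr k1.+2 k1) -> sat G e2 (fS J t rr k1.+2 k1.+1) -> sat G e2 (fhold J t rr k1.+2 us k1 k1.+1) ->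
         (sat G e2 (fzero J t rr k1.+2 k1) /\ sat G e2 (compf g vs k1.+1 k1.+2)) \/ (exists m b, sat G (update (update e2 k1.+2 m) k1.+3 b)
           (FAnd (fS J t rr k1.+4 k1.+2) (FAnd (fS J t rr k1.+4 k1.+3) (FAnd (fsucc J t rr k1.+4 k1.+2 k1)
                (FAnd (fhold J t rr k1.+4 us k1.+2 k1.+3) (compf h [:: k1.+2, k1.+3 & vs] k1.+1 k1.+4))))))) <->
        (i \in numS -> z \in numS -> holdS u i z ->
          (zeroS numS ltS i /\ CsS g (map e vs) z) \/
          exists m b, [/\ m \in numS, b \in numS, succS numS ltS m i, holdS u m b & CsS h [:: m, b & map e vs] z])).
      rewrite !sat_S // sat_hold //; last by move=> w /hus hw; apply: leq_trans hw (ltnW l02).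
      rewrite sat_zero // IHg //; last by move=> w /hvs1 hw; apply: leq_trans hw (ltnW l02).
      rewrite x1 x2 x3 x4; split=> hh h1 h2 h3; case: (hh h1 h2 h3) => [c|[m [b hm]]]; [by left| |by left|].
        by right; exists m, b; apply/inn.
      by right; exists m, b; apply/inn.
    change (sat G e' (fhold J t rr k1 us x y) /\ (forall i z, sat G (update (update e' k1 i) k1.+1 z)
          (FImp (fS J t rr k1.+2 k1) (FImp (fS J t rr k1.+2 k1.+1) (FImp (fhold J t rr k1.+2 us k1 k1.+1)
            (FOr (FAnd (fzero J t rr k1.+2 k1) (compf g vs k1.+1 k1.+2))
              (FEx k1.+2 (FEx k1.+3 (FAnd (fS J t rr k1.+4 k1.+2) (FAnd (fS J t rr k1.+4 k1.+3) (FAnd (fsucc J t rr k1.+4 k1.+2 k1)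
                (FAnd (fhold J t rr k1.+4 us k1.+2 k1.+3) (compf h [:: k1.+2, k1.+3 & vs] k1.+1 k1.+4)))))))))))) <->
      holdS u (e x) (e y) /\ forall i z, i \in numS -> z \in numS -> holdS u i z ->
          (zeroS numS ltS i /\ CsS g (map e vs) z) \/
          exists m b, [/\ m \in numS, b \in numS, succS numS ltS m i, holdS u m b & CsS h [:: m, b & map e vs] z]).
    by rewrite hold1; split=> -[h1 h2]; split=> // i z; apply/outer; apply: h2.
  apply/propext; split=> [[u su /(big u su) [h1 h2]]|[u [su h1 h2]]]; first by exists u.
  by exists u => //; apply/(big u su).
have P1 := leqW Pk; have P2 := leqW P1; have P3 := leqW P2.
have hv1 x : x \in vs -> x < k.+1 by move=> /hv; apply: leqW.
have inner o m q : sat G (update (update (update e k o) k.+1 m) k.+2 q)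
   (FAnd (fS J t rr k.+3 k.+2) (FAnd (FNot (fzero J t rr k.+3 k.+2)) (compf g (k.+1 :: vs) k.+2 k.+3))) <->
   [/\ q \in numS, ~ zeroS numS ltS q & CsS g (m :: map e vs) q].
  have a3 : agree (update (update (update e k o) k.+1 m) k.+2 q) by do 3 apply: agree_upd => //.
  cbn [sat]; rewrite sat_S // sat_zero // IH //; last first.
    by move=> x; rewrite inE => /orP [/eqP ->//|/hv1 h]; do 2 apply: leqW.
  rewrite /= !mapu //; last by move=> x /hv1; apply: leqW.
  by rewrite upd_eq upd_lt // upd_eq; split=> [[? []]|[]].
have outer o m : sat G (update (update e k o) k.+1 m) (FImp (fS J t rr k.+2 k.+1) (FImp (flt J t rr k.+2 k.+1 y)
          (FEx k.+2 (FAnd (fS J t rr k.+3 k.+2) (FAnd (FNot (fzero J t rr k.+3 k.+2)) (compf g (k.+1 :: vs) k.+2 k.+3)))))) <->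
   (m \in numS -> ltS m (e y) -> exists q, [/\ q \in numS, ~ zeroS numS ltS q & CsS g (m :: map e vs) q]).
  have inn := inner o m.
  have a2 : agree (update (update e k o) k.+1 m) by do 2 apply: agree_upd => //.
  have y1 : update (update e k o) k.+1 m y = e y by rewrite !upd_lt //; apply: leqW.
  have m1 : update (update e k o) k.+1 m k.+1 = m by rewrite upd_eq.
  move: (update _ k.+1 m) a2 y1 m1 inn => e2 a2 y1 m1 inn.
  change ((sat G e2 (fS J t rr k.+2 k.+1) -> sat G e2 (flt J t rr k.+2 k.+1 y) -> exists q, sat G (update e2 k.+2 q)
    (FAnd (fS J t rr k.+3 k.+2) (FAnd (FNot (fzero J t rr k.+3 k.+2)) (compf g (k.+1 :: vs) k.+2 k.+3)))) <->
   (m \in numS -> ltS m (e y) -> exists q, [/\ q \in numS, ~ zeroS numS ltS q & CsS g (m :: map e vs) q])).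
  rewrite sat_S // sat_lt //; last by do 2 apply: leqW.
  by rewrite y1 m1; split=> hh h1 h2; have [q hq] := hh h1 h2; exists q; apply/inn.
have top o : sat G (update e k o) (FAnd (fS J t rr k.+1 k) (FAnd (fzero J t rr k.+1 k) (FAnd (compf g (y :: vs) k k.+1)
        (FAll k.+1 (FImp (fS J t rr k.+2 k.+1) (FImp (flt J t rr k.+2 k.+1 y)
          (FEx k.+2 (FAnd (fS J t rr k.+3 k.+2) (FAnd (FNot (fzero J t rr k.+3 k.+2)) (compf g (k.+1 :: vs) k.+2 k.+3)))))))))) <->
   [/\ o \in numS, zeroS numS ltS o, CsS g (e y :: map e vs) o &
        forall m, m \in numS -> ltS m (e y) -> exists q, [/\ q \in numS, ~ zeroS numS ltS q & CsS g (m :: map e vs) q]].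
  have out := outer o; have a1 := agree_upd o Pk ag.
  have y1 : update e k o y = e y by rewrite upd_lt.
  have m1 : update e k o k = o by rewrite upd_eq.
  have v1 : map (update e k o) vs = map e vs by rewrite mapu.
  move: (update _ k o) a1 y1 m1 v1 out => e1 a1 y1 m1 v1 out.
  change ((sat G e1 (fS J t rr k.+1 k) /\ (sat G e1 (fzero J t rr k.+1 k) /\ (sat G e1 (compf g (y :: vs) k k.+1) /\
     forall m, sat G (update e1 k.+1 m) (FImp (fS J t rr k.+2 k.+1) (FImp (flt J t rr k.+2 k.+1 y)
          (FEx k.+2 (FAnd (fS J t rr k.+3 k.+2) (FAnd (FNot (fzero J t rr k.+3 k.+2)) (compf g (k.+1 :: vs) k.+2 k.+3))))))))) <->
   [/\ o \in numS, zeroS numS ltS o, CsS g (e y :: map e vs) o &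
        forall m, m \in numS -> ltS m (e y) -> exists q, [/\ q \in numS, ~ zeroS numS ltS q & CsS g (m :: map e vs) q]]).
  rewrite sat_S // sat_zero // IH //; last by move=> x; rewrite inE => /orP [/eqP ->|/hv1//]; apply: leqW.
  rewrite /= y1 m1 v1; split=> [[h1 [h2 [h3 h4]]]|[h1 h2 h3 h4]]; do !split=> //; move=> m; apply/out; apply: h4.
by apply/propext; split=> -[ o /top h]; exists o.
Qed.

End Semantics.

(** * The arithmetic sentences *)

Section Psi.
Variables (J t rr : nat).
Local Notation P := (PP J t rr).
Local Notation fS := (fS J t rr).
Local Notation flt := (flt J t rr).
Local Notation fzero := (fzero J t rr).
Local Notation fsucc := (fsucc J t rr).

Definition fax := FAnd (FAll P (FImp (fS P.+1 P) (FNot (flt P.+1 P P))))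
  (FAnd (FAll P (FAll P.+1 (FAll P.+2 (FImp (fS P.+3 P) (FImp (fS P.+3 P.+1) (FImp (fS P.+3 P.+2)
     (FImp (flt P.+3 P P.+1) (FImp (flt P.+3 P.+1 P.+2) (flt P.+3 P P.+2)))))))))
   (FAll P (FAll P.+1 (FImp (fS P.+2 P) (FImp (fS P.+2 P.+1)
     (FOr (flt P.+2 P P.+1) (FOr (FEq P P.+1) (flt P.+2 P.+1 P)))))))).

(** The predecessor is copied back to variable [P], so that each numeral wraps the previous one in
    the same context. Its code is then given by a primitive recursion, [rnu]. *)
Fixpoint fnu j := if j is j'.+1 then
  FEx P.+1 (FAnd (fS P.+2 P.+1) (FAnd (fsucc P.+2 P.+1 P) (FEx P (FAnd (FEq P P.+1) (fnu j'))))) else fzero P.+1 P.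

Definition ftm r := FEx P.+1 (FAnd (fS P.+2 P.+1) (FAnd (fzero P.+2 P.+1) (comp J t rr r [:: P] P.+1 P.+2))).
Definition fbody j p := FAnd fax (FEx P (FAnd (fS P.+1 P) (FAnd (fnu j) p))).
Definition psi j p := fexs 0 P (fbody j p).

Lemma P12 : P < P.+2 /\ P < P.+3 /\ P.+1 < P.+3.
Proof. by clear; lia. Qed.

Lemma fv_nu j : fvlt P.+1 (fnu j).
Proof.
have [l02 _] := P12; have P2 : P <= P.+2 := ltnW l02.
elim: j => [|j IH] /=; first exact: (fv_zero (k := P)).
apply: fvlt_Ex; apply: fvlt_And; first exact: (fv_S (k := P)).
apply: fvlt_And; first exact: (fv_succ (k := P)).
by apply: fvlt_Ex'; apply: fvlt_And; [apply: fvlt_Eq|apply: fvlt_W IH].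
Qed.

Lemma fv_tm r : fvlt P.+1 (ftm r).
Proof.
have [l02 _] := P12; have P2 : P <= P.+2 := ltnW l02.
apply: fvlt_Ex; apply: fvlt_And; first exact: (fv_S (k := P)).
apply: fvlt_And; first exact: (fv_zero (k := P)).
by apply: fv_comp => // x; rewrite inE => /eqP ->.
Qed.

Lemma fv_ax : fvlt P fax.
Proof.
have [l02 [l03 l13]] := P12; have P2 : P <= P.+2 := ltnW l02; have P3 : P <= P.+3 := ltnW l03.
have S j y : P <= j -> y < j -> fvlt j (fS j y) by apply: fv_S.
have L j x y : P <= j -> x < j -> y < j -> fvlt j (flt j x y) by apply: fv_lt.
apply: fvlt_And; first by apply: fvlt_All; apply: fvlt_Imp; [apply: S|apply: fvlt_Not; apply: L].
apply: fvlt_And.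
  do 3 apply: fvlt_All; do 3 (apply: fvlt_Imp; first by apply: S).
  by do 2 (apply: fvlt_Imp; first by apply: L); apply: L.
do 2 apply: fvlt_All; do 2 (apply: fvlt_Imp; first by apply: S).
by apply: fvlt_Or; [apply: L|apply: fvlt_Or; [apply: fvlt_Eq|apply: L]].
Qed.

Lemma psi_sentence j r : sentence (psi j (ftm r)).
Proof.
have : fvlt 0 (psi j (ftm r)).
  apply: fvlt_exs; rewrite add0n; apply: fvlt_And; first exact: fv_ax.
  apply: fvlt_Ex; apply: fvlt_And; first exact: (fv_S (k := P)).
  by apply: fvlt_And; [apply: fv_nu|apply: fv_tm].
by rewrite /fvlt /sentence; case: (free_vars _).
Qed.

Fixpoint NU (T : finType) (num : {set T}) (lt : rel T) j a : Prop :=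
  if j is j'.+1 then exists m, [/\ m \in num, succS num lt m a & NU num lt j' m] else zeroS num lt a.

Lemma NU_rk (T : finType) (num : {set T}) (lt : rel T) j a : numsys num lt -> a \in num ->
  NU num lt j a <-> rk num lt a = j.
Proof.
move=> ns; elim: j a => [|j IH] a aN /=; first exact: zero_rk.
split=> [[m [mN /(succ_rk ns mN aN) e /(IH m mN) em]]|e]; first by rewrite e em.
have lj : j < #|num| by rewrite ltnW // -e rk_lt.
have [m mN em] := rk_onto ns lj; exists m; split=> //; first by apply/succ_rk => //; rewrite e em.
exact/IH.
Qed.

Section Sat.
Variables (T : finType) (G : sgraph T) (e0 : nat -> T).
Local Notation num := (numS J t rr G e0).
Local Notation lt := (ltS J t rr G e0).
Local Notation agree := (agree J t rr e0).

Lemma sat_nu j e : agree e -> sat G e (fnu j) = NU num lt j (e P).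
Proof.
have [l02 _] := P12; have P2 : P <= P.+2 := ltnW l02.
elim: j e => [|j IH] e ag /=; first exact: sat_zero.
have inner m : sat G (update e P.+1 m) (FEx P (FAnd (FEq P P.+1) (fnu j))) <-> NU num lt j m.
  have a1 : agree (update e P.+1 m) by apply: agree_upd.
  have in2 a : sat G (update (update e P.+1 m) P a) (FAnd (FEq P P.+1) (fnu j)) <-> a = m /\ NU num lt j a.
    have a2 : agree (update (update e P.+1 m) P a) by apply: agree_upd.
    cbn [sat]; rewrite IH // upd_eq.
    suff -> : update (update e P.+1 m) P a P.+1 = m by [].
    by rewrite {1}/update gtn_eqF // upd_eq.
  by split=> [[a /in2 [-> //]]|h]; exists m; apply/in2.
have bridge m : sat G (update e P.+1 m) (FAnd (fS P.+2 P.+1) (FAnd (fsucc P.+2 P.+1 P) (FEx P (FAnd (FEq P P.+1) (fnu j))))) <->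
   [/\ m \in num, succS num lt m (e P) & NU num lt j m].
  have inn := inner m; have a1 : agree (update e P.+1 m) by apply: agree_upd.
  change (sat G (update e P.+1 m) (fS P.+2 P.+1) /\ (sat G (update e P.+1 m) (fsucc P.+2 P.+1 P) /\
     sat G (update e P.+1 m) (FEx P (FAnd (FEq P P.+1) (fnu j)))) <-> [/\ m \in num, succS num lt m (e P) & NU num lt j m]).
  rewrite (sat_S G a1) // (sat_succ G a1) // upd_eq upd_lt //; split=> [[h1 [h2 /inn h3]]|[h1 h2 h3]]; do !split=> //; exact/inn.
by apply/propext; split=> -[m /bridge h]; exists m.
Qed.

Lemma sat_ax e : agree e -> sat G e fax <-> numsys num lt.
Proof.
move=> ag; have [l02 [l03 l13]] := P12; have P2 : P <= P.+2 := ltnW l02; have P3 : P <= P.+3 := ltnW l03.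
have b1 x : sat G (update e P x) (FImp (fS P.+1 P) (FNot (flt P.+1 P P))) <-> (x \in num -> ~~ lt x x).
  have a1 : agree (update e P x) by apply: agree_upd.
  by cbn [sat]; rewrite (sat_S G a1) // (sat_lt G a1) // upd_eq; split=> h xN; apply/negP; apply: h.
have b2 x y z : sat G (update (update (update e P x) P.+1 y) P.+2 z) (FImp (fS P.+3 P) (FImp (fS P.+3 P.+1) (FImp (fS P.+3 P.+2)
     (FImp (flt P.+3 P P.+1) (FImp (flt P.+3 P.+1 P.+2) (flt P.+3 P P.+2)))))) <->
     (x \in num -> y \in num -> z \in num -> lt x y -> lt y z -> lt x z).
  have a3 : agree (update (update (update e P x) P.+1 y) P.+2 z) by do 3 (apply: agree_upd => //; try exact: leqnSn).
  have x1 : update (update (update e P x) P.+1 y) P.+2 z P = x.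
    by rewrite (@upd_lt _ _ P.+2) // (@upd_lt _ _ P.+1) // upd_eq.
  have y1 : update (update (update e P x) P.+1 y) P.+2 z P.+1 = y by rewrite (@upd_lt _ _ P.+2) // upd_eq.
  have z1 : update (update (update e P x) P.+1 y) P.+2 z P.+2 = z by rewrite upd_eq.
  move: (update _ P.+2 z) a3 x1 y1 z1 => e3 a3 x1 y1 z1.
  by cbn [sat]; rewrite !(sat_S G a3) // !(sat_lt G a3) // x1 y1 z1.
have b3 x y : sat G (update (update e P x) P.+1 y) (FImp (fS P.+2 P) (FImp (fS P.+2 P.+1)
     (FOr (flt P.+2 P P.+1) (FOr (FEq P P.+1) (flt P.+2 P.+1 P))))) <->
     (x \in num -> y \in num -> [|| lt x y, x == y | lt y x]).
  have a2 : agree (update (update e P x) P.+1 y) by do 2 (apply: agree_upd => //; try exact: leqnSn).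
  have x1 : update (update e P x) P.+1 y P = x by rewrite (@upd_lt _ _ P.+1) // upd_eq.
  have y1 : update (update e P x) P.+1 y P.+1 = y by rewrite upd_eq.
  move: (update _ P.+1 y) a2 x1 y1 => e2 a2 x1 y1.
  cbn [sat]; rewrite !(sat_S G a2) // !(sat_lt G a2) // x1 y1; split=> h xN yN.
    by apply/or3P; case: (h xN yN) => [?|[/eqP ?|?]]; [constructor 1|constructor 2|constructor 3].
  by case/or3P: (h xN yN) => [?|/eqP ?|?]; [left|right; left|right; right].
split=> [[h1 [h2 h3]]|[h1 h2 h3]].
  split; [by move=> x; apply/b1; apply: h1|by move=> x y z; apply/b2; apply: h2|by move=> x y; apply/b3; apply: h3].
split; [by move=> x; apply/b1; apply: h1|split; [by move=> x y z; apply/b2; apply: h2|by move=> x y; apply/b3; apply: h3]].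
Qed.

Lemma sat_body j r e : agree e -> sat G e (fbody j (ftm r)) <->
  numsys num lt /\ exists x, [/\ x \in num, NU num lt j x &
    exists o, [/\ o \in num, zeroS num lt o & Cs num lt (3 * t) (holdS J t rr G e0) r [:: x] o]].
Proof.
move=> ag; have [l02 [l03 l13]] := P12; have P2 : P <= P.+2 := ltnW l02.
have b2 x o : sat G (update (update e P x) P.+1 o) (FAnd (fS P.+2 P.+1) (FAnd (fzero P.+2 P.+1) (comp J t rr r [:: P] P.+1 P.+2))) <->
    [/\ o \in num, zeroS num lt o & Cs num lt (3 * t) (holdS J t rr G e0) r [:: x] o].
  have a2 : agree (update (update e P x) P.+1 o) by do 2 (apply: agree_upd => //; try exact: leqnSn).
  have x1 : update (update e P x) P.+1 o P = x by rewrite (@upd_lt _ _ P.+1) // upd_eq.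
  have y1 : update (update e P x) P.+1 o P.+1 = o by rewrite upd_eq.
  move: (update _ P.+1 o) a2 x1 y1 => e2 a2 x1 y1.
  cbn [sat]; rewrite (sat_S G a2) // (sat_zero G a2) // (sat_comp G r a2) //; last by move=> z; rewrite inE => /eqP ->.
  by rewrite /= x1 y1; split=> [[? []]|[]].
have b1 x : sat G (update e P x) (FAnd (fS P.+1 P) (FAnd (fnu j) (ftm r))) <-> [/\ x \in num, NU num lt j x &
    exists o, [/\ o \in num, zeroS num lt o & Cs num lt (3 * t) (holdS J t rr G e0) r [:: x] o]].
  have a1 : agree (update e P x) by apply: agree_upd.
  change (sat G (update e P x) (fS P.+1 P) /\ (sat G (update e P x) (fnu j) /\ (exists o, sat G (update (update e P x) P.+1 o)
    (FAnd (fS P.+2 P.+1) (FAnd (fzero P.+2 P.+1) (comp J t rr r [:: P] P.+1 P.+2))))) <-> [/\ x \in num, NU num lt j x &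
    exists o, [/\ o \in num, zeroS num lt o & Cs num lt (3 * t) (holdS J t rr G e0) r [:: x] o]]).
  rewrite (sat_S G a1) // (sat_nu j a1) // upd_eq; split=> [[h1 [h2 [ o /b2 h3]]]|[h1 h2 [ o h3]]].
    by split=> //; exists o.
  by do !split=> //; exists o; apply/b2.
split=> [[/(sat_ax ag) h1 [x /b1 h2]]|[h1 [x h2]]]; first by split=> //; exists x.
by split; [apply/sat_ax|exists x; apply/b1].
Qed.

End Sat.

(** The values of the parameters may be arbitrary, since the order axioms are asserted by the
    sentence itself and [Cs_sound] applies to every number system. *)
Lemma psi_sound (T : finType) (G : sgraph T) e j r : sat G e (psi j (ftm r)) -> computes r [:: j] 0.
Proof.
rewrite /psi sat_exs => -[u _ hs]; have ag : agree J t rr (upds e 0 u) (upds e 0 u) by [].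
have [ns [x [xN /(NU_rk _ ns xN) ex [ o [ oN /(zero_rk ns oN) zo c]]]]] := proj1 (@sat_body T G _ j r _ ag) hs.
by have := Cs_sound ns (v := [:: x]) _ oN c; rewrite /= xN ex zo; apply.
Qed.

Lemma psi_complete j r : computes r [:: j] 0 -> exists B, forall (T : finType) (G : sgraph T) e0,
  numsys (numS J t rr G e0) (ltS J t rr G e0) -> full (numS J t rr G e0) (3 * t) (holdS J t rr G e0) ->
  B <= #|numS J t rr G e0| -> forall e, sat G e (psi j (ftm r)).
Proof.
move=> /Cs_complete [B hB]; exists (B + j.+1) => T G e0 ns fu le e.
rewrite /psi sat_exs; pose u := map e0 (iota 0 P); have su : size u = P by rewrite size_map size_iota.
exists u => //; have ag : agree J t rr e0 (upds e 0 u).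
  move=> i hi; have := upds_iota e 0 u; rewrite su => /eq_in_map; apply; by rewrite mem_iota.
apply: (proj2 (@sat_body T G e0 j r _ ag)); split=> //.
have lj : j < #|numS J t rr G e0| by apply: leq_trans le; rewrite addnS ltnS leq_addl.
have [x xN ex] := rk_onto ns lj; have [ o oN eo] := rk_onto ns (leq_ltn_trans (leq0n _) lj).
exists x; split=> //; first exact/NU_rk.
exists o; split=> //; first exact/zero_rk.
by apply: hB; rewrite ?ns ?fu //= ?xN ?ex //; apply: leq_trans le; rewrite leq_addr.
Qed.

End Psi.

(** * Coded graphs are models *)

Section CodedModel.
Variables (J t rr sg : nat) (T : finType) (G H : sgraph T) (X Y Z : {set T}) (b : 'I_rr.+1 -> T)
  (Ct W E : 'I_rr.+1 -> {set T}) (S : {set T}) (y1 y2 : T).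
Hypotheses (cd : @codes T J t rr sg H X Y Z b Ct W E S) (y1Y : y1 \in Y)
  (HE : (if adj G y1 y2 then G else cg G) = H).

(** The order of the numbers is taken from [enum_rank]. By [codes_sh] each of its initial segments
    is the trace of a vertex of [Ct ord0]. *)
Definition segD : {set T} := [set p in Ct ord0 | [exists m : T, nb H p :&: S == [set x in S | enum_rank x <= enum_rank m]]].

Variables (Uw Ue : 'I_rr.+1 -> {set T}) (Uu : {set T}).
Hypotheses (cUw : forall i, #|Uw i| = t /\ capn H (blkof H X (b i)) (Uw i) = W i)
  (cUe : forall i, #|Ue i| = t /\ capn H (blkof H X (b i)) (Ue i) = E i)
  (cUu : #|Uu| = t /\ capn H (blkof H X (b ord0)) Uu = segD).

Let M := J + rr + 3.

Definition cenv (p : nat) : T :=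
  let i := (p %/ 8) %% M in let l := (p %/ 8) %/ M in
  match p %% 8 with
  | 0 => nth y1 (enum Z) i
  | 1 => y1
  | 2 => y2
  | 3 => b (inord i)
  | 4 => nth y1 (enum (Uw (inord i))) l
  | 5 => nth y1 (enum (Ue (inord i))) l
  | _ => nth y1 (enum Uu) l
  end.

Lemma pos_decode tag i l : tag < 8 -> i < M ->
  [/\ pos J rr tag i l %% 8 = tag, (pos J rr tag i l %/ 8) %% M = i & (pos J rr tag i l %/ 8) %/ M = l].
Proof.
move=> ht hi; rewrite /pos -/M; have e : (tag + 8 * (i + M * l)) %/ 8 = i + M * l.
  by rewrite [8 * _]mulnC addnC divnMDl // divn_small // addn0.
rewrite e; split; first by rewrite [8 * _]mulnC addnC modnMDl modn_small.
  by rewrite [M * l]mulnC addnC modnMDl modn_small.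
by rewrite [M * l]mulnC addnC divnMDl ?divn_small ?addn0 //; apply: leq_ltn_trans hi.
Qed.

Lemma M_gt i : i < rr.+1 -> i < M.
Proof. by rewrite /M; clear; lia. Qed.

Lemma cenv_z i : i < J -> cenv (vz J rr i) = nth y1 (enum Z) i.
Proof.
move=> hi; have hM : i < M by rewrite /M; move: hi; clear; lia.
by have [e1 e2 e3] := pos_decode 0 (isT : 0 < 8) hM; rewrite /cenv /vz e1 e2.
Qed.

Lemma cenv_m1 : cenv (vm1 J rr) = y1.
Proof. by have [e1 e2 e3] := pos_decode 0 (isT : 1 < 8) (M_gt (ltn0Sn rr)); rewrite /cenv /vm1 e1. Qed.

Lemma cenv_m2 : cenv (vm2 J rr) = y2.
Proof. by have [e1 e2 e3] := pos_decode 0 (isT : 2 < 8) (M_gt (ltn0Sn rr)); rewrite /cenv /vm2 e1. Qed.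

Lemma cenv_b (i : 'I_rr.+1) : cenv (vb J rr i) = b i.
Proof.
by have [e1 e2 e3] := pos_decode 0 (isT : 3 < 8) (M_gt (ltn_ord i)); rewrite /cenv /vb e1 e2 inord_val.
Qed.

Lemma map_nth_enum (U : {set T}) : #|U| = t -> [seq nth y1 (enum U) l | l <- iota 0 t] = enum U.
Proof. by move=> <-; rewrite cardE -/(mkseq _ _) mkseq_nth. Qed.

Lemma cenv_w (i : 'I_rr.+1) : map cenv (vw J t rr i) = enum (Uw i).
Proof.
rewrite -(map_nth_enum (cUw i).1) /vw -map_comp; apply: eq_map => l /=.
by have [e1 e2 e3] := pos_decode l (isT : 4 < 8) (M_gt (ltn_ord i)); rewrite /cenv e1 e2 e3 inord_val.
Qed.

Lemma cenv_e (i : 'I_rr.+1) : map cenv (ve J t rr i) = enum (Ue i).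
Proof.
rewrite -(map_nth_enum (cUe i).1) /ve -map_comp; apply: eq_map => l /=.
by have [e1 e2 e3] := pos_decode l (isT : 5 < 8) (M_gt (ltn_ord i)); rewrite /cenv e1 e2 e3 inord_val.
Qed.

Lemma cenv_u : map cenv (vu J t rr) = enum Uu.
Proof.
rewrite -(map_nth_enum cUu.1) /vu -map_comp; apply: eq_map => l /=.
by have [e1 e2 e3] := pos_decode l (isT : 6 < 8) (M_gt (ltn0Sn rr)); rewrite /cenv e1 e3.
Qed.

Lemma Hg_cenv : Hg J rr G cenv = H.
Proof. by rewrite /Hg cenv_m1 cenv_m2. Qed.

Lemma nexc_cenv v : nexcS J rr cenv v = (v \notin Z).
Proof.
apply/forallP/idP => [h|vZ i]; last first.
  rewrite cenv_z // cenv_m1; case: (ltnP i (size (enum Z))) => hi; last by rewrite nth_default // orNb.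
  by apply/orP; left; apply: contraNneq vZ => ->; rewrite -mem_enum mem_nth.
apply/negP => vZ; have iJ : index v (enum Z) < J.
  by apply: leq_trans (codes_J cd); rewrite cardE index_mem mem_enum.
have := h (Ordinal iJ); rewrite cenv_z // cenv_m1 /= nth_index ?mem_enum // eqxx /= => /eqP ev.
have := codes_Z cd; move=> /disjointFr /(_ vZ); by rewrite ev inE y1Y orbT.
Qed.

Lemma X_nZ x : x \in X -> x \notin Z.
Proof. by move=> xX; apply/negP => /(disjointFr (codes_Z cd)); rewrite inE xX. Qed.

Lemma Y_nZ x : x \in Y -> x \notin Z.
Proof. by move=> xX; apply/negP => /(disjointFr (codes_Z cd)); rewrite inE xX orbT. Qed.

Lemma tri_cenv v : v \notin Z -> triS J rr G cenv v = (v \in Y).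
Proof.
move=> vZ; rewrite /triS Hg_cenv; apply/idP/idP; last first.
  move=> /(codes_3 cd) [x1 [x2 [x3 [[h1 h2 h3] [[a1 a2 a3] [[n1 n2 n3] [m1 m2 m3]]]]]]].
  apply/existsP; exists x1; apply/existsP; exists x2; apply/existsP; exists x3.
  by rewrite !nexc_cenv !X_nZ // a1 a2 a3 n1 n2 n3 m1 m2 m3.
move=> /existsP [x1 /existsP [x2 /existsP [x3]]]; rewrite !nexc_cenv.
move=> /and4P [/and3P [z1 z2 z3] /and3P [a1 a2 a3] /and3P [n1 n2 n3] /and3P [m1 m2 m3]].
case/or3P: (codes_cover cd v) => // [vX|vZ']; last by rewrite vZ' in vZ.
(* [v] lies in [X], and its neighbourhood is the union of a clique in [Y] and one in [X]. *)
have adjX u w : u \in X -> w \in X -> u != w -> adj H v u -> adj H v w -> adj H u w.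
  move=> uX wX ne au aw; have := codes_X cd uX vX wX; rewrite /p3 ne adj_sym au aw /=; by rewrite negbK.
have side u w : u \notin Z -> w \notin Z -> u != w -> ~~ adj H u w -> adj H v u -> adj H v w -> (u \in X) != (w \in X).
  move=> uZ wZ ne na au aw; case/or3P: (codes_cover cd u) (uZ) (wZ) => [uX|uY|->] //; case/or3P: (codes_cover cd w) => [wX|wY|->] // _ _.
  - by rewrite adjX in na.
  - by rewrite uX (disjointFl (codes_XY cd) wY).
  - by rewrite wX (disjointFl (codes_XY cd) uY).
  - by move/cliqueP: (codes_Y cd) => cY; rewrite cY in na.
have := side _ _ z1 z2 n1 m1 a1 a2; have := side _ _ z1 z3 n2 m2 a1 a3; have := side _ _ z2 z3 n3 m3 a2 a3.
by case: (x1 \in X); case: (x2 \in X); case: (x3 \in X).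
Qed.

Lemma inX_cenv v : inXS J rr G cenv v = (v \in X).
Proof.
rewrite /inXS nexc_cenv; case: (boolP (v \in Z)) => vZ /=.
  by apply/esym/negbTE/negP => /X_nZ; rewrite vZ.
rewrite tri_cenv //; case/or3P: (codes_cover cd v) => h.
- by rewrite h (disjointFr (codes_XY cd) h).
- by rewrite h (disjointFl (codes_XY cd) h).
- by rewrite h in vZ.
Qed.

Lemma inY_cenv v : inYS J rr G cenv v = (v \in Y).
Proof.
rewrite /inYS nexc_cenv; case: (boolP (v \in Z)) => vZ /=; last exact: tri_cenv.
by apply/esym/negbTE/negP => /Y_nZ; rewrite vZ.
Qed.

Lemma blk_cenv c (U : {set T}) : blkS J rr G cenv c (enum U) = capn H (blkof H X c) U.
Proof.
apply/setP => x; rewrite !inE inX_cenv Hg_cenv [adj H c x]adj_sym -andbA; congr (_ && (_ && _)).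
apply/allP/forall_inP => h u uU; first by apply: h; rewrite mem_enum.
by apply: h; rewrite -mem_enum.
Qed.

Lemma num_cenv : numS J t rr G cenv = S.
Proof.
rewrite (codes_S cd); apply/setP => y; rewrite !inE inY_cenv; case: (boolP (y \in Y)) => //= _.
apply: eq_forallb => i; rewrite cenv_b cenv_w cenv_e !blk_cenv (cUw i).2 (cUe i).2 Hg_cenv.
apply/forall_inP/eqP => [h|e x xW].
  apply/setP => x; rewrite !inE; case: (boolP (x \in W i)) => xW; rewrite ?andbT ?andbF.
    by rewrite adj_sym (eqP (h _ xW)).
  by apply/esym/negbTE; apply: contra xW; apply: (subsetP (codes_E cd i)).
by rewrite adj_sym; have /setP /(_ x) := e; rewrite !inE xW andbT => ->.
Qed.

Lemma lt_cenv x y : x \in S -> y \in S -> ltS J t rr G cenv x y = (enum_rank x < enum_rank y).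
Proof.
move=> xS yS; rewrite /ltS (cenv_b ord0) cenv_u blk_cenv cUu.2 Hg_cenv; apply/existsP/idP.
  move=> [p /and3P []]; rewrite inE => /andP [pC /existsP [m /eqP /setP e]] ax ay.
  have := e x; have := e y; rewrite !inE xS yS ax (negbTE ay) /= => /esym /negbT; rewrite -ltnNge => h1 /esym h2.
  exact: leq_ltn_trans h2 h1.
move=> lt; pose R := [set z in S | enum_rank z <= enum_rank x].
have [|p pC e] := codes_sh cd (R := R); first by apply/subsetP => z; rewrite inE => /andP [].
exists p; rewrite inE pC; have -> : [exists m : T, nb H p :&: S == [set z in S | enum_rank z <= enum_rank m]].
  by apply/existsP; exists x; rewrite e.
have /setP e' := e; have := e' x; have := e' y; rewrite !inE xS yS leqnn /= andbT andbT => -> ->.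
by rewrite -ltnNge.
Qed.

Lemma ns_cenv : numsys (numS J t rr G cenv) (ltS J t rr G cenv).
Proof.
rewrite num_cenv; split=> [x xS|x y z xS yS zS|x y xS yS]; rewrite !lt_cenv ?ltnn //; first exact: ltn_trans.
by case: (ltngtP (enum_rank x) (enum_rank y)) => //= h; rewrite ?orbT // (enum_rank_inj (val_inj h)) eqxx.
Qed.

Lemma pair_cenv (D : {set T}) : D \subset Ct ord0 -> exists2 U : {set T}, #|U| = t &
  forall x y, pairS J rr G cenv (enum U) x y = [exists p, (p \in D) && (adj H p x && adj H p y)].
Proof.
move=> sD; have [U cU eU] := codes_D cd sD; exists U => // x' y'.
by rewrite /pairS (cenv_b ord0) blk_cenv eU Hg_cenv.
Qed.

(** A pair in [R] is represented by a vertex of [Ct ord0] whose trace on [S] is that pair; the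
    comparison [c] fixes which of the two elements comes first. *)
Lemma full_cenv : full (numS J t rr G cenv) (3 * t) (holdS J t rr G cenv).
Proof.
move=> R; rewrite num_cenv.
pose D (c : T -> T -> bool) : {set T} := [set p in Ct ord0 | [exists i : T, exists j : T,
  [&& i \in S, j \in S, c i j, R i j & nb H p :&: S == [set i; j]]]].
have sD c : D c \subset Ct ord0 by apply/subsetP => p; rewrite inE => /andP [].
have [U1 c1 h1] := pair_cenv (sD (fun i j => enum_rank i < enum_rank j)).
have [U2 c2 h2] := pair_cenv (sD (fun i j => enum_rank j < enum_rank i)).
have [U3 c3 h3] := pair_cenv (sD (fun i j => i == j)).
have s1 : size (enum U1) = t by rewrite -cardE.
have s2 : size (enum U2) = t by rewrite -cardE.
have s3 : size (enum U3) = t by rewrite -cardE.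
exists (enum U1 ++ enum U2 ++ enum U3); first by rewrite !size_cat s1 s2 s3; clear; lia.
have key (c : T -> T -> bool) (x y : T) : x \in S -> y \in S -> c x y -> (forall i j, c i j -> x \in [set i; j] -> y \in [set i; j] -> i = x /\ j = y) ->
    [exists p, (p \in D c) && (adj H p x && adj H p y)] = R x y.
  move=> xS yS cxy uni; apply/existsP/idP => [[p /and3P []]|rxy].
    rewrite inE => /andP [pC /existsP [i /existsP [j /and5P [iS jS cij rij /eqP /setP e]]]] ax ay.
    have := e x; have := e y; rewrite [y \in _ :&: _]inE [x \in _ :&: _]inE [y \in nb _ _]inE [x \in nb _ _]inE xS yS ax ay /=.
    by move=> /esym yi /esym xi; have [<- <-] := uni _ _ cij xi yi.
  have sR : [set x; y] \subset S by apply/subsetP => z; rewrite !inE => /orP [] /eqP ->.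
  have [p pC e] := codes_sh cd sR; exists p; apply/and3P; split.
  - by rewrite inE pC; apply/existsP; exists x; apply/existsP; exists y; rewrite xS yS cxy rxy e eqxx.
  - by have /setP /(_ x) := e; rewrite !inE eqxx /= => /andP [].
  - by have /setP /(_ y) := e; rewrite !inE eqxx orbT /= => /andP [].
move=> x y xS yS; rewrite /holdS !lt_cenv //.
have -> : take t (enum U1 ++ enum U2 ++ enum U3) = enum U1 by rewrite -{1}s1 take_size_cat.
have -> : take t (drop t (enum U1 ++ enum U2 ++ enum U3)) = enum U2.
  by rewrite -{2}s1 drop_size_cat // -{1}s2 take_size_cat.
have -> : drop (2 * t) (enum U1 ++ enum U2 ++ enum U3) = enum U3.
  by rewrite catA drop_size_cat // size_cat s1 s2 mul2n addnn.
rewrite h1 h2 h3; case: (ltngtP (enum_rank x) (enum_rank y)) => lt /=.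
- have /negbTE -> : x != y by apply: contraTneq lt => ->; rewrite ltnn.
  rewrite !orbF; apply: key => // i j ij; rewrite !inE => /orP [/eqP ex|/eqP ex] /orP [/eqP ey|/eqP ey]; subst => //.
  + by rewrite ltnn in lt.
  + by have := ltn_trans lt ij; rewrite ltnn.
  + by rewrite ltnn in lt.
- have /negbTE -> : x != y by apply: contraTneq lt => ->; rewrite ltnn.
  rewrite !orbF; apply: key => // i j ij; rewrite !inE => /orP [/eqP ex|/eqP ex] /orP [/eqP ey|/eqP ey]; subst => //.
  + by rewrite ltnn in lt.
  + by have := ltn_trans lt ij; rewrite ltnn.
  + by rewrite ltnn in lt.
have exy : x = y by apply: enum_rank_inj; apply: val_inj.
rewrite exy eqxx /=; apply: key => // i j /eqP ->; rewrite setUid !inE => /eqP -> _.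
by split.
Qed.

End CodedModel.

Lemma coded_models J t rr j r : computes r [:: j] 0 -> exists B, 0 < B /\ forall (T : finType) (G : sgraph T),
  coded J t rr B G \/ coded J t rr B (cg G) -> forall e, sat G e (psi J t rr j (ftm J t rr r)).
Proof.
move=> /(psi_complete J t rr) [B hB]; exists (B + 2); split=> [|T G hc e]; first by rewrite addn2.
suff main H : coded J t rr (B + 2) H -> (H = G \/ H = cg G) -> sat G e (psi J t rr j (ftm J t rr r)).
  by case: hc => h; apply: (main _ h); [left|right].
move=> [X [Y [Z [b [Ct [W [E [S cd]]]]]]]] HG.
have /card_gt1P [y1 [y2 [y1S y2S ne]]] : 1 < #|S| by apply: leq_trans (codes_sg cd); rewrite addn2.
have SY x : x \in S -> x \in Y by rewrite (codes_S cd) inE => /andP [].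
(* The test in [fE] must select [H]: a second vertex of the clique does so if [H = G], and [y1]
   itself, not being adjacent to itself, if [H] is the complement. For the former [S] needs two
   elements, hence [B + 2]. *)
have [y2' HE] : exists y2', (if adj G y1 y2' then G else cg G) = H.
  case: HG => eH; last by exists y1; rewrite adj_irrefl eH.
  exists y2; rewrite -eH; move/cliqueP: (codes_Y cd) => cY; by rewrite cY ?SY.
have hw i : exists U : {set T}, #|U| = t /\ capn H (blkof H X (b i)) U = W i.
  by have [U h1 h2] := codes_D cd (codes_W cd i); exists U.
have he i : exists U : {set T}, #|U| = t /\ capn H (blkof H X (b i)) U = E i.
  by have [U h1 h2] := codes_D cd (subset_trans (codes_E cd i) (codes_W cd i)); exists U.
have [Uw cUw] := fin_all_exists hw; have [Ue cUe] := fin_all_exists he.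
have [Uu cUu] : exists U : {set T}, #|U| = t /\ capn H (blkof H X (b ord0)) U = segD H Ct S.
  have [|U h1 h2] := codes_D cd (i := ord0) (D := segD H Ct S); last by exists U.
  by apply/subsetP => p; rewrite inE => /andP [].
have ns := ns_cenv cd (SY _ y1S) HE cUw cUe cUu; have fu := full_cenv cd (SY _ y1S) HE cUw cUe cUu.
apply: (hB T G _ ns fu); rewrite (num_cenv cd (SY _ y1S) HE Uu cUw cUe).
by apply: leq_trans (codes_sg cd); rewrite leq_addr.
Qed.

(** * Diagonalisation *)

Definition cmp1 f (F : nat -> nat) := forall x, computes f [:: x] (F x).

Fixpoint rconst c := if c is c'.+1 then Comp Succ [:: rconst c'] else Zero.

Lemma computes_const c v : computes (rconst c) v c.
Proof. by elim: c => [//|c IH] /=; exists [:: c]. Qed.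

Definition rdbl := Prec Zero (Comp Succ [:: Comp Succ [:: Proj 1]]).

Lemma computes_dbl x v : computes rdbl (x :: v) x.*2.
Proof.
apply/computes_Prec; elim: x => [//|x IH]; exists x.*2 => //=; exists [:: x.*2.+1] => //=; split=> //.
by exists [:: x.*2].
Qed.

(** The cons operation of [CodeSeq.code], obtained from [2 * m + 1] by doubling [n] times. *)
Definition rcc := Prec (Comp Succ [:: Comp rdbl [:: Proj 0]]) (Comp rdbl [:: Proj 1]).

Lemma computes_cc n m : computes rcc [:: n; m] (2 ^ n * m.*2.+1).
Proof.
apply/computes_Prec; elim: n => [|n IH].
  exists [:: m.*2]; last by rewrite expn0 mul1n.
  split=> //; exists [:: m] => //; exact: computes_dbl.
exists (2 ^ n * m.*2.+1) => //; exists [:: 2 ^ n * m.*2.+1] => //.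
rewrite expnS -mulnA mul2n; exact: computes_dbl.
Qed.

Definition ccf f g := Comp rcc [:: f; g].

Lemma cmp1_cc f g F G : cmp1 f F -> cmp1 g G -> cmp1 (ccf f g) (fun x => 2 ^ F x * (G x).*2.+1).
Proof. by move=> hf hg x; exists [:: F x; G x] => //; exact: computes_cc. Qed.

Definition ccf3 a f g := ccf (rconst a) (ccf f (ccf g Zero)).

Lemma cmp1_code3 a f g F G : cmp1 f F -> cmp1 g G -> cmp1 (ccf3 a f g) (fun x => CodeSeq.code [:: a; F x; G x]).
Proof.
move=> hf hg; apply: (@cmp1_cc _ _ (fun=> a) (fun x => CodeSeq.code [:: F x; G x])).
  by move=> x; apply: computes_const.
apply: (@cmp1_cc _ _ F (fun x => CodeSeq.code [:: G x])) => //.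
by apply: (@cmp1_cc _ _ G (fun x => CodeSeq.code [::])).
Qed.

Lemma cmp1_const c : cmp1 (rconst c) (fun=> c).
Proof. by move=> x; apply: computes_const. Qed.

Fixpoint gexs k m c := if m is m'.+1 then CodeSeq.code [:: 8; k; gexs k.+1 m' c] else c.

Lemma godel_exs k m p : godel (fexs k m p) = gexs k m (godel p).
Proof. by elim: m k => [//|m IH] k /=; rewrite IH. Qed.

Fixpoint rgexs k m f := if m is m'.+1 then ccf3 8 (rconst k) (rgexs k.+1 m' f) else f.

Lemma cmp1_gexs k m f F : cmp1 f F -> cmp1 (rgexs k m f) (fun x => gexs k m (F x)).
Proof.
move=> hf; elim: m k => [//|m IH] k; apply: (@cmp1_code3 8 _ _ (fun=> k)); [exact: cmp1_const|exact: IH].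
Qed.

Section Diagonal.
Variables (J t rr : nat).
Local Notation P := (PP J t rr).

Definition rstep := ccf3 8 (rconst P.+1) (ccf3 3 (rconst (godel (fS J t rr P.+2 P.+1)))
  (ccf3 3 (rconst (godel (fsucc J t rr P.+2 P.+1 P))) (ccf3 8 (rconst P) (ccf3 3 (rconst (godel (FEq P P.+1))) (Proj 0))))).

Definition rnu := Prec (rconst (godel (fnu J t rr 0))) (Comp rstep [:: Proj 1]).

Lemma cmp1_nu : cmp1 rnu (fun j => godel (fnu J t rr j)).
Proof.
have hp : cmp1 (Proj 0) id by [].
have hs : cmp1 rstep (fun c => CodeSeq.code [:: 8; P.+1; CodeSeq.code [:: 3; godel (fS J t rr P.+2 P.+1);
    CodeSeq.code [:: 3; godel (fsucc J t rr P.+2 P.+1 P); CodeSeq.code [:: 8; P; CodeSeq.code [:: 3; godel (FEq P P.+1); c]]]]]).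
  apply: (@cmp1_code3 8 _ _ (fun=> P.+1)); first exact: cmp1_const.
  apply: (@cmp1_code3 3 _ _ (fun=> godel (fS J t rr P.+2 P.+1))); first exact: cmp1_const.
  apply: (@cmp1_code3 3 _ _ (fun=> godel (fsucc J t rr P.+2 P.+1 P))); first exact: cmp1_const.
  apply: (@cmp1_code3 8 _ _ (fun=> P)); first exact: cmp1_const.
  by apply: (@cmp1_code3 3 _ _ (fun=> godel (FEq P P.+1))); first exact: cmp1_const.
move=> j; apply/computes_Prec; elim: j => [|j IH]; first exact: computes_const.
exists (godel (fnu J t rr j)) => //; exists [:: godel (fnu J t rr j)] => //; exact: hs.
Qed.

(** The diagonal function of the fixed point lemma: from the code [c] of a formula it computes the
    code of the sentence that applies this formula to the number [c]. *)
Definition rD := rgexs 0 P (ccf3 3 (rconst (godel (fax J t rr))) (ccf3 8 (rconst P)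
  (ccf3 3 (rconst (godel (fS J t rr P.+1 P))) (ccf3 3 rnu (Proj 0))))).

Lemma computes_D p : computes rD [:: godel p] (godel (psi J t rr (godel p) p)).
Proof.
rewrite /psi godel_exs.
have hp : cmp1 (Proj 0) id by [].
apply: (@cmp1_gexs 0 P _ (fun c => CodeSeq.code [:: 3; godel (fax J t rr); CodeSeq.code [:: 8; P;
   CodeSeq.code [:: 3; godel (fS J t rr P.+1 P); CodeSeq.code [:: 3; godel (fnu J t rr c); c]]]])).
apply: (@cmp1_code3 3 _ _ (fun=> godel (fax J t rr))); first exact: cmp1_const.
apply: (@cmp1_code3 8 _ _ (fun=> P)); first exact: cmp1_const.
apply: (@cmp1_code3 3 _ _ (fun=> godel (fS J t rr P.+1 P))); first exact: cmp1_const.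
by apply: (@cmp1_code3 3 _ _ (fun j => godel (fnu J t rr j))); first exact: cmp1_nu.
Qed.

(* The sentence asserts that [f] outputs 0 on its own code. *)
Lemma diagonal f : exists p, [/\ sentence p,
  computes f [:: godel p] 0 -> exists B, 0 < B /\ forall (T : finType) (G : sgraph T),
     coded J t rr B G \/ coded J t rr B (cg G) -> forall e, sat G e p &
  ~ computes f [:: godel p] 0 -> forall (T : finType) (G : sgraph T) e, ~ sat G e p].
Proof.
(* [q] says that [f], applied to the diagonal of its argument, outputs 0; the sentence is [q]
   applied to its own code. *)
pose r := Comp f [:: rD]; pose q := ftm J t rr r; exists (psi J t rr (godel q) q).
have rf : computes r [:: godel q] 0 <-> computes f [:: godel (psi J t rr (godel q) q)] 0.
  split=> [/computes_Comp [[|w [|w' ws]] ca cf]|c]; first by case: ca.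
  - by case: ca => c _; rewrite (computes_det (computes_D q) c).
  - by case: ca => _ [].
  by apply/computes_Comp; exists [:: godel (psi J t rr (godel q) q)] => //; split=> //; exact: computes_D.
split; first exact: psi_sentence.
  by move=> /rf; apply: coded_models.
by move=> nc T G e /psi_sound /rf.
Qed.

End Diagonal.

(** * Limit probabilities *)

Section Limits.
Import Order.TTheory GRing.Theory Num.Theory numFieldNormedType.Exports.
Variable R : realType.

(** With an empty [X] the construction of [many_perfect] gives the complete graph. *)
Lemma perfect_gt0 (T : finType) : (0 < #|[set G : sgraph T | perfect G]|)%N.
Proof.
have := @many_perfect T set0 set0 (sub0set _); rewrite cards0 mul0n expn0 expn0; exact.
Qed.

Lemma limit0_of_unsat p : (forall (T : finType) (G : sgraph T) e, ~ sat G e p) -> limit_prob p (0 : R)%R.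
Proof.
(* From [n = 1] on, since the empty graph has no assignment and satisfies [models] vacuously. *)
move=> h; apply: cvg_near_cst; exists 1%N => // n /= n1; rewrite /prob_perfect.
have -> : [set G : sgraph 'I_n | perfect G & `[< models G p >]] = set0; last by rewrite cards0 mul0r.
apply/setP => G; rewrite !inE; apply/negbTE; rewrite negb_and; apply/orP; right; apply/asboolPn => m.
exact: (h _ G (fun=> Ordinal n1) (m _)).
Qed.

Lemma limit1_of_most p n0 : (forall n, (n0 <= n)%N ->
    (#|[set G : sgraph 'I_n | perfect G && ~~ `[< models G p >]]| * n.+1 <= #|[set G : sgraph 'I_n | perfect G]|)%N) ->
  limit_prob p (1 : R)%R.
Proof.
move=> h; apply/cvgrPdist_le => e e0; near=> n.
have n0n : (n0 <= n)%N by near: n; exists n0.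
have D0 := perfect_gt0 'I_n; have := h _ n0n; rewrite /prob_perfect.
set N := #|[set G : sgraph 'I_n | perfect G & `[< models G p >]]|.
set B := #|[set G : sgraph 'I_n | perfect G && ~~ `[< models G p >]]|.
have DE : #|[set G : sgraph 'I_n | perfect G]| = (N + B)%N.
  rewrite -(cardsID [set G | `[< models G p >]]); congr (_ + _)%N; apply: eq_card => G; rewrite !inE //.
  by rewrite andbC.
rewrite DE in D0 *; move: N B D0 {DE} => a b ab0 le.
have abp : (0 < (a + b)%:R :> R)%R by rewrite ltr0n.
have -> : (1 - a%:R / (a + b)%:R = b%:R / (a + b)%:R :> R)%R.
  by apply: (mulIf (lt0r_neq0 abp)); rewrite mulrBl !mulfVK ?lt0r_neq0 // mul1r natrD addrC addKr.
rewrite ger0_norm ?divr_ge0 ?ler0n // ler_pdivrMr //.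
apply: le_trans (_ : (n.+1%:R^-1 * (a + b)%:R <= _)%R); last first.
  rewrite ler_wpM2r ?ler0n //; apply: ltW; near: n.
  exact: (near_infty_natSinv_lt (PosNum e0)).
by rewrite ler_pdivlMl ?ltr0n // mulrC -natrM ler_nat.
Unshelve. all: by end_near.
Qed.

Lemma limit_unique p : limit_prob p (0 : R)%R -> ~ limit_prob p (1 : R)%R.
Proof.
move=> h0 h1; have e : (0 : R)%R = (1 : R)%R by apply: (cvg_unique (@norm_hausdorff _ _) h0 h1).
by move/eqP: e; rewrite eq_sym oner_eq0.
Qed.

End Limits.

Theorem theorem2 (R : realType) :
  ~ exists f : recf,
      forall p : graph_formula, sentence p ->
        limit_prob p (0 : R)%R \/ limit_prob p (1 : R)%R ->
        (limit_prob p (1 : R)%R -> computes f [:: godel p] 1) /\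
        (~ limit_prob p (1 : R)%R -> computes f [:: godel p] 0).
Proof.
move=> [f hf]; have [J [t [rr pc]]] := perfect_coded; have [p [sp yes no]] := diagonal J t rr f.
have [c0|nc0] := pselect (computes f [:: godel p] 0).
  have [B [B0 hB]] := yes c0; have [n0 hn] := pc B B0.
  have l1 : limit_prob p (1 : R)%R.
    apply: (@limit1_of_most R p n0) => n n0n; have := hn 'I_n; rewrite card_ord => /(_ n0n).
    (* [2 ^ n] exceeds [n], so the perfect graphs in which [p] fails have proportion at most
       [1 / n.+1]. *)
    apply: leq_trans; apply: leq_mul; last exact: ltn_expl.
    apply: subset_leq_card; apply/subsetP => G; rewrite !inE => /andP [-> /asboolPn nm] /=.
    by apply/asboolPn => hc; apply: nm => e; apply: hB.
  have [h1 _] := hf p sp (or_intror l1).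
  by have := computes_det c0 (h1 l1).
have l0 : limit_prob p (0 : R)%R by apply: limit0_of_unsat; apply: no.
have [_ h0] := hf p sp (or_introl l0).
by apply: nc0; apply: h0; apply: limit_unique.
Qed.
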